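(* Let $a\in\mathbb{Q}\setminus\{-1,0,1\}$. Unconditionally, for every integer $k\ge0$, \[ \limsup_{x\to\infty} \sum_{n=0}^k D_a^{\omega/}(n;x) \le \sum_{n=0}^k \tilde D_a^{\omega/}(n). \]
   Context: $p,q$ denote primes; $\nu_p(a)$ is the $p$-adic valuation; $\mathrm{ord}_p(a)$ the multiplicative order of $a$ mod $p$; $\omega(n)$ the number of distinct prime factors. The numbers $D_a^{\omega/}(n;x)$ are defined by $\sum_{n\ge0} D_a^{\omega/}(n;x)z^n=\frac1{\pi(x)}\sum_{p\le x,\ \nu_p(a)=0} z^{\omega((p-1)/\mathrm{ord}_p(a))}$, and $\tilde D_a^{\omega/}(n)$ are the Maclaurin coefficients: $\sum_{n\ge0}\tilde D_a^{\omega/}(n)z^n = F^{\omega/}_a(z)H^{\omega/}_a(z)\prod_q(1+\frac{z-1}{q(q-1)})$. Here write $a=\pm a_0^h$ with $a_0>0$ rational not a perfect power ($h$ maximal), $a_0=b_0c_0^2$ with $b_0$ squarefree integer, and \[ H^{\omega/}_a(z) = \prod_{\substack{q\mid h\\ q\neq 2}} \frac{q(q+z-2)}{q^2-q+z-1},\quad f_a^{\omega/}(z) = \prod_{\substack{q\mid 2b_0 \\ q \nmid h}} \frac{z-1}{q^2-q+z-1} \prod_{q\mid (b_0,h)} \frac{z-1}{q+z-2}, \] $F^{\omega/}_a(z)=1$ if $2\nmid h$ and $\mathrm{sgn}(a)b_0\not\equiv1\pmod4$; $=1+f_a^{\omega/}(z)$ if $2\nmid h$ and $\mathrm{sgn}(a)b_0\equiv1\pmod4$;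 $=2z/(z+1)$ if $2\mid h$, $a>0$; $=1$ if $2\mid h$, $a<0$. *)

(* Defs.v *)
From HB Require Import structures.
From mathcomp Require Import all_boot all_order all_algebra.
From mathcomp Require Import all_classical all_reals all_analysis.
Set Implicit Arguments. Unset Strict Implicit. Unset Printing Implicit Defensive.
Import Order.TTheory GRing.Theory Num.Theory.
Import numFieldNormedType.Exports.
Local Open Scope ring_scope.

Definition nu (p : nat) (a : rat) : int :=
  (logn p `|numq a|%N)%:Z - (logn p `|denq a|%N)%:Z.

(* multiplicative order of a mod p (for nu p a = 0): the least m >= 1 with
   a^m = 1 in Z_(p)/pZ_(p), i.e. p | numq a ^ m - denq a ^ m.  Such an m
   lies in [1, p-1]; the value 0 is returned if none exists (never used). *)
Definition ordp (p : nat) (a : rat) : nat :=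
  head 0%N [seq m <- iota 1 p | ((p%:Z) %| numq a ^+ m - denq a ^+ m)%Z].

Definition omega (n : nat) : nat := size (primes n).

Definition primepi (R : realType) (x : R) : nat :=
  count (fun p => prime p && (p%:R <= x)) (iota 0 (Num.truncn x).+1).

Definition Domega (R : realType) (a : rat) (n : nat) (x : R) : R :=
  (count (fun p => [&& prime p, p%:R <= x, nu p a == 0 &
                      omega (p.-1 %/ ordp p a) == n])
         (iota 0 (Num.truncn x).+1))%:R / (primepi x)%:R.

Definition Euler_prod (R : realType) (z : R) : R :=
  limn (fun N : nat => (\prod_(q < N | prime q) (1 + (z - 1) / (q%:R * (q%:R - 1))) : R)).

Definition H_omega (R : realType) (h : nat) (z : R) : R :=
  \prod_(q <- primes h | q != 2%N)
     (q%:R * (q%:R + z - 2) / (q%:R ^+ 2 - q%:R + z - 1)).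

Definition f_omega (R : realType) (b0 h : nat) (z : R) : R :=
  (\prod_(q <- primes (2 * b0) | ~~ (q %| h)%N) ((z - 1) / (q%:R ^+ 2 - q%:R + z - 1)))
  * \prod_(q <- primes (gcdn b0 h)) ((z - 1) / (q%:R + z - 2)).

(* s = sgn(a) in {1,-1} *)
Definition F_omega (R : realType) (s : int) (b0 h : nat) (z : R) : R :=
  if ~~ odd h then (if 0 < s then 2 * z / (z + 1) else 1)
  else if ((s * b0%:Z - 1) %% 4)%Z == 0 then 1 + f_omega b0 h z else 1.

Definition G_omega (R : realType) (s : int) (b0 h : nat) (z : R) : R :=
  F_omega s b0 h z * H_omega h z * Euler_prod z.

Definition Dtilde (R : realType) (s : int) (b0 h : nat) (n : nat) : R :=
  derive1n n (G_omega s b0 h) 0 / (n`!)%:R.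

(* Main.v *)
(* A prime q divides (p-1)/ord_p(a) iff p splits completely in Q(zeta_q, a^(1/q)), so the proportion
   of p with d | (p-1)/ord_p(a) is read off the degree of Q(zeta_d, a^(1/d)) over Q. That proportion
   is obtained without Artin symbols: inverting a suitable integer makes an order of the number field
   a principal ideal ring, whose elements up to units are counted by a lattice-point argument, and the
   Erdos-Selberg method for this Beurling-type system gives its prime number theorem, where the
   completely split primes make the main contribution. The degree is computed by Kummer theory; the
   only entanglement is sqrt(+-b0) in a cyclotomic field.

   Counting only the prime factors below N gives an omega_N <= omega, hence an upper bound for the
   distribution function. For fixed N inclusion-exclusion makes the average of z^omega_N over p converge
   to an explicit polynomial in z, and as N grows its coefficients converge to those of F H times the
   Euler product. For upper bounds no uniformity in N is needed. *)
Require Import Defs.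
From HB Require Import structures.
From mathcomp Require Import all_boot all_order all_algebra all_field fingroup perm cyclic.
From mathcomp Require Import all_classical all_reals all_analysis.
From mathcomp Require Import ring lra zify.
Set Implicit Arguments. Unset Strict Implicit. Unset Printing Implicit Defensive.
Import Order.TTheory GRing.Theory Num.Theory.
Import numFieldNormedType.Exports.
Local Open Scope ring_scope.

(** The degree [D] enters only through a count. Outside a finite set, a rational prime [p] has
    exactly [D] classes of norm [p] if it splits completely, and none otherwise. The Beurling
    theorem gives [psi x ~ x] whatever the leading constant of the counting function is, so the
    split primes have density [1/D] and only positivity of that constant matters. The order is
    merely a Z-span with integral structure constants; ideal classes and short generators are
    handled by pigeonhole. Inverting [MM] leaves each class with infinitely many representatives, so
    classes are counted by a partition of unity: a cut-off keeping the finitely many representatives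
    of small height, divided by its sum over the class. This weight is Lipschitz on each residue
    class modulo [QQ]; comparing the scales [Y] and [k Y] then replaces a volume computation and
    yields the power saving which the Beurling theorem asks for. The price is a smoothed count known
    along [D]-th powers only, which has to be desmoothed. *)

Lemma le_of_eq (d : Order.disp_t) (T : porderType d) (x y : T) : x = y -> (x <= y)%O.
Proof. by move->. Qed.

(** * Summation and Dirichlet convolution *)

Section RealInequalities.
Variable R : realType.
Implicit Types (x y d : R) (n m : nat).

Lemma ln_le_subr1 x : 0 < x -> ln x <= x - 1.
Proof.
move=> x0; have := @le_ln1Dx R (x - 1).
by rewrite [1 + _]addrC subrK; apply; lra.
Qed.

Lemma ln_ge_1subV x : 0 < x -> 1 - x^-1 <= ln x.
Proof.
move=> x0; have xi : 0 < x^-1 by rewrite invr_gt0.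
by have := ln_le_subr1 xi; rewrite lnV ?posrE //; lra.
Qed.

Lemma ln_nat_ge0 n : 0 <= ln (n%:R : R).
Proof. by case: n => [|n]; [rewrite ln0 | apply: ln_ge0; rewrite ler1n]. Qed.

Lemma ler_ln_nat m n : (0 < m)%N -> (m <= n)%N -> ln (m%:R : R) <= ln n%:R.
Proof.
by move=> m0 mn; rewrite ler_ln ?posrE ?ltr0n ?ler_nat // (leq_trans m0 mn).
Qed.

Lemma ln_nat_gt0 n : (1 < n)%N -> 0 < ln (n%:R : R).
Proof. by move=> n1; apply: ln_gt0; rewrite ltr1n. Qed.

Lemma ln_succ_bounds n : (0 < n)%N ->
  (n.+1%:R : R)^-1 <= ln n.+1%:R - ln n%:R <= (n%:R : R)^-1.
Proof.
move=> n0; have n0R : (0 : R) < n%:R by rewrite ltr0n.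
have n1R : (0 : R) < n.+1%:R by rewrite ltr0n.
rewrite -ln_div ?posrE //; apply/andP; split.
  apply: le_trans (ln_ge_1subV _); last exact: divr_gt0.
  rewrite invf_div -natr1 le_eqVlt; apply/orP; left; apply/eqP; field.
  by rewrite natr1 (gt_eqF n1R).
apply: le_trans (ln_le_subr1 _) _; first exact: divr_gt0.
by rewrite -natr1 le_eqVlt; apply/orP; left; apply/eqP; field; rewrite (gt_eqF n0R).
Qed.

Lemma ler_powRl d x y : 0 <= d -> 0 <= x -> x <= y -> x `^ d <= y `^ d.
Proof.
by move=> d0 x0 xy; apply: ge0_ler_powR; rewrite // nnegrE // (le_trans x0 xy).
Qed.

(** [(1 - 1/n)^d <= exp (- d/n) <= 1/(1 + d/n) <= 1 - d/(2n)], the last step because [d/n <= 1];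
    this is the origin of the factor 1/2. The case [n = 1] is apart because of [0^d]. *)
Lemma powR_succ_ge d n : 0 < d <= 1 -> (0 < n)%N ->
  d / 2 * n%:R `^ (d - 1) <= n%:R `^ d - n.-1%:R `^ d.
Proof.
case: n => [//|[|n]] /andP[d0 d1] _.
  by rewrite /= !powR1 powR0 ?gt_eqF //; lra.
set N : R := n.+2%:R; have N0 : 0 < N by rewrite ltr0n.
have M0 : (0 : R) < n.+1%:R by rewrite ltr0n.
rewrite /= powRB ?(gt_eqF N0) ?implybT // powRr1 ?(ltW N0) //.
have -> : (n.+1%:R : R) = N * (n.+1%:R / N) by rewrite mulrC divfK // (gt_eqF N0).
rewrite powRM ?(ltW N0) ?divr_ge0 ?(ltW M0) ?(ltW N0) //.
suff H : (n.+1%:R / N) `^ d <= 1 - d / 2 / N.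
  have P0 : 0 <= N `^ d by rewrite powR_ge0.
  apply: le_trans (_ : N `^ d - N `^ d * (1 - d / 2 / N) <= _).
    by apply: le_of_eq; ring.
  by rewrite lerD2l lerN2 ler_wpM2l.
have q0 : 0 < n.+1%:R / N by exact: divr_gt0.
rewrite /powR gt_eqF //.
have lnq : ln (n.+1%:R / N) <= - N^-1.
  apply: le_trans (ln_le_subr1 q0) _; rewrite /N -(natr1 n.+1).
  apply: le_of_eq; field.
  by rewrite gt_eqF //; have := ler0n R n; lra.
apply: le_trans (_ : expR (- (d / N)) <= _).
  by rewrite ler_expR -mulrN ler_wpM2l // ltW.
have dN0 : 0 < d / N by exact: divr_gt0.
have dN1 : d / N <= 1 by rewrite ler_pdivrMr // mul1r (le_trans d1) // ler1n.
rewrite expRN; apply: le_trans (_ : (1 + d / N)^-1 <= _).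
  rewrite lef_pV2 ?posrE ?expR_gt0 ?expR_ge1Dx //; exact: addr_gt0.
rewrite -[d / 2 / N]mulrAC; set u := d / N in dN0 dN1 *.
rewrite -[X in X <= _]mul1r ler_pdivrMr; last lra.
nra.
Qed.

(** Obtained from [1 + t <= exp t] at [t = d (ln (n+1) - ln n)]; it makes increments of size
    [n^(-d-1)] telescope. *)
Lemma powRN_succ_ge d n : 0 < d -> (0 < n)%N ->
  d * n.+1%:R `^ (- d - 1) <= n%:R `^ (- d) - n.+1%:R `^ (- d).
Proof.
move=> d0 n0; have n0R : (0 : R) < n%:R by rewrite ltr0n.
have n1R : (0 : R) < n.+1%:R by rewrite ltr0n.
rewrite powRB ?(gt_eqF n1R) ?implybT // powRr1 ?(ltW n1R) //.
rewrite /powR !gt_eqF //; set a := ln _; set b := ln _.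
have ab : (n.+1%:R)^-1 <= a - b by have /andP[] := ln_succ_bounds n0.
have -> : - d * b = - d * a + d * (a - b) by ring.
rewrite expRD; set E := expR (- d * a).
have E0 : 0 < E by exact: expR_gt0.
have h := expR_ge1Dx (d * (a - b)).
have : 1 + d / n.+1%:R <= expR (d * (a - b)).
  by apply: le_trans h; rewrite lerD2l ler_wpM2l // ltW.
move=> {}h; apply: le_trans (_ : E * (1 + d / n.+1%:R) - E <= _).
  by apply: le_of_eq; ring.
by rewrite lerD2r ler_pM2l.
Qed.

Lemma ln_le_powR d x : 0 < d -> 0 < x -> ln x <= d^-1 * x `^ d.
Proof.
move=> d0 x0; rewrite ler_pdivlMl // -ln_powR.
by apply: le_trans (ln_le_subr1 _) _; [exact: powR_gt0 | lra].
Qed.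

Lemma sum_powR_le d n : 0 < d <= 1 ->
  \sum_(1 <= k < n.+1) (k%:R : R) `^ (d - 1) <= 2 / d * n%:R `^ d.
Proof.
move=> /andP[d0 d1]; elim: n => [|n IH].
  by rewrite big_geq // mulr_ge0 ?powR_ge0 // divr_ge0 // ltW.
rewrite big_nat_recr //=.
have := @powR_succ_ge d n.+1; rewrite d0 d1 /= => /(_ isT isT) H.
have : n.+1%:R `^ (d - 1) <= 2 / d * (n.+1%:R `^ d - n%:R `^ d).
  have -> : n.+1%:R `^ (d - 1) = 2 / d * (d / 2 * n.+1%:R `^ (d - 1)).
    by field; rewrite gt_eqF.
  by rewrite ler_wpM2l // divr_ge0 // ltW.
by rewrite mulrBr; lra.
Qed.

End RealInequalities.

Section Dirichlet.
Variable R : realType.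
Implicit Types (f g h : nat -> R) (n m x : nat).

(** A sum over all pairs with an indicator rather than over divisors: the range can then be enlarged
    to a common bound ([dconvE]) and sums exchanged freely. *)
Definition dconv f g n : R :=
  \sum_(1 <= i < n.+1) \sum_(1 <= j < n.+1) (f i * g j) *+ (i * j == n)%N.

Lemma dconvE f g n x : (0 < n <= x)%N ->
  dconv f g n =
  \sum_(1 <= i < x.+1) \sum_(1 <= j < x.+1) (f i * g j) *+ (i * j == n)%N.
Proof.
move=> /andP[n0 nx]; rewrite /dconv.
have out F : (forall i, (n < i)%N -> F i = 0 :> R) ->
    \sum_(1 <= i < n.+1) F i = \sum_(1 <= i < x.+1) F i.
  move=> H; rewrite [RHS](@big_cat_nat _ _ _ n.+1) //=.
  by rewrite [X in _ + X]big_nat_cond [X in _ + X]big1 ?addr0 // => i /andP[/andP[/H]].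
rewrite (out (fun i => \sum_(1 <= j < n.+1) (f i * g j) *+ (i * j == n)%N)).
  rewrite big_nat_cond [RHS]big_nat_cond; apply: eq_bigr => i /andP[/andP[i0 _] _].
  rewrite (out (fun j => (f i * g j) *+ (i * j == n)%N)) // => j nj.
  by rewrite (_ : (i * j == n)%N = false) //; nia.
move=> i ni; rewrite big_nat_cond big1 // => j /andP[/andP[j0 _] _].
by rewrite (_ : (i * j == n)%N = false) //; nia.
Qed.

Lemma dconvC f g n : dconv f g n = dconv g f n.
Proof.
rewrite /dconv exchange_big; apply: eq_bigr => i _; apply: eq_bigr => j _.
by rewrite mulrC mulnC.
Qed.

Lemma sum_nat_delta (a : R) k x : (0 < k)%N ->
  \sum_(1 <= n < x.+1) a *+ (k == n)%N = a *+ (k <= x)%N.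
Proof.
move=> k0; elim: x => [|x IH]; first by rewrite big_geq // leqNgt k0.
rewrite big_nat_recr //= IH -mulrnDr [(k <= x.+1)%N]leq_eqVlt ltnS; congr (_ *+ _).
by case: eqP => [->|//]; rewrite ?ltnn // addn0.
Qed.

Lemma sum_dconv_gen (F : nat -> nat -> R) x :
  \sum_(1 <= n < x.+1) \sum_(1 <= i < x.+1) \sum_(1 <= j < x.+1)
     F i j *+ (i * j == n)%N =
  \sum_(1 <= i < x.+1) \sum_(1 <= j < (x %/ i).+1) F i j.
Proof.
rewrite exchange_big /= [LHS]big_nat_cond [RHS]big_nat_cond.
apply: eq_bigr => i /andP[/andP[i0 ix] _]; rewrite exchange_big /=.
have le_xi : (x %/ i <= x)%N by exact: leq_div.
transitivity (\sum_(1 <= j < x.+1) F i j *+ (j <= x %/ i)%N).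
  rewrite [LHS]big_nat_cond [RHS]big_nat_cond.
  apply: eq_bigr => j /andP[/andP[j0 jx] _].
  by rewrite sum_nat_delta ?muln_gt0 ?i0 // leq_divRL // mulnC.
rewrite [LHS](@big_cat_nat _ _ _ (x %/ i).+1) //= [X in _ + X]big_nat_cond.
rewrite [X in _ + X]big1 ?addr0 => [|j /andP[/andP[xj _] _]]; last first.
  by rewrite leqNgt xj.
rewrite [LHS]big_nat_cond [RHS]big_nat_cond; apply: eq_bigr => j.
by rewrite ltnS => /andP[/andP[_ ->] _].
Qed.

Lemma sum_dconv f g x :
  \sum_(1 <= n < x.+1) dconv f g n =
  \sum_(1 <= i < x.+1) f i * \sum_(1 <= j < (x %/ i).+1) g j.
Proof.
transitivity (\sum_(1 <= i < x.+1) \sum_(1 <= j < (x %/ i).+1) f i * g j).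
  rewrite -sum_dconv_gen [LHS]big_nat_cond [RHS]big_nat_cond.
  by apply: eq_bigr => n; rewrite ltnS andbT => nx; apply: dconvE.
by apply: eq_bigr => i _; rewrite mulr_sumr.
Qed.

Lemma sum_dconv_weight f g (F : nat -> R) x :
  \sum_(1 <= n < x.+1) dconv f g n * F n =
  \sum_(1 <= i < x.+1) f i * \sum_(1 <= j < (x %/ i).+1) g j * F (i * j)%N.
Proof.
transitivity
  (\sum_(1 <= i < x.+1) \sum_(1 <= j < (x %/ i).+1) f i * (g j * F (i * j)%N)).
  rewrite -sum_dconv_gen [LHS]big_nat_cond [RHS]big_nat_cond.
  apply: eq_bigr => n; rewrite ltnS andbT => nx; rewrite (dconvE _ _ nx) mulr_suml.
  apply: eq_bigr => i _; rewrite mulr_suml; apply: eq_bigr => j _.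
  by case: eqP => [->|_]; rewrite ?mulr0n ?mul0r // mulrA.
by apply: eq_bigr => i _; rewrite mulr_sumr.
Qed.

(** The symmetric triple sum through which both bracketings pass, once [dconvC] has brought each to
    the form [dconv (dconv _ _) _]. *)
Let tconv f g h n : R := \sum_(1 <= i < n.+1) \sum_(1 <= j < n.+1)
  \sum_(1 <= k < n.+1) (f i * g j * h k) *+ (i * j * k == n)%N.

Let dconv_tconv f g h n : (0 < n)%N -> dconv (dconv f g) h n = tconv f g h n.
Proof.
move=> n0; rewrite /tconv.
transitivity (\sum_(1 <= d < n.+1) \sum_(1 <= k < n.+1) \sum_(1 <= i < n.+1)
   \sum_(1 <= j < n.+1) ((f i * g j * h k) *+ (i * j * k == n)%N) *+ (i * j == d)%N).
  rewrite [LHS]big_nat_cond [RHS]big_nat_cond.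
  apply: eq_bigr => d; rewrite ltnS andbT => dn; apply: eq_bigr => k _.
  rewrite (dconvE _ _ dn) mulr_suml -sumrMnl; apply: eq_bigr => i _.
  rewrite mulr_suml -sumrMnl; apply: eq_bigr => j _.
  by case: eqP => [<-|_]; rewrite ?mulr0n ?mul0r ?mul0rn.
rewrite exchange_big /= [RHS](eq_bigr _ (fun i _ => exchange_big _ _ _ _ _ _)) /=.
rewrite [RHS]exchange_big; apply: eq_bigr => k _ /=.
rewrite exchange_big [LHS]big_nat_cond [RHS]big_nat_cond.
apply: eq_bigr => i /andP[/andP[i0 _] _] /=.
rewrite exchange_big [LHS]big_nat_cond [RHS]big_nat_cond.
apply: eq_bigr => j /andP[/andP[j0 _] _] /=.
rewrite sum_nat_delta ?muln_gt0 ?i0 //; case: eqP => [E|]; last by rewrite mul0rn.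
rewrite (_ : (i * j <= n)%N) // -E leq_pmulr // lt0n.
by apply: contra_eq_neq E => ->; rewrite muln0 eq_sym -lt0n.
Qed.

Lemma eq_dconv f f' g g' n :
  (forall k, (0 < k <= n)%N -> f k = f' k) -> (forall k, (0 < k <= n)%N -> g k = g' k) ->
  dconv f g n = dconv f' g' n.
Proof.
move=> ff' gg'; rewrite /dconv [LHS]big_nat_cond [RHS]big_nat_cond.
apply: eq_bigr => i; rewrite ltnS andbT => ni; rewrite [LHS]big_nat_cond [RHS]big_nat_cond.
by apply: eq_bigr => j; rewrite ltnS andbT => nj; rewrite ff' // gg'.
Qed.

Lemma dconvA f g h n : (0 < n)%N -> dconv f (dconv g h) n = dconv (dconv f g) h n.
Proof.
move=> n0; rewrite dconvC.
rewrite (@eq_dconv (dconv g h) (dconv h g) f f) //; last by move=> *; exact: dconvC.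
rewrite !dconv_tconv // /tconv exchange_big [RHS]exchange_big /=.
apply: eq_bigr => j _; rewrite [RHS]exchange_big; apply: eq_bigr => i _ /=.
apply: eq_bigr => k _; congr (_ *+ _); first by ring.
by congr (nat_of_bool (_ == n)); ring.
Qed.

Lemma dconvNl f g n : dconv (fun k => - f k) g n = - dconv f g n.
Proof.
rewrite /dconv -sumrN; apply: eq_bigr => i _; rewrite -sumrN.
by apply: eq_bigr => j _; rewrite mulNr mulNrn.
Qed.

(** Coefficient form of minus the derivative of a Dirichlet series, hence a derivation for
    [dconv]. *)
Definition dlog f n : R := f n * ln n%:R.

Lemma dlog_dconv f g n :
  dlog (dconv f g) n = dconv (dlog f) g n + dconv f (dlog g) n.
Proof.
rewrite /dlog /dconv mulr_suml -big_split /= [LHS]big_nat_cond [RHS]big_nat_cond.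
apply: eq_bigr => i /andP[/andP[i0 _] _]; rewrite mulr_suml -big_split /=.
rewrite [LHS]big_nat_cond [RHS]big_nat_cond.
apply: eq_bigr => j /andP[/andP[j0 _] _]; case: eqP => [<-|_]; last first.
  by rewrite !mulr0n mul0r addr0.
by rewrite !mulr1n natrM lnM ?posrE ?ltr0n //; ring.
Qed.

Definition dunit n : R := (n == 1)%N%:R.

Lemma dconv_unit f n : (0 < n)%N -> dconv dunit f n = f n.
Proof.
move=> n0; rewrite /dconv big_ltn //= [X in _ + X]big_nat_cond.
rewrite [X in _ + X]big1 ?addr0 => [|i /andP[/andP[i1 _] _]]; last first.
  by rewrite big1 // => j _; rewrite /dunit gtn_eqF // mul0r mul0rn.
rewrite /dunit /= (eq_bigr (fun j => f n *+ (n == j)%N)); last first.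
  by move=> j _; rewrite mul1n mul1r eq_sym; case: eqP => [->|].
by rewrite sum_nat_delta // leqnn.
Qed.

End Dirichlet.

(** * Partial summation *)

Section Summation.
Variable R : realType.
Implicit Types (a f g : nat -> R) (n m x : nat).

Definition summ a x : R := \sum_(1 <= n < x.+1) a n.

Lemma summ0 a : summ a 0 = 0.
Proof. by rewrite /summ big_geq. Qed.

Lemma summS a x : summ a x.+1 = summ a x + a x.+1.
Proof. by rewrite /summ big_nat_recr. Qed.

Lemma le_summ a f x : (forall n, (0 < n <= x)%N -> a n <= f n) -> summ a x <= summ f x.
Proof. by move=> H; rewrite /summ; apply: ler_sum_nat => n nx; apply: H. Qed.

Lemma eq_summ a f x : (forall n, (0 < n <= x)%N -> a n = f n) -> summ a x = summ f x.
Proof. by move=> H; apply: eq_big_nat => n nx; apply: H. Qed.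

Lemma norm_summ a x : `|summ a x| <= summ (fun n => `|a n|) x.
Proof. exact: ler_norm_sum. Qed.

Lemma summD a f x : summ (fun n => a n + f n) x = summ a x + summ f x.
Proof. exact: big_split. Qed.

Lemma summB a f x : summ (fun n => a n - f n) x = summ a x - summ f x.
Proof. by rewrite /summ sumrB. Qed.

Lemma summZ k a x : summ (fun n => k * a n) x = k * summ a x.
Proof. by rewrite /summ mulr_sumr. Qed.

Lemma summ_ge0 a x : (forall n, 0 <= a n) -> 0 <= summ a x.
Proof. by move=> a0; apply: sumr_ge0. Qed.

Lemma summ1 x : summ (fun=> 1) x = x%:R.
Proof. by elim: x => [|x IH]; rewrite ?summ0 // summS IH natr1. Qed.

Lemma le_summ_nat a m n : (forall n, 0 <= a n) -> (m <= n)%N -> summ a m <= summ a n.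
Proof.
move=> a0 /subnK <-; elim: (n - m)%N => [//|k IH].
by rewrite addSn summS (le_trans IH) // lerDl.
Qed.

Lemma abel_summ a f x :
  summ (fun n => a n * f n) x.+1 =
  summ a x.+1 * f x.+1 + summ (fun n => summ a n * (f n - f n.+1)) x.
Proof.
elim: x => [|x IH]; first by rewrite !summS !summ0; ring.
by rewrite summS IH (summS (fun n => summ a n * _)) (summS a x.+1); ring.
Qed.

(** Partial summation against a nonincreasing weight gives the partial sums of [a] nonnegative
    coefficients, so a linear bound on them acts as if [a] were the constant [k]. *)
Lemma summ_le_mono a f k x : (forall n, summ a n <= k * n%:R) ->
  (forall n, 0 <= f n) -> (forall n, (0 < n < x)%N -> f n.+1 <= f n) ->
  summ (fun n => a n * f n) x <= k * summ f x.
Proof.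
move=> ak f0 fd; case: x fd => [|x] fd; first by rewrite !summ0 mulr0.
have -> : summ f x.+1 = summ (fun n => 1 * f n) x.+1.
  by apply: eq_summ => n _; rewrite mul1r.
rewrite !abel_summ summ1 mulrDr mulrA lerD ?ler_wpM2r // -summZ.
apply: le_summ => n nx; rewrite summ1 mulrA ler_wpM2r // subr_ge0; exact: fd.
Qed.

Lemma powR_divn x n d : (0 < n)%N ->
  (x%:R / n%:R) `^ (1 - d) = x%:R `^ (1 - d) * n%:R `^ (d - 1) :> R.
Proof.
move=> n0; rewrite powRM ?invr_ge0 //; congr (_ * _).
by rewrite -powR_inv1 // -powRrM; congr (_ `^ _); ring.
Qed.

Lemma summ_powR_le a k d x : 0 < d <= 1 -> (forall n, 0 <= a n) ->
  (forall n, summ a n <= k * n%:R) ->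
  summ (fun n => a n * (x%:R / n%:R) `^ (1 - d)) x <= k * (2 / d) * x%:R.
Proof.
move=> d01 a0 ak; have /andP[d0 d1] := d01.
have k0 : 0 <= k by have := ak 1%N; have := summ_ge0 1 a0; rewrite mulr1; lra.
rewrite (@eq_summ _ (fun n => a n * (x%:R `^ (1 - d) * n%:R `^ (d - 1)))); last first.
  by move=> n /andP[n0 _]; rewrite powR_divn.
apply: le_trans (_ : k * summ (fun n => x%:R `^ (1 - d) * n%:R `^ (d - 1)) x <= _).
  apply: summ_le_mono => // n /andP[n0 _].
  rewrite ler_wpM2l ?powR_ge0 // -[d - 1]opprB !powRN lef_pV2 ?posrE ?powR_gt0 ?ltr0n //.
  by apply: ler_powRl; rewrite ?ler_nat //; lra.
rewrite -mulrA ler_wpM2l // summZ.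
apply: le_trans (_ : x%:R `^ (1 - d) * (2 / d * x%:R `^ d) <= _).
  by rewrite ler_wpM2l ?powR_ge0 //; apply: sum_powR_le.
apply: le_of_eq; rewrite mulrCA -powRD; last by rewrite subrK oner_eq0.
by rewrite subrK powRr1.
Qed.

Lemma sum_inv_le x : (0 < x)%N -> summ (fun n => n%:R^-1) x <= 1 + ln (x%:R : R).
Proof.
case: x => // x _; elim: x => [|x IH]; first by rewrite summS summ0 /= ln1 invr1 add0r addr0.
rewrite summS /=; have /andP[+ _] := @ln_succ_bounds R x.+1 isT.
move: IH; move: (summ _ _) (x.+2%:R^-1) (ln x.+1%:R) (ln x.+2%:R) => *; lra.
Qed.

Lemma sum_inv_ge x : ln (x.+1%:R : R) <= summ (fun n => n%:R^-1) x.
Proof.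
elim: x => [|x IH]; first by rewrite summ0 ln1.
rewrite summS /=; have /andP[_ +] := @ln_succ_bounds R x.+1 isT.
move: IH; move: (summ _ _) (x.+1%:R^-1) (ln x.+1%:R) (ln x.+2%:R) => *; lra.
Qed.

Lemma sum_ln_bounds x : `|summ (fun n => ln n%:R) x - x%:R * ln x%:R| <= x%:R :> R.
Proof.
case: x => [|x]; first by rewrite summ0 mul0r subr0 normr0.
rewrite (@eq_summ _ (fun n => 1 * ln n%:R)); last by move=> n _; rewrite mul1r.
rewrite abel_summ summ1 [X in `|X|]addrAC subrr add0r.
apply: le_trans (norm_summ _ _) _; apply: le_trans (_ : x%:R <= _); last by rewrite ler_nat.
rewrite -[x%:R]summ1; apply: le_summ => n /andP[n0 _]; rewrite summ1.
have n0R : (0 : R) < n%:R by rewrite ltr0n.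
have /andP[h1 h2] := @ln_succ_bounds R n n0.
have h3 : 0 <= (n.+1%:R : R)^-1 by rewrite invr_ge0.
rewrite normrM distrC !ger0_norm //; last exact: le_trans h3 h1.
by rewrite -ler_pdivlMl // mulr1.
Qed.

(** With [C = k/d], the sequence [u n - C n^(-d)] increases and [u n + C n^(-d)] decreases; the
    limit is the supremum of the former and lies between the two. *)
Lemma rate_of_increments (u : nat -> R) k d : 0 < d ->
  (forall n, (0 < n)%N -> `|u n.+1 - u n| <= k * n.+1%:R `^ (- d - 1)) ->
  exists l, forall n, (0 < n)%N -> `|u n - l| <= k / d * n%:R `^ (- d).
Proof.
move=> d0 H; pose C := k / d.
have kd : C * d = k by rewrite /C divfK // gt_eqF.
have k0 : 0 <= k.
  have := le_trans (normr_ge0 _) (H 1%N isT); rewrite pmulr_lge0 => [//|].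
  by apply: powR_gt0; rewrite ltr0n.
have C0 : 0 <= C by rewrite divr_ge0 // ltW.
pose v n := u n - C * n%:R `^ (- d); pose w n := u n + C * n%:R `^ (- d).
have step n : (0 < n)%N -> v n <= v n.+1 /\ w n.+1 <= w n.
  move=> n0; have := H n n0; have := @powRN_succ_ge R d n d0 n0.
  move=> /(ler_wpM2l C0); rewrite mulrA kd ler_norml => h1 /andP[h2 h3].
  by rewrite /v /w; split; lra.
have mono m n : (0 < m)%N -> (m <= n)%N -> v m <= v n /\ w n <= w m.
  move=> m0 /subnK <-; elim: (n - m)%N => [//|j [IH1 IH2]].
  have [] := step (j + m)%N; first by rewrite addn_gt0 m0 orbT.
  by rewrite addSn => h1 h2; split; [apply: le_trans h1 | apply: le_trans IH2].
have vw n : v n <= w n.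
  by rewrite /v /w; have := mulr_ge0 C0 (powR_ge0 n%:R (- d)); lra.
have vwmn m n : (0 < m)%N -> (0 < n)%N -> v m <= w n.
  move=> m0 n0; have [h1 _] := mono m _ m0 (leq_maxl m n).
  have [_ h2] := mono n _ n0 (leq_maxr m n).
  exact: le_trans h1 (le_trans (vw _) h2).
pose E : set R := fun y => exists2 n, (0 < n)%N & y = v n.
have hE : has_sup E.
  split; first by exists (v 1%N), 1%N.
  by exists (w 1%N) => _ [n n0 ->]; apply: vwmn.
exists (sup E) => n n0; rewrite ler_norml.
have h1 : v n <= sup E by apply: sup_upper_bound => //; exists n.
have h2 : sup E <= w n by apply: ge_sup; [case: hE | move=> _ [m m0 ->]; apply: vwmn].
by rewrite /v in h1; rewrite /w in h2; rewrite -/C; apply/andP; split; lra.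
Qed.

End Summation.

(** * The prime number theorem for Beurling-type systems *)

Section Selberg.
(** [b] counts the elements of each norm in a multiplicative system and [L] is its von Mangoldt
    function: [bL] is the coefficient form of [- Z' = (- Z'/Z) Z] for the zeta function [Z] of the
    system. The saving [d] in [count_b] pays for the logarithms that appear below. *)
Variables (R : realType) (b L : nat -> R) (c d K0 : R).
Hypotheses (b_ge0 : forall n, 0 <= b n) (b1 : b 1%N = 1).
Hypothesis L_ge0 : forall n, 0 <= L n.
Hypothesis bL : forall n, (0 < n)%N -> dlog b n = dconv L b n.
Hypotheses (c_gt0 : 0 < c) (d_gt0 : 0 < d) (d_le : d <= 2^-1).
Hypothesis count_b : forall n, (0 < n)%N ->
  `|summ b n - c * n%:R| <= K0 * n%:R `^ (1 - d).
Implicit Types (n m k X : nat).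

Notation psi := (summ L).

Lemma L1_eq0 : L 1%N = 0.
Proof.
have := @bL 1%N isT; rewrite /dlog ln1 mulr0 /dconv !big_nat1 /= b1 mulr1 mulr1n.
by move->.
Qed.

Lemma eq_dconvL f g n : (0 < n)%N -> (forall k, (0 < k < n)%N -> f k = g k) ->
  dconv L f n = dconv L g n.
Proof.
move=> n0 fg; rewrite /dconv big_nat_cond [RHS]big_nat_cond.
apply: eq_bigr => i /andP[/andP[i0 _] _]; rewrite big_nat_cond [RHS]big_nat_cond.
apply: eq_bigr => j /andP[/andP[j0 _] _]; case: eqP => [ij|]; last by rewrite !mulr0n.
have [->|i1] := eqVneq i 1%N; first by rewrite L1_eq0 !mul0r.
by rewrite fg // j0; nia.
Qed.

(** The recursion [mu ln = - dconv L mu], well founded because [L 1 = 0], is solved one value at a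
    time up to [X]. Comparing it with [b ln = dconv L b] gives [|mu| <= b] by induction, and
    applying [dlog] to [dconv mu b] shows that this product vanishes beyond 1. *)
Lemma moebius_up_to X : exists mu : nat -> R,
  [/\ forall n, (0 < n <= X)%N -> `|mu n| <= b n,
      forall n, (0 < n <= X)%N -> dconv mu b n = dunit R n &
      forall n, (0 < n <= X)%N -> dconv (dlog mu) b n = - L n].
Proof.
have [mu [mu1 muL]] : exists mu : nat -> R, mu 1%N = 1 /\
    forall n, (0 < n <= X)%N -> dlog mu n = - dconv L mu n.
  elim: X => [|X [mu [mu1 IH]]]; first by exists (fun=> 1); split=> // -[].
  have [->|X0] := posnP X.
    exists mu; split=> // n n1; have -> : n = 1%N by lia.
    by rewrite /dlog ln1 mulr0 /dconv !big_nat1 /= mulr1n L1_eq0 mul0r oppr0.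
  exists (fun n => if n == X.+1 then - dconv L mu n / ln n%:R else mu n); split.
    by case: eqP => // -[] X0'; move: X0; rewrite -X0'.
  move=> n nX; rewrite [in RHS](@eq_dconvL _ mu); first last.
  - by move=> k kn; rewrite ltn_eqF //; lia.
  - by case/andP: nX.
  rewrite /dlog; case: eqP => [->|nX1].
    by rewrite divfK // gt_eqF // ln_nat_gt0.
  by rewrite -IH //; lia.
have mub n : (0 < n <= X)%N -> dconv mu b n = dunit R n.
  move=> nX; have n0 : (0 < n)%N by case/andP: nX.
  have [->|n1] := eqVneq n 1%N.
    by rewrite /dconv !big_nat1 /= mu1 b1 mulr1 mulr1n /dunit eqxx.
  have : dlog (dconv mu b) n = 0.
    rewrite dlog_dconv (@eq_dconv _ (dlog mu) (fun k => - dconv L mu k) b b) //; last first.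
      by move=> k kn; apply: muL; lia.
    rewrite (@eq_dconv _ mu mu (dlog b) (dconv L b)) //; last first.
      by move=> k /andP[k0 _]; apply: bL.
    rewrite dconvNl.
    rewrite dconvA // (@eq_dconv _ (dconv mu L) (dconv L mu) b b) ?addNr //.
    by move=> *; apply: dconvC.
  move/eqP; rewrite /dlog mulf_eq0 (gt_eqF (ln_nat_gt0 _ _)) ?orbF; last by lia.
  by move/eqP->; rewrite /dunit (negbTE n1).
exists mu; split=> // n nX.
  have [N] := ubnP n; elim: N n nX => // N IH n nX nN.
  have [->|n1] := eqVneq n 1%N; first by rewrite mu1 normr1 b1.
  have l0 : 0 < ln (n%:R : R) by apply: ln_nat_gt0; lia.
  rewrite -(ler_pM2r l0) -[ln _]gtr0_norm // -normrM -/(dlog mu n) muL // normrN.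
  rewrite gtr0_norm // -/(dlog b n) bL; last by lia.
  rewrite /dconv; apply: le_trans (ler_norm_sum _ _ _) _.
  apply: ler_sum_nat => i i0; apply: le_trans (ler_norm_sum _ _ _) _.
  apply: ler_sum_nat => j j0; case: eqP => [ij|_]; last by rewrite !mulr0n normr0.
  rewrite !mulr1n normrM (ger0_norm (L_ge0 _)).
  have [->|i1] := eqVneq i 1%N; first by rewrite L1_eq0 !mul0r.
  by rewrite ler_wpM2l // IH //; nia.
have n0 : (0 < n)%N by case/andP: nX.
rewrite (@eq_dconv _ (dlog mu) (fun k => - dconv L mu k) b b) //; last first.
  by move=> k kn; apply: muL; lia.
rewrite dconvNl.
rewrite -dconvA // (@eq_dconv _ L L _ (dunit R)) //; last first.
  by move=> k kn; apply: mub; lia.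
by rewrite dconvC dconv_unit.
Qed.

Lemma K0_ge0 : 0 <= K0.
Proof. by have := le_trans (normr_ge0 _) (@count_b 1%N isT); rewrite powR1 mulr1. Qed.

Let c0 : 0 <= c. Proof. exact: ltW. Qed.

Lemma powR_le_id n t : (0 < n)%N -> t <= 1 -> (n%:R : R) `^ t <= n%:R.
Proof. by move=> n0 t1; apply: ler1_powR => //; rewrite ler1n. Qed.

Lemma powR_ge1 n t : (0 < n)%N -> 0 <= t -> 1 <= (n%:R : R) `^ t.
Proof.
move=> n0 t0; have n1 : (1 : R) <= n%:R by rewrite ler1n.
by have := ler_powRl t0 ler01 n1; rewrite powR1.
Qed.

Lemma count_b_le n : summ b n <= (c + K0) * n%:R.
Proof.
case: (posnP n) => [->|n0]; first by rewrite summ0 mulr0.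
have := count_b n0; rewrite ler_norml => /andP[_ h].
have : K0 * n%:R `^ (1 - d) <= K0 * n%:R.
  by rewrite ler_wpM2l ?K0_ge0 // powR_le_id //; move: d_gt0; lra.
by rewrite mulrDl; lra.
Qed.

(** By partial summation the first two terms differ by the integral of [summ b t / t^2], so
    subtracting [c ln n] leaves a convergent quantity. Its limit [c1] plays the part of Euler's
    constant. *)
Lemma sum_b_div : exists c1 C : R, forall n, (0 < n)%N ->
  `|summ (fun m => b m / m%:R) n - summ b n / n%:R - c * ln n%:R - c1|
    <= C * n%:R `^ (- d).
Proof.
pose u n := summ (fun m => b m / m%:R) n - summ b n / n%:R - c * ln n%:R.
suff /(rate_of_increments d_gt0)[c1 H] : forall n, (0 < n)%N ->
   `|u n.+1 - u n| <= (2 * K0 + 2 * c) * n.+1%:R `^ (- d - 1).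
  by exists c1, ((2 * K0 + 2 * c) / d).
move=> n n0; rewrite /u !summS /=.
have /andP[] := @ln_succ_bounds R n n0; set l1 := ln _; set l0 := ln _ => h1 h2.
set x : R := n%:R in h2 *; set y : R := n.+1%:R in h1 *.
have x0 : 0 < x by rewrite ltr0n.
have yx : y = x + 1 by rewrite /y natr1.
have y0 : 0 < y by rewrite ltr0n.
have x1 : 1 <= x by rewrite ler1n.
set N := summ b n; set B := summ _ n; set bn := b n.+1.
have -> : B + bn / y - (N + bn) / y - c * l1 - (B - N / x - c * l0) =
   (N - c * x) / (x * y) + c * (y^-1 - (l1 - l0)).
  by rewrite yx; field; rewrite -yx !gt_eqF.
have P0 : 0 < y `^ (- d - 1) by apply: powR_gt0.
have cN : `|N - c * x| <= K0 * x `^ (1 - d) := count_b n0.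
have xd : x `^ (1 - d) / (x * y) <= 2 * y `^ (- d - 1).
  rewrite !powRB ?(gt_eqF x0) ?(gt_eqF y0) ?implybT // !powRr1 ?(ltW x0) ?(ltW y0) //.
  rewrite powRN; have X0 : 0 < x `^ d by apply: powR_gt0.
  have Y0 : 0 < y `^ d by apply: powR_gt0.
  have -> : x / x `^ d / (x * y) = (x `^ d)^-1 / y by field; rewrite !gt_eqF.
  rewrite mulrA ler_wpM2r ?invr_ge0 ?(ltW y0) // ler_pdivlMr // mulrC ler_pdivrMr //.
  apply: le_trans (_ : (2 * x) `^ d <= _).
    by apply: ler_powRl; move: d_gt0; lra.
  rewrite powRM ?(ltW x0) // ler_wpM2r ?(ltW X0) //.
  by apply: le_trans (_ : 2 `^ 1 <= _); [apply: ler_powR; move: d_le; lra | rewrite powRr1].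
apply: le_trans (ler_normD _ _) _; rewrite [leRHS]mulrDl lerD //.
  rewrite normrM [X in _ * X]gtr0_norm ?invr_gt0 ?mulr_gt0 //.
  apply: le_trans (_ : K0 * x `^ (1 - d) / (x * y) <= _).
    by rewrite ler_wpM2r // invr_ge0 mulr_ge0 // ltW.
  by rewrite -mulrA -[2 * K0]mulrC -[_ * 2 * _]mulrA ler_wpM2l ?K0_ge0.
rewrite normrM (ger0_norm c0) -[2 * c]mulrC -[_ * 2 * _]mulrA ler_wpM2l //.
rewrite distrC ger0_norm; last by move: h1; move: (y^-1) => *; lra.
apply: le_trans (_ : x^-1 - y^-1 <= _).
  by move: h2; move: (y^-1) (x^-1) => *; lra.
apply: le_trans xd.
have -> : x^-1 - y^-1 = 1 / (x * y) by rewrite yx; field; rewrite -yx !gt_eqF.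
rewrite ler_wpM2r ?invr_ge0 ?mulr_ge0 ?(ltW x0) ?(ltW y0) //.
by apply: powR_ge1 => //; move: d_le d_gt0; lra.
Qed.

Lemma sum_b_ln : exists C : R, forall n, (0 < n)%N ->
  `|summ (dlog b) n - summ b n * ln n%:R + c * n%:R| <= C * n%:R `^ (1 - d).
Proof.
exists (c + (K0 + c) * 4) => -[//|n] _.
suff H : `|summ (dlog b) n.+1 - summ b n.+1 * ln n.+1%:R + c * n.+1%:R| <=
    c + (K0 + c) * summ (fun k => k%:R `^ (1 - d - 1)) n.
  apply: le_trans H _; rewrite [leRHS]mulrDl lerD //.
    by rewrite -{1}[c]mulr1 ler_wpM2l // powR_ge1 //; move: d_le; lra.
  rewrite -mulrA ler_wpM2l ?addr_ge0 ?K0_ge0 //.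
  have d1 : 0 < 1 - d <= 1 by apply/andP; split; move: d_le d_gt0; lra.
  apply: le_trans (sum_powR_le _ d1) _; apply: ler_pM.
  - by rewrite divr_ge0 //; case/andP: d1 => /ltW.
  - exact: powR_ge0.
  - by case/andP: d1 => d1 _; rewrite ler_pdivrMr //; move: d_le; lra.
  - by apply: ler_powRl; rewrite ?ler_nat //; move: d_le; lra.
elim: n => [|n IH].
  by rewrite !summS !summ0 /dlog ln1 !(mulr0, add0r, oppr0, mulr1, addr0) ger0_norm.
rewrite [summ (dlog b) _]summS [summ b _]summS.
rewrite [summ (fun k => k%:R `^ _) _]summS.
have dist A B : c + (K0 + c) * (A + B) = c + (K0 + c) * A + (K0 + c) * B by ring.
rewrite dist.
have /andP[] := @ln_succ_bounds R n.+1 isT.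
move: IH; set N := summ b n.+1; set T := summ _ n.+1; set x : R := n.+1%:R.
set y : R := n.+2%:R; set l0 := ln x; set S := summ _ n => IH h1 h2.
have x0 : 0 < x by rewrite ltr0n.
have x1 : 1 <= x by rewrite ler1n.
have yx : y = x + 1 by rewrite /y natr1.
have y0 : 0 < y by rewrite ltr0n.
have -> : T + dlog b n.+2 - (N + b n.+2) * ln y + c * y =
  (T - N * l0 + c * x) + (- ((N - c * x) * (ln y - l0)) + c * (1 - x * (ln y - l0))).
  by rewrite /dlog -/y yx; ring.
apply: le_trans (ler_normD _ _) _; rewrite lerD //.
apply: le_trans (ler_normD _ _) _; rewrite normrN [leRHS]mulrDl lerD //.
  rewrite normrM.
  apply: le_trans (_ : K0 * x `^ (1 - d) * x^-1 <= _).
    apply: ler_pM => //; first exact: count_b.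
    rewrite ger0_norm //; apply: le_trans h1; by rewrite invr_ge0 ltW.
  rewrite -mulrA ler_wpM2l ?K0_ge0 //.
  by rewrite [x `^ (1 - d - 1)]powRB ?(gt_eqF x0) ?implybT // powRr1 ?(ltW x0).
have D0 : x * (ln y - l0) <= 1 by rewrite -ler_pdivlMl // mulr1.
have D1 : x / y <= x * (ln y - l0) by rewrite ler_wpM2l // ltW.
rewrite normrM (ger0_norm c0) ler_wpM2l // ger0_norm ?subr_ge0 //.
apply: le_trans (_ : y^-1 <= _).
  apply: le_trans (_ : 1 - x / y <= _); first by rewrite lerD2l lerN2.
  have -> : x = y - 1 by rewrite yx addrK.
  by apply: le_of_eq; rewrite mulrBl divff ?(gt_eqF y0) //; ring.
apply: le_trans (_ : x `^ (- 1) <= _).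
  by rewrite powR_inv1 ?(ltW x0) // lef_pV2 ?posrE // yx; lra.
by apply: ler_powR => //; move: d_le; lra.
Qed.

Lemma divn_real_bounds X m : (0 < m <= X)%N ->
  [/\ (0 < X %/ m)%N, (X %/ m)%:R <= (X%:R / m%:R : R),
      X%:R / m%:R <= (X %/ m)%:R + (1 : R) & 1 <= (X%:R / m%:R : R)].
Proof.
move=> /andP[m0 mX]; have m0R : (0 : R) < m%:R by rewrite ltr0n.
split; first by rewrite divn_gt0.
- by rewrite ler_pdivlMr // -natrM ler_nat leq_divM.
- by rewrite ler_pdivrMr // natr1 -natrM ler_nat ltnW // ltn_ceil.
- by rewrite ler_pdivlMr // mul1r ler_nat.
Qed.

(** The constant [C] is chosen in [sum_b_centred] so that averaging over [k] against [b] kills the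
    main terms; for the ordinary integers it would be minus one minus Euler's constant. *)
Definition centred C X k : R := psi (X %/ k) - X%:R / k%:R - C.

Lemma b_psi n : summ (fun k => b k * psi (n %/ k)) n = summ (dlog b) n.
Proof.
rewrite -[LHS](sum_dconv b L); apply: eq_summ => k /andP[k0 _].
by rewrite dconvC bL.
Qed.

Lemma sum_b_centred : exists C D : R, forall X m, (0 < m <= X)%N ->
  `|summ (fun k => b k * centred C X (m * k)) (X %/ m)| <=
  D * (X%:R / m%:R) `^ (1 - d / 2).
Proof.
have [c1 [K1 H1]] := sum_b_div; have [K2 H2] := sum_b_ln.
(* With [summ b n] replaced by [c n], the terms in [n ln n] cancel and the linear ones add up to
   [- (2c + c1 + c C) n]; this [C] makes them vanish. *)
pose C := - (2 * c + c1) / c; exists C.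
exists ((c + `|c + c1| + 4 * K0 + K2 + 2 * K1 + `|C| * K0) * (1 + 2 / d)) => X m mX.
have [n0 ny yn y1] := divn_real_bounds mX; move: ny yn y1.
set n := (X %/ m)%N in n0 *; set y := X%:R / m%:R; set z : R := n%:R => ny yn y1.
have z1 : 1 <= z by rewrite ler1n.
have z0 : 0 < z by lra.
have -> : summ (fun k => b k * centred C X (m * k)) n =
   summ (dlog b) n - y * summ (fun k => b k / k%:R) n - C * summ b n.
  rewrite -b_psi -!summZ -!summB; apply: eq_summ => k /andP[k0 _].
  rewrite /centred -divnMA -/n !mulrBr [b k * C]mulrC; congr (_ - _ - _).
  by rewrite natrM /y; field; rewrite !pnatr_eq0 -!lt0n k0; case/andP: mX => ->.
have := H1 n n0; have := H2 n n0; have := count_b n0; rewrite -/z.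
set T := summ (dlog b) n; set B := summ (fun k => b k / k%:R) n; set N := summ b n; set l := ln z.
set q := z `^ (1 - d) => h0 h2 h1.
have q1 : 1 <= q by apply: powR_ge1 => //; move: d_le; lra.
have l0 : 0 <= l by apply: ln_nat_ge0.
have zq : z * z `^ (- d) = q.
  by rewrite /q powRB ?(gt_eqF z0) ?implybT // powRr1 ?(ltW z0) // powRN.
have K1_ge0 : 0 <= K1.
  by have := le_trans (normr_ge0 _) h1; rewrite pmulr_lge0 // powR_gt0.
have K2_ge0 : 0 <= K2.
  by have := le_trans (normr_ge0 _) h2; rewrite pmulr_lge0 // powR_gt0.
pose E := N - c * z; pose v := T - N * l + c * z; pose r := B - N / z - c * l - c1.
have -> : T - y * B - C * N = c * (l * (z - y)) + (c + c1) * (z - y)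
   + E * l + v - (y / z) * E - y * r - C * E.
  by rewrite /E /v /r /C; field; rewrite !gt_eqF.
have yz2 : y / z <= 2 by rewrite ler_pdivrMr //; lra.
have yz0 : 0 <= y / z by rewrite divr_ge0 //; lra.
have zy : `|z - y| <= 1 by rewrite ler_norml; apply/andP; split; lra.
have t1 : `|c * (l * (z - y))| <= c * l.
  rewrite normrM (ger0_norm c0) ler_wpM2l // normrM (ger0_norm l0).
  by rewrite -[leRHS]mulr1 ler_wpM2l.
have t2 : `|(c + c1) * (z - y)| <= `|c + c1|.
  by rewrite normrM -[leRHS]mulr1 ler_wpM2l.
have t3 : `|E * l| <= K0 * q * l by rewrite normrM (ger0_norm l0) ler_wpM2r.
have t5 : `|y / z * E| <= 2 * (K0 * q).
  by rewrite normrM (ger0_norm yz0); apply: ler_pM.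
have t6 : `|y * r| <= 2 * K1 * q.
  rewrite normrM ger0_norm; last by lra.
  rewrite -zq [leRHS](_ : _ = (2 * z) * (K1 * z `^ (- d))); last by ring.
  by apply: ler_pM => //; lra.
have t7 : `|C * E| <= `|C| * K0 * q by rewrite normrM -mulrA ler_wpM2l.
have K0_ := K0_ge0.
apply: le_trans (_ : (c + `|c + c1| + 4 * K0 + K2 + 2 * K1 + `|C| * K0) * (1 + l) * q <= _).
  have tri (a1 a2 a3 a4 a5 a6 a7 : R) :
      `|a1 + a2 + a3 + a4 - a5 - a6 - a7| <= `|a1| + `|a2| + `|a3| + `|a4| + `|a5| + `|a6| + `|a7|.
    do 3 (apply: le_trans (ler_normB _ _) _; rewrite lerD //).
    do 2 (apply: le_trans (ler_normD _ _) _; rewrite lerD //).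
    exact: ler_normD.
  apply: le_trans (tri _ _ _ _ _ _ _) _.
  have C0 := normr_ge0 C; have cc := normr_ge0 (c + c1).
  have wE : (1 + l) * q = q + q * l by ring.
  have lql : l <= q * l by rewrite ler_peMl.
  have p1 : l <= (1 + l) * q by rewrite wE; lra.
  have p2 : 1 <= (1 + l) * q by rewrite wE; lra.
  have p3 : q <= (1 + l) * q by rewrite wE; lra.
  have p4 : q * l <= (1 + l) * q by rewrite wE; lra.
  have s1 : c * l <= c * ((1 + l) * q) by rewrite ler_wpM2l.
  have s2 : `|c + c1| <= `|c + c1| * ((1 + l) * q) by rewrite -[leLHS]mulr1 ler_wpM2l.
  have s3 : K0 * q * l <= K0 * ((1 + l) * q) by rewrite -mulrA ler_wpM2l.
  have s4 : K2 * q <= K2 * ((1 + l) * q) by rewrite ler_wpM2l.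
  have s5 : 2 * (K0 * q) <= 2 * K0 * ((1 + l) * q) by rewrite mulrA ler_wpM2l // mulr_ge0.
  have s6 : 2 * K1 * q <= 2 * K1 * ((1 + l) * q) by rewrite ler_wpM2l // mulr_ge0.
  have s7 : `|C| * K0 * q <= `|C| * K0 * ((1 + l) * q) by rewrite ler_wpM2l // mulr_ge0.
  have s8 : 0 <= K0 * ((1 + l) * q) by rewrite mulr_ge0 //; lra.
  rewrite -[leRHS]mulrA; set w := (1 + l) * q in s1 s2 s3 s4 s5 s6 s7 s8 p1 p2 p3 p4 *.
  rewrite ![in leRHS]mulrDl; move: h2 t1 t2 t3 t5 t6 t7; rewrite -/v -/q.
  move: `|c * _| `|(c + c1) * _| `|E * l| `|v| `|y / z * E| `|y * r| `|C * E|.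
  move=> a1 a2 a3 a4 a5 a6 a7; lra.
rewrite -!mulrA ler_wpM2l //.
  by rewrite !addr_ge0 ?mulr_ge0 ?normr_ge0.
(* The factor [1 + ln z] is paid with half of the saving, through [ln z <= (2/d) z^(d/2)]. *)
have d20 : 0 < d / 2 by rewrite divr_gt0 // ltr0n.
have lq : l <= 2 / d * z `^ (d / 2) by rewrite -[2 / d]invf_div; apply: ln_le_powR.
have z2 : 1 <= z `^ (d / 2) by apply: powR_ge1 => //; exact: ltW.
apply: le_trans (_ : (1 + 2 / d) * z `^ (d / 2) * q <= _).
  by rewrite ler_wpM2r ?powR_ge0 // mulrDl mul1r lerD.
rewrite -mulrA ler_wpM2l //; first by rewrite addr_ge0 // divr_ge0 // ltW.
rewrite /q -powRD ?(gt_eqF z0) ?implybT // (_ : d / 2 + (1 - d) = 1 - d / 2); last by field.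
by apply: ler_powRl => //; move: d_le d20; lra.
Qed.


Lemma sum_b_powR_le e : 0 < e <= 1 -> forall X,
  summ (fun m => b m * (X%:R / m%:R) `^ (1 - e)) X <= (c + K0) * (2 / e) * X%:R.
Proof. by move=> e01 X; apply: summ_powR_le => // n; apply: count_b_le. Qed.

Let d2 : 0 < d / 2 <= 1.
Proof. by rewrite divr_gt0 //= ler_pdivrMr // mul1r; move: d_le; lra. Qed.

Let d4 : 0 < d / 4 <= 1.
Proof. by rewrite divr_gt0 //= ler_pdivrMr // mul1r; move: d_le; lra. Qed.

(* Moebius inversion of [sum_b_centred]; this is Chebyshev's bound. *)
Lemma psi_le : exists K : R, 0 <= K /\ forall X, psi X <= K * X%:R.
Proof.
have [C [D H]] := sum_b_centred; pose K := D * ((c + K0) * (2 / (d / 2))).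
suff B : forall X, (0 < X)%N -> psi X <= (1 + `|C| + `|K|) * X%:R.
  exists (1 + `|C| + `|K|); split=> [|X]; first by rewrite !addr_ge0.
  by case: (posnP X) => [->|/B //]; rewrite summ0 mulr0.
move=> X X0; have X1 : (1 : R) <= X%:R by rewrite ler1n.
have [mu [mub muinv _]] := moebius_up_to X.
have E : centred C X 1 =
    summ (fun m => mu m * summ (fun k => b k * centred C X (m * k)) (X %/ m)) X.
  rewrite -[RHS](sum_dconv_weight mu b (centred C X)).
  rewrite big_ltn // muinv ?X0 // /dunit eqxx mul1r big_nat_cond big1 ?addr0 //.
  move=> n /andP[/andP[n1 nX] _]; rewrite muinv; last by lia.
  by rewrite /dunit gtn_eqF // mul0r.
have Hc : centred C X 1 <= `|K| * X%:R.
  apply: le_trans (ler_norm _) _; rewrite E; apply: le_trans (norm_summ _ _) _.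
  apply: le_trans (_ : summ (fun m => D * (b m * (X%:R / m%:R) `^ (1 - d / 2))) X <= _).
    apply: le_summ => m mX; rewrite normrM mulrCA; apply: ler_pM => //.
      exact: mub.
    by apply: H.
  rewrite summZ; apply: le_trans (_ : K * X%:R <= _); last by rewrite ler_wpM2r // ler_norm.
  rewrite /K -mulrA; have D0 : 0 <= D.
    have X11 : (0 < 1 <= 1)%N by [].
    have := le_trans (normr_ge0 _) (H 1%N 1%N X11).
    by rewrite divr1 powR1 mulr1.
  by rewrite ler_wpM2l //; apply: sum_b_powR_le.
move: Hc; rewrite /centred divn1 divr1 => Hc.
have C1 : C <= `|C| * X%:R.
  by apply: le_trans (ler_norm C) _; rewrite -[leLHS]mulr1 ler_wpM2l.
by rewrite !mulrDl mul1r; move: Hc C1; move: `|C| `|K| => *; lra.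
Qed.

Lemma sum_L_powR_le : exists K : R, forall X,
  summ (fun m => L m * (X%:R / m%:R) `^ (1 - d)) X <= K * X%:R.
Proof.
have [K [K_ge0 HK]] := psi_le; exists (K * (2 / d)) => X.
by apply: summ_powR_le => //; rewrite d_gt0 /=; move: d_le; lra.
Qed.

(** The sum of [b ln] is evaluated twice: as the sum of [L k] times [summ b (X/k)], which is [c X]
    times the sum of [L k / k] up to [O(X)] by Chebyshev's bound, and directly as [c X ln X] up to
    [O(X)]. *)
Lemma mertens : exists K : R, forall X, (0 < X)%N ->
  `|summ (fun k => L k / k%:R) X - ln X%:R| <= K.
Proof.
have [K1 H1] := sum_L_powR_le; have [K2 H2] := sum_b_ln.
pose A := (K0 + c) * K1 + K0 / d + c + `|K2|; exists (A / c) => X X0.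
have XR : (0 : R) < X%:R by rewrite ltr0n.
set M := summ _ X; set l := ln _.
have l0 : 0 <= l by apply: ln_nat_ge0.
suff H : `|c * X%:R * (M - l)| <= A * X%:R.
  move: H; rewrite !normrM (gtr0_norm c_gt0) (gtr0_norm XR) mulrAC ler_pM2r //.
  by rewrite ler_pdivlMr // mulrC.
have eT : summ (dlog b) X = summ (fun k => L k * summ b (X %/ k)) X.
  rewrite -[RHS](sum_dconv L b); apply: eq_summ => k /andP[k0 _]; exact: bL.
have powle : X%:R `^ (1 - d) <= X%:R :> R.
  by apply: powR_le_id => //; move: d_gt0; lra.
have B1 : `|summ (dlog b) X - c * X%:R * M| <= (K0 + c) * K1 * X%:R.
  rewrite eT /M -summZ -summB; apply: le_trans (norm_summ _ _) _.
  apply: le_trans (_ : (K0 + c) * summ (fun m => L m * (X%:R / m%:R) `^ (1 - d)) X <= _).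
    rewrite -summZ; apply: le_summ => k kX; have [n0 ny yn y1] := divn_real_bounds kX.
    rewrite [c * _ * _](_ : _ = L k * (c * (X%:R / k%:R))); last by ring.
    rewrite -mulrBr normrM (ger0_norm (L_ge0 k)) [leRHS]mulrCA ler_wpM2l //.
    move: ny yn y1; set y := X%:R / k%:R; set n := (X %/ k)%N in n0 * => ny yn y1.
    have -> : summ b n - c * y = (summ b n - c * n%:R) + c * (n%:R - y) by ring.
    have dd : 0 <= 1 - d by move: d_le; lra.
    have y1d : 1 <= y `^ (1 - d).
      by have := ler_powRl dd ler01 y1; rewrite powR1.
    apply: le_trans (ler_normD _ _) _; rewrite mulrDl lerD //.
      apply: le_trans (count_b n0) _; rewrite ler_wpM2l ?K0_ge0 //; exact: ler_powRl.
    rewrite normrM (ger0_norm c0) ler_wpM2l //; apply: le_trans _ y1d.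
    by rewrite ler_norml; apply/andP; split; move: ny yn; lra.
  by rewrite -mulrA ler_wpM2l // addr_ge0 ?K0_ge0.
have B2 : `|summ (dlog b) X - c * X%:R * l| <= (K0 / d + c + `|K2|) * X%:R.
  have := H2 X X0; set T := summ _ X; rewrite -/l => h2.
  have h2' : `|T - summ b X * l + c * X%:R| <= `|K2| * X%:R.
    apply: le_trans h2 _; apply: le_trans (_ : `|K2| * X%:R `^ (1 - d) <= _).
      by rewrite ler_wpM2r ?powR_ge0 // ler_norm.
    by rewrite ler_wpM2l.
  have h3 : `|(summ b X - c * X%:R) * l| <= K0 / d * X%:R.
    rewrite normrM (ger0_norm l0).
    apply: le_trans (_ : K0 * X%:R `^ (1 - d) * (d^-1 * X%:R `^ d) <= _).
      by apply: ler_pM => //; [exact: count_b | exact: ln_le_powR].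
    apply: le_of_eq; rewrite mulrACA -powRD; last by rewrite subrK oner_eq0.
    by rewrite subrK powRr1.
  have -> : T - c * X%:R * l = (T - summ b X * l + c * X%:R) +
      ((summ b X - c * X%:R) * l) - c * X%:R by ring.
  apply: le_trans (ler_normB _ _) _; rewrite [`|c * _|]ger0_norm ?mulr_ge0 //.
  apply: le_trans (lerD (ler_normD _ _) (lexx _)) _.
  by rewrite ![in leRHS]mulrDl; move: h2' h3; move: `|K2| `|_| `|_| => *; lra.
have -> : c * X%:R * (M - l) = (summ (dlog b) X - c * X%:R * l) -
   (summ (dlog b) X - c * X%:R * M) by ring.
apply: le_trans (ler_normB _ _) _; rewrite /A.
rewrite ![in leRHS]mulrDl; move: B1 B2; rewrite ![(_ + _) * X%:R]mulrDl; move: `|K2| `|_| `|_| => *; lra.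
Qed.


Lemma dconv_linear (f g h : nat -> R) (a : R) n :
  dconv (fun k => a * f k + g k) h n = a * dconv f h n + dconv g h n.
Proof.
rewrite /dconv mulr_sumr -big_split; apply: eq_bigr => i _.
rewrite mulr_sumr -big_split; apply: eq_bigr => j _ /=.
by rewrite mulrDl mulrnDl mulrnAr mulrA.
Qed.

Definition remainder n : R := psi n - n%:R.

(** The weights [w m = mu m ln (X/m)] convolve with [b] to [ln X] at 1 plus [L]. Inverting
    [sum_b_centred] with them in place of [mu] thus produces both terms of the formula; the extra
    logarithm costs another [d/4] of the exponent. *)
Lemma selberg_formula : exists K : R, forall X, (0 < X)%N ->
  `|remainder X * ln X%:R + summ (fun k => L k * remainder (X %/ k)) X| <= K * X%:R.
Proof.
have [C [D H]] := sum_b_centred; have [K1 [K1_ge0 HK1]] := psi_le.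
have D0 : 0 <= D.
  have X11 : (0 < 1 <= 1)%N by [].
  have := le_trans (normr_ge0 _) (H 1%N 1%N X11).
  by rewrite divr1 powR1 mulr1.
pose A := 4 / d * D * ((c + K0) * (2 / (d / 4))).
exists (A + `|C| + K1 + `|C| * K1) => X X0.
have XR : (0 : R) < X%:R by rewrite ltr0n.
have X1 : (1 : R) <= X%:R by rewrite ler1n.
set l := ln X%:R; have l0 : 0 <= l by apply: ln_nat_ge0.
have [mu [mub muinv mulog]] := moebius_up_to X.
pose w m := l * mu m + - dlog mu m.
have E : l * centred C X 1 + summ (fun k => L k * centred C X k) X =
    summ (fun m => w m * summ (fun k => b k * centred C X (m * k)) (X %/ m)) X.
  rewrite -[RHS](sum_dconv_weight w b (centred C X)).
  rewrite [RHS](eq_big_nat _ _ (F2 := fun n =>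
    (l * centred C X 1) * dunit R n + L n * centred C X n)); last first.
    move=> n nX; rewrite /w dconv_linear muinv // dconvNl mulog // opprK mulrDl.
    congr (_ + _); rewrite /dunit; case: eqP => [->|_]; first by rewrite !mulr1.
    by rewrite !mulr0 mul0r.
  rewrite big_split /=; congr (_ + _); rewrite -mulr_sumr.
  rewrite big_ltn // /dunit eqxx big_nat_cond big1 ?addr0 ?mulr1 // => n.
  by case/andP => /andP[n1 _] _; rewrite gtn_eqF.
have B : `|l * centred C X 1 + summ (fun k => L k * centred C X k) X| <= A * X%:R.
  rewrite E; apply: le_trans (norm_summ _ _) _.
  apply: le_trans (_ :
    summ (fun m => 4 / d * D * (b m * (X%:R / m%:R) `^ (1 - d / 4))) X <= _).
    apply: le_summ => m mX; have [n0 ny yn y1] := divn_real_bounds mX.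
    have m0 : (0 : R) < m%:R by rewrite ltr0n; case/andP: mX.
    set y := X%:R / m%:R in ny yn y1 *; have y0 : 0 < y := lt_le_trans ltr01 y1.
    have wE : w m = mu m * ln y.
      by rewrite /w /dlog /y ln_div ?posrE // /l; ring.
    have ly : ln y <= 4 / d * y `^ (d / 4).
      by rewrite -[4 / d]invf_div; apply: ln_le_powR => //; case/andP: d4.
    have ly0 : 0 <= ln y by apply: ln_ge0.
    rewrite normrM wE normrM (ger0_norm ly0).
    rewrite (_ : 1 - d / 4 = d / 4 + (1 - d / 2)); last by field.
    rewrite powRD ?(gt_eqF y0) ?implybT //.
    rewrite [leRHS](_ : _ = b m * (4 / d * y `^ (d / 4)) * (D * y `^ (1 - d / 2))); last by ring.
    apply: ler_pM => //; first by rewrite mulr_ge0.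
      by apply: ler_pM => //; apply: mub.
    by apply: H.
  rewrite summZ /A -[leRHS]mulrA ler_wpM2l //; last exact: sum_b_powR_le.
  by rewrite mulr_ge0 // divr_ge0 // ltW.
pose S1 := summ (fun k => L k * ((X %/ k)%:R - X%:R / k%:R)) X.
have S1_le : `|S1| <= K1 * X%:R.
  apply: le_trans (norm_summ _ _) _; apply: le_trans (HK1 X); apply: le_summ => k kX.
  have [n0 ny yn y1] := divn_real_bounds kX.
  rewrite normrM (ger0_norm (L_ge0 k)) -[leRHS]mulr1 ler_wpM2l //.
  by rewrite ler_norml; apply/andP; split; move: ny yn; lra.
have -> : remainder X * l + summ (fun k => L k * remainder (X %/ k)) X =
   (l * centred C X 1 + summ (fun k => L k * centred C X k) X) + C * l - S1
   + C * psi X.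
  rewrite /centred /remainder divn1 divr1.
  have -> : summ (fun k => L k * (psi (X %/ k) - X%:R / k%:R - C)) X =
    summ (fun k => L k * (psi (X %/ k) - (X %/ k)%:R)) X + S1 - C * psi X.
    rewrite -summZ -summD -summB; apply: eq_summ => k _; ring.
  ring.
have lX : l <= X%:R by apply: le_trans (ln_le_subr1 XR) _; rewrite gerBl.
have C1 : `|C * l| <= `|C| * X%:R by rewrite normrM (ger0_norm l0) ler_wpM2l.
have C2 : `|C * psi X| <= `|C| * K1 * X%:R.
  by rewrite normrM -mulrA ler_wpM2l // ger0_norm ?HK1 // summ_ge0.
apply: le_trans (ler_normD _ _) _; rewrite [leRHS]mulrDl lerD //.
apply: le_trans (ler_normB _ _) _; rewrite [leRHS]mulrDl lerD //.
by apply: le_trans (ler_normD _ _) _; rewrite [leRHS]mulrDl lerD.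
Qed.

End Selberg.

(** * Consequences of Selberg's formula *)

Section SelbergConsequences.
Variables (R : realType) (L : nat -> R) (Kp Km Ks : R).
Hypotheses (L_ge0 : forall n, 0 <= L n) (Kp_ge0 : 0 <= Kp).
Hypothesis psi_le : forall n, summ L n <= Kp * n%:R.
Hypothesis mertens : forall n, (0 < n)%N ->
  `|summ (fun k => L k / k%:R) n - ln n%:R| <= Km.
Hypothesis selberg : forall n, (0 < n)%N ->
  `|remainder L n * ln n%:R + summ (fun k => L k * remainder L (n %/ k)) n| <= Ks * n%:R.
Implicit Types (n m k X : nat).
Notation psi := (summ L).
Notation rem := (remainder L).

Let Km_ge0 : 0 <= Km.
Proof. exact: le_trans (normr_ge0 _) (@mertens 1%N isT). Qed.

Let Ks_ge0 : 0 <= Ks.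
Proof. by have := le_trans (normr_ge0 _) (@selberg 1%N isT); rewrite mulr1. Qed.

Lemma norm_rem_le n : `|rem n| <= (Kp + 1) * n%:R.
Proof.
apply: le_trans (ler_normB _ _) _; rewrite !ger0_norm ?summ_ge0 //.
by rewrite mulrDl mul1r lerD2r.
Qed.

(** Selberg's second-order von Mangoldt function, the coefficients of [Z''/Z]. *)
Definition lam2 n : R := L n * ln n%:R + dconv L L n.

Lemma dconvLL_ge0 n : 0 <= dconv L L n.
Proof.
rewrite /dconv; apply: sumr_ge0 => i _; apply: sumr_ge0 => j _.
by apply: mulrn_wge0; apply: mulr_ge0.
Qed.

Lemma sum_lam2 : exists K : R, forall X, (0 < X)%N ->
  `|summ lam2 X - 2 * X%:R * ln X%:R| <= K * X%:R.
Proof.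
exists (Ks + Kp + Kp + Km) => -[//|x] _; set X := x.+1.
have XR : (0 : R) < X%:R by rewrite ltr0n.
set l := ln X%:R.
have B1 : `|summ (fun n => L n * ln n%:R) X - psi X * l| <= Kp * X%:R.
  rewrite abel_summ addrAC subrr add0r; apply: le_trans (norm_summ _ _) _.
  apply: le_trans (_ : summ (fun=> Kp) x <= _); last first.
    rewrite (@eq_summ _ _ (fun=> Kp * 1)); last by move=> *; rewrite mulr1.
    by rewrite summZ summ1 ler_wpM2l // ler_nat.
  apply: le_summ => n /andP[n0 _]; have n0R : (0 : R) < n%:R by rewrite ltr0n.
  have /andP[h1 h2] := @ln_succ_bounds R n n0.
  rewrite normrM ger0_norm ?summ_ge0 // distrC ger0_norm; last first.
    by apply: le_trans h1; rewrite invr_ge0.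
  apply: le_trans (_ : Kp * n%:R * n%:R^-1 <= _).
    by apply: ler_pM => //; [exact: summ_ge0 | apply: le_trans h1; rewrite invr_ge0].
  by rewrite mulfK // gt_eqF.
pose S1 := summ (fun k => L k * ((X %/ k)%:R - X%:R / k%:R)) X.
have B2 : `|S1| <= Kp * X%:R.
  apply: le_trans (norm_summ _ _) _; apply: le_trans (psi_le X); apply: le_summ => k kX.
  have [n0 ny yn y1] := divn_real_bounds R kX.
  rewrite normrM (ger0_norm (L_ge0 k)) -[leRHS]mulr1 ler_wpM2l //.
  by rewrite ler_norml; apply/andP; split; move: ny yn; lra.
pose M := summ (fun k => L k / k%:R) X.
have B3 : `|X%:R * (M - l)| <= Km * X%:R.
  by rewrite normrM (gtr0_norm XR) mulrC ler_wpM2r // mertens.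
have -> : summ lam2 X - 2 * X%:R * l =
   (rem X * l + summ (fun k => L k * rem (X %/ k)) X)
   + (summ (fun n => L n * ln n%:R) X - psi X * l) + S1 + X%:R * (M - l).
  rewrite summD (_ : summ (dconv L L) X = summ (fun k => L k * psi (X %/ k)) X); last first.
    exact: sum_dconv.
  have -> : summ (fun k => L k * psi (X %/ k)) X =
      summ (fun k => L k * rem (X %/ k)) X + S1 + X%:R * M.
    by rewrite /M -summZ -!summD; apply: eq_summ => k _; rewrite /remainder; ring.
  by rewrite [in RHS]/remainder; ring.
do 3 (apply: le_trans (ler_normD _ _) _; rewrite [leRHS]mulrDl lerD //).
exact: selberg.
Qed.

(** [ln X] times Selberg's formula at [X], minus its [L]-average over the points [X/k], eliminates
    the first-order sum. What remains expresses [rem X ln^2 X] through [dconv L L] and [L ln] with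
    opposite signs, and absolute values merge these into [lam2]. *)
Lemma norm_rem_sq_le : exists K : R, forall X, (0 < X)%N ->
  `|rem X| * ln X%:R ^+ 2 <=
  summ (fun n => lam2 n * `|rem (X %/ n)|) X + K * (X%:R * (1 + ln X%:R)).
Proof.
exists (Ks + Ks * (1 + Km) + (Kp + 1) * Kp) => X X0.
have XR : (0 : R) < X%:R by rewrite ltr0n.
set l := ln X%:R; have l0 : 0 <= l by apply: ln_nat_ge0.
pose Q n := rem n * ln n%:R + summ (fun k => L k * rem (n %/ k)) n.
have HQ n : (0 < n)%N -> `|Q n| <= Ks * n%:R := @selberg n.
(* The defect between [ln X - ln k] and the logarithm of the integer part of [X/k]. It is at most
   the inverse of that integer part, which cancels the linear growth of [rem]. *)
pose dl k := l - ln (X %/ k)%:R - ln k%:R.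
have dlb k : (0 < k <= X)%N -> `|dl k * rem (X %/ k)| <= Kp + 1.
  move=> kX; have [n0 ny yn y1] := divn_real_bounds R kX.
  have k0 : (0 : R) < k%:R by rewrite ltr0n; case/andP: kX.
  have n0R : (0 : R) < (X %/ k)%:R by rewrite ltr0n.
  rewrite normrM; apply: le_trans (_ : (X %/ k)%:R^-1 * ((Kp + 1) * (X %/ k)%:R) <= _).
    apply: ler_pM => //; last exact: norm_rem_le.
    have -> : dl k = ln (X%:R / k%:R / (X %/ k)%:R).
      by rewrite !ln_div ?posrE ?divr_gt0 // /dl /l; ring.
    have q0 : 0 < X%:R / k%:R / (X %/ k)%:R :> R by rewrite !divr_gt0.
    rewrite ger0_norm; last by apply: ln_ge0; rewrite ler_pdivlMr // mul1r.
    apply: le_trans (ln_le_subr1 q0) _;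
    by rewrite lerBlDr ler_pdivrMr // mulrDl mulVf ?(gt_eqF n0R) // mul1r addrC.
  by apply: le_of_eq; rewrite mulrCA mulVf ?mulr1 // gt_eqF.
have E : rem X * l ^+ 2 = l * Q X - summ (fun k => L k * Q (X %/ k)%N) X
   + summ (fun n => dconv L L n * rem (X %/ n)) X
   - summ (fun k => L k * ln k%:R * rem (X %/ k)) X
   - summ (fun k => L k * (dl k * rem (X %/ k))) X.
  have W : summ (fun n => dconv L L n * rem (X %/ n)) X =
      summ (fun i => L i * summ (fun j => L j * rem (X %/ (i * j))) (X %/ i)) X.
    exact: (sum_dconv_weight L L (fun n => rem (X %/ n))).
  rewrite W {1}/Q mulrDr -summZ.
  have Z : summ (fun k => l * (L k * rem (X %/ k))) X - summ (fun k => L k * Q (X %/ k)%N) X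
     + summ (fun i => L i * summ (fun j => L j * rem (X %/ (i * j))) (X %/ i)) X
     - summ (fun k => L k * ln k%:R * rem (X %/ k)) X
     - summ (fun k => L k * (dl k * rem (X %/ k))) X = 0.
    rewrite -summB -summD -!summB -[RHS](mul0r (summ (fun=> 0) X)) -summZ.
    apply: eq_summ => k _.
    rewrite /Q /dl (@eq_summ _ (fun j => L j * rem (X %/ (k * j)))
      (fun j => L j * rem (X %/ k %/ j))); last by move=> j _; rewrite divnMA.
    by ring.
  move: Z; do 5 (set s := summ _ _; move: s).
  move=> s1 s2 s3 s4 s5 Z; apply/eqP; rewrite -subr_eq0 -oppr_eq0 -Z -/l; apply/eqP; ring.
have -> : `|rem X| * l ^+ 2 = `|rem X * l ^+ 2|.
  by rewrite normrM [`|l ^+ 2|]ger0_norm // sqr_ge0.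
rewrite E.
have T1 : `|l * Q X| <= Ks * (X%:R * (1 + l)).
  rewrite normrM (ger0_norm l0); apply: le_trans (_ : l * (Ks * X%:R) <= _).
    by rewrite ler_wpM2l // HQ.
  by have := mulr_ge0 Ks_ge0 (ltW XR); lra.
have T2 : `|summ (fun k => L k * Q (X %/ k)%N) X| <= Ks * (1 + Km) * (X%:R * (1 + l)).
  apply: le_trans (norm_summ _ _) _.
  apply: le_trans (_ : summ (fun k => Ks * X%:R * (L k / k%:R)) X <= _).
    apply: le_summ => k kX; have [n0 ny yn y1] := divn_real_bounds R kX.
    rewrite normrM (ger0_norm (L_ge0 k)).
    rewrite [leRHS](_ : _ = L k * (Ks * (X%:R / k%:R))); last by ring.
    rewrite ler_wpM2l //; apply: le_trans (HQ _ n0) _; exact: ler_wpM2l.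
  rewrite summZ -mulrA -[leRHS]mulrA ler_wpM2l // mulrCA ler_wpM2l ?(ltW XR) //.
  have := mertens X0; rewrite ler_norml => /andP[_ +]; rewrite -/l.
  by have := mulr_ge0 Km_ge0 l0; move: (summ _ _) => *; lra.
have T3 : `|summ (fun k => L k * (dl k * rem (X %/ k))) X| <= (Kp + 1) * Kp * (X%:R * (1 + l)).
  apply: le_trans (norm_summ _ _) _.
  apply: le_trans (_ : summ (fun k => (Kp + 1) * L k) X <= _).
    apply: le_summ => k kX; rewrite normrM (ger0_norm (L_ge0 k)) mulrC.
    by rewrite ler_wpM2r // dlb.
  rewrite summZ -mulrA ler_wpM2l ?addr_ge0 //; apply: le_trans (psi_le X) _.
  by rewrite ler_wpM2l // -[leLHS]mulr1 ler_wpM2l ?(ltW XR) // lerDl.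
have T4 : `|summ (fun n => dconv L L n * rem (X %/ n)) X| + `|summ (fun k => L k * ln k%:R * rem (X %/ k)) X|
   <= summ (fun n => lam2 n * `|rem (X %/ n)|) X.
  apply: le_trans (lerD (norm_summ _ _) (norm_summ _ _)) _.
  rewrite -summD; apply: le_summ => k _; rewrite !normrM (ger0_norm (L_ge0 k)).
  rewrite (ger0_norm (dconvLL_ge0 _)) (ger0_norm (ln_nat_ge0 _ _)) /lam2.
  by rewrite [leRHS]mulrDl addrC.
have tri (a1 a2 a3 a4 a5 : R) :
    `|a1 - a2 + a3 - a4 - a5| <= `|a1| + `|a2| + `|a3| + `|a4| + `|a5|.
  do 2 (apply: le_trans (ler_normB _ _) _; rewrite lerD //).
  by apply: le_trans (ler_normD _ _) _; rewrite lerD // ler_normB.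
apply: le_trans (tri _ _ _ _ _) _; rewrite (mulrDl _ _ (X%:R * (1 + l))) (mulrDl _ _ (X%:R * (1 + l))).
move: T1 T2 T3 T4; set B := X%:R * (1 + l).
move: `|l * _| `|summ _ X| `|summ _ X| `|summ _ X| `|summ _ X| => a1 a2 a3 a4 a5.
move: (summ _ X) (Ks * B) (Ks * (1 + Km) * B) ((Kp + 1) * Kp * B) => *; lra.
Qed.

Lemma sum_lam2_sub_ln : exists K : R, 0 <= K /\ forall X,
  `|summ (fun n => lam2 n - 2 * ln n%:R) X| <= K * X%:R.
Proof.
have [K H] := sum_lam2; have K0 : 0 <= K.
  by have := le_trans (normr_ge0 _) (@H 1%N isT); rewrite mulr1.
exists (K + 2); split=> [|X]; first by rewrite addr_ge0.
case: (posnP X) => [->|X0]; first by rewrite summ0 normr0 mulr0.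
rewrite summB summZ.
have -> : summ lam2 X - 2 * summ (fun n => ln n%:R) X =
   (summ lam2 X - 2 * X%:R * ln X%:R) -
   2 * (summ (fun n => ln n%:R) X - X%:R * ln X%:R) by ring.
apply: le_trans (ler_normB _ _) _; rewrite [leRHS]mulrDl lerD ?H //.
by rewrite normrM ger0_norm // ler_wpM2l // sum_ln_bounds.
Qed.

(** [lam2] is [2 ln] on average, so partial summation may replace it. This requires the variation of
    [|rem (X/n)|] in [n], which is bounded by that of [h]: [psi] and the integer quotient are both
    nondecreasing, so their changes add. *)
Lemma norm_rem_sq_le_ln : exists K : R, forall X, (0 < X)%N ->
  `|rem X| * ln X%:R ^+ 2 <=
  2 * summ (fun n => ln n%:R * `|rem (X %/ n)|) X + K * (X%:R * (1 + ln X%:R)).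
Proof.
have [K1 H1] := norm_rem_sq_le; have [K2 [K2_ge0 H2]] := sum_lam2_sub_ln.
exists (K1 + K2 * (Kp + 1) + K2 * (Kp + 1)) => -[//|x] _; have := H1 x.+1 isT.
move: (H2); set X := x.+1 => _ h1; have XR : (0 : R) < X%:R by rewrite ltr0n.
set l := ln X%:R in h1 *; have l0 : 0 <= l by apply: ln_nat_ge0.
pose g n := `|rem (X %/ n)|; pose s n := summ (fun n => lam2 n - 2 * ln n%:R) n.
pose h n : R := psi (X %/ n) + (X %/ n)%:R.
have gh n : (0 < n)%N -> `|g n - g n.+1| <= h n - h n.+1.
  move=> n0; have nn : (X %/ n.+1 <= X %/ n)%N by apply: leq_div2l.
  apply: le_trans (ler_dist_dist _ _) _.
  have p1 := le_summ_nat L_ge0 nn; have p2 : (X %/ n.+1)%:R <= (X %/ n)%:R :> R by rewrite ler_nat.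
  have -> : rem (X %/ n) - rem (X %/ n.+1) =
     (psi (X %/ n) - psi (X %/ n.+1)) - ((X %/ n)%:R - (X %/ n.+1)%:R).
    by rewrite /remainder; ring.
  apply: le_trans (ler_normB _ _) _; rewrite !ger0_norm ?subr_ge0 // /h.
  by apply: le_of_eq; ring.
have h_ge0 n : 0 <= h n by rewrite addr_ge0 // summ_ge0.
have hsum : summ h X <= (Kp + 1) * (X%:R * (1 + l)).
  apply: le_trans (_ : (Kp + 1) * (X%:R * summ (fun n => n%:R^-1) X) <= _).
    rewrite -!summZ; apply: le_summ => n nX; have [n0 ny yn y1] := divn_real_bounds R nX.
    apply: le_trans (_ : (Kp + 1) * (X %/ n)%:R <= _).
      by rewrite /h mulrDl mul1r lerD2r.
    by rewrite ler_wpM2l // addr_ge0.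
  by rewrite ler_wpM2l ?addr_ge0 // ler_wpM2l ?(ltW XR) // sum_inv_le.
have abel_h : summ (fun n => n%:R * (h n - h n.+1)) x <= summ h X.
  have := abel_summ (fun=> 1) h x; rewrite summ1.
  rewrite (@eq_summ _ _ h) => [->|n _]; last by rewrite mul1r.
  rewrite (@eq_summ _ (fun n => summ (fun=> 1) n * _) (fun n => n%:R * (h n - h n.+1))).
    by rewrite lerDr mulr_ge0.
  by move=> n _; rewrite summ1.
have main : summ (fun n => (lam2 n - 2 * ln n%:R) * g n) X <=
    K2 * (Kp + 1) * X%:R + K2 * summ h X.
  rewrite abel_summ lerD //.
    apply: le_trans (ler_norm _) _; rewrite normrM mulrAC; apply: ler_pM => //.
    rewrite /g divnn /= normr_id; have := norm_rem_le 1; by rewrite mulr1.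
  apply: le_trans (_ : K2 * summ (fun n => n%:R * (h n - h n.+1)) x <= _).
    apply: le_trans (ler_norm _) _; apply: le_trans (norm_summ _ _) _.
    rewrite -summZ; apply: le_summ => n /andP[n0 _]; rewrite normrM mulrA.
    by apply: ler_pM => //; apply: gh.
  by rewrite ler_wpM2l.
have E : summ (fun n => lam2 n * g n) X =
   summ (fun n => (lam2 n - 2 * ln n%:R) * g n) X + 2 * summ (fun n => ln n%:R * g n) X.
  by rewrite -summZ -summD; apply: eq_summ => n _; ring.
move: h1; rewrite -/(g _) E => h1; apply: le_trans h1 _.
have B : K2 * summ h X <= K2 * (Kp + 1) * (X%:R * (1 + l)) by rewrite -mulrA ler_wpM2l.
have B2 : K2 * (Kp + 1) * X%:R <= K2 * (Kp + 1) * (X%:R * (1 + l)).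
  rewrite ler_wpM2l ?mulr_ge0 ?addr_ge0 // -[leLHS]mulr1 ler_wpM2l ?(ltW XR) //.
  by rewrite lerDl.
rewrite (mulrDl _ _ (X%:R * (1 + l))) (mulrDl _ _ (X%:R * (1 + l))).
move: main B B2; set B0 := X%:R * (1 + l); rewrite -/g.
move: (K2 * summ h X) (K1 * B0) (K2 * (Kp + 1) * B0) (K2 * (Kp + 1) * X%:R).
move: (summ _ X) (2 * summ _ X) => *; lra.
Qed.

(** Partial summation turns this into the sum of [L n / n] minus that of [1/n], up to bounded terms,
    and [mertens] bounds the difference. *)
Lemma sum_rem_telescope : exists K : R, forall X,
  `|summ (fun k => rem k * (k%:R^-1 - k.+1%:R^-1)) X| <= K.
Proof.
exists (Km + 1 + Kp + 1) => x; have X0 : (0 < x.+1)%N by [].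
have XR : (0 : R) < x.+1%:R by rewrite ltr0n.
have e1 := abel_summ L (fun n => n%:R^-1) x.
have := abel_summ (fun=> 1) (fun n => (n%:R : R)^-1) x.
rewrite (@eq_summ _ (fun n => 1 * _) (fun n => n%:R^-1)); last by move=> n _; rewrite mul1r.
rewrite summ1 divff ?(gt_eqF XR) // => e2.
have -> : summ (fun k => rem k * (k%:R^-1 - k.+1%:R^-1)) x =
   summ (fun n => L n / n%:R) x.+1 - psi x.+1 / x.+1%:R - summ (fun n => n%:R^-1) x.+1 + 1.
  rewrite e1 e2 [LHS](_ : _ = summ (fun n => psi n * (n%:R^-1 - n.+1%:R^-1) -
     summ (fun=> 1) n * (n%:R^-1 - n.+1%:R^-1)) x); last first.
    by apply: eq_summ => n _; rewrite summ1 -mulrBl.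
  by rewrite summB; ring.
have h1 := mertens X0; have h2 := @sum_inv_le R _ X0.
have h3 : ln x.+1%:R <= summ (fun n => n%:R^-1) x.+1 :> R.
  by apply: le_trans (sum_inv_ge R x.+1); apply: ler_ln_nat.
have h4 : psi x.+1 / x.+1%:R <= Kp by rewrite ler_pdivrMr.
have h5 : 0 <= psi x.+1 / x.+1%:R by rewrite divr_ge0 // summ_ge0.
move: h1 h2 h3 h4 h5; rewrite !ler_norml; move: (summ _ _) (summ _ _) (_ / _) (ln _).
by move=> a1 a2 a3 a4 /andP[h1 h1'] h2 h3 h4 h5; apply/andP; split; lra.
Qed.

(** [L n ln n <= lam2 n], so a short interval inherits the main term of [sum_lam2]; the 2 is that of
    [2 X ln X]. *)
Lemma psi_short : exists K : R, forall u v, (1 < u)%N -> (u <= v <= 2 * u)%N ->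
  psi v - psi u <= 2 * (v%:R - u%:R) + K * (u%:R / ln u%:R).
Proof.
have [K H] := sum_lam2; exists (4 + 3 * `|K|) => u v u1 /andP[uv v2u].
have u0 : (0 < u)%N by apply: ltnW.
have uR : (0 : R) < u%:R by rewrite ltr0n.
have vR : (0 : R) < v%:R by rewrite ltr0n (leq_trans u0).
have lu0 : 0 < ln (u%:R : R) by apply: ln_nat_gt0.
have uvR : (u%:R : R) <= v%:R by rewrite ler_nat.
have vuR : (v%:R : R) <= 2 * u%:R by rewrite -natrM ler_nat.
have s1 : (psi v - psi u) * ln u%:R <= summ lam2 v - summ lam2 u.
  rewrite -(subnK uv); elim: (v - u)%N => [|k IH]; first by rewrite !subrr mul0r.
  rewrite addSn !summS; have : L (k + u).+1 * ln u%:R <= lam2 (k + u).+1.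
    rewrite /lam2 -[leLHS]addr0 lerD ?dconvLL_ge0 // ler_wpM2l //.
    by apply: ler_ln_nat => //; rewrite -addSn leq_addl.
  by move: IH; rewrite !mulrBl mulrDl; move: (_ * _) (_ * _) (_ * _) => *; lra.
have := H u u0; have := H v (leq_trans u0 uv); rewrite !ler_norml.
move=> /andP[_ hv] /andP[hu _].
have lv : ln v%:R - ln u%:R <= (v%:R - u%:R) / u%:R :> R.
  rewrite -ln_div ?posrE //; apply: le_trans (ln_le_subr1 _) _; first exact: divr_gt0.
  by rewrite mulrBl divff ?gt_eqF.
have lv' : u%:R * (ln v%:R - ln u%:R) <= v%:R - u%:R :> R.
  by rewrite -ler_pdivlMl // mulrC.
have vl : v%:R * ln v%:R <= v%:R * ln u%:R + 2 * (v%:R - u%:R) :> R.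
  have : v%:R * (ln v%:R - ln u%:R) <= 2 * (v%:R - u%:R) :> R.
    apply: le_trans (_ : v%:R * ((v%:R - u%:R) / u%:R) <= _).
      by rewrite ler_wpM2l // ltW.
    by rewrite mulrCA mulrC ler_wpM2r ?subr_ge0 // ler_pdivrMr.
  by rewrite mulrBr; lra.
have Kv : K * v%:R <= 2 * `|K| * u%:R.
  rewrite [leRHS](_ : _ = `|K| * (2 * u%:R)); last by ring.
  by apply: le_trans (ler_wpM2r (ltW vR) (ler_norm K)) _; rewrite ler_wpM2l.
have Ku : K * u%:R <= `|K| * u%:R by rewrite ler_wpM2r ?ler_norm // ltW.
rewrite -(ler_pM2r lu0); apply: le_trans s1 _.
rewrite [leRHS](_ : _ = 2 * (v%:R * ln u%:R) - 2 * (u%:R * ln u%:R) + 4 * u%:R + 3 * (`|K| * u%:R)); last first.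
  by field; rewrite gt_eqF.
move: hu hv vl Kv Ku vuR; rewrite -!mulrA.
move: (v%:R * ln v%:R) (v%:R * ln u%:R) (u%:R * ln u%:R) (K * _) (K * _) (`|K| * _).
move: (summ _ _) (summ _ _) => *; lra.
Qed.

End SelbergConsequences.

(** * The Erdos-Selberg argument *)

Section ErdosSelberg.
Variables (R : realType) (L : nat -> R) (Kr : R).
Notation psi := (summ L).
Notation rem := (remainder L).
Hypothesis L_ge0 : forall n, 0 <= L n.
Hypothesis Kr_ge0 : 0 <= Kr.
Hypothesis rem_le : forall n, `|rem n| <= Kr * n%:R.
Hypothesis rem_sq_le : exists K : R, forall X, (0 < X)%N ->
  `|rem X| * ln X%:R ^+ 2 <=
  2 * summ (fun n => ln n%:R * `|rem (X %/ n)|) X + K * (X%:R * (1 + ln X%:R)).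
Hypothesis rem_telescope : exists K : R, forall X,
  `|summ (fun k => rem k * (k%:R^-1 - k.+1%:R^-1)) X| <= K.
Hypothesis psi_short : exists K : R, forall u v, (1 < u)%N -> (u <= v <= 2 * u)%N ->
  psi v - psi u <= 2 * (v%:R - u%:R) + K * (u%:R / ln u%:R).
Implicit Types (n m k X t u v y : nat).

Lemma ln_nat_unbounded (M : R) : exists2 Y : nat, (1 < Y)%N &
  forall u, (Y <= u)%N -> M <= ln u%:R.
Proof.
exists (Num.truncn (expR M)).+2 => // u Yu.
have u0 : (0 : R) < u%:R by rewrite ltr0n (leq_trans _ Yu).
rewrite -ler_expR lnK ?posrE //; apply: le_trans (_ : (Num.truncn (expR M)).+1%:R <= _).
  by apply/ltW/truncnS_gt.
by rewrite ler_nat (leq_trans _ Yu).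
Qed.

Lemma nat_ge (M : R) : exists2 Y : nat, (1 < Y)%N & forall u, (Y <= u)%N -> M <= u%:R.
Proof.
have [Y Y1 H] := ln_nat_unbounded M; exists Y => // u Yu.
apply: le_trans (H u Yu) _; have u0 : (0 : R) < u%:R by rewrite ltr0n; lia.
by apply: le_trans (ln_le_subr1 u0) _; rewrite gerBl.
Qed.

Lemma le_summ_sub (f g : nat -> R) u v : (u <= v)%N ->
  (forall k, (u < k <= v)%N -> f k <= g k) ->
  summ f v - summ f u <= summ g v - summ g u.
Proof.
move=> uv; rewrite -(subnK uv); elim: (v - u)%N => [|k IH] H; first by rewrite !subrr.
rewrite addSn !summS; have hk : (u < (k + u).+1 <= k.+1 + u)%N by lia.
have h1 := H _ hk; have hj j : (u < j <= k + u)%N -> (u < j <= k.+1 + u)%N by lia.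
by have h2 := IH (fun j hjk => H j (hj j hjk)); lra.
Qed.

Lemma short_error (e : R) : 0 < e -> exists2 Y : nat, (1 < Y)%N &
  forall u v, (Y <= u)%N -> (u <= v <= 2 * u)%N ->
  psi v - psi u <= 2 * (v%:R - u%:R) + e * u%:R.
Proof.
move=> e0; have [K H] := psi_short.
have [Y Y1 HY] := ln_nat_unbounded (K / e); exists Y => // u v Yu uv.
have u1 : (1 < u)%N by apply: leq_trans Yu.
apply: le_trans (H u v u1 uv) _; rewrite lerD2l mulrCA mulrC ler_wpM2r //.
by rewrite ler_pdivrMr ?ln_nat_gt0 // mulrC -ler_pdivrMr // HY.
Qed.

(* Were [rem] large throughout [y, B y], it would keep a constant sign there,
   contradicting the boundedness of [sum rem k / (k (k+1))]. *)
Lemma small_point (e : R) : 0 < e -> exists B Y : nat, [/\ (1 < B)%N, (1 < Y)%N &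
  forall y, (Y <= y)%N -> exists2 t, (y <= t <= B * y)%N & `|rem t| <= e * t%:R].
Proof.
move=> e0; have [K3 H3] := rem_telescope.
have e20 : 0 < e / 2 by rewrite divr_gt0.
have [Y1 Y11 HY1] := short_error e20; have [Y2 Y22 HY2] := nat_ge (2 / e).
(* The sum of [1/(k+1)] over [y < k <= B y] is at least [ln B - 2]; multiplied by [e] it has to
   exceed [2 K3], the largest possible difference of two telescoping sums. *)
have [B B1 HB] := ln_nat_unbounded (2 * K3 / e + 3).
exists B, (maxn Y1 Y2); split=> //; first by rewrite leq_max Y11.
move=> y; rewrite geq_max => /andP[Y1y Y2y]; apply: contrapT => noS.
have y0 : (0 < y)%N by apply: leq_trans Y1y; apply: ltnW.
have yB : (y <= B * y)%N by rewrite leq_pmull // ltnW.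
have big t : (y <= t <= B * y)%N -> e * t%:R < `|rem t|.
  by move=> tB; rewrite ltNge; apply/negP => h; apply: noS; exists t.
(* One step changes [rem] by less than its assumed size, so it cannot change sign. *)
have step t : (y <= t)%N -> `|rem t.+1 - rem t| <= e * t%:R.
  move=> yt; rewrite /remainder summS -natr1.
  have h : L t.+1 <= 2 + e / 2 * t%:R.
    have := HY1 t t.+1 (leq_trans Y1y yt); rewrite summS => /(_ _).
    have tt : (t <= t.+1 <= 2 * t)%N by lia.
    by move=> /(_ tt); rewrite -natr1; lra.
  have h2 : 2 <= e * t%:R by rewrite -ler_pdivrMl // mulrC HY2 // (leq_trans Y2y).
  by have := L_ge0 t.+1; rewrite ler_norml => ?; apply/andP; split; lra.
have [s s1 sy] : exists2 s : R, `|s| = 1 & e * y%:R < s * rem y.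
  have := big y; rewrite leqnn yB => /(_ isT); case: (lerP 0 (rem y)) => h.
    by rewrite ger0_norm // => h'; exists 1; rewrite ?normr1 ?mul1r.
  by rewrite ltr0_norm // => h'; exists (- 1); rewrite ?normrN1 // mulN1r.
have sign t : (y <= t <= B * y)%N -> e * t%:R < s * rem t.
  move=> /andP[yt]; rewrite -(subnK yt); elim: (t - y)%N => [//|k IH] kB.
  have {IH} := IH (leq_trans (leqnSn _) kB); rewrite addSn in kB *.
  set j := (k + y)%N in kB *; have yj : (y <= j)%N by rewrite leq_addl.
  have := big j.+1; rewrite kB (leq_trans yj (leqnSn _)) => /(_ isT) h1 h2.
  have : `|s * (rem j.+1 - rem j)| <= e * j%:R by rewrite normrM s1 mul1r step.
  rewrite ler_norml mulrBr => /andP[h3 _].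
  have : `|s * rem j.+1| = `|rem j.+1| by rewrite normrM s1 mul1r.
  have h4 : 0 <= s * rem j.+1 by lra.
  by rewrite ger0_norm // => ->.
pose f k := s * (rem k * (k%:R^-1 - k.+1%:R^-1)).
pose g k := e * (k.+1%:R^-1 : R).
have := @le_summ_sub g f y (B * y) yB.
have gf k : (y < k <= B * y)%N -> g k <= f k.
  move=> kB; have k0 : (0 : R) < k%:R by rewrite ltr0n; lia.
  have k1 : (0 : R) < k.+1%:R by rewrite ltr0n.
  have dd : k%:R^-1 - k.+1%:R^-1 = k%:R^-1 * k.+1%:R^-1 :> R.
    by rewrite -natr1; field; rewrite natr1 !gt_eqF.
  rewrite /g /f mulrA dd mulrA ler_wpM2r ?invr_ge0 ?(ltW k1) //.
  by rewrite ler_pdivlMr // ltW // sign //; lia.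
move=> /(_ gf).
have -> : summ f (B * y) - summ f y = s *
   (summ (fun k => rem k * (k%:R^-1 - k.+1%:R^-1)) (B * y) -
    summ (fun k => rem k * (k%:R^-1 - k.+1%:R^-1)) y).
  by rewrite !summZ mulrBr.
have shift n : summ g n = e * (summ (fun k => k%:R^-1) n.+1 - 1).
  rewrite summZ; congr (_ * _); rewrite /summ [in RHS]big_nat_recl //=.
  by rewrite invr1 [1 + _]addrC addrK.
have F : 2 * K3 < summ g (B * y) - summ g y.
  rewrite !shift -mulrBr opprB addrA subrK -ltr_pdivrMl // mulrC.
  have h1 := @sum_inv_le R y.+1 isT; have h2 := sum_inv_ge R (B * y).+1.
  have h3 : ln B%:R + ln y%:R <= ln (B * y).+2%:R :> R.
    rewrite -lnM ?posrE ?ltr0n //; last by apply: ltnW.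
    by rewrite -natrM; apply: ler_ln_nat; rewrite ?muln_gt0 ?y0 ?(ltnW B1) //; lia.
  have h4 : ln y.+1%:R <= ln y%:R + 1 :> R.
    have /andP[_ h] := @ln_succ_bounds R y y0.
    have : y%:R^-1 <= 1 :> R by rewrite invf_le1 ?ler1n ?ltr0n.
    by move: h; move: (ln _) (ln _) (_^-1) => *; lra.
  have h5 := HB B (leqnn B).
  move: h1 h2 h3 h4 h5; move: (summ _ _) (summ _ _) (ln _) (ln _) (ln _) (ln _).
  by move=> a1 a2 a3 a4 a5 a6; lra.
have G : s * (summ (fun k => rem k * (k%:R^-1 - k.+1%:R^-1)) (B * y) -
    summ (fun k => rem k * (k%:R^-1 - k.+1%:R^-1)) y) <= 2 * K3.
  apply: le_trans (ler_norm _) _; rewrite normrM s1 mul1r.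
  apply: le_trans (ler_normB _ _) _; have := H3 (B * y)%N; have := H3 y.
  by move: `|_| `|_| => *; lra.
by move=> h; have := lt_le_trans F (le_trans h G); rewrite ltxx.
Qed.

(** From a point with [|rem t| <= e t] the bound persists to the right: [psi] is monotone, which
    controls the decrease of [rem], and [short_error] controls its increase. On an interval of
    relative length [e] the losses add up to [3 e t], whence [e = a/6]. *)
Lemma good_interval (a : R) : 0 < a -> exists B Y h : nat,
  [/\ (1 < B)%N, (1 < Y)%N, (0 < h)%N &
  forall y, (Y <= y)%N -> exists t, [/\ (y <= t)%N, (t + t %/ h < B * y)%N &
    forall t', (t <= t' <= t + t %/ h)%N -> `|rem t'| <= a / 2 * t'%:R]].
Proof.
move=> a0; pose e := a / 6; have e0 : 0 < e by rewrite divr_gt0.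
have [B [Y1 [B1 Y11 H1]]] := small_point e0; have [Y2 Y21 H2] := short_error e0.
have [h h1 Hh] := nat_ge e^-1; have h0 : (0 < h)%N by apply: ltnW.
have hR : (0 : R) < h%:R by rewrite ltr0n.
exists (2 * B).+1, (maxn Y1 Y2), h; split=> //; first by lia.
  by rewrite leq_max Y11.
move=> y; rewrite geq_max => /andP[Y1y Y2y].
have [t /andP[yt tB] Ht] := H1 y Y1y; exists t; split=> //.
  by have := leq_div t h; nia.
have tht : (t %/ h)%:R <= e * t%:R :> R.
  apply: le_trans (_ : t%:R / h%:R <= _).
    by rewrite ler_pdivlMr // -natrM ler_nat leq_divM.
  by rewrite mulrC ler_wpM2r // -[e]invrK lef_pV2 ?posrE ?invr_gt0 // Hh.
move=> t' /andP[tt' t't].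
have dR : t'%:R - t%:R <= e * t%:R :> R.
  by apply: le_trans tht; rewrite lerBlDl -natrD ler_nat.
have d0 : 0 <= t'%:R - t%:R :> R by rewrite subr_ge0 ler_nat.
have := H2 t t' (leq_trans Y2y yt); rewrite tt' => /(_ _).
have h2 : (t' <= 2 * t)%N by have := leq_div t h; lia.
move=> /(_ h2) up; have lo := le_summ_nat L_ge0 tt'.
have : a / 2 * t%:R <= a / 2 * t'%:R by rewrite ler_wpM2l ?ler_nat // divr_ge0 // ltW.
apply: le_trans; have -> : a / 2 = 3 * e by rewrite /e; field.
move: Ht; rewrite /remainder !ler_norml => /andP[l1 l2].
apply/andP; split; lra.
Qed.


Lemma sum_ln_div_le X : (0 < X)%N ->
  2 * summ (fun n => ln n%:R / n%:R) X <= ln X%:R ^+ 2 + ln X%:R + 1 :> R.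
Proof.
move=> X0; suff H : 2 * summ (fun n => ln n%:R / n%:R) X <=
    ln X%:R ^+ 2 + summ (fun n => n%:R^-1) X :> R.
  by apply: le_trans H _; rewrite -addrA lerD2l addrC sum_inv_le.
case: X X0 => // x _; elim: x => [|x IH].
  by rewrite !summS !summ0 /= ln1 mul0r !add0r mulr0 invr1 expr0n /= add0r.
rewrite summS [summ (fun n => n%:R^-1) _]summS mulrDr.
have /andP[] := @ln_succ_bounds R x.+1 isT.
have := ln_nat_ge0 R x.+1; have := ln_nat_ge0 R x.+2.
move: IH; set a := ln x.+2%:R; set b := ln x.+1%:R; set u := x.+2%:R^-1.
have u0 : 0 <= u by rewrite invr_ge0.
have v1 : x.+1%:R^-1 <= 1 :> R by rewrite invf_le1 ?ler1n ?ltr0n.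
move: (x.+1%:R^-1) v1 => v v1 IH a0 b0 h1 h2.
have h3 : 2 * a * u - u <= a ^+ 2 - b ^+ 2.
  have -> : a ^+ 2 - b ^+ 2 = (a - b) * (2 * a - (a - b)) by ring.
  have h4 : u * (2 * a - (a - b)) <= (a - b) * (2 * a - (a - b)).
    by rewrite ler_wpM2r //; lra.
  have h5 : u * (a - b) <= u * 1 by rewrite ler_wpM2l //; lra.
  by apply: le_trans h4; lra.
by move: IH h3; rewrite mulrA; move: (summ _ _) (summ _ _) (a ^+ 2) (b ^+ 2) => *; lra.
Qed.

(** The [n] with [X/n] in the interval fill [(X/(t + t/h + 1), X/t]], of length about [X/((h+1) t)],
    half of which is given up for rounding. The condition on [(t + t/h + 1)^2] keeps [n] above the
    square root of [X], so each weighs at least [(ln X / 2) (t/X)]. *)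
Lemma sum_good_block X t h : (0 < t)%N -> (0 < h)%N ->
  (2 * h.+1 * t <= X)%N -> ((t + t %/ h).+1 ^ 2 <= X)%N ->
  ln X%:R / (4 * h.+1%:R) <=
  summ (fun n => (ln n%:R / n%:R) *+ (t <= X %/ n <= t + t %/ h)%N) X :> R.
Proof.
move=> t0 h0 tX t2X; set f := (X in summ X _).
have X0 : (0 < X)%N by apply: leq_trans tX; rewrite !muln_gt0.
pose a := (X %/ (t + t %/ h).+1)%N; pose c := (X %/ t)%N.
have ac : (a <= c)%N by apply: leq_div2l => //; rewrite -addnS leq_addr.
have cX : (c <= X)%N by apply: leq_div.
have tR : (0 : R) < t%:R by rewrite ltr0n.
have XR : (0 : R) < X%:R by rewrite ltr0n.
have hR : (0 : R) < h%:R by rewrite ltr0n.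
have f0 n : 0 <= f n.
  by apply: mulrn_wge0; rewrite divr_ge0 ?ln_nat_ge0.
set l := ln X%:R; have l0 : 0 <= l by apply: ln_nat_ge0.
pose q : R := l / 2 * (t%:R / X%:R).
have low n : (a < n <= c)%N -> q * 1 <= f n.
  move=> /andP[an nc]; have n0 : (0 < n)%N by apply: leq_ltn_trans an.
  have nR : (0 : R) < n%:R by rewrite ltr0n.
  have -> : f n = ln n%:R / n%:R.
    rewrite /f (_ : (t <= X %/ n <= t + t %/ h)%N) //; apply/andP; split.
      by rewrite leq_divRL // mulnC -leq_divRL.
    by rewrite -ltnS ltn_divLR // mulnC -ltn_divLR.
  rewrite mulr1 /q; apply: ler_pM.
  - by rewrite divr_ge0.
  - by rewrite divr_ge0 // ltW.
  - have : (X <= n ^ 2)%N.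
      rewrite leqNgt; apply/negP => nX; move: an; rewrite /a ltn_divLR // => Xn.
      case: (leqP n (t + t %/ h).+1) => h1.
        by have := leq_ltn_trans t2X Xn; rewrite -mulnn ltnNge leq_mul2r h1 orbT.
      by have := ltn_trans nX Xn; rewrite -mulnn ltnNge leq_mul2l ltnW ?orbT.
    rewrite -(@ler_nat R) natrX => Xn.
    rewrite ler_pdivrMr // mulr_natr -lnXn // /l ler_ln ?posrE //.
    by apply: exprn_gt0.
  - rewrite -[n%:R^-1]mul1r ler_pdivrMr // mulrAC ler_pdivlMr // mul1r.
    by rewrite -natrM ler_nat mulnC -leq_divRL.
have H : summ (fun n => q * 1) c - summ (fun n => q * 1) a <= summ f X.
  have h1 := le_summ_sub (f := fun=> q * 1) (g := f) ac low; apply: le_trans h1 _.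
  rewrite lerBlDr; apply: le_trans (le_summ_nat f0 cX) _.
  by rewrite lerDl summ_ge0.
apply: le_trans H; rewrite !summZ !summ1 -mulrBr.
have h1R : (0 : R) < h.+1%:R by rewrite ltr0n.
have aR : a%:R <= X%:R / t%:R * (h%:R / h.+1%:R) :> R.
  apply: le_trans (_ : X%:R / (t + t %/ h).+1%:R <= _).
    by rewrite ler_pdivlMr ?ltr0n // -natrM ler_nat leq_divM.
  rewrite mulf_div ler_pdivrMr ?ltr0n // mulrAC ler_pdivlMr ?mulr_gt0 //.
  rewrite -!mulrA ler_wpM2l ?(ltW XR) // -!natrM ler_nat.
  have := ltn_ceil t h0; set w := (t %/ h)%N => tw; nia.
have cR : X%:R / t%:R - 1 <= c%:R :> R.
  rewrite lerBlDr natr1 ler_pdivrMr // -natrM ler_nat ltnW //; exact: ltn_ceil.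
have tXR : 2 * h.+1%:R * t%:R <= X%:R :> R by rewrite -!natrM ler_nat.
apply: le_trans (_ : q * (X%:R / t%:R * (1 / h.+1%:R) - 1) <= _); last first.
  rewrite ler_wpM2l //; first by rewrite mulr_ge0 ?divr_ge0 // ltW.
  apply: le_trans (lerB cR aR); rewrite -subr_ge0.
  have -> : h%:R = h.+1%:R - 1 :> R by rewrite -natr1 addrK.
  by apply: le_of_eq; move: (h.+1%:R) h1R => g g0; field; rewrite !gt_eqF.
rewrite /q -!mulrA ler_wpM2l //.
apply: le_trans (_ : 2^-1 * (h.+1%:R^-1 - t%:R / X%:R) <= _); last first.
  by apply: le_of_eq; move: (h.+1%:R) h1R => g g0; field; rewrite !gt_eqF.
have : t%:R / X%:R <= h.+1%:R^-1 / 2 :> R.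
  rewrite ler_pdivrMr // mulrAC ler_pdivlMr // ler_pdivlMl // mulrC.
  by apply: le_trans tXR; apply: le_of_eq; ring.
rewrite invfM; move: (t%:R / X%:R) (h.+1%:R^-1) => a1 a2 h3.
have -> : 4^-1 * a2 = 2^-1 * (a2 - a2 / 2) by field.
by rewrite ler_wpM2l //; lra.
Qed.


Lemma sum_good_le (f g : nat -> R) X (P Q : pred nat) : (forall n, 0 <= f n) ->
  (forall n, P n -> Q n) ->
  summ (fun n => f n *+ P n) X <= summ (fun n => f n *+ Q n) X.
Proof.
move=> f0 PQ; apply: le_summ => n _; have := PQ n; case: (P n) => [->//|_].
by rewrite mulr0n mulrn_wge0.
Qed.

(* Each geometric block [B^i, B^(i+1)) contributes a good interval, and there are
   about ln X / (2 ln B) blocks below the square root of X. *)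
Lemma sum_good_ge (a : R) : 0 < a -> exists s : R, 0 < s /\
  forall Y1 : nat, exists Y X0 : nat, (Y1 <= Y)%N /\ (0 < Y)%N /\ forall X, (X0 <= X)%N -> s * ln X%:R ^+ 2 <=
  summ (fun n => (ln n%:R / n%:R) *+
     ((Y <= X %/ n)%N && (`|rem (X %/ n)| <= a / 2 * (X %/ n)%:R))) X.
Proof.
move=> a0; have [B [Y2 [h [B1 Y21 h0 H]]]] := good_interval a0.
(* At least [ln X / (4 ln B)] blocks, each contributing [ln X / (4 (h+1))]. *)
exists ((16 * h.+1%:R * ln B%:R)^-1).
have lB : 0 < ln (B%:R : R) by apply: ln_nat_gt0.
split=> [|Y1]; first by rewrite invr_gt0 !mulr_gt0 ?ltr0n.
pose Y3 := maxn (maxn Y1 Y2) (2 * h.+1).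
pose i0 := up_log B Y3; pose Y := (B ^ i0)%N.
have YY3 : (Y3 <= Y)%N by apply: up_logP.
have B0 : (0 < B)%N by apply: ltnW.
have [X0 X01 HX0] := @ln_nat_unbounded (4 * ln B%:R * (1 + i0%:R)).
exists Y, X0; split; first by apply: leq_trans YY3; rewrite !leq_max leqnn.
split; first by rewrite expn_gt0 B0.
move=> X XX0; have X1 : (1 < X)%N by apply: leq_trans XX0.
have Xpos : (0 < X)%N by apply: ltnW.
set l := ln X%:R; have l0 : 0 <= l by apply: ln_nat_ge0.
pose good v := `|rem v| <= a / 2 * v%:R.
have w0 n : 0 <= ln n%:R / n%:R :> R by rewrite divr_ge0 ?ln_nat_ge0.
have blocks m : (B ^ (2 * (i0 + m)) <= X)%N ->
    m%:R * (l / (4 * h.+1%:R)) <= summ (fun n => (ln n%:R / n%:R) *+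
      ((Y <= X %/ n < B ^ (i0 + m))%N && good (X %/ n)%N)) X.
  elim: m => [_|m IH hm]; first by rewrite mul0r summ_ge0 // => n; apply: mulrn_wge0.
  have hm' : (B ^ (2 * (i0 + m)) <= X)%N.
    by apply: leq_trans hm; rewrite leq_exp2l //; lia.
  set y := (B ^ (i0 + m))%N.
  have Yy : (Y <= y)%N by rewrite leq_exp2l // leq_addr.
  have y0 : (0 < y)%N by rewrite expn_gt0 B0.
  have [t [yt tB Ht]] : exists t, [/\ (y <= t)%N, (t + t %/ h < B * y)%N &
      forall t', (t <= t' <= t + t %/ h)%N -> `|rem t'| <= a / 2 * t'%:R].
    by apply: H; apply: leq_trans Yy; apply: leq_trans YY3; rewrite !leq_max leqnn orbT.
  have ByE : (B * y = B ^ (i0 + m.+1))%N by rewrite addnS expnS.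
  have tX2 : ((t + t %/ h).+1 ^ 2 <= X)%N.
    by apply: leq_trans hm; rewrite mulnC expnM leq_sqr -ByE.
  have hX : (2 * h.+1 * t <= X)%N.
    apply: leq_trans tX2; rewrite -mulnn; apply: leq_mul.
      apply: leq_trans (_ : y <= _)%N; last by rewrite -addnS (leq_trans yt) ?leq_addr.
      by apply: leq_trans Yy; apply: leq_trans YY3; rewrite leq_max leqnn orbT.
    by rewrite -addnS leq_addr.
  have t0 : (0 < t)%N by apply: leq_trans yt.
  have := sum_good_block t0 h0 hX tX2; rewrite -/l => blk.
  rewrite -natr1 mulrDl mul1r; apply: le_trans (lerD (IH hm') blk) _.
  rewrite -summD; apply: le_summ => n _; rewrite -mulrnDr.
  rewrite -!/(good _); apply: ler_wpMn2l => //.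
  set v := (X %/ n)%N; rewrite -ByE -/y.
  case: (leqP t v) => tv /=; last first.
    rewrite addn0; case: (good v); rewrite ?andbF ?andbT //.
    by case: (leqP Y v) => //= _; case: (ltnP v y) => // vy; rewrite (leq_trans vy) // leq_pmull.
  rewrite (ltnNge v y) (leq_trans yt tv) /= andbF add0n.
  case: (leqP v (t + t %/ h)) => // vt.
  rewrite (leq_trans Yy (leq_trans yt tv)) (leq_ltn_trans vt tB) /=.
  by rewrite /good Ht // tv.
pose M := trunc_log B X.
have /andP[M1 M2] : (B ^ M <= X < B ^ M.+1)%N by apply: trunc_log_bounds.
have lM : l <= M.+1%:R * ln B%:R.
  rewrite /l mulr_natl -lnXn ?ltr0n // -natrX; apply: ler_ln_nat => //; exact: ltnW.
have hl : 4 * ln B%:R * (1 + i0%:R) <= l by apply: HX0.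
have Mi : (2 * i0 <= M)%N.
  have : (4 * (1 + i0))%:R <= M.+1%:R :> R.
    rewrite -(ler_pM2r lB) natrM natrD; apply: le_trans lM.
    by apply: le_trans hl; apply: le_of_eq; ring.
  by rewrite ler_nat; lia.
pose m := (M %/ 2 - i0)%N.
have mE : (i0 + m = M %/ 2)%N by rewrite /m subnKC // leq_divRL // mulnC.
have hm : (B ^ (2 * (i0 + m)) <= X)%N.
  by apply: leq_trans M1; rewrite leq_exp2l // mE mulnC leq_divM.
have mR : l / (4 * ln B%:R) <= m%:R.
  have : (M.+1 <= 2 * (i0 + m) + 2)%N by rewrite mE; have := divn_eq M 2; have := ltn_pmod M (isT : (0 < 2)%N); lia.
  rewrite -(ler_nat R) natrD natrM natrD => hM.
  have : l <= (2 * (i0%:R + m%:R) + 2) * ln B%:R.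
    by apply: le_trans lM _; rewrite ler_wpM2r // ltW.
  rewrite ler_pdivrMr ?mulr_gt0 //; move: hl; clear hM.
  have : 0 <= i0%:R * ln B%:R :> R by rewrite mulr_ge0 // ltW.
  by rewrite !mulrDl !mulrDr; move: (i0%:R) (m%:R) (ln B%:R) => *; lra.
apply: le_trans (_ : m%:R * (l / (4 * h.+1%:R)) <= _).
  apply: le_trans (_ : l / (4 * ln B%:R) * (l / (4 * h.+1%:R)) <= _).
    apply: le_of_eq; have : (0 : R) < h.+1%:R by rewrite ltr0n.
    by move: (h.+1%:R) => g g0; field; rewrite !gt_eqF.
  by rewrite ler_wpM2r // divr_ge0.
apply: le_trans (blocks m hm) _; apply: sum_good_le => // n.
by move=> /andP[/andP[-> _]].
Qed.

Lemma sum_small_le (Y X : nat) : (0 < Y)%N -> (0 < X)%N ->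
  summ (fun n => (ln n%:R / n%:R) *+ (X %/ n < Y)%N) X <=
  ln X%:R * (1 + ln Y%:R) :> R.
Proof.
move=> Y0 X0; pose c := (X %/ Y)%N; have cX : (c <= X)%N by apply: leq_div.
set l := ln X%:R; have l0 : 0 <= l by apply: ln_nat_ge0.
pose f n := ((ln n%:R / n%:R) *+ (X %/ n < Y)%N : R).
have f0 : summ f c = 0.
  rewrite /summ big_nat_cond big1 // => n /andP[/andP[n0 nc] _].
  rewrite /f ltnNge (_ : (Y <= X %/ n)%N) //.
  by move: nc; rewrite ltnS /c !leq_divRL // mulnC.
pose g n := l * (n%:R^-1 : R).
have fg n : (c < n <= X)%N -> f n <= g n.
  move=> /andP[cn nX]; have n0 : (0 < n)%N by apply: leq_ltn_trans cn.
  apply: le_trans (_ : ln n%:R / n%:R <= _).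
    by rewrite /f; case: (_ < _)%N => //=; rewrite mulr0n divr_ge0 ?ln_nat_ge0.
  by rewrite ler_wpM2r ?invr_ge0 // ler_ln_nat.
have := le_summ_sub (f := f) (g := g) cX fg; rewrite f0 subr0 !summZ -mulrBr => h.
apply: le_trans h _; rewrite ler_wpM2l //.
have h1 := @sum_inv_le R X X0; have h2 := sum_inv_ge R c.
have h3 : l <= ln c.+1%:R + ln Y%:R.
  rewrite -lnM ?posrE ?ltr0n // -natrM; apply: ler_ln_nat => //.
  by apply/ltnW/ltn_ceil.
by move: h1 h2 h3; rewrite -/l; move: (summ _ _) (summ _ _) (ln _) (ln _) => *; lra.
Qed.

(** In [rem_sq_le] the constant [a1], valid for large arguments, improves to [a/2] on the good set,
    whose weight is at least [s ln^2 X]. The right-hand side is then at most [X (a1 - a s) ln^2 X]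
    up to lower order. Since [s] depends on [a] alone, [a1 = a + a s/4] may be taken after it;
    another [a s/4] absorbs the lower order terms and [a - a s/2] remains. *)
Lemma remainder_improve (a : R) : 0 < a ->
  (forall a', a < a' -> exists Y, forall v, (Y <= v)%N -> `|rem v| <= a' * v%:R) ->
  exists2 a', a' < a & exists Y, forall v, (Y <= v)%N -> `|rem v| <= a' * v%:R.
Proof.
move=> a0 Ha; have [K4 H4] := rem_sq_le; have [s [s0 Hs]] := sum_good_ge a0.
have as0 : 0 < a * s by apply: mulr_gt0.
pose a1 := a + a * s / 4; have aa1 : a < a1 by rewrite ltrDl divr_gt0.
have [Y1 HY1] := Ha a1 aa1; have [Y [X0 [Y1Y [Y0 HX0]]]] := Hs Y1.
pose C := a1 + 2 * (Kr * (1 + ln Y%:R)) + `|K4|.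
have lY0 : 0 <= ln Y%:R :> R by apply: ln_nat_ge0.
have C0 : 0 <= C by rewrite !addr_ge0 ?mulr_ge0 ?addr_ge0 // ltW // (lt_trans a0).
have [X1 X11 HX1] := @ln_nat_unbounded (1 + 8 * C / (a * s)).
exists (a - a * s / 2); first by rewrite gtrBl divr_gt0.
exists (maxn X0 X1) => X; rewrite geq_max => /andP[XX0 XX1].
have Xpos : (0 < X)%N by apply: leq_trans XX1; apply: ltnW.
have XR : (0 : R) < X%:R by rewrite ltr0n.
have := HX1 X XX1; have := HX0 X XX0; have := H4 X Xpos.
set l := ln X%:R => h4 hs hl.
have l1 : 1 <= l by apply: le_trans hl; rewrite lerDl divr_ge0 ?mulr_ge0 // ltW.
have a1_gt0 : 0 < a1 by apply: lt_trans aa1.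
pose u n : R := ln n%:R / n%:R.
have u0 n : 0 <= u n by rewrite divr_ge0 ?ln_nat_ge0.
have main : summ (fun n => ln n%:R * `|rem (X %/ n)|) X <=
   X%:R * (a1 * summ u X - a / 2 * summ (fun n => u n *+
      ((Y <= X %/ n)%N && (`|rem (X %/ n)| <= a / 2 * (X %/ n)%:R))) X
     + Kr * summ (fun n => u n *+ (X %/ n < Y)%N) X).
  rewrite -!summZ -summB -summD -summZ; apply: le_summ => n nX.
  have [n0 ny yn y1] := divn_real_bounds R nX.
  have nR : (0 : R) < n%:R by rewrite ltr0n; case/andP: nX.
  have ln0 := ln_nat_ge0 R n.
  pose z : R := X%:R / n%:R; have z0 : 0 < z by apply: divr_gt0.
  suff [k [kb]] : exists k : R, `|rem (X %/ n)| <= k * z /\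
     k <= a1 - a / 2 * ((Y <= X %/ n)%N && (`|rem (X %/ n)| <= a / 2 * (X %/ n)%:R))%:R
       + Kr * (X %/ n < Y)%N%:R.
    move=> hk; apply: le_trans (_ : ln n%:R * (k * z) <= _); first by rewrite ler_wpM2l.
    rewrite [leRHS](_ : _ = ln n%:R * (z * (a1 - a / 2 * ((Y <= X %/ n)%N &&
       (`|rem (X %/ n)| <= a / 2 * (X %/ n)%:R))%:R + Kr * (X %/ n < Y)%N%:R))).
      by rewrite ler_wpM2l // mulrC ler_wpM2l // ltW.
    rewrite -[u n *+ _]mulr_natr -[X in Kr * X]mulr_natr /u /z; ring.
  case: (ltnP (X %/ n) Y) => [vY|Yv] /=; last first.
    case: (lerP `|rem (X %/ n)| (a / 2 * (X %/ n)%:R)) => hg.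
      exists (a / 2); split; last by rewrite ?(mulr1, mulr0, addr0, subr0); lra.
      by apply: le_trans hg _; rewrite ler_wpM2l // divr_ge0 // ltW.
    exists a1; split; last by rewrite ?(mulr1, mulr0, addr0, subr0); lra.
    apply: le_trans (HY1 _ (leq_trans Y1Y Yv)) _; by rewrite ler_wpM2l // ltW.
  exists Kr; split; last by rewrite ?(mulr1, mulr0, addr0, subr0); lra.
  by apply: le_trans (rem_le _) _; rewrite ler_wpM2l.
have S1 : 2 * summ u X <= l ^+ 2 + l + 1 := sum_ln_div_le Xpos.
have S3 : summ (fun n => u n *+ (X %/ n < Y)%N) X <= l * (1 + ln Y%:R) := @sum_small_le Y X Y0 Xpos.
have l20 : 0 < l ^+ 2 by rewrite exprn_gt0 // (lt_le_trans ltr01).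
rewrite -(ler_pM2r l20); apply: le_trans h4 _.
have B1 : a1 * (2 * summ u X) <= a1 * (l ^+ 2 + l + 1) by rewrite ler_wpM2l // ltW.
set S3' := summ (fun n => u n *+ (X %/ n < Y)%N) X in S3 main.
set S2 := summ (fun n => u n *+ (_ && _)) X in main.
have B2 : a * (s * l ^+ 2) <= a * S2 by rewrite ler_wpM2l // ltW.
have B3 : 2 * Kr * S3' <= 2 * Kr * (l * (1 + ln Y%:R)) by rewrite ler_wpM2l // mulr_ge0.
have B4 : K4 * (X%:R * (1 + l)) <= X%:R * (`|K4| * (1 + l)).
  by rewrite mulrCA ler_wpM2l ?(ltW XR) // ler_wpM2r ?ler_norm //; lra.
have B5 : 2 * C * l <= a * s / 4 * l ^+ 2.
  rewrite expr2 mulrA ler_wpM2r //; first by lra.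
  have : 8 * C / (a * s) <= l by apply: le_trans hl; rewrite lerDr.
  by rewrite ler_pdivrMr // => h; lra.
apply: le_trans (_ : X%:R * (a1 * (l ^+ 2 + l + 1) - a * (s * l ^+ 2)
   + 2 * Kr * (l * (1 + ln Y%:R)) + `|K4| * (1 + l)) <= _).
  apply: le_trans (_ : X%:R * (2 * (a1 * summ u X - a / 2 * S2 + Kr * S3')) + X%:R * (`|K4| * (1 + l)) <= _).
    by apply: lerD => //; rewrite [leRHS]mulrCA ler_wpM2l.
  by rewrite -mulrDr ler_wpM2l ?(ltW XR) //; lra.
rewrite [leRHS](_ : _ = X%:R * ((a - a * s / 2) * l ^+ 2)); last by ring.
rewrite ler_wpM2l ?(ltW XR) //.
apply: le_trans (_ : a1 * l ^+ 2 - a * (s * l ^+ 2) + 2 * C * l <= _).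
  have C1 : a1 <= a1 * l by rewrite -[leLHS]mulr1 ler_wpM2l // ltW.
  have C2 : `|K4| <= `|K4| * l by rewrite -[leLHS]mulr1 ler_wpM2l.
  have C3 : 0 <= Kr * (l * (1 + ln Y%:R)).
    by rewrite !mulr_ge0 ?addr_ge0 // (le_trans ler01).
  by rewrite /C; lra.
by rewrite /a1; lra.
Qed.

(** The eventually admissible constants have an infimum; were it positive, [remainder_improve] would
    produce one below it. *)
Theorem remainder_small (e : R) : 0 < e ->
  exists Y, forall v, (Y <= v)%N -> `|rem v| <= e * v%:R.
Proof.
pose E : set R := fun a => 0 <= a /\
  exists Y, forall v, (Y <= v)%N -> `|rem v| <= a * v%:R.
have EKr : E Kr by split=> //; exists 0%N.
have hE : has_inf E by split; [exists Kr | exists 0 => x []].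
have inf0 : 0 <= inf E by apply: lb_le_inf; [exists Kr | move=> x []].
have above a' : inf E < a' -> exists Y, forall v, (Y <= v)%N -> `|rem v| <= a' * v%:R.
  move=> /inf_lt [|b [b0 [Y HY]] ba]; first by case: hE.
  exists Y => v Yv; apply: le_trans (HY v Yv) _; by rewrite ler_wpM2r // ltW.
suff infE0 : inf E = 0 by move=> e0; apply: above; rewrite infE0.
apply/eqP; rewrite eq_le inf0 andbT leNgt; apply/negP => i0.
have [a' a'i [Y HY]] := remainder_improve i0 above.
have a'0 : 0 <= a'.
  have := le_trans (normr_ge0 _) (HY (maxn Y 1) (leq_maxl _ _)).
  by rewrite pmulr_lge0 // ltr0n leq_max orbT.
have : inf E <= a' by apply: inf_lbound; [case: hE | split=> //; exists Y].
by rewrite leNgt a'i.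
Qed.

End ErdosSelberg.

Theorem beurling_pnt (R : realType) (b L : nat -> R) (c d K0 : R) :
  (forall n, 0 <= b n) -> b 1%N = 1 -> (forall n, 0 <= L n) ->
  (forall n, (0 < n)%N -> dlog b n = dconv L b n) ->
  0 < c -> 0 < d -> d <= 2^-1 ->
  (forall n, (0 < n)%N -> `|summ b n - c * n%:R| <= K0 * n%:R `^ (1 - d)) ->
  forall e : R, 0 < e -> exists Y, forall v, (Y <= v)%N -> `|summ L v - v%:R| <= e * v%:R.
Proof.
move=> b0 b1 L0 bL c0 d0 d1 cb.
have [Kp [Kp0 HKp]] := psi_le b0 b1 L0 bL c0 d0 d1 cb.
have [Km HKm] := mertens b0 b1 L0 bL c0 d0 d1 cb.
have [Ks HKs] := selberg_formula b0 b1 L0 bL c0 d0 d1 cb.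
apply: (@remainder_small R L (Kp + 1)) => //.
- by rewrite addr_ge0.
- exact: norm_rem_le.
- exact: (norm_rem_sq_le_ln L0 Kp0 HKp HKm HKs).
- apply: sum_rem_telescope; eassumption.
- apply: psi_short; eassumption.
Qed.

(** * Removing the smoothing from a counting function *)

Section Desmoothing.
Variable R : realType.
Implicit Types (k x y : nat).

(** [f k] and [f y] are both close to [f (k y)], hence to each other; this gives a limit with a rate
    although nothing relates neighbouring indices directly. *)
Lemma cauchy_div_limit (f : nat -> R) (K : R) :
  (forall k y, (0 < k)%N -> (0 < y)%N -> `|f (k * y)%N - f y| <= K / y%:R) ->
  exists c : R, forall y, (0 < y)%N -> `|f y - c| <= K / y%:R.
Proof.
move=> H; have K0 : 0 <= K by have := le_trans (normr_ge0 _) (H 1%N 1%N isT isT); rewrite divr1.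
have H2 k y : (0 < k)%N -> (0 < y)%N -> f k <= f y + K / y%:R + K / k%:R.
  move=> k0 y0; have := H k y k0 y0; have := H y k y0 k0; rewrite mulnC !ler_norml.
  move: (f (k * y)%N) (K / y%:R) (K / k%:R) => a b e /andP[h1 h2] /andP[h3 h4]; lra.
pose E : set R := fun v => exists2 k, (0 < k)%N & v = f k - K / k%:R.
have hE : has_sup E.
  split; first by exists (f 1%N - K / 1%:R); exists 1%N.
  exists (f 1%N + K / 1%:R) => _ [k k0 ->].
  have := H2 k 1%N k0 isT; lra.
exists (sup E) => y y0; rewrite ler_norml; apply/andP; split.
  suff : sup E <= f y + K / y%:R by lra.
  apply: ge_sup; first by exists (f 1%N - K / 1%:R); exists 1%N.
  by move=> _ [k k0 ->]; have := H2 k y k0 y0; lra.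
suff : f y - K / y%:R <= sup E by lra.
by apply: ub_le_sup; [case: hE | exists y].
Qed.

Lemma powR_add (x r s : R) : 0 < x -> x `^ r * x `^ s = x `^ (r + s).
Proof. by move=> x0; rewrite powRD // (gt_eqF x0) implybT. Qed.

Lemma cube_diff (u v : R) : 0 <= u <= v -> v ^+ 3 - u ^+ 3 <= 3 * v ^+ 2 * (v - u).
Proof.
move=> /andP[u0 uv]; have v0 := le_trans u0 uv.
have -> : v ^+ 3 - u ^+ 3 = (v ^+ 2 + u * v + u ^+ 2) * (v - u) by ring.
rewrite ler_wpM2r ?subr_ge0 //.
have a1 : u * v <= v ^+ 2 by rewrite expr2 ler_wpM2r.
have a2 : u ^+ 2 <= v ^+ 2 by rewrite lerXn2r ?nnegrE.
by move: a1 a2; move: (u * v) (u ^+ 2) (v ^+ 2) => *; lra.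
Qed.

Lemma powers_diff (n Y : nat) : (0 < Y)%N ->
  ((Y.+1 ^ n.+1 - Y ^ n.+1) * Y <= n.+1 * 2 ^ n.+1 * Y ^ n.+1)%N.
Proof.
move=> Y0; rewrite subn_exp subSn // subnn mul1n -mulnA -expnMn.
apply: leq_trans (_ : n.+1 * (2 * Y) ^ n * Y <= _)%N; last first.
  by rewrite -mulnA leq_mul // expnS mulnC leq_mul // leq_pmull.
rewrite leq_mul // -[X in (X * _)%N]card_ord -sum_nat_const; apply: leq_sum => i _.
have iD : (i <= n)%N by rewrite -ltnS.
have h q (a b : nat) : (a <= b)%N -> (a ^ q <= b ^ q)%N by case: q => // q; rewrite leq_exp2r.
rewrite /= -[in X in (_ <= X)%N](subnK iD) expnD leq_mul // h //; last exact: leq_pmull.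
by rewrite mul2n -addnn -addn1 leq_add2l.
Qed.

(** Any [x] lies between consecutive powers [Y^(n+1)] and [(Y+1)^(n+1)], whose relative gap is of
    order [1/Y], that is [x^(-1/(n+1))]; monotonicity of [U] does the rest. *)
Lemma interpolate_powers (n : nat) (U : nat -> R) (c K : R) : 0 < c -> 0 <= K ->
  (forall x y, (x <= y)%N -> U x <= U y) ->
  (forall Y, (0 < Y)%N ->
    `|U (Y ^ n.+1)%N - c * (Y ^ n.+1)%:R ^+ 3| <= K * ((Y ^ n.+1)%:R ^+ 3 / Y%:R)) ->
  exists2 K' : R, 0 <= K' & forall x, (0 < x)%N ->
    `|U x - c * x%:R ^+ 3| <= K' * (x%:R ^+ 3 * x%:R `^ (- n.+1%:R^-1)).
Proof.
move=> c0 K0 mono H; set d : R := n.+1%:R^-1; have d0 : 0 < d by rewrite invr_gt0.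
pose B : R := (2 ^ n.+1)%:R; have B1 : 1 <= B by rewrite ler1n expn_gt0.
have B0 : 0 <= B by apply: le_trans B1.
pose M : R := (n.+1 * 2 ^ n.+1)%:R; have M0 : 0 <= M by [].
pose C1 := B ^+ 3 * K * 2; pose C2 := c * (3 * B ^+ 3 * M * 2).
have C10 : 0 <= C1 by rewrite !mulr_ge0 ?exprn_ge0.
have C20 : 0 <= C2 by rewrite !mulr_ge0 ?exprn_ge0 ?(ltW c0).
exists (C1 + C2); first by rewrite addr_ge0.
move=> x x0.
have [Y [Y0 Y1 Y2]] : exists Y, [/\ (0 < Y)%N, (Y ^ n.+1 <= x)%N & (x < Y.+1 ^ n.+1)%N].
  pose P q := (q ^ n.+1 <= x)%N; have P1 : exists q, P q by exists 1%N; rewrite /P exp1n.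
  have Pb q : P q -> (q <= x)%N.
    by apply: leq_trans; case: q => // q; rewrite -{1}[q.+1]expn1 leq_pexp2l.
  exists (ex_maxn P1 Pb); case: ex_maxnP => i iP imax; split=> //.
    by apply: imax; rewrite /P exp1n.
  by rewrite ltnNge; apply/negP => /imax; rewrite ltnn.
have x0r : 0 < x%:R :> R by rewrite ltr0n.
set X1 : R := (Y ^ n.+1)%:R; set X2 : R := (Y.+1 ^ n.+1)%:R.
have X1x : X1 <= x%:R by rewrite ler_nat.
have xX2 : x%:R <= X2 by rewrite ler_nat ltnW.
have X10 : 0 < X1 by rewrite ltr0n expn_gt0 Y0.
have X2B : X2 <= B * x%:R.
  apply: le_trans (_ : B * X1 <= _); last by rewrite ler_wpM2l.
  by rewrite -natrM ler_nat -expnMn leq_exp2r // mul2n -addnn -addn1 leq_add2l.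
set p := x%:R `^ (- d); have p0 : 0 <= p by apply: powR_ge0.
have Yroot : (Y.+1%:R)^-1 <= p.
  rewrite /p powRN lef_pV2 ?posrE ?ltr0n ?powR_gt0 //.
  apply: le_trans (_ : X2 `^ d <= _).
    by apply: ge0_ler_powR; rewrite ?nnegrE ?(ltW d0) // (le_trans (ltW x0r)).
  by rewrite /X2 natrX -powR_mulrn // -powRrM divff ?powRr1.
have Yroot2 : Y%:R^-1 <= 2 * p.
  apply: le_trans (_ : 2 * Y.+1%:R^-1 <= _); last by rewrite ler_wpM2l.
  rewrite ler_pdivlMr ?ltr0n // mulrC ler_pdivrMr ?ltr0n // -natrM ler_nat.
  by rewrite mul2n -addnn -addn1 leq_add2l.
set x3 : R := x%:R ^+ 3; have x30 : 0 <= x3 by rewrite exprn_ge0.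
have diff : X2 - X1 <= M * (X1 / Y%:R).
  rewrite mulrA ler_pdivlMr ?ltr0n // /X1 /X2 -natrB ?leq_exp2r // -!natrM ler_nat.
  exact: powers_diff.
have cube (v : R) : 0 <= v -> v <= B * x%:R -> v ^+ 3 <= B ^+ 3 * x3.
  by move=> v0 vB; rewrite -exprMn lerXn2r ?nnegrE ?mulr_ge0.
have xB : x%:R <= B * x%:R by rewrite ler_peMl.
have E1 : `|U (Y ^ n.+1)%N - c * X1 ^+ 3| <= C1 * (x3 * p).
  apply: le_trans (H Y Y0) _.
  rewrite (_ : C1 * _ = K * ((B ^+ 3 * x3) * (2 * p))); last by rewrite /C1; ring.
  rewrite ler_wpM2l //; apply: ler_pM; rewrite ?exprn_ge0 ?invr_ge0 //.
  by apply: cube; [apply: ltW | apply: le_trans xB].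
have E2 : `|U (Y.+1 ^ n.+1)%N - c * X2 ^+ 3| <= C1 * (x3 * p).
  apply: le_trans (H Y.+1 isT) _.
  rewrite (_ : C1 * _ = K * ((B ^+ 3 * x3) * (2 * p))); last by rewrite /C1; ring.
  rewrite ler_wpM2l //; apply: ler_pM; rewrite ?exprn_ge0 ?invr_ge0 //.
    by apply: cube.
  by apply: le_trans Yroot _; rewrite ler_peMl // ler1n.
have E3 : c * X2 ^+ 3 - c * X1 ^+ 3 <= C2 * (x3 * p).
  rewrite -mulrBr /C2 -[leRHS]mulrA ler_wpM2l ?(ltW c0) //.
  apply: le_trans (cube_diff _) _; first by rewrite (ltW X10) (le_trans X1x xX2).
  rewrite (_ : _ * _ * _ = 3 * (X2 ^+ 2 * (X2 - X1))); last by ring.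
  rewrite (_ : 3 * B ^+ 3 * M * 2 * _ = 3 * ((B * x%:R) ^+ 2 * (M * ((B * x%:R) * (2 * p))))); last by rewrite /x3; ring.
  rewrite ler_wpM2l //; apply: ler_pM; rewrite ?exprn_ge0 ?subr_ge0 ?(le_trans X1x xX2) //.
    by rewrite lerXn2r ?nnegrE ?mulr_ge0.
  apply: le_trans diff _; rewrite ler_wpM2l //; apply: ler_pM; rewrite ?(ltW X10) //.
  exact: le_trans X1x xB.
have M1 := mono _ _ Y1; have M2 := mono _ _ (ltnW Y2).
have D1 : c * X1 ^+ 3 <= c * x3 by rewrite ler_wpM2l ?(ltW c0) // lerXn2r ?nnegrE ?(ltW X10).
have D2 : c * x3 <= c * X2 ^+ 3 by rewrite ler_wpM2l ?(ltW c0) // lerXn2r ?nnegrE.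
rewrite mulrDl; move: E1 E2 E3 M1 M2 D1 D2; rewrite !ler_norml.
move: (U _) (U _) (U _) (c * X1 ^+ 3) (c * X2 ^+ 3) (c * x3) (C1 * _) (C2 * _) => a1 a2 a3 a4 a5 a6 a7 a8.
move=> /andP[? ?] /andP[? ?] ? ? ? ? ?; apply/andP; split; lra.
Qed.

Lemma desmooth_monotone (F : nat -> R) (c K d : R) : 0 < c -> 0 <= K -> 0 < d <= 1 ->
  (forall x, 0 <= F x) -> (forall x y, (x <= y)%N -> F x <= F y) ->
  (forall x, (0 < x)%N ->
     `|\sum_(j < x) F j - c * x%:R ^+ 3| <= K * (x%:R ^+ 3 * x%:R `^ (- d))) ->
  exists2 K' : R, 0 <= K' & forall x, (0 < x)%N ->
    `|F x - 3 * c * x%:R ^+ 2| <= K' * (x%:R ^+ 2 * x%:R `^ (- (d / 2))).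
Proof.
move=> c0 K0 /andP[d0 d1] F0 mono H.
exists (10 * c + 28 * K); first by rewrite addr_ge0 ?mulr_ge0 ?(ltW c0).
move=> x x0; pose X : R := x%:R; have X0 : 0 < X by rewrite ltr0n.
have X1 : 1 <= X by rewrite ler1n.
set p := X `^ (- (d / 2)); have p0 : 0 < p by apply: powR_gt0.
have p1 : p <= 1.
  by rewrite /p -[leRHS](powRr0 X) ler_powR // oppr_le0 divr_ge0 // ltW.
have pp : X `^ (- d) = p * p by rewrite /p powR_add //; congr (_ `^ _); lra.
have Xp1 : 1 <= X * p.
  rewrite /p -{1}[X]powRr1 ?(ltW X0) // powR_add // -[leLHS](powRr0 X) ler_powR //.
  by move: d0 d1; lra.
(* A difference step [y] of size about [X p], with [p = X^(-d/2)], balances the error [X^3 p^2 / y]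
   of the hypothesis against the curvature error [X y]: both become [X^2 p], and half of the
   exponent is lost. *)
pose y := (Num.truncn (X * p)).+1; pose Y : R := y%:R.
have Yl : X * p <= Y by apply: ltW; apply: truncnS_gt.
have Yu : Y <= 2 * (X * p).
  have h : (Num.truncn (X * p))%:R <= X * p by rewrite truncn_le (le_trans ler01 Xp1).
  rewrite /Y /y -natr1; move: h Xp1.
  by move: (X * p) ((Num.truncn (X * p))%:R : R) => a b *; lra.
have Y0 : 0 < Y by rewrite ltr0n.
have YX : Y <= 2 * X by apply: le_trans Yu _; rewrite ler_wpM2l // ler_piMr // ltW.
have cub : X ^+ 3 * (p * p) <= X ^+ 2 * p * Y.
  rewrite (_ : X ^+ 3 * _ = X ^+ 2 * p * (X * p)); last by ring.
  by rewrite ler_wpM2l // mulr_ge0 ?exprn_ge0 // ltW.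
have XYp : X * Y <= 2 * (X ^+ 2 * p).
  rewrite (_ : 2 * _ = X * (2 * (X * p))); last by ring.
  by rewrite ler_wpM2l // ltW.
have HX := H x x0; rewrite -/X pp in HX.
have sumD z k : \sum_(j < z + k) F j = \sum_(j < z) F j + \sum_(j < k) F (z + j)%N.
  by rewrite big_split_ord.
have Fup : Y * F x <= \sum_(j < x + y) F j - \sum_(j < x) F j.
  rewrite sumD addrAC subrr add0r; apply: le_trans (_ : \sum_(j < y) F x <= _).
    by rewrite sumr_const card_ord mulr_natl.
  by apply: ler_sum => j _; apply: mono; apply: leq_addr.
have up : F x <= 3 * c * X ^+ 2 + (10 * c + 28 * K) * (X ^+ 2 * p).
  have xy0 : (0 < x + y)%N by rewrite addn_gt0 x0.
  have := H (x + y)%N xy0; rewrite natrD -/X -/Y => HY.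
  have HY' : \sum_(j < x + y) F j <= c * (X + Y) ^+ 3 + 27 * K * (X ^+ 3 * (p * p)).
    have : (X + Y) ^+ 3 * (X + Y) `^ (- d) <= 27 * (X ^+ 3 * (p * p)).
      rewrite mulrA; apply: ler_pM; rewrite ?exprn_ge0 ?addr_ge0 ?powR_ge0 ?(ltW X0) ?(ltW Y0) //.
        rewrite (_ : 27 * X ^+ 3 = (3 * X) ^+ 3); last by ring.
        rewrite lerXn2r ?nnegrE ?addr_ge0 ?mulr_ge0 ?(ltW X0) ?(ltW Y0) //.
        by move: YX; lra.
      rewrite -pp !powRN lef_pV2 ?posrE ?powR_gt0 ?addr_gt0 //.
      by apply: ge0_ler_powR; rewrite ?nnegrE ?addr_ge0 ?(ltW X0) ?(ltW Y0) ?(ltW d0) // lerDl ltW.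
    move=> h; have := le_trans HY (ler_wpM2l K0 h); rewrite ler_norml => /andP[_].
    by rewrite (_ : K * _ = 27 * K * (X ^+ 3 * (p * p))); [rewrite lerBlDl | ring].
  rewrite -(ler_pM2l Y0); apply: le_trans Fup _.
  move: HX; rewrite ler_norml => /andP[HX _].
  have e1 : (X + Y) ^+ 3 - X ^+ 3 <= 3 * X ^+ 2 * Y + 5 * (X * Y) * Y.
    have : Y ^+ 3 <= 2 * X * Y ^+ 2 by rewrite exprS ler_wpM2r ?exprn_ge0 // ltW.
    rewrite (_ : (X + Y) ^+ 3 = X ^+ 3 + 3 * X ^+ 2 * Y + 3 * X * Y ^+ 2 + Y ^+ 3); last by ring.
    rewrite (_ : 5 * (X * Y) * Y = 3 * X * Y ^+ 2 + 2 * X * Y ^+ 2); last by ring.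
    by move: (Y ^+ 3) (X ^+ 3) (3 * X ^+ 2 * Y) (3 * X * Y ^+ 2) (2 * X * Y ^+ 2) => *; lra.
  have e2 : 5 * (X * Y) * Y <= 10 * (X ^+ 2 * p) * Y.
    by rewrite ler_wpM2r ?(ltW Y0) //; move: XYp; lra.
  have e3 : c * ((X + Y) ^+ 3 - X ^+ 3) <= c * (3 * X ^+ 2 * Y + 10 * (X ^+ 2 * p) * Y).
    by rewrite ler_wpM2l ?(ltW c0) //; apply: le_trans e1 _; rewrite lerD2l.
  have e4 : 28 * K * (X ^+ 3 * (p * p)) <= 28 * K * (X ^+ 2 * p * Y).
    by rewrite ler_wpM2l // mulr_ge0.
  have -> : Y * (3 * c * X ^+ 2 + (10 * c + 28 * K) * (X ^+ 2 * p)) =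
    c * (3 * X ^+ 2 * Y + 10 * (X ^+ 2 * p) * Y) + 28 * K * (X ^+ 2 * p * Y) by ring.
  apply: le_trans (lerD e3 e4); rewrite mulrBr.
  move: HX HY'; rewrite -(mulrA 27) -(mulrA 28).
  by move: (\sum_(j < x + y) F j) (\sum_(j < x) F j) (c * (X + Y) ^+ 3) (c * X ^+ 3) (K * (X ^+ 3 * (p * p))) => *; lra.
have lo : 3 * c * X ^+ 2 - (10 * c + 28 * K) * (X ^+ 2 * p) <= F x.
  have [yx|xy] := leqP y x; last first.
    apply: le_trans (F0 x); have : X <= Y by rewrite ler_nat ltnW.
    move=> XY; have Xp : X * X <= 2 * (X ^+ 2 * p).
      by apply: le_trans XYp; rewrite ler_wpM2l // ltW.
    have K1 : 0 <= K * (X ^+ 2 * p) by rewrite !mulr_ge0 ?exprn_ge0 ?(ltW X0) ?(ltW p0).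
    have K2 : 0 <= c * (X ^+ 2 * p) by rewrite !mulr_ge0 ?exprn_ge0 ?(ltW c0) ?(ltW X0) ?(ltW p0).
    have K3 : c * (X * X) <= 2 * (c * (X ^+ 2 * p)) by apply: le_trans (ler_wpM2l (ltW c0) Xp) _; apply: le_of_eq; ring.
    have -> : 3 * c * X ^+ 2 - (10 * c + 28 * K) * (X ^+ 2 * p) =
      3 * (c * (X * X)) - 10 * (c * (X ^+ 2 * p)) - 28 * (K * (X ^+ 2 * p)) by ring.
    by move: K1 K2 K3; move: (c * (X * X)) (c * (X ^+ 2 * p)) (K * (X ^+ 2 * p)) => *; lra.
  have xE : x = ((x - y) + y)%N by rewrite subnK.
  have Fdn : \sum_(j < x) F j - \sum_(j < x - y) F j <= Y * F x.
    have := sumD (x - y)%N y; rewrite subnK // => ->.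
    rewrite addrAC subrr add0r; apply: le_trans (_ : \sum_(j < y) F x <= _).
      by apply: ler_sum => j _; apply: mono; rewrite [leqRHS]xE leq_add2l ltnW.
    by rewrite sumr_const card_ord mulr_natl.
  have Z0 : 0 <= X - Y by rewrite subr_ge0 ler_nat.
  have HY' : \sum_(j < x - y) F j <= c * (X - Y) ^+ 3 + K * (X ^+ 3 * (p * p)).
    have [z0|z0] := posnP (x - y).
      rewrite z0 big_ord0 addr_ge0 ?mulr_ge0 ?exprn_ge0 ?(ltW c0) ?(ltW X0) ?(ltW p0) //.
    have := H (x - y)%N z0; rewrite natrB // -/X -/Y => HY.
    have Zp : 0 < X - Y by rewrite subr_gt0 ltr_nat -subn_gt0.
    have P3 (v : R) : 0 < v -> v ^+ 3 * v `^ (- d) = v `^ (3%:R - d).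
      by move=> v0; rewrite -powR_mulrn ?(ltW v0) // powR_add.
    have : (X - Y) ^+ 3 * (X - Y) `^ (- d) <= X ^+ 3 * (p * p).
      rewrite -pp !P3 //; apply: ge0_ler_powR; rewrite ?nnegrE ?(ltW X0) ?(ltW Zp) //; first by lra.
      by rewrite gerBl ltW.
    move=> h; have := le_trans HY (ler_wpM2l K0 h); rewrite ler_norml => /andP[_].
    by rewrite lerBlDl.
  rewrite -(ler_pM2l Y0); apply: le_trans Fdn.
  move: HX; rewrite ler_norml => /andP[HX _].
  have e1 : 3 * X ^+ 2 * Y - 3 * (X * Y) * Y <= X ^+ 3 - (X - Y) ^+ 3.
    have : 0 <= Y ^+ 3 by rewrite exprn_ge0 ?(ltW Y0).
    rewrite (_ : (X - Y) ^+ 3 = X ^+ 3 - 3 * X ^+ 2 * Y + 3 * (X * Y) * Y - Y ^+ 3); last by ring.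
    by move: (Y ^+ 3) (X ^+ 3) (3 * X ^+ 2 * Y) (3 * (X * Y) * Y) => *; lra.
  have e2 : 3 * (X * Y) * Y <= 10 * (X ^+ 2 * p) * Y.
    rewrite ler_wpM2r ?(ltW Y0) //; have : 0 <= X * Y by rewrite mulr_ge0 ?(ltW X0) ?(ltW Y0).
    by move: XYp; lra.
  have e3 : c * (3 * X ^+ 2 * Y - 10 * (X ^+ 2 * p) * Y) <= c * (X ^+ 3 - (X - Y) ^+ 3).
    by rewrite ler_wpM2l ?(ltW c0) //; apply: le_trans e1; rewrite lerD2l lerN2.
  have e4 : 28 * K * (X ^+ 3 * (p * p)) <= 28 * K * (X ^+ 2 * p * Y).
    by rewrite ler_wpM2l // mulr_ge0.
  have -> : Y * (3 * c * X ^+ 2 - (10 * c + 28 * K) * (X ^+ 2 * p)) =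
    c * (3 * X ^+ 2 * Y - 10 * (X ^+ 2 * p) * Y) - 28 * K * (X ^+ 2 * p * Y) by ring.
  apply: le_trans (lerB e3 e4) _; rewrite mulrBr.
  have : 0 <= K * (X ^+ 3 * (p * p)) by rewrite !mulr_ge0 ?exprn_ge0 ?(ltW X0) ?(ltW p0).
  move: HX HY'; rewrite -(mulrA 28).
  by move: (\sum_(j < x - y) F j) (\sum_(j < x) F j) (c * (X - Y) ^+ 3) (c * X ^+ 3) (K * (X ^+ 3 * (p * p))) => *; lra.
rewrite ler_norml -/X; move: up lo; move: (_ * (X ^+ 2 * p)) (3 * c * X ^+ 2) => a b *.
by apply/andP; split; lra.
Qed.

Lemma abel_remove_weight (b : nat -> R) (c K d : R) : 0 <= K -> 0 < d <= 2^-1 ->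
  (forall x, (0 < x)%N -> `|summ (fun m => m%:R * b m) x - c * x%:R ^+ 2| <=
     K * (x%:R ^+ 2 * x%:R `^ (- d))) ->
  exists K' : R, forall x, (0 < x)%N -> `|summ b x - 2 * c * x%:R| <= K' * x%:R `^ (1 - d).
Proof.
move=> K0 /andP[d0 d2] H; have d1 : d < 1 by move: d2; lra.
have sp x : summ (fun m => m%:R `^ (- d)) x <= (2 / (1 - d)) * x%:R `^ (1 - d).
  have /(_ x) := @sum_powR_le R (1 - d).
  rewrite (_ : 1 - d - 1 = - d); last by ring.
  by apply; move: d0 d1; lra.
exists ((K + `|c|) * (2 / (1 - d)) + K + `|c|) => -[//|x] _.
set X : R := x.+1%:R; have X0 : 0 < X by rewrite ltr0n.
have X1 : 1 <= X by rewrite ler1n.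
set q := X `^ (1 - d).
have q1 : 1 <= q by rewrite /q -[leLHS](powRr0 X) ler_powR // subr_ge0 ltW.
have bE : summ b x.+1 = summ (fun m => m%:R * b m * m%:R^-1) x.+1.
  by apply: eq_summ => m /andP[m0 _]; rewrite mulrAC divff ?mul1r // pnatr_eq0 -lt0n.
rewrite bE abel_summ -/X; set A := summ _ x.+1.
have HA : `|A / X - c * X| <= K * q.
  have := H x.+1 isT; rewrite -/A -/X => h.
  rewrite (_ : A / X - c * X = (A - c * X ^+ 2) / X); last by field; rewrite gt_eqF.
  rewrite normrM [`|X^-1|]gtr0_norm ?invr_gt0 // ler_pdivrMr //; apply: le_trans h _.
  rewrite (_ : q = X * X `^ (- d)); last by rewrite /q -powR_add // powRr1 // ltW.
  by apply: le_of_eq; ring.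
have term m : (0 < m)%N -> `|summ (fun m => m%:R * b m) m * (m%:R^-1 - m.+1%:R^-1) - c| <=
    (K + `|c|) * m%:R `^ (- d).
  move=> m0; have m0r : 0 < m%:R :> R by rewrite ltr0n.
  have m1r : 0 < m.+1%:R :> R by rewrite ltr0n.
  have := H m m0; set S := summ _ m => h.
  have -> : S * (m%:R^-1 - m.+1%:R^-1) - c =
     (S - c * m%:R ^+ 2) * (m%:R * m.+1%:R)^-1 - c * m.+1%:R^-1.
    have E : m.+1%:R = m%:R + 1 :> R by rewrite natr1.
    by rewrite E in m1r *; field; rewrite !gt_eqF.
  apply: le_trans (ler_normB _ _) _; rewrite [leRHS]mulrDl; apply: lerD.
    rewrite normrM [`|(_ * _)^-1|]gtr0_norm ?invr_gt0 ?mulr_gt0 // ler_pdivrMr ?mulr_gt0 //.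
    apply: le_trans h _; rewrite -[leRHS]mulrA ler_wpM2l // [leRHS]mulrC ler_wpM2r ?powR_ge0 //.
    by rewrite expr2 ler_wpM2l ?(ltW m0r) // ler_nat.
  rewrite normrM ler_wpM2l // gtr0_norm ?invr_gt0 // powRN lef_pV2 ?posrE ?powR_gt0 //.
  apply: le_trans (_ : m%:R `^ 1 <= _); last by rewrite powRr1 ?ler_nat // ltW.
  by rewrite ler_powR ?ler1n // ltW.
have HS : `|summ (fun n => summ (fun m => m%:R * b m) n * (n%:R^-1 - n.+1%:R^-1)) x - c * x%:R| <=
   (K + `|c|) * (2 / (1 - d)) * q.
  have -> : c * x%:R = summ (fun=> c * 1) x by rewrite summZ summ1.
  rewrite -summB; apply: le_trans (norm_summ _ _) _.
  apply: le_trans (_ : summ (fun m => (K + `|c|) * m%:R `^ (- d)) x <= _).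
    by apply: le_summ => m /andP[m0 _]; rewrite mulr1; apply: term.
  rewrite summZ -mulrA ler_wpM2l ?addr_ge0 //; apply: le_trans (sp x) _.
  rewrite ler_wpM2l ?divr_ge0 ?subr_ge0 ?(ltW d1) // /q; apply: ge0_ler_powR; rewrite ?nnegrE ?ler_nat //.
  by rewrite subr_ge0 ltW.
set S2 := summ _ x in HS *.
rewrite (_ : A * X^-1 + S2 - 2 * c * X = (A / X - c * X) + (S2 - c * x%:R) - c); last first.
  by rewrite {4}/X -natr1 /X; ring.
apply: le_trans (ler_normB _ _) _; rewrite mulrDl mulrDl; apply: lerD; last first.
  by rewrite ler_peMr.
rewrite addrC; apply: le_trans (ler_normD _ _) _.
exact: lerD.
Qed.

End Desmoothing.

Lemma Fp_int_eq0 (p : nat) (c : int) : prime p -> (c%:~R == 0 :> 'F_p) = (p%:Z %| c)%Z.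
Proof.
move=> pp; have Fn k : (k%:R == 0 :> 'F_p) = (p %| k)%N.
  by rewrite -(dvdn_pcharf (pchar_Fp pp)).
rewrite dvdzE absz_nat; case: c => k; first by rewrite -pmulrn Fn.
by rewrite NegzE mulrNz oppr_eq0 -pmulrn Fn abszN.
Qed.

Lemma fermat_int (p : nat) (y : int) : prime p -> ~~ (p%:Z %| y)%Z -> (p%:Z %| y ^+ p.-1 - 1)%Z.
Proof.
move=> pp; rewrite -!Fp_int_eq0 // rmorphB rmorphXn /= subr_eq0; move: (y%:~R) => X X0.
have Xp : X ^+ p.-1.+1 = X by rewrite prednK ?prime_gt0 //; have := expf_card X; rewrite card_Fp.
by apply/eqP/(mulfI X0); rewrite -exprS Xp mulr1.
Qed.

(** * Kummer and cyclotomic theory *)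

Section RadicalExtension.
Variables (F : fieldType) (L : fieldExtType F).
Implicit Types (K : {subfield L}) (x : L).

Lemma XnsubC_factor (e : nat) (w a : L) : (0 < e)%N -> e.-primitive_root w ->
  a != 0 -> 'X^e - (a ^+ e)%:P = \prod_(0 <= i < e) ('X - (w ^+ i * a)%:P).
Proof.
move=> e0 we a0.
have := factor_Xn_sub_1 we => /(congr1 (fun P => a ^+ e *: (P \Po (a^-1 *: 'X)))).
rewrite rmorphB /= comp_Xn_poly rmorph1 exprZn scalerBr scalerA -exprMn divff // expr1n scale1r.
rewrite -[a ^+ e *: 1]mul_polyC mulr1 => <-.
rewrite rmorph_prod /= -[e in a ^+ e]subn0 -prodr_const_nat -scaler_prod.
by apply: eq_bigr => i _; rewrite rmorphB /= comp_polyX comp_polyC scalerBr scalerA divff // scale1r -mul_polyC -polyCM mulrC.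
Qed.

(** The minimal polynomial divides [X^e - a^e], whose roots are [w^i a], so its constant term is an
    element of [K] times [a^t] and [a^t] lies in [K]. Conversely [t] is the least such exponent,
    whence [t] divides [e]. If [t < e], a prime [q] dividing [e/t] would make [a^e] a [q]-th power
    in [K]. *)
Lemma radical_degree K (e : nat) (w a : L) : (0 < e)%N -> e.-primitive_root w -> w \in K ->
  a != 0 -> a ^+ e \in K ->
  (forall q b, prime q -> (q %| e)%N -> b \in K -> b ^+ q != a ^+ e) ->
  adjoin_degree K a = e.
Proof.
move=> e0 we wK a0 aK np.
set t := adjoin_degree K a; pose P := minPoly K a.
have [s sP] : {s : seq nat | P = \prod_(i <- s) ('X - (w ^+ i * a)%:P)}.
  have : P %| 'X^e - (a ^+ e)%:P.
    apply: minPoly_dvdp; first by rewrite rpredB ?rpredX ?polyOverX // polyOverC.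
    by rewrite /root !hornerE subrr.
  rewrite (XnsubC_factor e0 we a0) => /dvdp_prod_XsubC[m Pm].
  exists (mask m (index_iota 0 e)); apply/eqP.
  by rewrite -eqp_monic // ?monic_minPoly ?monic_prod_XsubC.
have sz : size s = t.
  by have := size_minPoly K a; rewrite -/P sP size_prod_XsubC => /eqP; rewrite eqSS => /eqP.
have atK : a ^+ t \in K.
  have : P`_0 \in K by apply: (polyOverP (minPolyOver K a)).
  rewrite sP -horner_coef0 horner_prod.
  rewrite (eq_bigr (fun i => (- w ^+ i) * a)); last by move=> i _; rewrite !hornerE mulNr.
  rewrite big_split /= big_const_seq count_predT iter_mulr_1 sz => h.
  set c := \prod_(i <- s) _ in h.
  have cK : c \in K by apply: rpred_prod => i _; rewrite rpredN rpredX.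
  have c0 : c != 0.
    rewrite prodf_seq_neq0; apply/allP => i _ /=; rewrite oppr_eq0 expf_neq0 //.
    by apply/eqP => h0; have /eqP := prim_expr_order we; rewrite h0 expr0n gtn_eqF // eq_sym oner_eq0.
  by rewrite -(mulKf c0 (a ^+ t)) rpredM ?rpredV.
have tmin i : (0 < i)%N -> a ^+ i \in K -> (t <= i)%N.
  move=> i0 ai; have : P %| 'X^i - (a ^+ i)%:P.
    apply: minPoly_dvdp; first by rewrite rpredB ?rpredX ?polyOverX // polyOverC.
    by rewrite /root !hornerE subrr.
  move=> /dvdp_leq; rewrite -size_poly_eq0 size_XnsubC // => /(_ isT).
  by rewrite size_minPoly ltnS.
have t0 : (0 < t)%N by [].
have te : (t %| e)%N.
  rewrite /dvdn; case: posnP => // r0; have := tmin _ r0.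
  have -> : a ^+ (e %% t) \in K.
    have h : a ^+ (e %/ t * t) \in K by rewrite mulnC exprM rpredX.
    have h0 : a ^+ (e %/ t * t) != 0 by rewrite expf_neq0.
    by rewrite -(mulKf h0 (a ^+ (e %% t))) rpredM ?rpredV // -exprD -divn_eq.
  by move=> /(_ isT); rewrite leqNgt ltn_mod t0.
apply/eqP; rewrite eqn_leq (dvdn_leq e0 te) /= leqNgt; apply/negP => lt.
pose r := (e %/ t)%N; have r1 : (1 < r)%N by rewrite /r ltn_divRL // mul1n.
pose q := pdiv r; have qp := pdiv_prime r1; have qr := pdiv_dvd r.
have rE : e = (t * (r %/ q) * q)%N by rewrite -mulnA divnK // /r mulnC divnK.
have qe : (q %| e)%N by rewrite rE dvdn_mull.
have := np q (a ^+ (t * (r %/ q))) qp qe; rewrite -exprM -rE eqxx => /(_ _)/negP; apply=> //.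
by rewrite exprM rpredX.
Qed.

End RadicalExtension.

Section KummerField.
Variables (m e : nat) (A : int) (z : algC).
Hypotheses (m0 : (0 < m)%N) (e0 : (0 < e)%N) (em : (e %| m)%N) (A0 : A != 0).
Hypothesis zm : m.-primitive_root z.
(** [A] is not a [q]-th power in the cyclotomic field, whose elements are written as polynomial
    values at [z]. *)
Hypothesis npow : forall q (P : {poly rat}), prime q -> (q %| e)%N ->
  (map_poly ratr P).[z] ^+ q != A%:~R.

(** The basis consists of the monomials in a primitive root of unity and a radical, with exponents
    below [totient m] and [e]. [radical_degree] makes them independent, and the order they span is
    closed under multiplication. *)
Lemma kummer_field : exists (L : fieldExtType rat) (n : nat) (B : n.+1.-tuple L) (zt al : L),
  [/\ basis_of {:L} B, B`_0 = 1,
      (forall i j k : 'I_n.+1, coord B k (B`_i * B`_j) \is a Num.int),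
      n.+1 = (totient m * e)%N &
   [/\ m.-primitive_root zt, al ^+ e = A%:~R,
      (forall i : 'I_n.+1, exists k l : nat, B`_i = zt ^+ k * al ^+ l) &
      forall k l : nat, forall i : 'I_n.+1, coord B i (zt ^+ k * al ^+ l) \is a Num.int]].
Proof.
have [L [f [[|zt [|al [|? ?]]] //= [fz fa] gen]]] := num_field_exists [:: z; e.-root (A%:~R : algC)].
have zm' : m.-primitive_root zt by rewrite -(fmorph_primitive_root f) fz.
have ale : al ^+ e = A%:~R.
  by apply: (fmorph_inj f); rewrite rmorphXn /= fa rootCK // rmorph_int.
have al0 : al != 0.
  apply/eqP => h; have /(congr1 f)/eqP := ale; rewrite h expr0n gtn_eqF // rmorph0 rmorph_int.
  by rewrite eq_sym intr_eq0 (negPf A0).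
pose K : {subfield L} := <<1; zt>>%AS.
have ztK : zt \in K by apply: memv_adjoin.
have ratf (c : rat) : f c%:A = ratr c by rewrite -(fmorph_eq_rat (f \o in_alg L)).
pose w := zt ^+ (m %/ e); have we : e.-primitive_root w.
  by have := dvdn_prim_root zm' em.
(* The minimal polynomial over the prime field is divisible by that of [z], which is cyclotomic. The
   opposite inequality is implied by the spanning argument below. *)
have deg1 : (totient m <= adjoin_degree 1%AS zt)%N.
  have /polyOver1P[P PE] := minPolyOver 1 zt.
  have fP : map_poly f (minPoly 1 zt) = map_poly ratr P.
    by rewrite PE -map_poly_comp; apply: eq_map_poly => c /=; rewrite ratf.
  have rP : root (map_poly ratr P : {poly algC}) z.
    by rewrite -fz -fP fmorph_root root_minPoly.
  have [p [pE _] pdv] := minCpolyP z; rewrite pdv in rP.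
  have szp : size p = (totient m).+1.
    by rewrite -(size_map_poly (ratr : {rmorphism rat -> algC})) -pE (minCpoly_cyclotomic zm) size_cyclotomic.
  have := dvdp_leq _ rP; rewrite szp -(size_map_poly (ratr : {rmorphism rat -> algC}) P) -fP size_map_poly size_minPoly ltnS; apply.
  by apply/eqP => P0; have := monic_minPoly 1 zt; rewrite PE P0 map_poly0 monicE lead_coef0 eq_sym oner_eq0.
have inK v : v \in K -> exists P : {poly rat}, v = (map_poly (in_alg L) P).[zt].
  by move=> /Fadjoin_polyP[p /polyOver1P[P ->] ->]; exists P.
have degK : adjoin_degree K al = e.
  apply: (@radical_degree _ _ K e w) => //; first by rewrite rpredX.
    have -> : al ^+ e = (A%:~R : rat) *: (1 : L) by rewrite ale scaler_int.
    by apply: memvZ; exact: mem1v.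
  move=> q b qp qe /inK[P ->]; apply/eqP => /(congr1 f); rewrite rmorphXn /= ale rmorph_int.
  rewrite -horner_map fz -map_poly_comp (@eq_map_poly _ _ _ (ratr : rat -> algC)); last by move=> c /=; rewrite ratf.
  by apply/eqP/npow.
pose ph := totient m; have ph0 : (0 < ph)%N by rewrite totient_gt0.
have ratL (c : int) v : c%:~R *: v = c%:~R * v :> L by rewrite scaler_int mulrzl.
case E: (ph * e)%N => [|n]; first by move/eqP: E; rewrite muln_eq0 (gtn_eqF ph0) (gtn_eqF e0).
pose B : n.+1.-tuple L := [tuple zt ^+ (i %% ph) * al ^+ (i %/ ph) | i < n.+1].
have BE (i : 'I_n.+1) : B`_i = zt ^+ (i %% ph) * al ^+ (i %/ ph).
  by rewrite -tnth_nth tnth_mktuple.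
(* [T] is the ring [Z[zt, al]]: every monomial reduces into the integral span of [B], because the
   cyclotomic polynomial is monic and [al^e] is an integer. *)
pose T v := exists c : 'I_n.+1 -> int, v = \sum_i (c i)%:~R *: B`_i.
have T0 : T 0 by exists (fun=> 0); rewrite big1 // => i _; rewrite scale0r.
have TD u v : T u -> T v -> T (u + v).
  move=> [c ->] [c' ->]; exists (fun i => c i + c' i); rewrite -big_split /=.
  by apply: eq_bigr => i _; rewrite rmorphD scalerDl.
have TZ (k : int) v : T v -> T (k%:~R * v).
  move=> [c ->]; exists (fun i => k * c i); rewrite mulr_sumr.
  by apply: eq_bigr => i _; rewrite -ratL scalerA rmorphM.
have TB a b : (a < ph)%N -> (b < e)%N -> T (zt ^+ a * al ^+ b).
  move=> ap be; have lt : (b * ph + a < n.+1)%N.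
    rewrite -E; apply: (@leq_trans (b.+1 * ph)); first by rewrite mulSn addnC ltn_add2r.
    by rewrite mulnC leq_mul.
  exists (fun i => (i == Ordinal lt)%:R).
  rewrite (eq_bigr (fun i => if i == Ordinal lt then B`_i else 0)); last first.
    by move=> i _; case: eqP; rewrite ?scale1r ?scale0r.
  rewrite -big_mkcond big_pred1_eq BE [nat_of_ord _]/= modnMDl modn_small // divnMDl //.
  by rewrite divn_small // addn0.
have rPhi : root (map_poly intr 'Phi_m) zt.
  rewrite -(fmorph_root f) -map_poly_comp (@eq_map_poly _ _ _ (intr : int -> algC)); last by move=> c /=; rewrite rmorph_int.
  by rewrite fz (Cintr_Cyclotomic zm) root_cyclotomic.
have Tall k l : T (zt ^+ k * al ^+ l).
  have -> : al ^+ l = (A ^+ (l %/ e))%:~R * al ^+ (l %% e).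
    by rewrite {1}(divn_eq l e) exprD mulnC exprM ale rmorphXn.
  rewrite mulrCA; apply: (TZ).
  have := Pdiv.RingMonic.rdivp_eq (Cyclotomic_monic m) 'X^k; set R := Pdiv.Ring.rmodp _ _ => kE.
  have szR : (size R < (totient m).+1)%N.
    by rewrite -size_Phi_m || (have := Pdiv.Ring.ltn_rmodpN0 'X^k (monic_neq0 (Cyclotomic_monic m)); rewrite -/R size_Cyclotomic).
  have -> : zt ^+ k = \sum_(i < size R) (R`_i)%:~R * zt ^+ i.
    have := congr1 (fun p => (map_poly intr p).[zt]) kE.
    rewrite map_polyXn rmorphD rmorphM /= !hornerE (rootP rPhi) mulr0 add0r => ->.
    by rewrite horner_coef size_map_inj_poly ?rmorph0 //; [apply: eq_bigr => i _; rewrite coef_map | by move=> x y /(congr1 f); rewrite !rmorph_int => /intr_inj].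
  rewrite mulr_suml; elim/big_ind: _ => // i _; rewrite -mulrA; apply: TZ; apply: TB.
    by apply: leq_trans (ltn_ord i) _; rewrite -ltnS.
  by rewrite ltn_mod.
have full : (fullv <= <<B>>)%VS.
  have Tspan v : T v -> v \in <<B>>%VS.
    move=> [c ->]; apply: rpred_sum => i _; apply: rpredZ; apply: memv_span; apply: mem_nth.
    by rewrite size_tuple.
  apply/subvP => v _; have : v \in <<<<1; zt>>; al>>%AS.
    have -> : v \in <<<<1; zt>>; al>>%AS = (v \in <<1 & [:: zt; al]>>%VS); last by rewrite gen memvf.
    by rewrite adjoin_cons adjoin_seq1.
  move=> /Fadjoin_polyP[p /polyOverP pK ->]; rewrite horner_coef; apply: rpred_sum => j _.
  have [P ->] := inK _ (pK j); rewrite horner_coef mulr_suml; apply: rpred_sum => i _.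
  by rewrite coef_map /= -mulrA mulr_algl; apply: rpredZ; apply: Tspan.
have basisB : basis_of fullv B.
  rewrite basisEdim full size_tuple /= -E mulnC.
  have -> : \dim (fullv : {vspace L}) = (adjoin_degree K al * adjoin_degree 1%AS zt)%N.
    rewrite -gen adjoin_cons adjoin_seq1.
    by rewrite (dim_Fadjoin K al) (dim_Fadjoin 1%AS zt) dimv1 muln1.
  by rewrite degK leq_mul.
have coordT v i : T v -> coord B i v \is a Num.int.
  by move=> [c ->]; rewrite coord_sum_free ?(basis_free basisB) //; apply: intr_int.
exists L, n, B, zt, al; split=> //.
- by rewrite (BE ord0) mod0n div0n !expr0 mulr1.
- move=> i j k; rewrite !BE mulrACA -!exprD; apply: (coordT); exact: Tall.
split=> //; first by move=> i; rewrite BE; exists (i %% ph)%N, (i %/ ph)%N.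
by move=> k l i; apply: coordT; exact: Tall.
Qed.

End KummerField.

(** All primitive [m]-th roots of unity share the cyclotomic polynomial as their minimal polynomial.
    This plays the part of the Galois action. *)
Lemma cyclotomic_eval_eq0 (m k : nat) (z : algC) (Q : {poly rat}) : m.-primitive_root z -> coprime k m ->
  (map_poly ratr Q).[z] = 0 -> (map_poly ratr Q).[z ^+ k] = 0.
Proof.
move=> zm km /eqP; have [p [pE _] pdv] := minCpolyP z.
rewrite -/(root _ _) pdv => pQ.
have zk : m.-primitive_root (z ^+ k) by rewrite prim_root_exp_coprime.
have [p' [pE' _] pdv'] := minCpolyP (z ^+ k).
apply/eqP; rewrite -/(root _ _) pdv'.
suff -> : p' = p by [].
have m0 := prim_order_gt0 zm.
apply: (@map_poly_inj _ _ (ratr : {rmorphism rat -> algC})).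
by rewrite -pE -pE' (minCpoly_cyclotomic zm) (minCpoly_cyclotomic zk) -(Cintr_Cyclotomic zm) -(Cintr_Cyclotomic zk).
Qed.

(** At every conjugate of [z] the value of [P] has the same [q]-th power, hence the same modulus.
    The squared modulus is itself a polynomial in [z], so it is a rational number [c] with
    [c^q = a^2]; as [q] is odd, [a] is the [q]-th power of [a / c^((q-1)/2)]. *)
Lemma cyclotomic_odd_power (m q : nat) (z : algC) (P : {poly rat}) (a : rat) :
  m.-primitive_root z -> odd q -> a != 0 -> (map_poly ratr P).[z] ^+ q = ratr a ->
  exists r : rat, a = r ^+ q.
Proof.
move=> zm oq a0 Pa; have m0 := prim_order_gt0 zm.
have q0 : (0 < q)%N by case: q oq {Pa}.
have Pk k : coprime k m -> (map_poly ratr P).[z ^+ k] ^+ q = ratr a.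
  move=> km; apply/eqP; rewrite -subr_eq0; apply/eqP.
  have := @cyclotomic_eval_eq0 m k z (P ^+ q - a%:P) zm km.
  by rewrite !rmorphB !rmorphXn /= !map_polyC /= !hornerE Pa subrr; apply.
pose R := P * (P \Po 'X^(m.-1)).
have REv k : (map_poly ratr R).[z ^+ k] = (map_poly ratr P).[z ^+ k] * (map_poly ratr P).[(z ^+ k)^*].
  rewrite /R rmorphM /= hornerM map_comp_poly map_polyXn horner_comp hornerXn; congr (_ * _.[_]).
  have nz : `|z ^+ k| = 1.
    rewrite normrX; suff -> : `|z| = 1 by rewrite expr1n.
    apply/eqP; rewrite -(@pexpr_eq1 _ _ m) // -normrX (prim_expr_order zm) normr1 //.
  have zz : z ^+ k * (z ^+ k)^* = 1 by rewrite -normCK nz expr1n.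
  have z0 : z ^+ k != 0 by rewrite -normr_eq0 nz oner_eq0.
  by apply: (mulfI z0); rewrite zz -exprS prednK // -exprM mulnC exprM (prim_expr_order zm) expr1n.
have PC (x : algC) : (map_poly ratr P).[x^*] = ((map_poly ratr P).[x])^*.
  rewrite -horner_map -map_poly_comp; congr (_.[_]); apply: eq_map_poly => c /=.
  by rewrite conj_Crat // Crat_rat.
pose g := (map_poly ratr R).[z].
have RN k : (map_poly ratr R).[z ^+ k] = `|(map_poly ratr P).[z ^+ k]| ^+ 2.
  by rewrite REv PC -normCK.
have Rg k : coprime k m -> (map_poly ratr R).[z ^+ k] = g.
  move=> km; have gE : g = (map_poly ratr R).[z ^+ 1] by rewrite expr1.
  rewrite gE !RN; congr (_ ^+ 2); apply/eqP; rewrite -(@eqrXn2 _ q) //.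
  by rewrite -!normrX !Pk // coprime1n.
have gq : g ^+ q = ratr (a ^+ 2).
  have gE : g = (map_poly ratr R).[z ^+ 1] by rewrite expr1.
  rewrite gE RN exprAC -normrX Pk ?coprime1n // rmorphXn /= -normrX.
  by rewrite ger0_norm // -rmorphXn /= ler0q sqr_ge0.
have [c cE] : exists c : rat, g = ratr c.
  have [p [pE pm] pdv] := minCpolyP z.
  have szp : size p = (totient m).+1.
    by rewrite -(size_map_poly (ratr : {rmorphism rat -> algC})) -pE (minCpoly_cyclotomic zm) size_cyclotomic.
  have rp k : coprime k m -> (map_poly ratr p).[z ^+ k] = 0.
    by move=> km; apply: (cyclotomic_eval_eq0 zm km); rewrite -pE; apply/rootP/root_minCpoly.
  pose S := R %% p.
  have SE k : coprime k m -> (map_poly ratr S).[z ^+ k] = g.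
    move=> km; rewrite -(Rg k km) [in RHS](divp_eq R p) rmorphD rmorphM /= !hornerE rp //.
    by rewrite mulr0 add0r.
  exists S`_0.
  pose rs := [seq z ^+ k | k <- iota 0 m & coprime k m].
  (* [S - g] has degree below [totient m] and vanishes at all [totient m] primitive roots. *)
  have Z : map_poly ratr S - g%:P = 0.
    apply: (@roots_geq_poly_eq0 _ _ rs).
    - by apply/allP => x /mapP[k]; rewrite mem_filter => /andP[km _] ->; rewrite /root !hornerE SE // subrr.
    - rewrite map_inj_in_uniq ?filter_uniq ?iota_uniq // => i j.
      rewrite !mem_filter !mem_iota /= add0n => /andP[_ im] /andP[_ jm] /eqP.
      by rewrite (eq_prim_root_expr zm) !modn_small // => /eqP.
    rewrite size_map size_filter.
    have -> : count (coprime^~ m) (iota 0 m) = totient m.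
      rewrite totient_count_coprime -sum1_count big_mkcond /= -{1}[m]subn0 -/(index_iota 0 m).
      by rewrite big_mkord [RHS]big_mkord; apply: eq_bigr => i _; rewrite coprime_sym; case: coprime.
    have szS : (size S <= totient m)%N.
      by rewrite -ltnS -szp ltn_modp -size_poly_eq0 szp.
    have t0 : (0 < totient m)%N by rewrite totient_gt0.
    apply: leq_trans (size_polyD _ _) _; rewrite geq_max size_polyN size_map_poly szS /=.
    by rewrite size_polyC; case: (g != 0).
  have /polyP/(_ 0%N) := Z.
  by rewrite coefB coefC coef0 coef_map /= => /eqP; rewrite subr_eq0 => /eqP.
have cq : c ^+ q = a ^+ 2.
  by apply: (fmorph_inj (ratr : {rmorphism rat -> algC})); rewrite rmorphXn /= -cE gq.
have c0 : c != 0.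
  apply/eqP => c0; move: cq; rewrite c0 expr0n gtn_eqF //= => /esym/eqP.
  by rewrite expf_eq0 (negPf a0).
exists (a / c ^+ q./2); rewrite exprMn exprVn -exprM mulnC exprM cq -exprM mul2n.
have qE : q = (q./2).*2.+1 by rewrite -[LHS]odd_double_half oq.
by rewrite {1}qE exprS mulfK // expf_neq0.
Qed.

(** * Square roots in cyclotomic fields of odd conductor *)

Section SqrtCyclotomic.
Variables (m : nat) (z : algC).
Hypothesis zm : m.-primitive_root z.

Definition Zz (w : algC) : Prop := exists P : {poly int}, w = (map_poly intr P).[z].

Lemma ZzD v w : Zz v -> Zz w -> Zz (v + w).
Proof. by move=> [P ->] [Q ->]; exists (P + Q); rewrite rmorphD hornerD. Qed.
Lemma ZzN v : Zz v -> Zz (- v).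
Proof. by move=> [P ->]; exists (- P); rewrite rmorphN hornerN. Qed.
Lemma ZzM v w : Zz v -> Zz w -> Zz (v * w).
Proof. by move=> [P ->] [Q ->]; exists (P * Q); rewrite rmorphM hornerM. Qed.
Lemma Zz_int (c : int) : Zz c%:~R.
Proof. by exists c%:P; rewrite map_polyC hornerC. Qed.
Lemma ZzX v k : Zz v -> Zz (v ^+ k).
Proof.
move=> vZ; elim: k => [|k IH]; first exact: (Zz_int 1).
by rewrite exprS; apply: ZzM.
Qed.

Lemma Zz_rat w : Zz w -> w \in Crat -> w \is a Num.int.
Proof.
move=> [P ->] wr; apply: Cint_rat_Aint => //; rewrite horner_coef; apply: rpred_sum => i _.
by rewrite coef_map rpredM ?rpredX ?(Aint_prim_root zm) // Aint_int // intr_int.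
Qed.

Lemma poly_frobenius (l : nat) (P : {poly int}) : prime l ->
  exists Q, P ^+ l = P \Po 'X^l + l%:R *: Q.
Proof.
move=> lp; elim/poly_ind: P => [|P c [Q QE]].
  by exists 0; rewrite comp_poly0 scaler0 addr0 expr0n gtn_eqF // prime_gt0.
have [E EE] : exists E : {poly int}, (P * 'X + c%:P) ^+ l = (P * 'X) ^+ l + c%:P ^+ l + l%:R *: E.
  have [k kE] : exists k, l = k.+1 by exists l.-1; rewrite prednK // prime_gt0.
  rewrite exprDn kE big_ord_recl big_ord_recr /= /bump /= add1n subn0 subnn expr0 mulr1 mul1r.
  rewrite bin0 binn !mulr1n -kE.
  have [E EE] : exists E : {poly int}, \sum_(i < k) ((P * 'X) ^+ (l - i.+1) * c%:P ^+ i.+1) *+ 'C(l, i.+1) = l%:R *: E.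
    elim/big_ind: _ => [|x y [E ->] [E' ->]|i _]; first by exists 0; rewrite scaler0.
      by exists (E + E'); rewrite scalerDr.
    have ik : (i.+1 < l)%N by rewrite kE ltnS ltn_ord.
    have : (l %| 'C(l, i.+1))%N by rewrite prime_dvd_bin.
    move=> /dvdnP[b ->]; exists (((P * 'X) ^+ (l - i.+1) * c%:P ^+ i.+1) *+ b).
    by rewrite mulrnA scaler_nat.
  by exists E; rewrite -EE -addrA; congr (_ + _); exact: addrC.
have [b bE] : exists b : int, c ^+ l = c + l%:R * b.
  have : ((l%:Z %| c ^+ l - c)%Z).
    have Fn k : (k%:R == 0 :> 'F_l) = (l %| k)%N by rewrite -(dvdn_pcharf (pchar_Fp lp)).
    have Fi (d : int) : (d%:~R == 0 :> 'F_l) = (l%:Z %| d)%Z.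
      rewrite dvdzE absz_nat; case: d => k; first by rewrite -pmulrn Fn.
      by rewrite NegzE mulrNz oppr_eq0 -pmulrn Fn abszN.
    by rewrite -Fi rmorphB rmorphXn /= subr_eq0; have := expf_card (c%:~R : 'F_l); rewrite card_Fp // => ->.
  by move=> /dvdzP[b bE]; exists b; rewrite -[LHS](subrK c) bE addrC mulrC natz.
exists (Q * 'X^l + b%:P + E).
rewrite EE exprMn QE -rmorphXn /= bE comp_polyD comp_polyM comp_polyX comp_polyC.
by rewrite !scalerDr -!mul_polyC rmorphD rmorphM /= !polyC_natr || rewrite !scalerDr; ring.
Qed.

Lemma Zz_frobenius (l j : nat) (P : {poly int}) : prime l ->
  exists2 r, Zz r & (map_poly intr P).[z] ^+ (l ^ j) = (map_poly intr P).[z ^+ (l ^ j)] + l%:R * r.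
Proof.
move=> lp; elim: j => [|j [r rZ rE]].
  by exists 0; [exact: (Zz_int 0) | rewrite expn0 !expr1 mulr0 addr0].
have [Q QE] := poly_frobenius P lp.
set v := (map_poly intr P).[z ^+ (l ^ j)] in rE.
have vZ : Zz v by exists (P \Po 'X^(l ^ j)); rewrite map_comp_poly map_polyXn horner_comp hornerXn.
have [t tZ tE] : exists2 t, Zz t & (v + l%:R * r) ^+ l = v ^+ l + l%:R * t.
  exists (r * \sum_(i < l) (v + l%:R * r) ^+ (l.-1 - i) * v ^+ i).
    apply: ZzM => //; elim/big_ind: _ => [|x y|i _]; [exact: (Zz_int 0) | exact: ZzD |].
    apply: ZzM; apply: ZzX => //; apply: ZzD => //; apply: ZzM => //; exact: (Zz_int l).
  have := subrXX (v + l%:R * r) v l; rewrite addrAC subrr add0r => h.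
  by rewrite -[LHS](subrK (v ^+ l)) h addrC mulrA.
have vl : v ^+ l = (map_poly intr P).[z ^+ (l ^ j.+1)] + l%:R * (map_poly intr Q).[z ^+ (l ^ j)].
  have := congr1 (fun p => (map_poly intr p).[z ^+ (l ^ j)]) QE.
  rewrite rmorphXn /= horner_exp => ->.
  rewrite rmorphD /= map_comp_poly map_polyXn hornerD horner_comp hornerXn -exprM -expnSr.
  by rewrite map_polyZ hornerZ /= rmorph_nat.
exists ((map_poly intr Q).[z ^+ (l ^ j)] + t).
  by apply: ZzD => //; exists (Q \Po 'X^(l ^ j)); rewrite map_comp_poly map_polyXn horner_comp hornerXn.
by rewrite [in LHS]expnSr exprM rE tE vl mulrDr addrA.
Qed.

(** For [l] prime to [m], raising to the power [l^(totient m)] is the identity of [Z[z]] modulo [l],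
    because it fixes [z]. So this quotient has no nilpotents, which stands in for [l] being
    unramified. *)
Lemma Zz_reduced (l : nat) w r : prime l -> ~~ (l %| m)%N -> Zz w -> Zz r ->
  w ^+ 2 = l%:R * r -> exists2 t, Zz t & w = l%:R * t.
Proof.
move=> lp lm [P wE] rZ w2; have m0 := prim_order_gt0 zm.
have cop : coprime l m by rewrite prime_coprime.
have [t tZ tE] := Zz_frobenius (totient m) P lp.
have lt2 : (2 <= l ^ totient m)%N.
  have t0 : (0 < totient m)%N by rewrite totient_gt0.
  by apply: leq_trans (prime_gt1 lp) _; rewrite -{1}[l]expn1 leq_exp2l ?prime_gt1.
have zl : z ^+ (l ^ totient m) = z.
  rewrite -(prim_expr_mod zm) (Euler_exp_totient cop) (prim_expr_mod zm) expr1 //.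
rewrite zl -wE -(subnKC lt2) exprD w2 in tE.
exists (r * w ^+ (l ^ totient m - 2) - t).
  by apply: ZzD; [apply: ZzM => //; apply: ZzX; exists P | exact: ZzN].
by rewrite mulrBr mulrA tE addrK.
Qed.

(** Let [N] be the least positive integer with [N d] in [Z[z]]. By [Zz_reduced] and minimality, [N]
    is prime to every [l] not dividing [m]. If such an [l] divided [c], then [l] would divide [N d],
    so [l^2] would divide [N^2 c] and hence [c]. The congruence modulo 4 is the same argument at 2,
    applied to [N d - 1]. *)
Lemma sqrt_cyclotomic (P : {poly rat}) (c : int) : odd m ->
  (forall l, prime l -> ~~ (l ^ 2 %| `|c|)%N) -> (map_poly ratr P).[z] ^+ 2 = c%:~R ->
  (forall l, prime l -> (l %| `|c|)%N -> (l %| m)%N) /\ (4%:Z %| c - 1)%Z.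
Proof.
move=> om sqf; set d := _.[z] => d2.
have exN : exists N : nat, (0 < N)%N && `[< Zz (N%:R * d) >].
  have [Q [a a0 PE]] := rat_poly_scale P.
  exists `|a|%N; rewrite absz_gt0 a0 /=; apply/asboolP.
  have aZ : Zz (a%:~R * d).
    exists Q; rewrite /d PE map_polyZ hornerZ fmorphV rmorph_int mulrA divff ?intr_eq0 // mul1r.
    by rewrite -map_poly_comp; congr (_.[_]); apply: eq_map_poly => x /=; rewrite rmorph_int.
  rewrite pmulrn abszE; case: (ger0P a) => _ //; rewrite rmorphN mulNr; exact: ZzN.
case: (ex_minnP exN) => N /andP[N0 /asboolP NZ] Nmin.
have Nl l : prime l -> ~~ (l %| m)%N -> ~~ (l %| N)%N.
  move=> lp lm; apply/negP => /dvdnP[k kE].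
  have l0 : (l%:R : algC) != 0 by rewrite pnatr_eq0 -lt0n prime_gt0.
  have [t tZ tE] : exists2 t, Zz t & N%:R * d = l%:R * t.
    apply: (@Zz_reduced l _ (k%:R * N%:R * c%:~R)) => //.
      by apply: ZzM; [apply: ZzM; [exact: (Zz_int k) | exact: (Zz_int N)] | exact: Zz_int].
    by rewrite exprMn d2 expr2 {1}kE natrM; ring.
  have k0 : (0 < k)%N by move: N0; rewrite kE; case: k {kE}.
  have : (N <= k)%N.
    apply: Nmin; rewrite k0; apply/asboolP; suff -> : k%:R * d = t by [].
    by apply: (mulfI l0); rewrite -tE kE natrM; ring.
  by rewrite kE leqNgt ltn_Pmulr // prime_gt1.
have dN2 : (N%:R * d) ^+ 2 = (N%:Z ^+ 2 * c)%:~R by rewrite exprMn d2 rmorphM rmorphXn.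
have H1 l : prime l -> (l %| `|c|)%N -> (l %| m)%N.
  move=> lp lc; apply/negPn/negP => lm.
  have l0 : (l%:R : algC) != 0 by rewrite pnatr_eq0 -lt0n prime_gt0.
  have /dvdzP[b bE] : (l%:Z %| c)%Z by rewrite dvdzE absz_nat.
  have [t tZ tE] : exists2 t, Zz t & N%:R * d = l%:R * t.
    apply: (@Zz_reduced l _ (N%:Z ^+ 2 * b)%:~R) => //; first exact: Zz_int.
    by rewrite dN2 bE !rmorphM /= -pmulrn; ring.
  have t2 : t ^+ 2 = ratr ((N%:Z ^+ 2 * c)%:~R / (l%:R ^+ 2)).
    apply: (mulfI (_ : l%:R ^+ 2 != 0 :> algC)); first by rewrite expf_neq0.
    rewrite -exprMn -tE dN2 fmorph_div /= rmorph_int rmorphXn /= ratr_nat mulrCA divff ?mulr1 // expf_neq0 //.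
  have : t ^+ 2 \is a Num.int by apply: Zz_rat; [exact: ZzX | rewrite t2 Crat_rat].
  move=> /intrP[j jE].
  have : (N%:Z ^+ 2 * c) = l%:Z ^+ 2 * j.
    by apply: (@intr_inj algC); rewrite -dN2 tE exprMn jE [RHS]rmorphM rmorphXn.
  move=> /(congr1 absz); rewrite abszM [in RHS]abszM !abszX !absz_nat => E.
  have : (l ^ 2 %| N ^ 2 * `|c|)%N by rewrite E dvdn_mulr.
  rewrite Gauss_dvdr; first by apply/negP/sqf.
  by rewrite coprimeXl // coprimeXr // prime_coprime // Nl.
split=> //.
have l2 : prime 2 by []. have m2 : ~~ (2 %| m)%N by rewrite dvdn2 om.
have oN : odd N by have := Nl 2%N l2 m2; rewrite dvdn2 negbK.
have oc : odd `|c|.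
  by rewrite -[odd _]negbK -dvdn2; apply/negP => /(H1 2%N l2); apply/negP.
have [M ME] : exists M : int, M = N%:Z ^+ 2 * c by exists (N%:Z ^+ 2 * c).
rewrite -ME in dN2.
have /dvdzP[b bE] : (2%:Z %| M + 1)%Z.
  rewrite dvdzE absz_nat dvdn2; have : odd `|M| by rewrite ME abszM abszX absz_nat oddM oddX oN oc orbT.
  by move: (M) => M'; lia.
(* [(N d - 1)^2] is divisible by 2 because [(N d)^2 = M] is odd; then [t + t^2 = (M - 1)/4] is
   rational and an algebraic integer. *)
have [t tZ tE] : exists2 t, Zz t & N%:R * d - 1 = 2%:R * t.
  apply: (@Zz_reduced 2 _ (b%:~R - N%:R * d)) => //.
  - by apply: ZzD => //; exact: (Zz_int (-1)).
  - by apply: ZzD; [exact: Zz_int | exact: ZzN].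
  have : (M + 1)%:~R = (b * 2%:Z)%:~R :> algC by rewrite bE.
  rewrite rmorphD rmorphM /= -dN2 => h.
  have -> : (N%:R * d - 1) ^+ 2 = ((N%:R * d) ^+ 2 + 1) - 2%:R * (N%:R * d) by ring.
  by rewrite h -pmulrn; ring.
have wE : N%:R * d = 1 + 2%:R * t by rewrite -tE addrC subrK.
have t2 : t + t ^+ 2 = ratr ((M - 1)%:~R / 4%:R).
  have n4 : 4%:R != 0 :> algC by rewrite pnatr_eq0.
  apply: (mulfI n4); rewrite fmorph_div /= rmorph_int ratr_nat mulrCA divff // mulr1.
  by rewrite rmorphB /= -dN2 wE; ring.
have : t + t ^+ 2 \is a Num.int by apply: Zz_rat; [apply: ZzD => //; exact: ZzX | rewrite t2 Crat_rat].
move=> /intrP[j jE].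
have M4 : M - 1 = 4%:Z * j.
  apply: (@intr_inj algC); rewrite rmorphB rmorphM /= -dN2 wE -jE -pmulrn; ring.
have [k kE] : exists k : int, N%:Z = 2 * k + 1.
  by exists (N./2)%:Z; rewrite -{1}[N]odd_double_half oN; lia.
have -> : c - 1 = 4%:Z * (j - (k ^+ 2 + k) * c).
  by rewrite mulrBr -M4 ME kE; ring.
by rewrite dvdz_mulr.
Qed.

End SqrtCyclotomic.

(** * Counting elements of an order by norm *)

Section Order.
Set Default Proof Using "All".
Variables (L : fieldExtType rat) (n : nat) (B : n.+1.-tuple L).
Hypothesis basisB : basis_of {:L} B.
Hypothesis B0 : B`_0 = 1.
Hypothesis intB : forall i j k : 'I_n.+1, coord B k (B`_i * B`_j) \is a Num.int.
Local Notation D := n.+1.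
Implicit Types (u v w : L) (z : 'rV[int]_D).

Definition crd v : 'rV[rat]_D := \row_i coord B i v.
Definition mulmat v : 'M[rat]_D := \matrix_(i, j) coord B j (v * B`_i).
(** The field norm, as the determinant of multiplication in the basis [B]; vectors are rows, so
    [mulmat] acts on the right. *)
Definition nm v : rat := \det (mulmat v).
Definition isO v : bool := [forall i, coord B i v \is a Num.int].
Definition el z : L := \sum_i (z 0 i)%:~R *: B`_i.

Let freeB : free B. Proof. exact: basis_free basisB. Qed.

Lemma crdK v : v = \sum_i crd v 0 i *: B`_i.
Proof.
rewrite {1}(coord_basis basisB (memvf v)); apply: eq_bigr => i _.
by rewrite mxE.
Qed.

Lemma crd_inj : injective crd.
Proof. by move=> v w vw; rewrite (crdK v) vw -crdK. Qed.

Lemma crdD v w : crd (v + w) = crd v + crd w.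
Proof. by apply/rowP => i; rewrite !mxE linearD. Qed.

Lemma crdB v w : crd (v - w) = crd v - crd w.
Proof. by apply/rowP => i; rewrite !mxE linearB. Qed.

Lemma crdZ a v : crd (a *: v) = a *: crd v.
Proof. by apply/rowP => i; rewrite !mxE linearZ. Qed.

Lemma crd_el z : crd (el z) = map_mx intr z.
Proof.
apply/rowP => i; rewrite !mxE /el linear_sum (bigD1 i) //= linearZ /= coord_free //.
rewrite eqxx mulr1 big1 ?addr0 // => j ji.
by rewrite linearZ /= coord_free // (negbTE (contraNneq _ ji)) ?mulr0 // => ->.
Qed.

Lemma el_inj : injective el.
Proof.
move=> y z /(congr1 crd); rewrite !crd_el => /rowP yz; apply/rowP => i.
by have := yz i; rewrite !mxE => /intr_inj.
Qed.

Lemma isO_el z : isO (el z).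
Proof.
apply/forallP => i; have /rowP/(_ i) := crd_el z; rewrite !mxE => ->.
exact: intr_int.
Qed.

Lemma isOP v : isO v -> exists z, v = el z.
Proof.
move=> /forallP vO; exists (\row_i numq (coord B i v)).
apply: crd_inj; rewrite crd_el; apply/rowP => i; rewrite !mxE.
by rewrite numqK.
Qed.

Lemma isO_mul v w : isO v -> isO w -> isO (v * w).
Proof.
move=> /isOP[y ->] /isOP[z ->]; apply/forallP => k.
rewrite /el mulr_suml linear_sum; apply: rpred_sum => i _.
rewrite mulr_sumr linear_sum; apply: rpred_sum => j _.
by rewrite -scalerAl -scalerAr !linearZ /= !rpredM ?intr_int.
Qed.

Lemma isO_add v w : isO v -> isO w -> isO (v + w).
Proof. by move=> /forallP vO /forallP wO; apply/forallP => i; rewrite linearD rpredD ?vO ?wO. Qed.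

Lemma isO_sub v w : isO v -> isO w -> isO (v - w).
Proof. by move=> /forallP vO /forallP wO; apply/forallP => i; rewrite linearB rpredB ?vO ?wO. Qed.

Lemma isO_intZ (m : int) v : isO v -> isO (m%:~R *: v).
Proof.
by move=> /forallP vO; apply/forallP => i; rewrite linearZ /= rpredM ?intr_int ?vO.
Qed.

Lemma isO_natZ (m : nat) v : isO v -> isO (m%:R *: v).
Proof. exact: (@isO_intZ m). Qed.

Lemma isO_basis (i : 'I_D) : isO B`_i.
Proof. by apply/forallP => j; rewrite coord_free // -[_%:R]/(_%:Z%:~R) intr_int. Qed.

Lemma isO1 : isO 1.
Proof. by rewrite -B0 (isO_basis 0). Qed.

Lemma isO0 : isO 0.
Proof. by have := isO_intZ 0 isO1; rewrite scale0r. Qed.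

Lemma crd1 : crd 1 = delta_mx 0 0.
Proof.
apply/rowP => i; have := coord_free ord0 i freeB; rewrite /= B0 !mxE => ->.
by rewrite eq_sym.
Qed.

Lemma crdM v w : crd (v * w) = crd w *m mulmat v.
Proof.
apply/rowP => j; rewrite !mxE {1}(crdK w) mulr_sumr linear_sum; apply: eq_bigr => i _.
by rewrite -scalerAr linearZ !mxE.
Qed.

Lemma mulmatM v w : mulmat (v * w) = mulmat w *m mulmat v.
Proof.
apply/row_matrixP => i; rewrite row_mul.
have rE u : row i (mulmat u) = crd (u * B`_i) by apply/rowP => j; rewrite !mxE.
by rewrite !rE -mulrA crdM.
Qed.

Lemma mulmat1 : mulmat 1 = 1%:M.
Proof. by apply/matrixP => i j; rewrite !mxE mul1r coord_free. Qed.

Lemma mulmatZ a v : mulmat (a *: v) = a *: mulmat v.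
Proof. by apply/matrixP => i j; rewrite !mxE -scalerAl linearZ. Qed.

Lemma mulmatB v w : mulmat (v - w) = mulmat v - mulmat w.
Proof. by apply/matrixP => i j; rewrite !mxE mulrBl linearB. Qed.

Lemma nmM v w : nm (v * w) = nm v * nm w.
Proof. by rewrite /nm mulmatM det_mulmx mulrC. Qed.

Lemma nm1 : nm 1 = 1.
Proof. by rewrite /nm mulmat1 det1. Qed.

Lemma nmZ a v : nm (a *: v) = a ^+ D * nm v.
Proof. by rewrite /nm mulmatZ detZ. Qed.

Lemma nm0 : nm 0 = 0.
Proof. by rewrite -(scale0r 0) nmZ expr0n mul0r. Qed.

Lemma nm_eq0 v : (nm v == 0) = (v == 0).
Proof.
apply/eqP/eqP => [v0|->]; last exact: nm0.
apply: contra_eq v0 => v0; apply/eqP => n0.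
by have := nm1; rewrite -(divff v0) nmM n0 mul0r => /eqP; rewrite eq_sym oner_eq0.
Qed.

Lemma mulmat_el z : exists A : 'M[int]_D, mulmat (el z) = map_mx intr A.
Proof.
exists (\matrix_(i, j) numq (coord B j (el z * B`_i))).
apply/matrixP => i j; rewrite !mxE numqK //.
by have /forallP := isO_mul (isO_el z) (isO_basis i).
Qed.

Lemma nm_int v : isO v -> nm v \is a Num.int.
Proof. by move=> /isOP[z ->]; have [A E] := mulmat_el z; rewrite /nm E det_map_mx intr_int. Qed.

(** The adjugate of the multiplication matrix has integer entries, so an element of the order
    divides its norm there. *)
Lemma isO_nm_inv v : isO v -> isO (nm v *: v^-1).
Proof.
move=> vO; have [->|v0] := eqVneq v 0; first by rewrite nm0 scale0r isO0.
have E : crd (nm v *: v^-1) = crd 1 *m \adj (mulmat v).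
  have := crdM v v^-1; rewrite divff // => ->.
  by rewrite -mulmxA mul_mx_adj crdZ -mul_mx_scalar.
have [z vE] := isOP vO; have [A AE] := mulmat_el z.
apply/forallP => i; have /rowP/(_ i) := E; rewrite !mxE => ->.
rewrite vE AE crd1; apply: rpred_sum => j _; rewrite !mxE rpredM //.
  by rewrite -[_%:R]/(_%:Z%:~R) intr_int.
by rewrite cofactor_map_mx intr_int.
Qed.


Definition ht v : rat := \big[Num.max/0]_i `|crd v 0 i|.

Lemma ht_ge v i : `|crd v 0 i| <= ht v.
Proof. by rewrite /ht; apply: le_bigmax. Qed.

Lemma ht_le v (M : rat) : 0 <= M -> (forall i, `|crd v 0 i| <= M) -> ht v <= M.
Proof. by move=> M0 H; apply/bigmax_leP; split=> // i _; apply: H. Qed.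

Lemma ht_ge0 v : 0 <= ht v.
Proof. exact: le_trans (normr_ge0 _) (ht_ge v 0). Qed.

Lemma htD v w : ht (v + w) <= ht v + ht w.
Proof.
apply: ht_le => [|i]; first by rewrite addr_ge0 ?ht_ge0.
by rewrite crdD mxE; apply: le_trans (ler_normD _ _) _; rewrite lerD ?ht_ge.
Qed.

Lemma htN v : ht (- v) = ht v.
Proof.
by rewrite /ht; apply: eq_bigr => i _; rewrite -[- v]sub0r crdB !mxE linear0 sub0r normrN.
Qed.

Lemma htZ a v : ht (a *: v) = `|a| * ht v.
Proof.
apply/le_anti/andP; split.
  apply: ht_le => [|i]; first by rewrite mulr_ge0 ?ht_ge0.
  by rewrite crdZ mxE normrM ler_wpM2l // ht_ge.
have [->|a0] := eqVneq a 0; first by rewrite normr0 mul0r ht_ge0.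
rewrite -ler_pdivlMl ?normr_gt0 //; apply: ht_le => [|i].
  by rewrite mulr_ge0 ?invr_ge0 ?ht_ge0.
have := ht_ge (a *: v) i; rewrite crdZ mxE normrM.
by rewrite ler_pdivlMl ?normr_gt0.
Qed.

Lemma ht1 : ht 1 = 1.
Proof.
apply/le_anti/andP; split.
  apply: ht_le => // i; rewrite crd1 mxE.
  by case: (_ && _); rewrite ?normr1 ?normr0.
by have := ht_ge 1 0; rewrite crd1 mxE !eqxx normr1.
Qed.

Lemma det_bound m (A : 'M[rat]_m) M : (forall i j, `|A i j| <= M) ->
  `|\det A| <= m`!%:R * M ^+ m.
Proof.
move=> AM; apply: le_trans (ler_norm_sum _ _ _) _.
apply: le_trans (_ : \sum_(s : {perm 'I_m}) M ^+ m <= _).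
  apply: ler_sum => s _; rewrite normrM normrX normrN1 expr1n mul1r normr_prod.
  rewrite -[m in leRHS]card_ord -prodr_const; apply: ler_prod => i _.
  by rewrite normr_ge0 AM.
by rewrite sumr_const card_Sn mulr_natl.
Qed.

Lemma prod_lipschitz (I : Type) (s : seq I) (a b : I -> rat) M e :
  0 <= M -> 0 <= e ->
  (forall i, `|a i| <= M) -> (forall i, `|b i| <= M) -> (forall i, `|a i - b i| <= e) ->
  `|\prod_(i <- s) a i - \prod_(i <- s) b i| <= (size s)%:R * M ^+ (size s).-1 * e.
Proof.
move=> M0 e0 aM bM ab; elim: s => [|x s IH]; first by rewrite !big_nil subrr normr0 !mul0r.
rewrite !big_cons /=; set P := \prod_(i <- s) a i in IH *; set Q := \prod_(i <- s) b i in IH *.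
have QM : `|Q| <= M ^+ size s.
  rewrite /Q; elim: (s) => [|y t IH2]; first by rewrite big_nil normr1.
  by rewrite big_cons normrM exprS ler_pM.
have -> : a x * P - b x * Q = a x * (P - Q) + (a x - b x) * Q by ring.
apply: le_trans (ler_normD _ _) _; rewrite !normrM -natr1.
have h1 : `|a x| * `|P - Q| <= M * ((size s)%:R * M ^+ (size s).-1 * e) by apply: ler_pM.
have h2 : `|a x - b x| * `|Q| <= e * M ^+ size s by apply: ler_pM.
apply: le_trans (lerD h1 h2) _; case: (size s) => [|k] /=; first by apply: le_of_eq; ring.
by apply: le_of_eq; rewrite exprS; ring.
Qed.

Lemma det_lipschitz m (A A' : 'M[rat]_m) M e : 0 <= M -> 0 <= e ->
  (forall i j, `|A i j| <= M) -> (forall i j, `|A' i j| <= M) ->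
  (forall i j, `|A i j - A' i j| <= e) ->
  `|\det A - \det A'| <= m`!%:R * (m%:R * M ^+ m.-1 * e).
Proof.
move=> M0 e0 AM A'M AA'; rewrite /determinant -sumrB.
apply: le_trans (ler_norm_sum _ _ _) _.
apply: le_trans (_ : \sum_(s : {perm 'I_m}) (m%:R * M ^+ m.-1 * e) <= _).
  apply: ler_sum => s _; rewrite -mulrBr normrM normrX normrN1 expr1n mul1r.
  have := @prod_lipschitz _ (index_enum 'I_m) (fun i => A i (s i)) (fun i => A' i (s i)) M e
    M0 e0 (fun i => AM _ _) (fun i => A'M _ _) (fun i => AA' _ _).
  by rewrite -[index_enum _]/(Finite.enum _) -enumT size_enum_ord.
by rewrite sumr_const card_Sn -[leLHS]mulr_natl.
Qed.

Definition cA : rat :=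
  1 + \sum_(i < D) \sum_(j < D) \sum_(l < D) `|coord B j (B`_l * B`_i)|.

Lemma cA_ge1 : 1 <= cA.
Proof.
by rewrite /cA lerDl; apply: sumr_ge0 => i _; apply: sumr_ge0 => j _; apply: sumr_ge0.
Qed.

Lemma mulmat_le v i j : `|mulmat v i j| <= cA * ht v.
Proof.
rewrite mxE {1}(crdK v) mulr_suml linear_sum; apply: le_trans (ler_norm_sum _ _ _) _.
apply: le_trans (_ : \sum_(l < D) ht v * `|coord B j (B`_l * B`_i)| <= _).
  apply: ler_sum => l _; rewrite -scalerAl linearZ normrM ler_wpM2r //; exact: ht_ge.
rewrite -mulr_sumr mulrC ler_wpM2r ?ht_ge0 // /cA.
set S := \sum_(l < D) _; apply: le_trans (_ : \sum_(i < D) \sum_(j < D)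
  \sum_(l < D) `|coord B j (B`_l * B`_i)| <= _); last by rewrite lerDr.
have T0 k k' : 0 <= \sum_(l < D) `|coord B k' (B`_l * B`_k)| by apply: sumr_ge0.
apply: le_trans (_ : \sum_(j < D) \sum_(l < D) `|coord B j (B`_l * B`_i)| <= _).
  by rewrite [leRHS](bigD1 j) //= -/S lerDl; apply: sumr_ge0.
by rewrite [leRHS](bigD1 i) //= lerDl; apply: sumr_ge0 => k _; apply: sumr_ge0.
Qed.

(* A single natural number dominating all the constants of this section. *)
Definition cC : nat :=
  (Num.truncn (D%:R * cA + D`!%:R * (D%:R * cA ^+ D) + D`!%:R * cA ^+ D)).+1.

Lemma cC_ge : D%:R * cA + D`!%:R * (D%:R * cA ^+ D) + D`!%:R * cA ^+ D <= cC%:R.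
Proof. by apply/ltW/truncnS_gt. Qed.

Lemma cC_ge1 : 1 <= cC%:R :> rat.
Proof. by rewrite ler1n. Qed.

Let cA0 : 0 <= cA. Proof. exact: le_trans ler01 cA_ge1. Qed.

Let t1_ge0 : 0 <= D%:R * cA. Proof. by rewrite mulr_ge0. Qed.
Let t2_ge0 : 0 <= D`!%:R * (D%:R * cA ^+ D). Proof. by rewrite !mulr_ge0 ?exprn_ge0. Qed.
Let t3_ge0 : 0 <= D`!%:R * cA ^+ D. Proof. by rewrite mulr_ge0 ?exprn_ge0. Qed.

Lemma nm_le v : `|nm v| <= cC%:R * ht v ^+ D.
Proof.
apply: le_trans (det_bound (mulmat_le v)) _; rewrite exprMn mulrA ler_wpM2r ?exprn_ge0 ?ht_ge0 //.
by have := cC_ge; move: t1_ge0 t2_ge0; lra.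
Qed.

Lemma ht_mul v w : ht (v * w) <= cC%:R * (ht v * ht w).
Proof.
have h0 := mulr_ge0 (ht_ge0 v) (ht_ge0 w).
apply: ht_le => [|j]; first by rewrite mulr_ge0.
rewrite crdM mxE; apply: le_trans (ler_norm_sum _ _ _) _.
apply: le_trans (_ : \sum_(i < D) ht w * (cA * ht v) <= _).
  by apply: ler_sum => i _; rewrite normrM ler_pM ?ht_ge ?mulmat_le.
rewrite sumr_const card_ord -mulr_natl.
rewrite [leLHS](_ : _ = D%:R * cA * (ht v * ht w)); last by ring.
by rewrite ler_wpM2r //; have := cC_ge; move: t3_ge0 t2_ge0; lra.
Qed.

Lemma nm_lipschitz v w (R : rat) : ht v <= R -> ht w <= R ->
  `|nm v - nm w| <= cC%:R * (R ^+ n * ht (v - w)).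
Proof.
move=> vR wR; have R0 : 0 <= R := le_trans (ht_ge0 v) vR.
have bd u i j : ht u <= R -> `|mulmat u i j| <= cA * R.
  by move=> uR; apply: le_trans (mulmat_le _ _ _) _; rewrite ler_wpM2l.
have := @det_lipschitz D (mulmat v) (mulmat w) (cA * R) (cA * ht (v - w))
  (mulr_ge0 cA0 R0) (mulr_ge0 cA0 (ht_ge0 _)) (fun i j => bd v i j vR) (fun i j => bd w i j wR).
move=> /(_ _) H; apply: le_trans (H _) _.
  by move=> i j; have := mulmat_le (v - w) i j; rewrite mulmatB !mxE.
rewrite /= exprMn.
rewrite [leLHS](_ : _ = D`!%:R * (D%:R * cA ^+ D) * (R ^+ n * ht (v - w))); last by rewrite exprS; ring.
rewrite ler_wpM2r ?mulr_ge0 ?exprn_ge0 ?ht_ge0 //.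
by have := cC_ge; move: t3_ge0 t1_ge0; lra.
Qed.

Lemma ht_nm_inv v : ht (nm v *: v^-1) <= cC%:R * ht v ^+ n.
Proof.
have h0 : 0 <= ht v ^+ n by rewrite exprn_ge0 ?ht_ge0.
have [->|v0] := eqVneq v 0.
  by rewrite nm0 scale0r; apply: ht_le => [|i]; rewrite ?mxE ?linear0 ?normr0 mulr_ge0 ?exprn_ge0 ?ht_ge0.
have E : crd (nm v *: v^-1) = crd 1 *m \adj (mulmat v).
  have := crdM v v^-1; rewrite divff // => ->.
  by rewrite -mulmxA mul_mx_adj crdZ -mul_mx_scalar.
apply: ht_le => [|i]; first by rewrite mulr_ge0.
rewrite E crd1 -rowE mxE mxE /cofactor normrM normrX normrN1 expr1n mul1r.
have := @det_bound n (row' i (col' 0 (mulmat v))) (cA * ht v) (fun k l => _).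
move=> H; apply: le_trans (H _) _ => [k l|]; first by rewrite mxE mxE; exact: mulmat_le.
rewrite exprMn mulrA ler_wpM2r //.
apply: le_trans (_ : D`!%:R * cA ^+ D <= _); last by have := cC_ge; move: t2_ge0 t1_ge0; lra.
apply: ler_pM; rewrite ?exprn_ge0 // ?ler_nat ?fact_geq //.
  by rewrite factS leq_pmull.
by rewrite exprS ler_peMl ?cA_ge1 // exprn_ge0.
Qed.


(** [Hb] is the number of cells in the pigeonhole of [hurwitz]. Inverting [MM], the factorial of
    [Hb], makes every multiplier found there a unit. [OS] is the localised ring, and [NS], the part
    of the norm prime to [MM], is the index of a principal ideal in it ([residues]). *)
Definition Hb : nat := cC.+1 ^ D.
Definition MM : nat := Hb`!.
Definition an v : nat := `|numq (nm v)|%N.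
Definition NS v : nat := (an v)`_(\pi(MM)^').
Definition OS v : Prop := exists j : nat, isO ((MM ^ j)%:R *: v).

Lemma MM_gt0 : (0 < MM)%N. Proof. exact: fact_gt0. Qed.

Lemma Hb_gt : (cC < Hb)%N.
Proof. by rewrite -[cC.+1]expn1; apply: leq_pexp2l. Qed.

Lemma small_prime_dvd_MM p : prime p -> (p <= Hb)%N -> p \in \pi(MM).
Proof. by move=> pp pH; rewrite mem_primes pp MM_gt0 dvdn_fact // prime_gt0. Qed.

Lemma pnat_dvd_exp (m M : nat) : (0 < M)%N -> \pi(M).-nat m -> (m %| M ^ m)%N.
Proof.
move=> M0; have [k] := ubnP m; elim: k m => // k IH m mk piM.
have m0 : (0 < m)%N by case/andP: piM.
have [m1|m1] := leqP m 1; first by rewrite (_ : m = 1%N) ?dvd1n //; lia.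
have pp := pdiv_prime m1; have pm := pdiv_dvd m.
have pM : (pdiv m %| M)%N.
  have : pdiv m \in \pi(M) by apply: (pnatP _ m0 piM).
  by rewrite mem_primes => /and3P[].
have lt : (m %/ pdiv m < m)%N by apply: ltn_Pdiv => //; apply: prime_gt1.
have := IH (m %/ pdiv m)%N (leq_trans lt mk) (pnat_div pm piM) => H.
rewrite -{1}(divnK pm); apply: dvdn_trans (dvdn_mul H pM) _.
by rewrite -expnSr dvdn_exp2l.
Qed.

Lemma anE v : isO v -> `|nm v| = (an v)%:R.
Proof.
move=> vO; rewrite /an -[in LHS](numqK (nm_int vO)) -intr_norm.
by rewrite -abszE -pmulrn.
Qed.

Lemma an_eq0 v : isO v -> (an v == 0)%N = (v == 0).
Proof. by move=> vO; rewrite -(eqr_nat rat) -anE // normr_eq0 nm_eq0. Qed.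

Lemma an_gt0 v : isO v -> v != 0 -> (0 < an v)%N.
Proof. by move=> vO v0; rewrite lt0n an_eq0. Qed.

Lemma anM v w : isO v -> isO w -> an (v * w) = (an v * an w)%N.
Proof.
move=> vO wO; apply/eqP; rewrite -(eqr_nat rat) -anE ?isO_mul // nmM normrM.
by rewrite !anE // natrM.
Qed.

Lemma an_nat (m : nat) : an m%:R = (m ^ D)%N.
Proof.
have -> : m%:R = m%:R *: (1 : L) by rewrite scaler_nat.
have mO : isO (m%:R *: (1 : L)) by apply: isO_natZ; apply: isO1.
apply/eqP; rewrite -(eqr_nat rat) -anE // nmZ nm1 mulr1 natrX.
by rewrite ger0_norm // exprn_ge0.
Qed.

Lemma isO_nat (m : nat) : isO m%:R.
Proof. by rewrite -(scaler_nat m (1 : L)); apply: isO_natZ; apply: isO1. Qed.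

Lemma NS_gt0 v : (0 < NS v)%N. Proof. exact: part_gt0. Qed.

Lemma NSM v w : isO v -> isO w -> v != 0 -> w != 0 -> NS (v * w) = (NS v * NS w)%N.
Proof. by move=> vO wO v0 w0; rewrite /NS anM // partnM // an_gt0. Qed.

Lemma NS_nat (m : nat) : (0 < m)%N -> NS m%:R = (m`_(\pi(MM)^') ^ D)%N.
Proof. by move=> m0; rewrite /NS an_nat partnX. Qed.

Lemma NS1 : NS 1 = 1%N.
Proof. by have := @NS_nat 1 isT; rewrite partn1 exp1n. Qed.

Lemma NS_dvd v : isO v -> v != 0 -> (NS v %| an v)%N.
Proof. by move=> vO v0; rewrite /NS dvdn_part. Qed.

Lemma pi_nat1 j : ((MM ^ j)`_(\pi(MM)^') = 1)%N.
Proof.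
apply: part_p'nat; rewrite pnatNK; apply/pnatP => [|p pp]; first by rewrite expn_gt0 MM_gt0.
by rewrite Euclid_dvdX // => /andP[pM _]; rewrite mem_primes pp MM_gt0.
Qed.

Lemma MMX_neq0 j : (MM ^ j)%:R != 0 :> rat.
Proof. by rewrite pnatr_eq0 -lt0n expn_gt0 MM_gt0. Qed.

Lemma MMX_neq0L j : (MM ^ j)%:R != 0 :> L.
Proof. by rewrite -(scaler_nat _ (1 : L)) scaler_eq0 (negbTE (MMX_neq0 j)) oner_eq0. Qed.

Lemma OS_O v : isO v -> OS v.
Proof. by exists 0%N; rewrite scale1r. Qed.

Lemma OS_scale v : OS v -> exists j, forall k, (j <= k)%N -> isO ((MM ^ k)%:R *: v).
Proof.
move=> [j vO]; exists j => k jk; rewrite -(subnK jk) expnD natrM -scalerA.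
exact: isO_natZ.
Qed.

Lemma OS_common v w : OS v -> OS w ->
  exists j, isO ((MM ^ j)%:R *: v) /\ isO ((MM ^ j)%:R *: w).
Proof.
move=> /OS_scale[j vO] /OS_scale[k wO]; exists (maxn j k).
by rewrite vO ?wO ?leq_maxl ?leq_maxr.
Qed.

Lemma OS_add v w : OS v -> OS w -> OS (v + w).
Proof. by move=> vS /(OS_common vS)[j [vO wO]]; exists j; rewrite scalerDr isO_add. Qed.

Lemma OS_sub v w : OS v -> OS w -> OS (v - w).
Proof. by move=> vS /(OS_common vS)[j [vO wO]]; exists j; rewrite scalerBr isO_sub. Qed.

Lemma OS_mul v w : OS v -> OS w -> OS (v * w).
Proof.
move=> vS /(OS_common vS)[j [vO wO]]; exists (j + j)%N.
by rewrite expnD natrM -scalerA scalerAr scalerAl isO_mul.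
Qed.

Lemma OS1 : OS 1. Proof. by apply/OS_O/isO1. Qed.

Lemma OS_X v (k : nat) : OS v -> OS (v ^+ k).
Proof. by move=> vS; elim: k => [|k IH]; [exact: OS1 | rewrite exprS; exact: OS_mul]. Qed.

Lemma OS_div_MM m v : (m %| MM)%N -> OS v -> OS (m%:R^-1 *: v).
Proof.
move=> mM [j vO]; exists j.+1; rewrite expnS natrM scalerA.
have m0 : m%:R != 0 :> rat by rewrite pnatr_eq0 -lt0n (dvdn_gt0 MM_gt0 mM).
rewrite [_ * _ / _](_ : _ = (MM %/ m)%:R * (MM ^ j)%:R); last first.
  by rewrite -{1}(divnK mM) natrM; field.
by rewrite -scalerA; apply: isO_natZ.
Qed.

Lemma OS_clear_MM j v : OS ((MM ^ j)%:R *: v) -> OS v.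
Proof. by move=> [k vO]; exists (k + j)%N; rewrite expnD natrM -scalerA. Qed.

Lemma NS_eq1 v : isO v -> v != 0 -> NS v = 1%N -> OS v^-1.
Proof.
move=> vO v0 v1; have a0 := an_gt0 vO v0.
have piM : \pi(MM).-nat (an v).
  by rewrite -(partnC (\pi(MM)) a0) -/(NS v) v1 muln1 part_pnat.
have := pnat_dvd_exp MM_gt0 piM => /dvdnP[k E]; exists (an v).
rewrite E natrM -scalerA; apply: isO_natZ.
rewrite -(anE vO); case: (ger0P (nm v)) => _.
  exact: isO_nm_inv.
by rewrite scaleNr -sub0r; apply: isO_sub; [exact: isO0 | exact: isO_nm_inv].
Qed.

Lemma OS_div_dvd v w : isO v -> isO w -> v != 0 -> w != 0 -> OS (w / v) -> (NS v %| NS w)%N.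
Proof.
move=> vO wO v0 w0 [j cO]; set c := (MM ^ j)%:R *: (w / v) in cO.
have c0 : c != 0 by rewrite scaler_eq0 negb_or MMX_neq0 mulf_neq0 // invr_neq0.
have E : (MM ^ j)%:R * w = v * c.
  by rewrite /c -scalerAr mulrCA divff // mulr1 -[(MM ^ j)%:R in LHS]scaler_nat -scalerAl mul1r.
have := congr1 NS E; rewrite !NSM ?isO_nat ?MMX_neq0L // NS_nat ?expn_gt0 ?MM_gt0 //.
by rewrite pi_nat1 exp1n mul1n => ->; rewrite dvdn_mulr.
Qed.

(** A prime factor of [NS v] lies outside [\pi(MM)], hence exceeds [Hb > cC]. *)
Lemma NS_small v : isO v -> v != 0 -> (NS v <= cC)%N -> NS v = 1%N.
Proof.
move=> vO v0 vC; apply/eqP; rewrite eqn_leq NS_gt0 andbT leqNgt; apply/negP => v1.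
have pp := pdiv_prime v1.
have : pdiv (NS v) \in \pi(MM)^'.
  by apply: (pnatP _ (NS_gt0 v) _ _ pp (pdiv_dvd _)); apply: part_pnat.
rewrite inE /= small_prime_dvd_MM //; apply: leq_trans (ltnW Hb_gt).
by apply: leq_trans vC; apply: pdiv_leq; apply: NS_gt0.
Qed.

(** Dirichlet's pigeonhole: cut the unit cube into [k^D] cells with [k = cC + 1]. Two multiples of
    [v] with fractional parts in one cell differ from an element of the order by a height at most
    [1/k], hence by a norm at most [cC/k < 1]. *)
Lemma hurwitz v : exists (t : nat) w,
  [/\ (0 < t <= Hb)%N, isO w & `|nm (t%:R *: v - w)| < 1].
Proof.
pose k := cC.+1; pose fr (t : nat) (i : 'I_D) : rat :=
  crd (t%:R *: v) 0 i - (Num.floor (crd (t%:R *: v) 0 i))%:~R.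
have fr01 t i : 0 <= fr t i < 1.
  have /andP[h1 h2] := floor_itv (crd (t%:R *: v) 0 i).
  by rewrite /fr subr_ge0 h1 /= ltrBlDl -[1]/(1%:~R) -intrD.
have kk : 0 < k%:R :> rat by rewrite ltr0n.
have cellP t i : (Num.truncn (fr t i * k%:R) < k)%N.
  have /andP[h1 h2] := fr01 t i.
  have h3 : 0 <= fr t i * k%:R by rewrite mulr_ge0.
  rewrite -(ltr_nat rat); have /andP[h4 _] := truncn_itv h3.
  by apply: le_lt_trans h4 _; rewrite -[ltRHS]mul1r ltr_pM2r.
pose cell (t : 'I_(k ^ D).+1) : {ffun 'I_D -> 'I_k} := [ffun i => Ordinal (cellP t i)].
have [t1 [t2 [t12 ct]]] : exists t1 t2 : 'I_(k ^ D).+1, (t1 < t2)%N /\ cell t1 = cell t2.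
  have /injectivePn[t1 [t2 t12 ct]] : ~~ injectiveb cell.
    by apply/injectiveP => /leq_card; rewrite card_ffun !card_ord ltnn.
  case: (ltngtP t1 t2) => h.
  - by exists t1, t2.
  - by exists t2, t1.
  - by case/eqP: t12; apply: val_inj.
pose t := (t2 - t1)%N; exists t.
pose w := el (\row_i (Num.floor (crd (t2%:R *: v) 0 i) - Num.floor (crd (t1%:R *: v) 0 i))).
exists w; split.
- by rewrite subn_gt0 t12 /= /Hb -/k; have := ltn_ord t2; rewrite /t; lia.
- exact: isO_el.
have h : ht (t%:R *: v - w) <= k%:R^-1.
  apply: ht_le => [|i]; first by rewrite invr_ge0 ltW.
  have -> : crd (t%:R *: v - w) 0 i = fr t2 i - fr t1 i.
    by rewrite crdB crd_el /fr !mxE natrB ?(ltnW t12) // scalerBl linearB rmorphB /=; ring.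
  have /ffunP/(_ i) := ct; rewrite !ffunE => /(congr1 val) /= E.
  have nn s : 0 <= fr s i * k%:R by rewrite mulr_ge0 ?(ltW kk) //; case/andP: (fr01 s i).
  have := truncn_itv (nn t1); have := truncn_itv (nn t2); rewrite -E.
  move: (Num.truncn _) => q /andP[h1 h2] /andP[h3 h4].
  rewrite -(ler_pM2r kk) mulVf ?gt_eqF // -[k%:R in leLHS]gtr0_norm // -normrM mulrBl.
  by move: h2 h4; rewrite -natr1 => h2 h4; rewrite ler_norml; apply/andP; split; lra.
apply: le_lt_trans (nm_le _) _.
apply: le_lt_trans (_ : _ <= cC%:R * k%:R^-1) _.
  rewrite ler_wpM2l //; apply: le_trans (_ : ht (t%:R *: v - w) <= _) => //.
  rewrite exprS ler_piMr ?ht_ge0 // exprn_ile1 ?ht_ge0 //; apply: le_trans h _.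
  by rewrite invf_le1 // ler1n.
by rewrite ltr_pdivrMr // mul1r ltr_nat.
Qed.

(* Hurwitz's Euclid-like property, with the multipliers t <= Hb inverted. *)
Lemma OS_principal (I : L -> Prop) :
  (forall v w, I v -> I w -> I (v - w)) -> (forall v w, OS v -> I w -> I (v * w)) ->
  (forall v, I v -> OS v) -> (exists2 v, I v & v != 0) ->
  exists b, [/\ I b, isO b, b != 0 & forall v, I v -> OS (v / b)].
Proof.
move=> Isub Imul IOS [v0 Iv0 v00].
have scaleI j v : I v -> I ((MM ^ j)%:R *: v).
  move=> Iv; rewrite -[v]mul1r scalerAl; apply: Imul => //.
  by apply/OS_O/isO_natZ/isO1.
pose P (k : nat) := `[< exists b, [/\ I b, isO b, b != 0 & an b = k] >].
have exP : exists k, P k.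
  have [j jO] := IOS _ Iv0; exists (an ((MM ^ j)%:R *: v0)); apply/asboolP.
  exists ((MM ^ j)%:R *: v0); split=> //; first exact: scaleI.
  by rewrite scaler_eq0 negb_or MMX_neq0.
case: (ex_minnP exP) => k /asboolP[b [Ib bO b0 bk]] kmin.
exists b; split=> // v Iv; have [j jO] := IOS _ Iv.
have [t [w [/andP[t0 tH] wO tw]]] := hurwitz ((MM ^ j)%:R *: v / b).
pose r := t%:R *: ((MM ^ j)%:R *: v) - w * b.
have rE : r = (t%:R *: ((MM ^ j)%:R *: v / b) - w) * b.
  by rewrite mulrBl -scalerAl divfK.
have rO : isO r by apply: isO_sub; [apply: isO_natZ | apply: isO_mul].
have Ir : I r.
  apply: Isub; last by apply: Imul => //; apply: OS_O.
  rewrite -[(MM ^ j)%:R *: v]mul1r scalerAl; apply: Imul; last exact: scaleI.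
  by apply/OS_O/isO_natZ/isO1.
have r0 : r = 0.
  apply/eqP; apply: contraT => r0; have := kmin (an r).
  have : (an r < k)%N.
    rewrite -bk -(ltr_nat rat) -!anE // rE nmM normrM.
    by rewrite -[ltRHS]mul1r ltr_pM2r // normr_gt0 nm_eq0.
  move=> lt /(_ _) H; have : (k <= an r)%N by apply: H; apply/asboolP; exists r.
  by rewrite leqNgt lt.
have tn : t%:R != 0 :> rat by rewrite pnatr_eq0 -lt0n.
apply: (@OS_clear_MM j); rewrite scalerAl.
have -> : (MM ^ j)%:R *: v / b = t%:R^-1 *: w.
  apply: (mulIf b0); rewrite divfK // -scalerAl.
  move/eqP: r0; rewrite subr_eq0 => /eqP <-.
  by rewrite [RHS]scalerA mulVf // scale1r.
by apply: OS_div_MM; [apply: dvdn_fact; rewrite t0 | apply: OS_O].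
Qed.


Lemma partn_prod (I : Type) (s : seq I) (F : I -> nat) (pi : nat_pred) :
  (forall i, 0 < F i)%N -> ((\prod_(i <- s) F i)%N`_pi = \prod_(i <- s) (F i)`_pi)%N.
Proof.
move=> F0; elim: s => [|x s IH]; first by rewrite !big_nil partn1.
by rewrite !big_cons partnM ?IH // prodn_gt0.
Qed.

Lemma absz_det_unit m (U : 'M[int]_m) : U \in unitmx -> `|\det U|%N = 1%N.
Proof.
move=> UU; have : \det U * \det (invmx U) = 1 by rewrite -det_mulmx mulmxV // det1.
by move/(congr1 absz); rewrite abszM => /eqP; rewrite muln_eq1 => /andP[/eqP].
Qed.

(* Smith normal form turns the congruence modulo [v] into a congruence coordinate by
   coordinate; only the part of each invariant factor prime to [MM] matters. *)
Lemma residues v : isO v -> v != 0 -> exists (T : finType) (r : 'rV[int]_D -> T),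
  [/\ #|T| = NS v, (forall t, exists z, r z = t) &
      forall y z, r y = r z <-> OS ((el y - el z) / v)].
Proof.
move=> vO v0; have [z0 vE] := isOP vO; have [A AE] := mulmat_el z0; rewrite -vE in AE.
have [Ls LU [Rs RU [d _ AS]]] := int_Smith_normal_form A.
set Dg := \matrix_(i, j) _ in AS.
pose dd (i : 'I_D) : int := d`_i.
have DgE i j : Dg i j = dd i *+ (i == j) by rewrite mxE.
have detDg : \det Dg = \prod_(i < D) dd i.
  rewrite det_trig; last first.
    by apply/is_trig_mxP => i j ij; rewrite DgE -val_eqE /= (ltn_eqF ij).
  by apply: eq_bigr => i _; rewrite DgE eqxx.
have anv : an v = (\prod_(i < D) `|dd i|)%N.
  apply/eqP; rewrite -(eqr_nat rat) -anE // /nm AE det_map_mx AS !det_mulmx detDg.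
  rewrite -intr_norm -abszE -pmulrn eqr_nat !abszM !absz_det_unit // mul1n muln1.
  by apply/eqP; elim/big_rec2: _ => // i x y _ <-; rewrite abszM.
have d0 (i : 'I_D) : (0 < `|dd i|)%N.
  rewrite lt0n; apply/eqP => di; have := an_gt0 vO v0.
  by rewrite anv (bigD1 i) //= di mul0n.
pose m (i : 'I_D) := ((absz (dd i))`_(\pi(MM)^'))%N.
pose s (i : 'I_D) := ((absz (dd i))`_(\pi(MM)))%N.
have ms i : (s i * m i)%N = `|dd i|%N by apply: partnC.
have m0 i : (0 < m i)%N by apply: part_gt0.
have s0 i : (0 < s i)%N by apply: part_gt0.
pose cf (z : 'rV[int]_D) (i : 'I_D) : int := (z *m invmx Rs) 0 i.
have cfB y z i : cf (y - z) i = cf y i - cf z i by rewrite /cf mulmxBl !mxE.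
have coef (z : 'rV[int]_D) (i : 'I_D) : (`|(cf z i %% m i)%Z| < m i)%N.
  have mi : (m i)%:Z != 0 by rewrite eqz_nat -lt0n.
  rewrite -ltz_nat gez0_abs ?modz_ge0 //.
  by have := ltz_pmod (cf z i) (m0 i : 0 < (m i)%:Z).
pose T : finType := {dffun forall i : 'I_D, 'I_(m i)}.
pose r (z : 'rV[int]_D) : T := [ffun i => Ordinal (coef z i)].
have rP y z : r y = r z <-> forall i, ((m i)%:Z %| cf (y - z) i)%Z.
  have E i : (r y i == r z i) = ((m i)%:Z %| cf (y - z) i)%Z.
    rewrite !ffunE -val_eqE /= cfB -eqz_mod_dvd.
    have mi : (m i)%:Z != 0 by rewrite eqz_nat -lt0n.
    by rewrite -eqz_nat !gez0_abs ?modz_ge0.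
  split=> [yz i|H]; first by rewrite -E yz.
  by apply/ffunP => i; apply/eqP; rewrite E.
have crd_vel (u : 'rV[int]_D) : crd (v * el u) = map_mx intr (u *m A).
  by rewrite crdM crd_el AE map_mxM.
exists T, r; split.
- rewrite card_dep_ffun foldrE big_image /=.
  rewrite /NS anv partn_prod //.
  by apply: eq_bigr => i _; rewrite card_ord.
- move=> t; exists ((\row_i (t i : nat)%:Z) *m Rs); apply/ffunP => i.
  apply: val_inj; rewrite ffunE /= /cf mulmxK // mxE modz_nat.
  by rewrite modn_small.
move=> y z; rewrite rP; split=> [H|[j H] i].
  (* A power of [MM] that every [s i] divides: [s i] divides [MM^(s i)], and [s i <= an v]. *)
  pose J := an v; pose q i := (cf (y - z) i %/ m i)%Z.
  pose c i : int := (MM ^ J %/ s i)%N%:Z * sgz (dd i) * q i.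
  pose u := (\row_i c i) *m invmx Ls.
  have sJ i : (s i %| MM ^ J)%N.
    apply: dvdn_trans (_ : MM ^ s i %| _)%N.
      by apply: pnat_dvd_exp; rewrite ?MM_gt0 ?part_pnat.
    apply: dvdn_exp2l; rewrite /J anv (bigD1 i) //= -(ms i) -mulnA leq_pmulr //.
    by rewrite muln_gt0 m0 prodn_gt0.
  have uA : u *m A = (MM ^ J)%:Z *: (y - z).
    rewrite AS !mulmxA mulmxKV //.
    have -> : (\row_i c i) *m Dg = (MM ^ J)%:Z *: ((y - z) *m invmx Rs).
      apply/rowP => i; rewrite mxE [RHS]mxE (bigD1 i) //= big1 ?addr0 => [|k ki]; last first.
        by rewrite DgE (negbTE ki) mulr0n mulr0.
      rewrite DgE eqxx mulr1n mxE /c -/(cf _ i) -[cf (y - z) i](divzK (H i)) -/(q i).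
      rewrite mulrAC -!mulrA [q i * _]mulrC !mulrA -[_ * sgz _ * _]mulrA -abszEsg -(ms i).
      by rewrite -PoszM mulnA divnK // PoszM -!mulrA [(m i)%:Z * _]mulrC.
    by rewrite -scalemxAl mulmxKV.
  exists J; rewrite (_ : _ *: _ = el u) ?isO_el //.
  apply: (mulfI v0); rewrite -scalerAr mulrCA divff // mulr1.
  apply: crd_inj; rewrite crd_vel uA crdZ crdB !crd_el.
  by apply/rowP => i; rewrite !mxE rmorphM rmorphB.
have [u uE] := isOP H.
have wE : (MM ^ j)%:Z *: (y - z) = u *m A.
  suff /rowP H2 : map_mx intr ((MM ^ j)%:Z *: (y - z)) = map_mx intr (u *m A) :> 'rV[rat]_D.
    by apply/rowP => k; have := H2 k; rewrite [LHS]mxE [RHS]mxE => /intr_inj.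
  rewrite -crd_vel -uE -scalerAr mulrCA divff // mulr1 crdZ crdB !crd_el.
  by apply/rowP => k; rewrite !mxE rmorphM rmorphB.
have : (MM ^ j)%:Z *: ((y - z) *m invmx Rs) = u *m Ls *m Dg.
  by rewrite scalemxAl wE AS !mulmxA mulmxK.
move/rowP/(_ i); rewrite mxE -/(cf _ i) [RHS]mxE (bigD1 i) //= big1 ?addr0 => [|k ki]; last first.
  by rewrite DgE (negbTE ki) mulr0n mulr0.
rewrite DgE eqxx mulr1n => E.
have : ((m i)%:Z %| (MM ^ j)%:Z * cf (y - z) i)%Z.
  by rewrite E dvdz_mull // dvdzE /= -(ms i) dvdn_mull.
rewrite Gauss_dvdzr // coprimezE /= coprime_sym.
apply: (@pnat_coprime (\pi(MM))); last exact: part_pnat.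
by rewrite pnatX pnat_pi // MM_gt0.
Qed.

Lemma pigeonhole v (m : nat) (F : 'I_m -> 'rV[int]_D) : isO v -> v != 0 -> (NS v < m)%N ->
  exists i j, i != j /\ OS ((el (F i) - el (F j)) / v).
Proof.
move=> vO v0 vm; have [T [r [cT _ rP]]] := residues vO v0.
have /injectivePn[i [j ij rij]] : ~~ injectiveb (r \o F).
  by apply/injectiveP => /leq_card; rewrite cT card_ord leqNgt vm.
by exists i, j; split=> //; apply/rP.
Qed.

Definition sim v w : Prop := OS (v / w) /\ OS (w / v).

Lemma root_floor (m k : nat) : (0 < k)%N -> exists T : nat, (T ^ k <= m < T.+1 ^ k)%N.
Proof.
move=> k0; elim: m => [|m [T /andP[T1 T2]]].
  by exists 0%N; rewrite exp0n // exp1n.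
have [h|h] := ltnP m.+1 (T.+1 ^ k)%N; first by exists T; rewrite h (leq_trans T1).
exists T.+1; rewrite h (leq_ltn_trans T2) //.
by rewrite ltn_exp2r.
Qed.

(* Minkowski's pigeonhole: an element of the ideal generated by [v] of height at most
   the root of the index has a cofactor of norm at most [cC], hence an S-unit. *)
Lemma short_rep v : isO v -> v != 0 ->
  exists w, [/\ isO w, w != 0, sim w v & ht w ^+ D <= (NS v)%:R].
Proof.
move=> vO v0; have [T /andP[T1 T2]] := root_floor (NS v) (ltn0Sn n).
pose F (f : {ffun 'I_D -> 'I_T.+1}) : 'rV[int]_D := \row_i (f i : nat)%:Z.
have cF : (NS v < #|{ffun 'I_D -> 'I_T.+1}|)%N by rewrite card_ffun !card_ord.
have [i [j [ij OSij]]] :=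
  @pigeonhole v _ (fun k : 'I_#|{ffun 'I_D -> 'I_T.+1}| => F (enum_val k)) vO v0 cF.
set f := enum_val i in OSij; set g := enum_val j in OSij.
have fg : f != g by rewrite (inj_eq enum_val_inj).
pose w := el (F f) - el (F g); have wO : isO w by rewrite isO_sub ?isO_el.
have w0 : w != 0.
  rewrite subr_eq0 (inj_eq el_inj); apply: contra fg => /eqP /rowP E.
  by apply/eqP/ffunP => k; have := E k; rewrite !mxE => -[] /val_inj.
have htw : ht w <= T%:R.
  apply: ht_le => // k; rewrite crdB !crd_el !mxE.
  have := ltn_ord (f k); have := ltn_ord (g k); rewrite !ltnS -!(ler_nat rat).
  have := ler0n rat (f k); have := ler0n rat (g k); rewrite -!pmulrn => h1 h2 h3 h4.
  by rewrite ler_norml; apply/andP; split; lra.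
have htwD : ht w ^+ D <= (NS v)%:R.
  apply: le_trans (_ : T%:R ^+ D <= _); last by rewrite -natrX ler_nat.
  by rewrite lerXn2r ?nnegrE ?ht_ge0.
exists w; split=> //; split=> //; have [k cO] := OSij; rewrite -/w in cO.
set c := (MM ^ k)%:R *: (w / v) in cO.
have c0 : c != 0 by rewrite scaler_eq0 negb_or MMX_neq0 mulf_neq0 // invr_neq0.
have E : (MM ^ k)%:R * w = v * c.
  by rewrite /c -scalerAr mulrCA divff // mulr1 -[(MM ^ k)%:R in LHS]scaler_nat -scalerAl mul1r.
have EN : NS w = (NS v * NS c)%N.
  have := congr1 NS E; rewrite !NSM ?isO_nat ?MMX_neq0L // NS_nat ?expn_gt0 ?MM_gt0 //.
  by rewrite pi_nat1 exp1n mul1n.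
have NSc : NS c = 1%N.
  apply: NS_small => //.
  have wle : (NS w)%:R <= cC%:R * (NS v)%:R :> rat.
    apply: le_trans (_ : (an w)%:R <= _).
      by rewrite ler_nat dvdn_leq ?NS_dvd ?an_gt0.
    by rewrite -anE //; apply: le_trans (nm_le w) _; rewrite ler_wpM2l.
  by move: wle; rewrite EN natrM mulrC ler_pM2r ?ltr0n ?NS_gt0 // ler_nat.
have := NS_eq1 cO c0 NSc => ciS.
have -> : v / w = (MM ^ k)%:R *: c^-1.
  rewrite (_ : v = (MM ^ k)%:R * w / c); last by rewrite E mulfK.
  by rewrite mulrAC mulfK // mulr_natl -scaler_nat.
rewrite -[c^-1]mul1r scalerAl; apply: OS_mul => //.
by apply/OS_O/isO_natZ/isO1.
Qed.


(** * Divisibility and classes in the localised ring *)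

Definition O1 v : bool := isO v && (v != 0).
Definition dv v w : bool := `[< OS (w / v) >].

Lemma O1_O v : O1 v -> isO v. Proof. by case/andP. Qed.
Lemma O1_n0 v : O1 v -> v != 0. Proof. by case/andP. Qed.
Lemma O1M v w : O1 v -> O1 w -> O1 (v * w).
Proof. by move=> /andP[vO v0] /andP[wO w0]; rewrite /O1 isO_mul // mulf_neq0. Qed.
Lemma O11 : O1 1. Proof. by rewrite /O1 isO1 oner_neq0. Qed.
Lemma O1X v k : O1 v -> O1 (v ^+ k).
Proof. by move=> v1; elim: k => [|k IH]; rewrite ?O11 // exprS O1M. Qed.
Lemma O1NSM v w : O1 v -> O1 w -> NS (v * w) = (NS v * NS w)%N.
Proof. by move=> /andP[? ?] /andP[? ?]; apply: NSM. Qed.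
Lemma O1NSX v k : O1 v -> NS (v ^+ k) = (NS v ^ k)%N.
Proof. by move=> v1; elim: k => [|k IH]; rewrite ?NS1 // exprS O1NSM ?O1X // IH expnS. Qed.

Lemma O1MM j : O1 (MM ^ j)%:R.
Proof. by rewrite /O1 isO_nat MMX_neq0L. Qed.

Lemma NS_MM j : NS (MM ^ j)%:R = 1%N.
Proof. by rewrite NS_nat ?expn_gt0 ?MM_gt0 // pi_nat1 exp1n. Qed.

Lemma dvP v w : reflect (OS (w / v)) (dv v w). Proof. exact: asboolP. Qed.

Lemma dv_refl v : v != 0 -> dv v v.
Proof. by move=> v0; apply/dvP; rewrite divff //; exact: OS1. Qed.

Lemma dv_trans v w x : w != 0 -> dv v w -> dv w x -> dv v x.
Proof.
move=> w0 /dvP vw /dvP wx; apply/dvP.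
have -> : x / v = (x / w) * (w / v) by rewrite mulrA divfK.
exact: OS_mul.
Qed.

Lemma dv_mull v w x : OS w -> dv v x -> dv v (w * x).
Proof. by move=> wS /dvP vx; apply/dvP; rewrite -mulrA; apply: OS_mul. Qed.

Lemma dv_mulr v w : v != 0 -> isO w -> dv v (v * w).
Proof. by move=> v0 wO; rewrite mulrC; apply: dv_mull (dv_refl v0); apply: OS_O. Qed.

Lemma dv_mul2l v w x : v != 0 -> dv (v * w) (v * x) = dv w x.
Proof. by move=> v0; rewrite /dv -mulf_div divff // mul1r. Qed.

Lemma dv_O w : isO w -> dv 1 w.
Proof. by move=> wO; apply/dvP; rewrite divr1; apply: OS_O. Qed.

Lemma dv_NS v w : O1 v -> O1 w -> dv v w -> (NS v %| NS w)%N.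
Proof. by move=> /andP[? ?] /andP[? ?] /dvP; apply: OS_div_dvd. Qed.

Lemma dv_MM v w j : v != 0 -> dv v ((MM ^ j)%:R * w) = dv v w.
Proof.
move=> v0; apply/idP/idP => [/dvP|]; last by apply: dv_mull; apply/OS_O/isO_nat.
rewrite -mulrA mulr_natl -scaler_nat => h; apply/dvP; exact: OS_clear_MM h.
Qed.

Lemma dv_cofactor v w : O1 v -> O1 w -> dv v w ->
  exists j c, O1 c /\ (MM ^ j)%:R * w = v * c.
Proof.
move=> /andP[vO v0] /andP[wO w0] /dvP[j cO]; exists j, ((MM ^ j)%:R *: (w / v)).
rewrite /O1 cO scaler_eq0 negb_or MMX_neq0 mulf_neq0 ?invr_neq0 //; split=> //.
by rewrite -scalerAr mulrCA divff // mulr1 scaler_nat mulr_natl.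
Qed.

Lemma dv_cofactor_NS v w c j : O1 v -> O1 w -> O1 c -> (MM ^ j)%:R * w = v * c ->
  NS w = (NS v * NS c)%N.
Proof.
move=> v1 w1 c1 /(congr1 NS).
by rewrite !O1NSM ?O1MM // NS_MM mul1n.
Qed.

Lemma dv_unit v w : O1 v -> NS v = 1%N -> isO w -> dv v w.
Proof.
move=> /andP[vO v0] v1 wO; apply/dvP; apply: OS_mul; first exact: OS_O.
exact: NS_eq1.
Qed.

Lemma dv_antisym_NS v w : O1 v -> O1 w -> dv v w -> NS v = NS w -> dv w v.
Proof.
move=> v1 w1 vw E; have [j [c [c1 cE]]] := dv_cofactor v1 w1 vw.
have := dv_cofactor_NS v1 w1 c1 cE; rewrite -E => /eqP.
rewrite -{1}[NS v]muln1 eqn_pmul2l ?NS_gt0 // => /eqP Nc.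
rewrite -(dv_MM v j) ?O1_n0 //.
have c0 := O1_n0 c1; rewrite -[w in dv w _](mulfK c0) -[X in dv _ X](mulfK c0).
rewrite /dv; apply/asboolP.
have -> : (MM ^ j)%:R * v * c / c / (w * c / c) = (MM ^ j)%:R * ((MM ^ j)%:R * c^-1).
  rewrite !mulfK // (_ : v = (MM ^ j)%:R * w / c); last by rewrite cE mulfK.
  have w0 := O1_n0 w1; move: ((MM ^ j)%:R : L) => x.
  by field; rewrite w0 c0.
have MS : OS (MM ^ j)%:R by apply/OS_O/isO_nat.
by apply: (OS_mul MS); apply: (OS_mul MS); apply: NS_eq1 => //; apply: O1_O.
Qed.

Definition simb v w : bool := dv v w && dv w v.

(** [choose] returns the same element for extensionally equal predicates, so this is a canonical
    generator of the principal ideal of [v] in the localised ring. *)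
Definition cls v : L := choose (fun w => O1 w && simb w v) v.

Lemma simb_refl v : v != 0 -> simb v v.
Proof. by move=> v0; rewrite /simb dv_refl. Qed.

Lemma simb_sym v w : simb v w = simb w v.
Proof. by rewrite /simb andbC. Qed.

Lemma simb_trans v w x : w != 0 -> simb v w -> simb w x -> simb v x.
Proof.
by move=> w0 /andP[vw wv] /andP[wx xw]; rewrite /simb (dv_trans w0 vw wx) (dv_trans w0 xw wv).
Qed.

Lemma clsP v : O1 v -> O1 (cls v) /\ simb (cls v) v.
Proof.
move=> v1; apply/andP; rewrite /cls.
by apply: (chooseP (P := fun w => O1 w && simb w v)); rewrite v1 simb_refl ?O1_n0.
Qed.

Lemma cls_eq v w : O1 v -> O1 w -> simb v w -> cls v = cls w.
Proof.
move=> v1 w1 vw; rewrite /cls; have v0 := O1_n0 v1; have w0 := O1_n0 w1.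
rewrite (@eq_choose _ _ (fun x => O1 x && simb x w)); last first.
  move=> x; case x1: (O1 x) => //=; apply/idP/idP => h; first exact: simb_trans vw.
  by apply: simb_trans h _ => //; rewrite simb_sym.
by apply: choose_id; rewrite ?v1 ?vw ?w1 ?simb_refl.
Qed.

Lemma cls_inj v w : O1 v -> O1 w -> cls v = cls w -> simb v w.
Proof.
move=> v1 w1 E; have [c1 cv] := clsP v1; have [_ cw] := clsP w1.
apply: simb_trans (O1_n0 c1) _ _; first by rewrite simb_sym.
by rewrite E.
Qed.

Lemma simb_NS v w : O1 v -> O1 w -> simb v w -> NS v = NS w.
Proof.
move=> v1 w1 /andP[vw wv]; apply/eqP; rewrite eqn_dvd.
by rewrite (dv_NS v1 w1 vw) (dv_NS w1 v1 wv).
Qed.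

Lemma NS_cls v : O1 v -> NS (cls v) = NS v.
Proof. by move=> v1; have [c1 cv] := clsP v1; apply: simb_NS. Qed.

Lemma cls_cls v : O1 v -> cls (cls v) = cls v.
Proof. by move=> v1; have [c1 cv] := clsP v1; apply: cls_eq. Qed.

Lemma simb_MM v j : O1 v -> simb ((MM ^ j)%:R * v) v.
Proof.
move=> v1; have v0 := O1_n0 v1; have m1 := O1MM j.
rewrite /simb dv_MM ?dv_refl // andbT -[X in dv _ X]mul1r.
apply/dvP; rewrite -mulf_div divff // mulr1 mul1r; apply: NS_eq1.
- exact: O1_O m1.
- exact: O1_n0 m1.
- exact: NS_MM.
Qed.

Definition box (T : nat) : seq 'rV[int]_D :=
  [seq (\row_i ((f i : nat)%:Z - T%:Z)) | f : {ffun 'I_D -> 'I_(2 * T).+1}].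

Lemma mem_box T z : (z \in box T) = [forall i, (absz (z 0 i)%R <= T)%N].
Proof.
apply/mapP/forallP => [[f _ ->] i|H].
  by rewrite mxE; move: (ltn_ord (f i)); move: (nat_of_ord (f i)) => k; lia.
have bd i : (`|(z 0 i + T%:Z)%R| < (2 * T).+1)%N by have := H i; lia.
exists [ffun i => Ordinal (bd i)]; first by rewrite mem_enum.
by apply/rowP => i; rewrite !mxE ffunE /=; have := H i; lia.
Qed.

Lemma uniq_box T : uniq (box T).
Proof.
rewrite map_inj_uniq ?enum_uniq // => f g /rowP fg; apply/ffunP => i.
by have := fg i; rewrite !mxE => /addIr [] /val_inj.
Qed.

Lemma size_box T : size (box T) = ((2 * T).+1 ^ D)%N.
Proof. by rewrite size_map -cardE card_ffun !card_ord. Qed.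

Lemma ht_el_le z T : (ht (el z) <= T%:R) = (z \in box T).
Proof.
rewrite mem_box; apply/idP/forallP => [h i|H].
  have := le_trans (ht_ge (el z) i) h; rewrite crd_el mxE -intr_norm -abszE -pmulrn.
  by rewrite ler_nat.
by apply: ht_le => // i; rewrite crd_el mxE -intr_norm -abszE -pmulrn ler_nat.
Qed.

(** All classes of norm [m]: by [short_rep] each has a representative of height at most [m^(1/D)],
    so the search in [box m] misses none. [bcl] counts the ideals of norm [m] of the localised
    ring. *)
Definition lev (m : nat) : seq L :=
  undup [seq cls (el z) | z <- box m & O1 (el z) && (NS (el z) == m)].

Lemma mem_lev m c : c \in lev m = [&& O1 c, cls c == c & NS c == m].
Proof.
rewrite mem_undup; apply/mapP/and3P => [[z]|[c1 /eqP cc /eqP cm]].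
  rewrite mem_filter => /andP[/andP[z1 /eqP zm] _] ->.
  by rewrite cls_cls // NS_cls // zm; have [-> _] := clsP z1; split.
have [w [wO w0 [/dvP cw /dvP wc] hw]] := short_rep (O1_O c1) (O1_n0 c1).
have [z wE] := isOP wO; have w1 : O1 w by rewrite /O1 wO.
have wc' : simb w c by rewrite /simb wc cw.
exists z; last by rewrite -wE -cc; apply: cls_eq; rewrite // simb_sym.
rewrite mem_filter -wE w1 (simb_NS w1 c1 wc') cm eqxx /= -ht_el_le -wE.
have m1 : 1 <= m%:R :> rat by rewrite -cm ler1n NS_gt0.
have [//|mw] := lerP (ht w) m%:R; rewrite cm in hw.
have hD : ht w <= ht w ^+ D.
  by rewrite exprS ler_peMr ?ht_ge0 // exprn_ege1 // (le_trans m1) // ltW.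
by have := lt_le_trans mw (le_trans hD hw); rewrite ltxx.
Qed.

Lemma uniq_lev m : uniq (lev m). Proof. exact: undup_uniq. Qed.

Definition bcl (m : nat) : nat := size (lev m).

(** When [NS c] divides [m], multiplication by [c] maps the classes of norm [m / NS c] bijectively
    onto those of norm [m] divisible by [c]. *)
Lemma count_multiples c m : O1 c -> (0 < m)%N ->
  count (dv c) (lev m) = if (NS c %| m)%N then bcl (m %/ NS c) else 0%N.
Proof.
move=> c1 m0; have c0 := O1_n0 c1; case: ifP => [cm|ncm]; last first.
  apply/eqP; rewrite -leqn0 leqNgt -has_count; apply/negP => /hasP[a].
  by rewrite mem_lev => /and3P[a1 _ /eqP am] /(dv_NS c1 a1); rewrite am ncm.
rewrite /bcl -size_filter -(size_map (fun a => cls (a * c)) (lev (m %/ NS c))).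
apply: perm_size; apply: uniq_perm.
- by rewrite filter_uniq ?uniq_lev.
- rewrite map_inj_in_uniq ?uniq_lev // => a a'.
  rewrite !mem_lev => /and3P[a1 /eqP aa _] /and3P[a'1 /eqP aa' _] E.
  rewrite -aa -aa'; apply: cls_eq => //.
  have := cls_inj (O1M a1 c1) (O1M a'1 c1) E.
  by rewrite /simb ![_ * c]mulrC !dv_mul2l.
move=> x; rewrite mem_filter mem_lev; apply/andP/mapP => [[cx /and3P[x1 /eqP xx /eqP xm]]|[a]].
  have [j [a [a1 E]]] := dv_cofactor c1 x1 cx.
  exists (cls a).
    rewrite mem_lev cls_cls // eqxx NS_cls //; have [-> _] := clsP a1 => /=.
    by rewrite -xm (dv_cofactor_NS c1 x1 a1 E) mulKn ?NS_gt0.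
  have [ca1 caa] := clsP a1.
  rewrite -[LHS]xx; apply: cls_eq => //; first exact: O1M.
  apply: simb_trans (_ : simb ((MM ^ j)%:R * x) _); first exact: O1_n0 (O1M (O1MM j) x1).
    by rewrite simb_sym simb_MM.
  by rewrite E mulrC; move: caa; rewrite simb_sym /simb ![_ * c]mulrC !dv_mul2l.
rewrite mem_lev => /and3P[a1 /eqP aa /eqP am] ->.
have ac1 := O1M a1 c1; have [k1 kac] := clsP ac1.
rewrite cls_cls // eqxx k1 NS_cls // O1NSM // am divnK // eqxx; split=> //.
apply: dv_trans (O1_n0 ac1) _ _; last by case/andP: kac.
by rewrite mulrC dv_mulr // O1_O.
Qed.


(** * Prime elements and the von Mangoldt function *)

Definition prm v : bool := `[< [/\ O1 v, (1 < NS v)%N &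
  forall a b, O1 a -> O1 b -> dv v (a * b) -> dv v a || dv v b] >].

Lemma prmP v : reflect [/\ O1 v, (1 < NS v)%N &
  forall a b, O1 a -> O1 b -> dv v (a * b) -> dv v a || dv v b] (prm v).
Proof. exact: asboolP. Qed.

Lemma dv_simbl v w x : v != 0 -> w != 0 -> simb v w -> dv v x = dv w x.
Proof.
move=> v0 w0 /andP[vw wv]; apply/idP/idP; first exact: dv_trans.
exact: dv_trans.
Qed.

Lemma dv_simbr v w x : v != 0 -> w != 0 -> simb v w -> dv x v = dv x w.
Proof.
move=> v0 w0 /andP[vw wv]; apply/idP/idP => h; first exact: dv_trans v0 h vw.
exact: dv_trans w0 h wv.
Qed.

Lemma prm_cls v : prm v -> prm (cls v).
Proof.
move=> /prmP[v1 v2 vp]; have [c1 cv] := clsP v1; apply/prmP; split=> //.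
  by rewrite NS_cls.
move=> a b a1 b1; rewrite !(@dv_simbl _ v) ?O1_n0 //; exact: vp.
Qed.

(* In a principal ideal ring a divisor of minimal norm is prime. *)
Lemma prm_exists a : O1 a -> (1 < NS a)%N -> exists2 v, prm v & dv v a.
Proof.
move=> a1 a2; pose P (k : nat) := `[< exists v, [/\ O1 v, dv v a, (1 < NS v)%N & NS v = k] >].
have exP : exists k, P k.
  by exists (NS a); apply/asboolP; exists a; rewrite dv_refl ?O1_n0.
case: (ex_minnP exP) => k /asboolP[v [v1 va v2 vk]] kmin.
have v0 := O1_n0 v1; exists v => //; apply/prmP; split=> // x y x1 y1 vxy.
case vx: (dv v x) => //=.
(* The ideal of [v] and [x] has a generator [w]. If [w] is a unit, the Bezout relation gives
   [v | y]; otherwise minimality makes [w] an associate of [v], and [v | x]. *)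
pose I u := exists s t, [/\ OS s, OS t & u = s * v + t * x].
have vI : I v by exists 1, 0; split; rewrite ?mul1r ?mul0r ?addr0 //; apply: OS_O; rewrite ?isO1 ?isO0.
have xI : I x by exists 0, 1; split; rewrite ?mul1r ?mul0r ?add0r //; apply: OS_O; rewrite ?isO1 ?isO0.
have [| | | |w [[s [t [sS tS wE]]] wO w0 wI]] := @OS_principal I.
- move=> u u' [s [t [sS tS ->]]] [s' [t' [s'S t'S ->]]].
  by exists (s - s'), (t - t'); split; [exact: OS_sub | exact: OS_sub | ring].
- move=> c u cS [s [t [sS tS ->]]].
  by exists (c * s), (c * t); split; [exact: OS_mul | exact: OS_mul | ring].
- move=> u [s [t [sS tS ->]]].
  by apply: OS_add; apply: OS_mul => //; apply: OS_O; apply: O1_O.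
- by exists v.
have w1 : O1 w by rewrite /O1 wO.
have wv : dv w v by apply/dvP/wI. have wx : dv w x by apply/dvP/wI.
have [w2|w2] := leqP (NS w) 1.
  have Nw : NS w = 1%N by apply/eqP; rewrite eqn_leq w2 NS_gt0.
  have wiS : OS w^-1 by apply: NS_eq1.
  apply/dvP; have -> : y / v = s * w^-1 * y + t * w^-1 * (x * y / v).
    rewrite (_ : y / v = w * w^-1 * (y / v)); last by rewrite divff // mul1r.
    by rewrite {1}wE; field; rewrite v0 w0.
  apply: OS_add; apply: OS_mul; try exact: OS_mul.
    by apply: OS_O; apply: O1_O.
  exact/dvP.
have Nwv : NS w = NS v.
  apply/eqP; rewrite eqn_leq dvdn_leq ?NS_gt0 ?(dv_NS w1 v1) //= vk.
  by apply: kmin; apply/asboolP; exists w; split=> //; apply: dv_trans va.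
by move: vx; rewrite (dv_trans w0 (dv_antisym_NS w1 v1 wv Nwv) wx).
Qed.

(** If [v] divided [u], primality of [u] would make it divide either [v], so that the two are
    associated, or the cofactor, which has smaller norm. Hence one factor [v] at a time comes from
    [a]. *)
Lemma dv_prime_pow v u a k : prm v -> prm u -> ~~ simb v u -> O1 a ->
  dv (v ^+ k) (u * a) = dv (v ^+ k) a.
Proof.
move=> /prmP[v1 v2 vp] /prmP[u1 u2 up] vu a1.
have v0 := O1_n0 v1; have u0 := O1_n0 u1.
have vX i : v ^+ i != 0 by rewrite expf_neq0.
apply/idP/idP; last by apply: dv_mull; apply: OS_O; apply: O1_O.
elim: k a a1 => [|k IH] a a1; first by move=> _; rewrite expr0; apply/dv_O/O1_O.
rewrite exprS => h.
have : dv v (u * a).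
  by apply: dv_trans h; [rewrite mulf_neq0 ?vX | apply: dv_mulr => //; apply/O1_O/O1X].
move/(vp _ _ u1 a1)/orP=> [vdu|va].
  have [j [c [c1 cE]]] := dv_cofactor v1 u1 vdu.
  have : dv u (v * c) by rewrite -cE dv_MM // dv_refl.
  move/(up _ _ v1 c1)/orP=> [udv|uc]; first by rewrite /simb vdu udv in vu.
  have := dv_cofactor_NS v1 u1 c1 cE => E.
  have := dvdn_leq (NS_gt0 _) (dv_NS u1 c1 uc).
  by rewrite E leqNgt ltn_Pmull ?NS_gt0.
have [j [c [c1 cE]]] := dv_cofactor v1 a1 va.
rewrite -(dv_MM _ j) ?mulf_neq0 ?vX // cE dv_mul2l //; apply: IH => //.
move: h; rewrite -(dv_MM _ j) ?mulf_neq0 ?vX // mulrCA cE mulrCA dv_mul2l //.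
Qed.

Definition Pr m : seq L := [seq v <- lev m | prm v].

Lemma mem_Pr m v : v \in Pr m = [&& prm v, cls v == v & NS v == m].
Proof.
rewrite mem_filter mem_lev; case pv: (prm v) => //=.
by case/prmP: pv => -> _ _.
Qed.

Definition prc (m : nat) : nat := size (Pr m).

Section Valuations.
Variable R : realType.

(** The sum over primes [v] of the [v]-adic valuation of [a] times [ln (NS v)], a valuation being
    the number of [k >= 1] with [v^k | a]. The cut-off at [X] loses nothing once [NS a <= X];
    [vlogE] is then unique factorisation in logarithmic form. *)
Definition vlog a (X : nat) : R := \sum_(1 <= m < X.+1) \sum_(v <- Pr m)
  \sum_(1 <= k < X.+1) (ln (m%:R : R)) *+ dv (v ^+ k) a.

Lemma vlog_simb a a' X : O1 a -> O1 a' -> simb a a' -> vlog a X = vlog a' X.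
Proof.
move=> a1 a'1 aa'; apply: eq_bigr => m _; apply: eq_bigr => v _; apply: eq_bigr => k _.
by rewrite (dv_simbr _ _ _ aa') ?O1_n0.
Qed.

Lemma dvX_large v a k : prm v -> O1 a -> (NS a <= k)%N -> dv (v ^+ k) a = false.
Proof.
move=> /prmP[v1 v2 _] a1 ak; apply/negP => h.
have := dvdn_leq (NS_gt0 _) (dv_NS (O1X k v1) a1 h); rewrite O1NSX // => le.
by have := leq_trans (ltn_expl k v2) (leq_trans le ak); rewrite ltnn.
Qed.

Lemma vlog_mul_prime u a X : prm u -> cls u = u -> O1 a -> (NS u * NS a <= X)%N ->
  vlog (u * a) X = ln (NS u)%:R + vlog a X.
Proof.
move=> pu cu a1 uaX; have /prmP[u1 u2 up] := pu; have u0 := O1_n0 u1.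
have uX : (0 < NS u <= X)%N by rewrite NS_gt0 (leq_trans _ uaX) // leq_pmulr ?NS_gt0.
pose E m : R := \sum_(v <- Pr m) (ln (m%:R : R)) *+ (v == u).
have H m : \sum_(v <- Pr m) \sum_(1 <= k < X.+1) (ln (m%:R : R)) *+ dv (v ^+ k) (u * a) =
   E m + \sum_(v <- Pr m) \sum_(1 <= k < X.+1) (ln (m%:R : R)) *+ dv (v ^+ k) a.
  rewrite /E -big_split /=; rewrite big_seq [RHS]big_seq; apply: eq_bigr => v.
  rewrite mem_Pr => /and3P[pv /eqP cv /eqP vm].
  have [->|vu] := eqVneq v u; last first.
    rewrite mulr0n add0r; apply: eq_bigr => k _; rewrite dv_prime_pow //.
    apply: contra vu => vu; apply/eqP; rewrite -cv -cu.
    by apply: cls_eq => //; case/prmP: pv.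
  rewrite mulr1n big_nat_recl //; last by case/andP: uX => h1 h2; apply: leq_trans h2.
  rewrite expr1 dv_mulr ?O1_O // mulr1n; congr (_ + _).
  rewrite [RHS]big_nat_recr /=; last by case/andP: uX => h1 h2; apply: leq_trans h2.
  rewrite (@dvX_large u a X) ?mulr0n ?addr0 //; last by rewrite (leq_trans _ uaX) // leq_pmull ?NS_gt0.
  by apply: eq_bigr => k _; rewrite exprS dv_mul2l.
rewrite /vlog (eq_bigr _ (fun m _ => H m)) big_split /=; congr (_ + _).
rewrite (bigD1_seq (NS u)) ?iota_uniq ?mem_index_iota //=.
rewrite [X in _ + X]big1_seq ?addr0 => [|m /andP[mu _]]; last first.
  rewrite /E big1_seq // => v /andP[_]; rewrite mem_Pr => /and3P[_ _ /eqP vm].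
  by case: eqP => // vu; rewrite -vm vu eqxx in mu.
rewrite /E (bigD1_seq u) /=; last 2 first.
- by rewrite mem_Pr pu cu !eqxx.
- by rewrite filter_uniq ?uniq_lev.
by rewrite eqxx big1 ?addr0 // => v /negbTE ->.
Qed.

Lemma vlogE a X : O1 a -> (NS a <= X)%N -> vlog a X = ln (NS a)%:R.
Proof.
have [N] := ubnP (NS a); elim: N a => // N IH a aN a1 aX.
have [a2|a2] := leqP (NS a) 1.
  have Na : NS a = 1%N by apply/eqP; rewrite eqn_leq a2 NS_gt0.
  rewrite Na ln1 /vlog big1 // => m _; rewrite big1_seq // => v /andP[_].
  rewrite mem_Pr => /and3P[pv _ _]; rewrite big_nat_cond big1 // => k /andP[/andP[k1 _] _].
  by rewrite dvX_large // Na.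
have [v pv va] := prm_exists a1 a2; have pu := prm_cls pv.
have v1 : O1 v by case/prmP: pv.
have [u1 uv] := clsP v1; set u := cls v in pu u1 uv.
have u2 : (1 < NS u)%N by case/prmP: pu.
have ua : dv u a by rewrite (@dv_simbl _ v) ?O1_n0.
have [j [c [c1 cE]]] := dv_cofactor u1 a1 ua.
have Na := dv_cofactor_NS u1 a1 c1 cE.
have ac : simb a (u * c) by rewrite -cE simb_sym simb_MM.
rewrite (vlog_simb _ a1 (O1M u1 c1) ac) vlog_mul_prime ?cls_cls //; last by rewrite -Na.
have c0 := NS_gt0 c; have u0 := NS_gt0 u.
rewrite IH //; last 2 first.
- by rewrite ltnS in aN; apply: leq_trans aN; rewrite Na ltn_Pmull.
- by apply: leq_trans aX; rewrite Na leq_pmull.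
by rewrite -lnM ?posrE ?ltr0n // -natrM -Na.
Qed.

Definition Lam (d : nat) : R := \sum_(1 <= m < d.+1) \sum_(1 <= k < d.+1)
  ((prc m)%:R * ln m%:R) *+ (m ^ k == d)%N.

Lemma Lam_ge0 d : 0 <= Lam d.
Proof.
apply: sumr_ge0 => m _; apply: sumr_ge0 => k _; apply: mulrn_wge0.
by rewrite mulr_ge0 ?ln_nat_ge0.
Qed.

Lemma LamE d X : (d <= X)%N -> (1 < d)%N -> Lam d = \sum_(1 <= m < X.+1)
   \sum_(1 <= k < X.+1) ((prc m)%:R * ln (m%:R : R)) *+ (m ^ k == d)%N.
Proof.
move=> dX d1.
have out (F : nat -> R) : (forall i, (d < i)%N -> F i = 0) ->
    \sum_(1 <= i < d.+1) F i = \sum_(1 <= i < X.+1) F i.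
  move=> H; rewrite [RHS](@big_cat_nat _ _ _ d.+1) //=.
  by rewrite [X in _ + X]big_nat_cond [X in _ + X]big1 ?addr0 // => i /andP[/andP[/H]].
rewrite /Lam [RHS]big_nat_cond [LHS]big_nat_cond.
have mk m k : (0 < m)%N -> (0 < k)%N -> (m ^ k)%N = d -> (k <= d)%N /\ (m <= d)%N.
  move=> m0 k0 E; have m1 : (1 < m)%N.
    by rewrite ltn_neqAle m0 andbT; apply/eqP => m1; move: d1; rewrite -E -m1 exp1n.
  split; first by rewrite -E ltnW // ltn_expl.
  by rewrite -E -{1}[m]expn1 leq_pexp2l.
rewrite -!big_nat_cond (out (fun m => \sum_(1 <= k < d.+1)
  ((prc m)%:R * ln (m%:R : R)) *+ (m ^ k == d)%N)).
  rewrite [LHS]big_nat_cond [RHS]big_nat_cond; apply: eq_bigr => m /andP[/andP[m0 _] _].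
  apply: out => k dk; case: eqP => // E.
  by have [kd _] := mk m k m0 (leq_ltn_trans (leq0n _) dk) E; move: dk; rewrite ltnNge kd.
move=> m dm; rewrite big_nat_cond big1 // => k /andP[/andP[k0 _] _].
by case: eqP => // E; have [_ md] := mk m k (leq_ltn_trans (leq0n _) dm) k0 E; move: dm; rewrite ltnNge md.
Qed.

Lemma Lam1 : Lam 1 = 0.
Proof. by rewrite /Lam !big_nat1 ln1 mulr0 mul0rn. Qed.

Definition bR (m : nat) : R := (bcl m)%:R.

(** Summing [ln (NS a) = vlog a] over the classes [a] of norm [m] and exchanging sums, the multiples
    of each [v^k] are counted by [count_multiples]. *)
Lemma dlog_bR m : (0 < m)%N -> dlog bR m = dconv Lam bR m.
Proof.
move=> m0; have -> : dlog bR m = \sum_(a <- lev m) vlog a m.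
  rewrite (@eq_big_seq _ _ _ _ _ (fun a => vlog a m) (fun=> ln (m%:R : R))); last first.
    by move=> a; rewrite mem_lev => /and3P[a1 _ /eqP am]; rewrite vlogE ?am.
  by rewrite big_const_seq count_predT iter_addr_0 /dlog /bR /bcl mulr_natl.
pose W (p k : nat) : R := ln p%:R *+ (if (p ^ k %| m)%N then bcl (m %/ p ^ k) else 0%N).
transitivity (\sum_(1 <= p < m.+1) \sum_(1 <= k < m.+1) W p k *+ prc p).
  rewrite /vlog exchange_big; apply: eq_bigr => p _ /=.
  rewrite exchange_big /= (@eq_big_seq _ _ _ _ _ _ (fun v => \sum_(1 <= k < m.+1) W p k)).
    rewrite big_const_seq count_predT iter_addr_0 -sumrMnl /prc.
    by apply: eq_bigr => k _.
  move=> v; rewrite mem_Pr => /and3P[pv _ /eqP vp]; rewrite exchange_big.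
  apply: eq_bigr => k _; have v1 : O1 v by case/prmP: pv.
  rewrite /W -vp -(O1NSX k v1) -count_multiples ?O1X // vp.
  rewrite -sum1_count -sumrMnr.
  by rewrite [RHS]big_mkcond; apply: eq_bigr => a _; case: (dv _ _).
rewrite /dconv.
transitivity (\sum_(1 <= d < m.+1) \sum_(1 <= j < m.+1) \sum_(1 <= p < m.+1)
   \sum_(1 <= k < m.+1) ((ln (p%:R : R) *+ prc p * bR j) *+ (d * j == m)%N) *+ (p ^ k == d)%N);
  last first.
  rewrite [LHS]big_nat_cond [RHS]big_nat_cond; apply: eq_bigr => d /andP[/andP[d0 dm] _].
  apply: eq_bigr => j _; have [d1|d1] := leqP d 1.
    have -> : d = 1%N by apply/eqP; rewrite eqn_leq d1 d0.
    rewrite Lam1 mul0r mul0rn big_nat_cond big1 // => p /andP[/andP[p0 _] _].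
    rewrite big_nat_cond big1 // => k /andP[/andP[k0 _] _].
    case: (p ^ k =P 1)%N => // E; have -> : p = 1%N.
      by apply/eqP; rewrite eqn_leq p0 andbT -[leqRHS]E -{1}[p]expn1 leq_pexp2l.
    by rewrite ln1 mul0rn mul0r mul0rn.
  rewrite (@LamE d m) // mulr_suml -sumrMnl; apply: eq_bigr => p _.
  rewrite mulr_suml -sumrMnl; apply: eq_bigr => k _.
  by rewrite mulrnAl mulrnAC mulr_natl.
rewrite [RHS](eq_bigr _ (fun d _ => exchange_big _ _ _ _ _ _)) /= [RHS]exchange_big /=.
rewrite [LHS]big_nat_cond [RHS]big_nat_cond; apply: eq_bigr => p /andP[/andP[p0 _] _].
rewrite [RHS](eq_bigr _ (fun d _ => exchange_big _ _ _ _ _ _)) /= [RHS]exchange_big /=.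
apply: eq_bigr => k _; rewrite exchange_big /=.
transitivity (\sum_(1 <= j < m.+1) (ln (p%:R : R) *+ prc p * bR j) *+ (p ^ k * j == m)%N);
  last first.
  rewrite [LHS]big_nat_cond [RHS]big_nat_cond; apply: eq_bigr => j /andP[/andP[j0 _] _].
  rewrite (eq_bigr (fun d => ((ln (p%:R : R) *+ prc p * bR j) *+ (p ^ k * j == m)%N) *+ (p ^ k == d)%N)).
    rewrite sum_nat_delta ?expn_gt0 ?p0 //; case: eqP => [E|]; last by rewrite !mul0rn.
    by rewrite (_ : (p ^ k <= m)%N) // -E leq_pmulr.
  by move=> d _; case: (_ =P d) => [->|]; rewrite ?mulr0n.
rewrite /W; have pk0 : (0 < p ^ k)%N by rewrite expn_gt0 p0.
case: ifP => [/dvdnP[q E]|ndv]; last first.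
  rewrite mulr0n mul0rn big1 // => j _; case: eqP => // E.
  by move: ndv; rewrite -E dvdn_mulr.
have q0 : (0 < q)%N by move: m0; rewrite E muln_gt0 => /andP[].
have -> : (m %/ p ^ k = q)%N by rewrite E mulnK.
rewrite (eq_bigr (fun j => (ln (p%:R : R) *+ prc p * bR q) *+ (q == j)%N)); last first.
  move=> j _; rewrite E mulnC eqn_pmul2r // eq_sym; by case: eqP => [->|].
rewrite sum_nat_delta // (_ : (q <= m)%N); last by rewrite E leq_pmulr.
by rewrite mulr1n /bR mulr_natr mulrnAC.
Qed.

End Valuations.


Lemma dv_an v : O1 v -> dv v (an v)%:R.
Proof.
move=> v1; apply/dvP/OS_O; have vO := O1_O v1; rewrite mulr_natl -scaler_nat -(anE vO).
case: (ger0P (nm v)) => _; first exact: isO_nm_inv.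
by rewrite scaleNr -sub0r; apply: isO_sub; [exact: isO0 | exact: isO_nm_inv].
Qed.

Lemma O1_nat (m : nat) : (0 < m)%N -> O1 m%:R.
Proof.
move=> m0; rewrite /O1 isO_nat -(scaler_nat m (1 : L)) scaler_eq0 oner_eq0 orbF.
by rewrite pnatr_eq0 -lt0n.
Qed.

(** A prime element divides its own integer norm, hence one of the rational prime factors [p] of it;
    [p] is not inverted, for otherwise [v] would divide a unit. *)
Lemma prm_dv_prime v : prm v -> exists p, [/\ prime p, dv v p%:R & NS p%:R = (p ^ D)%N].
Proof.
move=> pv; have /prmP[v1 v2 vp] := pv.
suff [p [pp vdp]] : exists p, prime p /\ dv v p%:R.
  exists p; split=> //; have p0 := prime_gt0 pp; rewrite NS_nat //.
  have [ppi|] := boolP (p \in \pi(MM)); last first.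
    by move=> npi; rewrite part_pnat_id // pnatE //.
  have := dv_NS v1 (O1_nat p0) vdp; rewrite NS_nat // part_p'nat; last first.
    by rewrite pnatNK pnatE.
  by rewrite exp1n dvdn1 => /eqP vE; rewrite vE in v2.
have := dv_an v1; have := an_gt0 (O1_O v1) (O1_n0 v1); move: (an v) => m.
have [N] := ubnP m; elim: N m => // N IH m mN m0 vm.
have [m1|m1] := leqP m 1.
  have E : m = 1%N by apply/eqP; rewrite eqn_leq m1 m0.
  have := dv_NS v1 O11; rewrite E in vm; move=> /(_ vm); rewrite NS1 dvdn1 => /eqP vE.
  by rewrite vE in v2.
have pp := pdiv_prime m1; have pm := pdiv_dvd m.
have q0 : (0 < m %/ pdiv m)%N by rewrite divn_gt0 ?prime_gt0 // pdiv_leq.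
have := vp _ _ (O1_nat (prime_gt0 pp)) (O1_nat q0).
rewrite -natrM mulnC divnK // => /(_ vm)/orP[h|h]; first by exists (pdiv m).
apply: IH h => //; rewrite ltnS in mN; apply: leq_trans mN.
by rewrite ltn_Pdiv ?prime_gt1.
Qed.

Lemma prm_norm v : prm v -> exists p f, [/\ prime p, (0 < f)%N, NS v = (p ^ f)%N & dv v p%:R].
Proof.
move=> pv; have [p [pp vp Np]] := prm_dv_prime pv; have /prmP[v1 v2 _] := pv.
have := dv_NS v1 (O1_nat (prime_gt0 pp)) vp; rewrite Np => /(dvdn_pfactor _ _ pp)[f _ E].
by exists p, f; split=> //; case: f E => // E; rewrite E in v2.
Qed.

Section PrimeCount.
Variable R : realType.

(** The primes of norm [m = p^f] all divide the same [p], and [vlogE] applied to [p], of norm [p^D],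
    leaves room for at most [D] of them. *)
Lemma prc_le m : (prc m <= D)%N.
Proof.
case E: (Pr m) => [|v0 s]; first by rewrite /prc E.
have : v0 \in Pr m by rewrite E mem_head.
rewrite mem_Pr => /and3P[pv0 _ /eqP vm].
have [p [f [pp f0 vE _]]] := prm_norm pv0; have p0 := prime_gt0 pp.
have mE : m = (p ^ f)%N by rewrite -vm.
have m1 : (1 < m)%N by rewrite -vm; case/prmP: pv0.
have pm : (p <= m)%N by rewrite mE -{1}[p]expn1 leq_pexp2l.
have dvp v : v \in Pr m -> dv v p%:R.
  rewrite mem_Pr => /and3P[pv _ /eqP vm'].
  have [q [g [qq g0 vE' vq]]] := prm_norm pv.
  suff -> : p = q by [].
  have : (p %| q ^ g)%N by rewrite -vE' vm' mE dvdn_exp.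
  by rewrite Euclid_dvdX // g0 andbT => /(prime_nt_dvdP qq) -> //; rewrite gtn_eqF ?prime_gt1.
have p1 := O1_nat p0; have Np : NS p%:R = (p ^ D)%N.
  have [q [qq vq Nq]] := prm_dv_prime pv0.
  suff <- : q = p by [].
  have := dv_NS _ (O1_nat (prime_gt0 qq)) vq; rewrite Nq => /(_ _) H.
  have : (p %| q ^ D)%N.
    by apply: dvdn_trans (H _); [rewrite vm mE dvdn_exp | case/prmP: pv0].
  by rewrite Euclid_dvdX // andbT => /(prime_nt_dvdP qq) -> //; rewrite gtn_eqF ?prime_gt1.
pose X := maxn m (p ^ D).
have := @vlogE R p%:R X p1; rewrite Np leq_maxr => /(_ isT) H.
have lm : 0 < ln (m%:R : R) by apply: ln_nat_gt0.
rewrite -(ler_nat R) -(ler_pM2r lm).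
apply: le_trans (_ : ln (p ^ D)%:R <= _); last first.
  rewrite natrX lnXn ?ltr0n // -[leLHS]mulr_natl ler_wpM2l //.
  exact: ler_ln_nat.
rewrite -H /vlog (bigD1_seq m) ?iota_uniq ?mem_index_iota //=; last first.
  by rewrite ltnW // ltnS leq_maxl.
apply: le_trans (_ : \sum_(v <- Pr m) ln (m%:R : R) <= _).
  by rewrite big_const_seq count_predT iter_addr_0 /prc mulr_natl.
apply: le_trans (_ : \sum_(v <- Pr m) \sum_(1 <= k < X.+1)
     ln m%:R *+ dv (v ^+ k) p%:R <= _); last first.
  rewrite lerDl; apply: sumr_ge0 => i _; apply: sumr_ge0 => v _.
  by apply: sumr_ge0 => k _; apply: mulrn_wge0; apply: ln_nat_ge0.
rewrite big_seq [leRHS]big_seq; apply: ler_sum => v vP.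
rewrite big_ltn; last by rewrite ltnS; apply: leq_trans (leq_maxl _ _); apply: ltnW.
rewrite expr1 dvp // mulr1n lerDl; apply: sumr_ge0 => k _.
by apply: mulrn_wge0; apply: ln_nat_ge0.
Qed.

Lemma prc_prime p : prime p -> prc p = bcl p.
Proof.
move=> pp; rewrite /prc /bcl /Pr; congr size; apply/all_filterP/allP => v.
rewrite mem_lev => /and3P[v1 _ /eqP vp].
have v2 : (1 < NS v)%N by rewrite vp prime_gt1.
have [u pu uv] := prm_exists v1 v2; have /prmP[u1 u2 up] := pu.
have Nuv : NS u = NS v.
  by have := dv_NS u1 v1 uv; rewrite vp => /(prime_nt_dvdP pp) -> //; rewrite gtn_eqF.
have uvs : simb v u by rewrite /simb uv (dv_antisym_NS u1 v1 uv Nuv).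
apply/prmP; split=> // a b a1 b1.
by rewrite !(dv_simbl _ _ _ uvs) ?O1_n0 //; apply: up.
Qed.

Lemma Lam_prime p : prime p -> Lam R p = (bcl p)%:R * ln p%:R.
Proof.
move=> pp; rewrite /Lam; have p1 := prime_gt1 pp; have p0 := prime_gt0 pp.
rewrite (bigD1_seq p) /=; [|by rewrite mem_index_iota p0 ltnS leqnn|exact: iota_uniq].
rewrite [X in _ + X]big1_seq ?addr0 => [|m /andP[mp]]; last first.
  rewrite mem_index_iota => /andP[m0 _]; rewrite big_nat_cond big1 // => k.
  case/andP=> /andP[k0 _] _; case: eqP => // E; exfalso.
  have : (m %| p)%N by rewrite -E dvdn_exp.
  move: pp => /primeP[_ H] /H /orP[/eqP m1|/eqP mp']; last by rewrite mp' eqxx in mp.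
  by move: p1; rewrite -E m1 exp1n.
rewrite (bigD1_seq 1%N) /=; [|by rewrite mem_index_iota ltnS|exact: iota_uniq].
rewrite expn1 eqxx mulr1n prc_prime // big1_seq ?addr0 // => k /andP[k1].
rewrite mem_index_iota => /andP[k0 _]; case: eqP => // E; exfalso.
by move/eqP: E; rewrite -[X in _ == X]expn1 eqn_exp2l // (negbTE k1).
Qed.

Lemma Lam_le d X : (1 < d <= X)%N -> Lam R d <= D%:R * ln X%:R * (trunc_log 2 X)%:R.
Proof.
move=> /andP[d1 dX]; have d0 : (0 < d)%N by apply: ltnW.
have X1 : (1 < X)%N by apply: leq_trans dX.
have lX : 0 <= ln (X%:R : R) by apply: ln_nat_ge0.
rewrite (@LamE R d X) // exchange_big /=.
apply: le_trans (_ : \sum_(1 <= k < X.+1) (D%:R * ln X%:R) *+ (k <= trunc_log 2 X)%N <= _).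
  rewrite big_nat_cond [leRHS]big_nat_cond; apply: ler_sum => k /andP[/andP[k0 kX] _].
  case: (leqP k (trunc_log 2 X)) => kl; last first.
    rewrite mulr0n big_nat_cond big1 // => m /andP[/andP[m0 _] _].
    case: eqP => // E; have m1 : (1 < m)%N.
      by rewrite ltn_neqAle m0 andbT; apply/eqP => m1; move: d1; rewrite -E -m1 exp1n.
    have : (2 ^ k <= X)%N by apply: leq_trans dX; rewrite -E leq_exp2r.
    move=> h; have := trunc_log_max (isT : 1 < 2)%N h; by rewrite leqNgt kl.
  rewrite mulr1n.
  have [[m m0 E]|no] := pselect (exists2 m, (0 < m)%N & (m ^ k = d)%N); last first.
    rewrite big_nat_cond big1 ?mulr_ge0 // => m /andP[/andP[m0 _] _].
    by case: eqP => // E; exfalso; apply: no; exists m.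
  rewrite (eq_bigr (fun j => ((prc j)%:R * ln (j%:R : R)) *+ (j == m)%N)); last first.
    by move=> j _; rewrite -E eqn_exp2r.
  rewrite (eq_bigr (fun j => ((prc m)%:R * ln (m%:R : R)) *+ (m == j)%N)); last first.
    by move=> j _; rewrite eq_sym; case: eqP => [->|].
  rewrite sum_nat_delta //; have mX : (m <= X)%N.
    by apply: leq_trans dX; rewrite -E -{1}[m]expn1 leq_pexp2l.
  rewrite mX mulr1n; apply: ler_pM; rewrite ?ln_nat_ge0 ?ler_nat ?prc_le //.
  exact: ler_ln_nat.
set l := trunc_log 2 X; have lX' : (l <= X)%N.
  have := trunc_logP (isT : 1 < 2)%N (ltnW X1); rewrite -/l => h.
  by apply: ltnW; apply: leq_trans h; apply: ltn_expl.
rewrite (@big_cat_nat _ _ _ l.+1) //= [X in _ + X]big_nat_cond [X in _ + X]big1 ?addr0 => [|k /andP[/andP[lk _] _]].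
  rewrite (eq_big_nat _ _ (F2 := fun=> D%:R * ln X%:R)) => [|k /andP[_]].
    by rewrite sumr_const_nat subn1 /= mulr_natr.
  by rewrite ltnS => ->.
by rewrite leqNgt lk.
Qed.

Lemma Lam_nonprime d : ~~ prime d -> (1 < d)%N -> Lam R d != 0 ->
  exists y a, [/\ (1 < y)%N, (1 < a)%N & d = (y ^ a)%N].
Proof.
move=> nd d1 L0; have [//|no] := pselect (exists y a, [/\ (1 < y)%N, (1 < a)%N & d = (y ^ a)%N]).
case/eqP: L0; rewrite /Lam big_nat_cond big1 // => m /andP[/andP[m0 _] _].
rewrite big_nat_cond big1 // => k /andP[/andP[k0 _] _]; case: eqP => // E.
rewrite mulr1n /prc; case EP: (Pr m) => [|v s]; first by rewrite mul0r.
have : v \in Pr m by rewrite EP mem_head.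
rewrite mem_Pr => /and3P[pv _ /eqP vm]; have [p [f [pp f0 vE _]]] := prm_norm pv.
exfalso; apply: no; exists p, (f * k)%N; have dE : d = (p ^ (f * k))%N by rewrite expnM -vE vm E.
split=> //; first exact: prime_gt1.
rewrite ltn_neqAle eq_sym muln_gt0 f0 k0 !andbT; apply: contra nd => /eqP fk.
by rewrite dE fk expn1.
Qed.

(** Norms of primes are powers of rational primes, so away from the primes [Lam] lives on perfect
    powers [y^a] with [a >= 2]. There are at most the square root of [X] times [trunc_log 2 X] pairs
    [(y, a)], and [Lam_le] bounds each term. *)
Lemma sum_Lam_nonprime X : (1 < X)%N ->
  summ (fun d => Lam R d *+ ~~ prime d) X <=
  D%:R * ln X%:R * (trunc_log 2 X)%:R ^+ 2 * Num.sqrt X%:R.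
Proof.
move=> X1; have [s /andP[s1 s2]] := root_floor X (isT : 0 < 2)%N.
set l := trunc_log 2 X; pose E : R := D%:R * ln X%:R * l%:R.
have E0 : 0 <= E by rewrite !mulr_ge0 ?ln_nat_ge0.
apply: le_trans (_ : \sum_(1 <= d < X.+1) \sum_(1 <= y < s.+1) \sum_(1 <= a < l.+1)
   E *+ (y ^ a == d)%N <= _).
  rewrite /summ; apply: ler_sum_nat => d /andP[d0 dX].
  have nn : 0 <= \sum_(1 <= y < s.+1) \sum_(1 <= a < l.+1) E *+ (y ^ a == d)%N.
    by apply: sumr_ge0 => y _; apply: sumr_ge0 => a _; apply: mulrn_wge0.
  have [pd|pd] := boolP (prime d); first by rewrite mulr0n.
  rewrite mulr1n; have [d1|d1] := leqP d 1.
    by move: nn; have -> : d = 1%N by [apply/eqP; rewrite eqn_leq d1 d0]; rewrite Lam1.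
  have [->//|L0] := eqVneq (Lam R d) 0.
  have [y [a [y1 a1 dE]]] := Lam_nonprime pd d1 L0.
  rewrite ltnS in dX; apply: le_trans (Lam_le (_ : 1 < d <= X)%N) _; first by rewrite d1.
  have al : (a <= l)%N.
    by apply: trunc_log_max => //; apply: leq_trans dX; rewrite dE leq_exp2r //; apply: ltnW.
  have ys : (y <= s)%N.
    rewrite -ltnS -(@ltn_exp2r _ _ 2) //; apply: leq_ltn_trans s2.
    by apply: leq_trans dX; rewrite dE leq_exp2l.
  rewrite (bigD1_seq y) /=; [|by rewrite mem_index_iota ltnS ys ltnW|exact: iota_uniq].
  rewrite (bigD1_seq a) /=; [|by rewrite mem_index_iota ltnS al ltnW|exact: iota_uniq].
  rewrite -dE eqxx mulr1n -/l -/E -addrA lerDl addr_ge0 //.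
    by apply: sumr_ge0 => *; apply: mulrn_wge0.
  by apply: sumr_ge0 => *; apply: sumr_ge0 => *; apply: mulrn_wge0.
rewrite exchange_big /=.
apply: le_trans (_ : \sum_(1 <= y < s.+1) \sum_(1 <= a < l.+1) E <= _).
  apply: ler_sum_nat => y /andP[y0 _]; rewrite exchange_big /=; apply: ler_sum_nat => a _.
  by rewrite sum_nat_delta ?expn_gt0 ?y0 //; case: leqP => _; rewrite ?mulr1n ?mulr0n.
rewrite !sumr_const_nat !subn1 /= -mulrnA -[leLHS]mulr_natr natrM.
rewrite [leRHS](_ : _ = E * (l%:R * Num.sqrt X%:R)); last by rewrite /E; ring.
rewrite ler_wpM2l // ler_wpM2l // -[s%:R]ger0_norm // -sqrtr_sqr ler_sqrt //.
by rewrite -natrX ler_nat.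
Qed.

End PrimeCount.


(** * Weights on representatives and the lattice-point count *)

Lemma sum_delta (V : nmodType) (a : V) k x : (0 < k)%N ->
  \sum_(1 <= j < x.+1) a *+ (k == j)%N = a *+ (k <= x)%N.
Proof.
move=> k0; elim: x => [|x IH]; first by rewrite big_geq // leqNgt k0.
rewrite big_nat_recr //= IH -mulrnDr [(k <= x.+1)%N]leq_eqVlt ltnS; congr (_ *+ _).
by case: eqP => [->|_]; rewrite ?ltnn ?addn0.
Qed.

Lemma elDZ z y (c : int) : el (z + c *: y) = el z + c%:~R *: el y.
Proof.
by apply: crd_inj; rewrite crdD crdZ !crd_el; apply/rowP => i; rewrite !mxE rmorphD rmorphM.
Qed.

(** A continuous cut-off on representatives: zero unless [ht^D < 2 NS], and at least 1 on the
    representative from [short_rep]. Dividing by its sum over the class ([Wt]) counts each class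
    once without a fundamental domain. *)
Definition wt v : rat := Num.max 0 (2 - ht v ^+ D / (NS v)%:R).

Lemma wt_ge0 v : 0 <= wt v. Proof. by rewrite /wt le_max lexx. Qed.

Let NSr_gt0 v : 0 < (NS v)%:R :> rat. Proof. by rewrite ltr0n NS_gt0. Qed.

Lemma wt_gt0 v : (0 < wt v) = (ht v ^+ D < 2 * (NS v)%:R).
Proof. by rewrite /wt lt_max ltxx subr_gt0 ltr_pdivrMr. Qed.

(** The norm is at most [cC ht^D < 2 cC NS], and its quotient by [NS] is its [MM]-part. *)
Lemma wt_smooth v : O1 v -> 0 < wt v ->
  an v = ((an v)`_(\pi(MM)) * NS v)%N /\ ((an v)`_(\pi(MM)) < 2 * cC)%N.
Proof.
move=> v1; rewrite wt_gt0 => h; have vO := O1_O v1.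
have E : an v = ((an v)`_(\pi(MM)) * NS v)%N by rewrite partnC // an_gt0 // O1_n0.
split=> //; have := nm_le v; rewrite anE // => h2.
have : ((an v)%:R : rat) < (2 * cC * NS v)%:R.
  apply: le_lt_trans h2 _; rewrite -mulnA mulnCA natrM ltr_pM2l; last first.
    exact: lt_le_trans ltr01 cC_ge1.
  by rewrite natrM.
by rewrite ltr_nat {1}E ltn_pmul2r // NS_gt0.
Qed.

(** Bounds for the quotients of two associated elements of positive weight: [Qz] is a common
    denominator, since the [MM]-part of the norm is below [2 cC], and [2 cC^2] bounds their height.
    Hence the finite list [units], read off from the box of side [TE]. *)
Definition Qz : nat := (2 * cC)`!.
Definition TE : nat := (Qz * (2 * cC ^ 2))%N.
Definition units : seq L :=
  [seq u <- [seq Qz%:R^-1 *: el z | z <- box TE] | (u != 0) && `[< OS u /\ OS u^-1 >] ].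

Let Qz_gt0 : 0 < Qz%:R :> rat. Proof. by rewrite ltr0n fact_gt0. Qed.
Let Qz_n0 : Qz%:R != 0 :> rat. Proof. by rewrite gt_eqF. Qed.

Lemma mem_units u : reflect
  [/\ u != 0, OS u, OS u^-1, isO (Qz%:R *: u) & ht u <= (2 * cC ^ 2)%:R] (u \in units).
Proof.
rewrite mem_filter; apply: (iffP andP) => [[/andP[u0 /asboolP[u1 u2]] /mapP[z zb E]]|[u0 u1 u2 uO uh]].
  split=> //; first by rewrite E scalerA divff // scale1r isO_el.
  rewrite -ht_el_le in zb; rewrite E htZ ger0_norm ?invr_ge0 //.
  by rewrite mulrC ler_pdivrMr // (le_trans zb) // /TE natrM mulrC.
split; first by rewrite u0; apply/asboolP.
have [z E] := isOP uO; apply/mapP; exists z; last by rewrite -E scalerA mulVf // scale1r.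
by rewrite -ht_el_le -E htZ ger0_norm ?ler0n // /TE natrM ler_wpM2l // ler0n.
Qed.

Lemma uniq_units : uniq units.
Proof.
apply: filter_uniq; rewrite map_inj_uniq ?uniq_box // => z z' /(congr1 (fun v => Qz%:R *: v)).
by rewrite !scalerA divff // !scale1r => /el_inj.
Qed.

Lemma isO_bezout v (a b : nat) : coprime a b -> isO (a%:R *: v) -> isO (b%:R *: v) -> isO v.
Proof.
case: a => [|a] cab aO bO.
  by move: cab; rewrite /coprime gcd0n => /eqP b1; rewrite b1 scale1r in bO.
have [x y E _] := egcdnP b (ltn0Sn a); move: E; rewrite (eqP cab) => E.
have -> : v = x%:R *: (a.+1%:R *: v) - y%:R *: (b%:R *: v).
  by rewrite !scalerA -!natrM E -scalerBl natrD addrAC subrr add0r scale1r.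
by apply: isO_sub; apply: isO_natZ.
Qed.

(** With [s] the [MM]-part of the norm of [v], both a power of [MM] and [NS v] carry [s w/v] into
    the order; being coprime, they show that [s w/v] is already there, and [s] divides [Qz]. The
    height follows from writing [w/v] as [w] times [nm v / v], divided by the norm. *)
Lemma units_ratio v w : O1 v -> O1 w -> simb v w -> 0 < wt v -> 0 < wt w -> w / v \in units.
Proof.
move=> v1 w1 vw vt wt0; have vO := O1_O v1; have v0 := O1_n0 v1.
have [vE sv] := wt_smooth v1 vt; have Nvw := simb_NS v1 w1 vw.
have nm0' : nm v != 0 by rewrite nm_eq0.
have O_inv : isO ((an v)%:R *: (w / v)).
  rewrite -(anE vO) scalerAr; apply: isO_mul; first exact: O1_O.
  case: (ger0P (nm v)) => _; first exact: isO_nm_inv.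
  by rewrite scaleNr -sub0r; apply: isO_sub; [exact: isO0 | exact: isO_nm_inv].
have /andP[/dvP dvw /dvP dwv] := vw.
apply/mem_units; split=> //; first by rewrite mulf_neq0 ?invr_eq0 // O1_n0.
- by rewrite invf_div.
- have [j jO] := dvw; set s := ((an v)`_(\pi(MM)))%N in vE sv.
  have sO : isO (s%:R *: (w / v)).
    apply: (@isO_bezout _ (MM ^ j) (NS v)).
    - apply: coprimeXl; rewrite coprime_pi' ?NS_gt0 ?MM_gt0 //; exact: part_pnat.
    - by rewrite scalerA mulrC -scalerA; apply: isO_natZ.
    - by rewrite scalerA -natrM mulnC -vE.
  have /dvdnP[k kE] : (s %| Qz)%N by apply: dvdn_fact; rewrite part_gt0 ltnW.
  by rewrite kE natrM -scalerA; apply: isO_natZ.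
have MD : Num.max (ht v) (ht w) ^+ D <= 2 * (NS v)%:R.
  have hv : ht v ^+ D <= 2 * (NS v)%:R by apply: ltW; rewrite -wt_gt0.
  have hw : ht w ^+ D <= 2 * (NS v)%:R by rewrite Nvw; apply: ltW; rewrite -wt_gt0.
  by rewrite /Num.max; case: ifP.
have -> : w / v = (nm v)^-1 *: (w * (nm v *: v^-1)).
  by rewrite -scalerAr scalerA mulVf // scale1r.
rewrite htZ normfV (anE vO) mulrC ler_pdivrMr; last by rewrite ltr0n an_gt0.
apply: le_trans (ht_mul _ _) _.
apply: le_trans (_ : cC%:R * (cC%:R * Num.max (ht v) (ht w) ^+ D) <= _).
  rewrite ler_wpM2l // exprS mulrCA; apply: ler_pM; rewrite ?ht_ge0 ?le_max ?lexx ?orbT //.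
  apply: le_trans (ht_nm_inv _) _; rewrite ler_wpM2l // lerXn2r ?nnegrE ?ht_ge0 ?le_max ?lexx //.
  by rewrite ht_ge0.
rewrite mulrA -expr2 -natrX; apply: le_trans (ler_wpM2l _ MD) _ => //.
rewrite mulrA [_ * 2]mulrC -[2]/(2%:R) -natrM ler_wpM2l // ler_nat.
by apply: dvdn_leq; [apply: an_gt0 | apply: NS_dvd].
Qed.

Definition Wt v : rat := \sum_(u <- units | isO (u * v)) wt (u * v).

Lemma unit_simb u v : u \in units -> O1 v -> isO (u * v) -> O1 (u * v) /\ simb v (u * v).
Proof.
move=> /mem_units[u0 u1 u2 _ _] v1 uvO; have v0 := O1_n0 v1.
split; first by rewrite /O1 uvO mulf_neq0.
by apply/andP; split; apply/dvP; [rewrite mulfK | rewrite invfM mulrCA divff // mulr1].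
Qed.

Lemma Wt_ge1 v : O1 v -> 0 < wt v -> 1 <= Wt v.
Proof.
move=> v1 vt; have v0 := O1_n0 v1.
have [w [wO w0 [sw1 sw2] wh]] := short_rep (O1_O v1) v0.
have w1 : O1 w by rewrite /O1 wO.
have vw : simb v w by apply/andP; split; apply/dvP.
have wt1 : 1 <= wt w.
  rewrite /wt le_max; apply/orP; right; rewrite lerBrDr -lerBrDl (_ : 2 - 1 = 1) //.
  by rewrite ler_pdivrMr // mul1r -(simb_NS v1 w1 vw).
have uu := units_ratio v1 w1 vw vt (lt_le_trans ltr01 wt1).
rewrite /Wt big_mkcond (bigD1_seq (w / v)) ?uniq_units //= divfK // wO.
by apply: le_trans wt1 _; rewrite lerDl sumr_ge0 // => *; case: ifP => // _; exact: wt_ge0.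
Qed.

(** On representatives of positive weight [Wt] is constant: by [units_ratio] the list [units] runs
    exactly once through all of them. They lie in the box because [ht^D < 2m <= (2Y)^D]. *)
Lemma class_weight c m Y : c \in lev m -> (0 < m <= Y ^ D)%N ->
  \sum_(z <- box (2 * Y) | O1 (el z) && (cls (el z) == c)) wt (el z) / Wt (el z) = 1.
Proof.
rewrite mem_lev => /and3P[c1 /eqP cc /eqP cm] /andP[m0 mY].
pose P z := O1 (el z) && (cls (el z) == c).
pose S := \sum_(z <- box (2 * Y) | P z) wt (el z).
have inbox v : O1 v -> NS v = m -> 0 < wt v -> ht v <= (2 * Y)%:R.
  move=> v1 Nv; rewrite wt_gt0 Nv => h; rewrite leNgt; apply/negP => h2.
  have : ((2 * Y)%:R : rat) ^+ D < 2 * m%:R.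
    by apply: le_lt_trans h; rewrite lerXn2r ?nnegrE ?ht_ge0 // ltW.
  rewrite -natrX -[2]/(2%:R) -natrM ltr_nat ltnNge expnMn leq_mul //.
  by rewrite -{1}[2%N]expn1 leq_pexp2l.
have PS z : P z -> 0 < wt (el z) -> Wt (el z) = S.
  move=> /andP[z1 /eqP zc] zt; have z0 := O1_n0 z1.
  rewrite /Wt (bigID (fun u => 0 < wt (u * el z))) /= [X in _ + X]big1 ?addr0; last first.
    by move=> u /andP[_]; rewrite -leNgt => h; apply/eqP; rewrite eq_le h wt_ge0.
  rewrite /S [RHS](bigID (fun z => 0 < wt (el z))) /= [X in _ = _ + X]big1 ?addr0; last first.
    by move=> u /andP[_]; rewrite -leNgt => h; apply/eqP; rewrite eq_le h wt_ge0.
  rewrite -big_filter -[RHS]big_filter.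
  rewrite -(big_map (fun u => u * el z) xpredT wt) -[RHS](big_map el xpredT wt).
  apply: perm_big; apply: uniq_perm.
  - by rewrite map_inj_uniq; [exact: filter_uniq uniq_units | move=> x y /(mulIf z0)].
  - by rewrite map_inj_uniq; [exact: filter_uniq (uniq_box _) | exact: el_inj].
  move=> v; apply/mapP/mapP => [[u]|[y]].
    rewrite mem_filter => /andP[/andP[uO ut] uu ->].
    have [uz1 uz] := unit_simb uu z1 uO; have [y yE] := isOP uO.
    exists y => //; rewrite mem_filter -ht_el_le -yE ut /P -yE uz1 /=.
    rewrite -(cls_eq z1 uz1 uz) zc eqxx /=; apply: inbox => //.
    by rewrite -(simb_NS z1 uz1 uz) -cm -zc NS_cls.
  rewrite mem_filter => /andP[/andP[/andP[y1 /eqP yc] yt] yb] ->.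
  exists (el y / el z); last by rewrite divfK.
  rewrite mem_filter divfK // O1_O // yt /=; apply: units_ratio => //.
  by apply: cls_inj => //; rewrite zc yc.
have S1 : S != 0.
  have [w [wO w0 [sw1 sw2] wh]] := short_rep (O1_O c1) (O1_n0 c1).
  have w1 : O1 w by rewrite /O1 wO.
  have wc : simb w c by apply/andP; split; apply/dvP.
  have wt1 : 0 < wt w.
    rewrite wt_gt0 (simb_NS w1 c1 wc); apply: le_lt_trans wh _.
    by rewrite ltr_pMl // ltr1n.
  have [y yE] := isOP wO; rewrite /S big_mkcond (bigD1_seq y) ?uniq_box //=; last first.
    by rewrite -ht_el_le -yE inbox // (simb_NS w1 c1 wc).
  rewrite /P -yE w1 (cls_eq w1 c1 wc) cc eqxx /= gt_eqF //.
  by apply: ltr_wpDr => //; apply: sumr_ge0 => *; case: ifP => // _; exact: wt_ge0.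
rewrite (eq_bigr (fun z => wt (el z) / S)) => [|z Pz]; first by rewrite -mulr_suml divff.
have := wt_ge0 (el z); rewrite le_eqVlt => /orP[/eqP <-|zt]; first by rewrite !mul0r.
by rewrite (PS z).
Qed.

Definition kap (t : rat) : rat := Num.max 0 (1 - t).

(** With [t = NS / Y^D], the factor [t] removes the denominator of [wt]: [t wt] is the tent
    [max 0 (2t - ht^D)] at the scaled point, Lipschitz even near 0, and [frac_lipschitz] handles the
    quotient by [t Wt]. The factor [kap] ends the count continuously at norm [Y^D]. *)
Definition Gw (Y : nat) z : rat :=
  if O1 (el z) then wt (el z) / Wt (el z) *
    ((NS (el z))%:R / Y%:R ^+ D * kap ((NS (el z))%:R / Y%:R ^+ D)) else 0.

Definition Vol (Y : nat) : rat := \sum_(z <- box (2 * Y)) Gw Y z.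

Lemma VolE Y : (0 < Y)%N -> Vol Y = \sum_(1 <= m < (Y ^ D).+1)
  (bcl m)%:R * (m%:R / Y%:R ^+ D * (1 - m%:R / Y%:R ^+ D)).
Proof.
move=> Y0; pose kk (m : nat) : rat := m%:R / Y%:R ^+ D * kap (m%:R / Y%:R ^+ D).
have YD : 0 < Y%:R ^+ D :> rat by rewrite exprn_gt0 // ltr0n.
have -> : Vol Y = \sum_(z <- box (2 * Y)) \sum_(1 <= m < (Y ^ D).+1) \sum_(c <- lev m)
   (if O1 (el z) && (cls (el z) == c) then wt (el z) / Wt (el z) * kk m else 0).
  apply: eq_bigr => z _; rewrite /Gw; case: ifP => z1 /=; last first.
    by rewrite big1 // => m _; rewrite big1.
  transitivity (\sum_(1 <= m < (Y ^ D).+1) (wt (el z) / Wt (el z) * kk m) *+ (NS (el z) == m)).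
    rewrite (eq_bigr (fun m => (wt (el z) / Wt (el z) * kk (NS (el z))) *+ (NS (el z) == m))); last first.
      by move=> m _; case: eqP => [->|].
    rewrite sum_delta ?NS_gt0 //; case: leqP => h; rewrite ?mulr1n // mulr0n.
    rewrite /kap (elimT max_idPl) ?mulr0 // subr_le0 ler_pdivlMr // mul1r -natrX ler_nat.
    exact: ltnW.
  apply: eq_bigr => m _; rewrite -big_mkcond /= big_const_seq.
  rewrite (_ : count _ _ = (cls (el z) \in lev m)) ?iter_addr_0; last first.
    by rewrite -count_uniq_mem ?uniq_lev //; apply: eq_count => c; rewrite /= eq_sym.
  have [cz1 _] := clsP z1.
  by rewrite mem_lev cz1 cls_cls // eqxx /= NS_cls.
rewrite exchange_big /=; apply: eq_big_nat => m /andP[m0 mY].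
rewrite exchange_big /= (eq_big_seq (fun c => kk m)) => [|c cl].
  rewrite big_const_seq count_predT iter_addr_0 mulr_natl /kk /kap.
  rewrite (elimT max_idPr) // subr_ge0 ler_pdivrMr // mul1r -natrX ler_nat.
  by rewrite -ltnS.
by rewrite -big_mkcond /= -mulr_suml (class_weight cl) ?mul1r // m0 -ltnS.
Qed.



Section Aux.
Variable F : realFieldType.
Implicit Types a t A : F.

Lemma max0_lipschitz a t : `|Num.max 0 a - Num.max 0 t| <= `|a - t|.
Proof.
wlog le : a t / t <= a => [H|].
  by case: (leP t a) => [/H//|/ltW/H]; rewrite distrC [`|t - a|]distrC.
rewrite ger0_norm ?subr_ge0; last first.
  by rewrite ge_max !le_max lexx le orbT.
rewrite ger0_norm ?subr_ge0 //; case: (leP 0 a) => ?; case: (leP 0 t) => ?; lra.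
Qed.

(* Valid also for [A = 0], thanks to [x / 0 = 0]. *)
Lemma frac_lipschitz a t A a' t' A' :
  0 <= a <= A -> 0 <= t -> (0 < a -> t <= A) ->
  0 <= a' <= A' -> 0 <= t' -> (0 < a' -> t' <= A') ->
  `|a * t / A - a' * t' / A'| <= `|a - a'| + `|t - t'| + `|A - A'|.
Proof.
have small (b s C : F) : 0 <= b <= C -> 0 <= s -> (0 < b -> s <= C) -> 0 <= b * s / C <= b.
  move=> /andP[b0 bC] s0 h; move: b0; rewrite le_eqVlt => /orP[/eqP<-|b0].
    by rewrite !mul0r lexx.
  have C0 : 0 < C by apply: lt_le_trans bC.
  apply/andP; split; first by apply: divr_ge0; [apply: mulr_ge0 => //|]; apply: ltW.
  by rewrite ler_pdivrMr // ler_pM2l // h.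
move=> aA t0 tA aA' t0' tA'.
have := small _ _ _ aA t0 tA; have := small _ _ _ aA' t0' tA'.
have /andP[a0 _] := aA; have /andP[a0' _] := aA'.
have n1 := normr_ge0 (t - t'); have n2 := normr_ge0 (A - A').
have zero (b b' : F) : 0 <= b <= b' -> `|b| <= `|b' - 0| + `|t - t'| + `|A - A'|.
  move=> /andP[b0 bb]; rewrite subr0 [`|b|]ger0_norm // [`|b'|]ger0_norm; last exact: le_trans bb.
  by rewrite -addrA; apply: le_trans bb _; rewrite lerDl addr_ge0.
move: a0; rewrite le_eqVlt => /orP[/eqP<-|a0] H1 H2.
  by rewrite !mul0r sub0r normrN [`|0 - a'|]distrC; apply: zero.
move: a0'; rewrite le_eqVlt => /orP[/eqP<-|a0'].
  by rewrite !mul0r !subr0 -[in X in _ <= X + _ + _](subr0 a); apply: zero.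
have /andP[_ aA1] := aA; have /andP[_ aA1'] := aA'.
have A0 : 0 < A by apply: lt_le_trans aA1.
have A0' : 0 < A' by apply: lt_le_trans aA1'.
have f1 : `|t / A| <= 1.
  by rewrite ger0_norm ?divr_ge0 ?(ltW A0) // ler_pdivrMr // mul1r tA.
have f2 : `|a' / A'| <= 1.
  by rewrite ger0_norm ?divr_ge0 ?(ltW A0') ?(ltW a0') // ler_pdivrMr // mul1r.
rewrite (_ : _ - _ = (a - a') * (t / A) + (a' / A') * (t - t') + (a' / A') * (t / A) * (A' - A)).
  apply: le_trans (ler_normD _ _) _; apply: lerD; last first.
    by rewrite [leRHS]distrC normrM -[leRHS]mul1r ler_wpM2r // normrM mulr_ile1.
  apply: le_trans (ler_normD _ _) _; apply: lerD; rewrite normrM.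
    by rewrite -[leRHS]mulr1 ler_wpM2l.
  by rewrite -[leRHS]mul1r ler_wpM2r.
by field; rewrite !gt_eqF.
Qed.

End Aux.

Lemma det_cong m (A A' : 'M[int]_m) (q : int) :
  (forall i j, (q %| A i j - A' i j)%Z) -> (q %| \det A - \det A')%Z.
Proof.
move=> H; rewrite /determinant; apply: (big_ind2 (fun x y => (q %| x - y)%Z)).
- by rewrite subrr dvdz0.
- by move=> x y z t h1 h2; rewrite opprD addrACA rpredD.
move=> s _; rewrite -mulrBr dvdz_mull //.
apply: (big_ind2 (fun x y => (q %| x - y)%Z)) => [|x y z t h1 h2|i _].
- by rewrite subrr dvdz0.
- rewrite (_ : _ - _ = (x - y) * z + y * (z - t)); last by ring.
  by apply: rpredD; [exact: dvdz_mulr | exact: dvdz_mull].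
exact: H.
Qed.

(** A modulus fine enough for two purposes: it is divisible by [s MM] for each possible [MM]-part
    [s < 2 cC] of a norm, and by the common denominator [Qz] of [units]. *)
Definition QQ : nat := (Qz * MM ^ (2 * cC))%N.

Lemma QQ_gt0 : (0 < QQ)%N.
Proof. by rewrite muln_gt0 fact_gt0 expn_gt0 MM_gt0. Qed.

Lemma an_cong z y : exists x x' : int, [/\ an (el z) = `|x|%N,
  an (el (z + QQ%:Z *: y)) = `|x'|%N & (QQ%:Z %| x' - x)%Z].
Proof.
have [A AE] := mulmat_el z; have [A' AE'] := mulmat_el (z + QQ%:Z *: y).
have [C CE] := mulmat_el y; exists (\det A), (\det A').
rewrite /an /nm AE AE' !det_map_mx !numq_int; split=> //; apply: det_cong => i j.
suff -> : A' i j - A i j = QQ%:Z * C i j by apply: dvdz_mulr.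
apply: (@intr_inj rat); rewrite rmorphB rmorphM /=.
have /matrixP/(_ i j) := mulmatB (el (z + QQ%:Z *: y)) (el z).
rewrite elDZ addrAC subrr add0r -elDZ mulmatZ AE AE' CE !mxE => ->.
by [].
Qed.

(** The two norms agree modulo [QQ] up to sign. As [s MM] divides [QQ], their cofactors by [s] agree
    modulo [MM], and the first one is prime to [MM], hence so is the second. *)
Lemma smooth_cong z y : O1 (el z) -> 0 < wt (el z) ->
  O1 (el (z + QQ%:Z *: y)) /\
  ((an (el (z + QQ%:Z *: y)))`_(\pi(MM)) = (an (el z))`_(\pi(MM)))%N.
Proof.
move=> z1 zt; have [x [x' [xE xE' dq]]] := an_cong z y.
have [aE sC] := wt_smooth z1 zt; set s := ((an (el z))`_(\pi(MM)))%N in aE sC *.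
have s0 : (0 < s)%N by apply: part_gt0.
have dsM : (s%:Z * MM%:Z %| QQ%:Z)%Z.
  rewrite -PoszM dvdzE !absz_nat /QQ dvdn_mull //.
  apply: dvdn_trans (_ : MM ^ s.+1 %| _)%N; last by rewrite dvdn_exp2l.
  rewrite expnSr dvdn_mul // pnat_dvd_exp ?MM_gt0 //; exact: part_pnat.
have sx : (s%:Z %| x)%Z by rewrite dvdzE absz_nat -xE aE dvdn_mulr.
have sx' : (s%:Z %| x')%Z.
  have : (s%:Z %| x' - x)%Z by apply: dvdz_trans dq; apply: dvdz_trans dsM; apply: dvdz_mulr.
  by move=> h; rewrite -[x'](subrK x) rpredD.
move/dvdzP: sx => [m mE]; move/dvdzP: sx' => [m' mE'].
have s0z : s%:Z != 0 by rewrite eqz_nat -lt0n.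
have mm : (MM%:Z %| m' - m)%Z.
  have := dvdz_trans dsM dq; rewrite mE mE' -mulrBl [_ * s%:Z]mulrC.
  by rewrite dvdz_mul2l.
have cm : coprimez MM%:Z m.
  rewrite coprimezE absz_nat coprime_pi' ?MM_gt0 //; last first.
    by rewrite lt0n; apply/eqP => h; move: xE; rewrite mE abszM h mul0n => /eqP; rewrite an_eq0 ?O1_O // (negPf (O1_n0 z1)).
  have -> : `|m|%N = NS (el z); last by apply: part_pnat.
  by apply/eqP; rewrite -(eqn_pmul2r s0) mulnC [X in _ == X]mulnC -aE xE mE abszM absz_nat mulnC.
have cm' : coprime MM `|m'|.
  have : coprimez MM%:Z m' by rewrite -[m'](subrK m) /coprimez; move/dvdzP: mm => [k ->]; rewrite gcdzMDl.
  by rewrite coprimezE absz_nat.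
have an' : an (el (z + QQ%:Z *: y)) = (s * `|m'|)%N by rewrite xE' mE' abszM absz_nat mulnC.
have m'0 : (0 < `|m'|)%N.
  rewrite lt0n; apply/eqP => h; move: cm'; rewrite h /coprime gcdn0 => /eqP h1.
  by have := small_prime_dvd_MM (isT : prime 2); rewrite h1 => /(_ (leq_ltn_trans (isT : (0 < cC)%N) Hb_gt)).
have z1' : O1 (el (z + QQ%:Z *: y)).
  by rewrite /O1 isO_el /= -an_eq0 ?isO_el // an' -lt0n muln_gt0 s0.
split=> //; rewrite an' partnM // part_pnat_id; last exact: part_pnat.
by rewrite part_p'nat ?muln1 // -coprime_pi' // MM_gt0.
Qed.

Lemma unit_isO_cong u z y : u \in units -> isO (u * el z) -> isO (u * el (z + QQ%:Z *: y)).
Proof.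
move=> /mem_units[_ _ _ uO _] h; rewrite elDZ mulrDr; apply: isO_add => //.
rewrite -scalerAr scalerAl; apply: isO_mul; last exact: isO_el.
by rewrite /QQ PoszM mulrC intrM -scalerA; apply: isO_natZ.
Qed.

Lemma wt_scaled u z (Y : nat) : (0 < Y)%N -> u \in units -> O1 (el z) -> isO (u * el z) ->
  (NS (el z))%:R / Y%:R ^+ D * wt (u * el z) =
  Num.max 0 (2 * ((NS (el z))%:R / Y%:R ^+ D) - ht (u * (Y%:R^-1 *: el z)) ^+ D).
Proof.
move=> Y0 uu z1 uz; have [uz1 uzs] := unit_simb uu z1 uz.
rewrite /wt -(simb_NS z1 uz1 uzs) maxr_pMr; last by rewrite divr_ge0 ?exprn_ge0.
rewrite mulr0 -scalerAr htZ exprMn ger0_norm ?invr_ge0 // exprVn; congr Num.max.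
have YD : Y%:R ^+ D != 0 :> rat by rewrite expf_neq0 // pnatr_eq0 -lt0n.
have N0 : (NS (el z))%:R != 0 :> rat by rewrite (gt_eqF (NSr_gt0 _)).
by move: YD N0; move: (Y%:R ^+ D) (NS _)%:R (ht _ ^+ D) => a b c a0 b0; field; rewrite a0.
Qed.

Lemma unit1 : 1 \in units.
Proof.
apply/mem_units; rewrite invr1 oner_neq0; split=> //; try exact: OS1.
  by rewrite scaler_nat; exact: isO_nat.
by rewrite ht1 -[1]/(1%:R) ler_nat muln_gt0 expn_gt0.
Qed.

Lemma ht_dist v w : `|ht v - ht w| <= ht (v - w).
Proof.
rewrite ler_norml; have := htD (v - w) w; rewrite subrK.
have := htD (w - v) v; rewrite subrK -[w - v]opprB htN; lra.
Qed.

Lemma exp_lipschitz (p q R : rat) : 0 <= R -> `|p| <= R -> `|q| <= R ->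
  `|p ^+ D - q ^+ D| <= D%:R * R ^+ n * `|p - q|.
Proof.
move=> R0 pR qR.
have := @prod_lipschitz _ (iota 0 D) (fun=> p) (fun=> q) R _ R0 (normr_ge0 (p - q))
  (fun=> pR) (fun=> qR) (fun=> lexx _).
by rewrite !big_const_seq !count_predT size_iota !iter_mulr_1.
Qed.

Definition Klip (R : rat) : rat :=
  let K1 := cC%:R * R ^+ n in let Ku := cC%:R * (2 * cC ^ 2)%:R in
  let Ka := 2 * K1 + D%:R * (Ku * R) ^+ n * Ku in
  K1 * (2 * (cC%:R * R ^+ D)) + (Ka + K1 + (size units)%:R * Ka).

Lemma Klip_ge0 R : 0 <= R -> 0 <= Klip R.
Proof. by move=> R0; rewrite /Klip !(addr_ge0, mulr_ge0, exprn_ge0). Qed.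

(** Along a residue class modulo [QQ] the [MM]-part [s] is fixed, so [t = |nm|/s] is Lipschitz in
    the scaled point, and the units keeping the point integral are the same. All terms of numerator
    and denominator then vary in a Lipschitz way, with the scales [Y] and [Y'] allowed to differ. *)
Lemma Gw_lipschitz_pos z y (Y Y' : nat) (R : rat) : (0 < Y)%N -> (0 < Y')%N -> 0 <= R ->
  O1 (el z) -> 0 < wt (el z) ->
  let v := Y%:R^-1 *: el z in let v' := Y'%:R^-1 *: el (z + QQ%:Z *: y) in
  ht v <= R -> ht v' <= R ->
  `|Gw Y z - Gw Y' (z + QQ%:Z *: y)| <= Klip R * ht (v - v').
Proof.
move=> Y0 Y0' R0 z1 zt v v' vR vR'; set z' := z + QQ%:Z *: y in v' vR' *.
have [z1' sE] := smooth_cong y z1 zt; rewrite -/z' in z1' sE.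
set s := ((an (el z))`_(\pi(MM)))%N in sE; set d := ht (v - v').
have d0 : 0 <= d by apply: ht_ge0.
pose t : rat := (NS (el z))%:R / Y%:R ^+ D; pose t' : rat := (NS (el z'))%:R / Y'%:R ^+ D.
have s1 : 1 <= s%:R :> rat by rewrite ler1n part_gt0.
have tE (w : 'rV[int]_D) (X : nat) : O1 (el w) -> ((an (el w))`_(\pi(MM)) = s)%N -> (0 < X)%N ->
  `|nm (X%:R^-1 *: el w)| = s%:R * ((NS (el w))%:R / X%:R ^+ D).
  move=> w1 ws X0; rewrite nmZ normrM normrX normfV normr_nat anE ?O1_O //.
  rewrite -{1}(partnC \pi(MM) (an_gt0 (O1_O w1) (O1_n0 w1))) ws natrM exprVn mulrC mulrA //.
have t0 : 0 < t by rewrite divr_gt0 ?exprn_gt0 ?NSr_gt0 // ltr0n.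
have t0' : 0 < t' by rewrite divr_gt0 ?exprn_gt0 ?NSr_gt0 // ltr0n.
set K1 : rat := cC%:R * R ^+ n; set Ku : rat := cC%:R * (2 * cC ^ 2)%:R.
set Ka := 2 * K1 + D%:R * (Ku * R) ^+ n * Ku.
have K10 : 0 <= K1 by rewrite mulr_ge0 ?exprn_ge0.
have Ku0 : 0 <= Ku by rewrite mulr_ge0.
have Ka0 : 0 <= Ka by rewrite !(addr_ge0, mulr_ge0, exprn_ge0).
have dtt : `|t - t'| <= K1 * d.
  apply: le_trans (_ : s%:R * `|t - t'| <= _); first by rewrite -[leLHS]mul1r ler_wpM2r.
  rewrite -{1}[s%:R]ger0_norm ?ler0n // -normrM mulrBr -(tE z) // -(tE z') //.
  apply: le_trans (ler_dist_dist _ _) _.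
  by apply: le_trans (nm_lipschitz vR vR') _; rewrite mulrA.
have tR : t <= cC%:R * R ^+ D.
  apply: le_trans (_ : s%:R * t <= _); first by rewrite -[leLHS]mul1r ler_wpM2r // ltW.
  rewrite -tE //; apply: le_trans (nm_le _) _; rewrite ler_wpM2l // lerXn2r ?nnegrE ?ht_ge0 //.
pose a u := Num.max 0 (2 * t - ht (u * v) ^+ D); pose a' u := Num.max 0 (2 * t' - ht (u * v') ^+ D).
have hu u w : u \in units -> ht (u * w) <= Ku * ht w.
  move=> /mem_units[_ _ _ _ uh]; apply: le_trans (ht_mul _ _) _; rewrite -mulrA ler_wpM2l //.
  by rewrite ler_wpM2r ?ht_ge0.
have aa u : u \in units -> `|a u - a' u| <= Ka * d.
  move=> uu; apply: le_trans (max0_lipschitz _ _) _.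
  rewrite (_ : _ - _ = 2 * (t - t') - (ht (u * v) ^+ D - ht (u * v') ^+ D)); last by ring.
  apply: le_trans (ler_normB _ _) _; rewrite /Ka [leRHS]mulrDl; apply: lerD.
    by rewrite normrM ger0_norm // -mulrA ler_wpM2l.
  have hR w : ht w <= R -> `|ht (u * w)| <= Ku * R.
    by move=> wR; rewrite ger0_norm ?ht_ge0 //; apply: le_trans (hu u w uu) _; rewrite ler_wpM2l.
  apply: le_trans (exp_lipschitz _ (hR _ vR) (hR _ vR')) _; first by rewrite mulr_ge0.
  rewrite -[leRHS]mulrA ler_wpM2l ?mulr_ge0 ?exprn_ge0 ?mulr_ge0 //.
  by apply: le_trans (ht_dist _ _) _; rewrite -mulrBr; apply: hu.
pose A := \sum_(u <- units | isO (u * el z)) a u; pose A' := \sum_(u <- units | isO (u * el z)) a' u.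
have same u : u \in units -> isO (u * el z') = isO (u * el z).
  move=> uu; apply/idP/idP; last exact: unit_isO_cong.
  by move=> /(unit_isO_cong (- y) uu); rewrite scalerN addrK.
have AA : `|A - A'| <= (size units)%:R * Ka * d.
  rewrite /A /A' -sumrB; apply: le_trans (ler_norm_sum _ _ _) _.
  apply: le_trans (_ : \sum_(u <- units) Ka * d <= _).
    rewrite big_mkcond big_seq [leRHS]big_seq; apply: ler_sum => u uu.
    by case: ifP => _; [apply: aa | rewrite mulr_ge0].
  by rewrite big_const_seq count_predT iter_addr_0 -[leLHS]mulr_natl mulrA.
have AE : t * Wt (el z) = A.
  rewrite /Wt mulr_sumr /A big_seq_cond [RHS]big_seq_cond.
  by apply: eq_bigr => u /andP[uu uO]; apply: wt_scaled.
have AE' : t' * Wt (el z') = A'.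
  rewrite /Wt mulr_sumr /A' big_seq_cond [RHS]big_seq_cond.
  apply: eq_big => [u|u /andP[uu uO]]; first by case: (boolP (u \in units)) => //= uu; apply: same.
  exact: wt_scaled.
have aE : t * wt (el z) = a 1.
  by move: (@wt_scaled 1 z Y Y0 unit1 z1); rewrite /a !mul1r isO_el; apply.
have aE' : t' * wt (el z') = a' 1.
  by move: (@wt_scaled 1 z' Y' Y0' unit1 z1'); rewrite /a' !mul1r isO_el; apply.
have GE (w : 'rV[int]_D) X (tt aw Aw : rat) : O1 (el w) -> tt = (NS (el w))%:R / X%:R ^+ D -> 0 < tt ->
  tt * wt (el w) = aw -> tt * Wt (el w) = Aw -> Gw X w = kap tt * (aw * tt / Aw).
  move=> w1 ttE tt0 <- <-; rewrite /Gw w1 -ttE.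
  have [W0|W0] := eqVneq (Wt (el w)) 0; first by rewrite W0 mulr0 !invr0 !mulr0 mul0r.
  by field; rewrite W0 gt_eqF.
rewrite (GE _ _ _ _ _ z1 erefl t0 aE AE) (GE _ _ _ _ _ z1' erefl t0' aE' AE').
have cond (w : 'rV[int]_D) X (tt aw Aw : rat) : O1 (el w) -> tt = (NS (el w))%:R / X%:R ^+ D -> 0 < tt ->
  tt * wt (el w) = aw -> tt * Wt (el w) = Aw -> (0 <= aw <= Aw) /\ (0 < aw -> tt <= Aw).
  move=> w1 ttE tt0 <- <-; split.
    rewrite mulr_ge0 ?(ltW tt0) ?wt_ge0 //= ler_wpM2l ?(ltW tt0) //.
    rewrite /Wt big_mkcond (bigD1_seq 1) ?unit1 ?uniq_units //= mul1r isO_el.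
    by rewrite lerDl sumr_ge0 // => *; case: ifP => // _; exact: wt_ge0.
  by rewrite pmulr_rgt0 // => h; rewrite ler_peMr ?(ltW tt0) // Wt_ge1.
have [c1 c2] := cond _ _ _ _ _ z1 erefl t0 aE AE.
have [c1' c2'] := cond _ _ _ _ _ z1' erefl t0' aE' AE'.
have FL := frac_lipschitz c1 (ltW t0) c2 c1' (ltW t0') c2'.
have kk : `|kap t - kap t'| <= K1 * d.
  apply: le_trans (max0_lipschitz _ _) _.
  by rewrite (_ : 1 - t - (1 - t') = t' - t); [rewrite distrC | ring].
have k1 : `|kap t'| <= 1.
  by rewrite /kap ger0_norm ?le_max ?lexx // ge_max ler01 lerBlDr lerDl ltW.
have ph : `|a 1 * t / A| <= 2 * (cC%:R * R ^+ D).
  have /andP[a0 aA] := c1.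
  have [A0|A0] := eqVneq A 0; first by rewrite A0 invr0 mulr0 normr0 !mulr_ge0 ?exprn_ge0.
  have Ap : 0 < A by rewrite lt_neqAle eq_sym A0 (le_trans a0).
  rewrite ger0_norm; last by rewrite divr_ge0 ?mulr_ge0 // ltW.
  apply: le_trans (_ : a 1 <= _).
    rewrite ler_pdivrMr //; move: a0; rewrite le_eqVlt => /orP[/eqP<-|a0]; first by rewrite !mul0r.
    by rewrite ler_wpM2l ?(ltW a0) ?c2.
  apply: le_trans (_ : 2 * t <= _); last by rewrite ler_wpM2l.
  by rewrite ge_max mulr_ge0 ?(ltW t0) //= lerBlDr lerDl exprn_ge0 // ht_ge0.
rewrite (_ : _ - _ = (kap t - kap t') * (a 1 * t / A) + kap t' * (a 1 * t / A - a' 1 * t' / A')).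
  apply: le_trans (ler_normD _ _) _; rewrite /Klip -/K1 -/Ku -/Ka [leRHS]mulrDl; apply: lerD.
    by rewrite normrM [leRHS]mulrAC; apply: ler_pM.
  rewrite normrM -[leRHS]mul1r; apply: ler_pM => //; apply: le_trans FL _.
  rewrite [leRHS]mulrDl [X in _ <= X + _]mulrDl.
  by apply: lerD => //; apply: lerD => //; apply: aa; exact: unit1.
by rewrite mulrBl mulrBr [RHS]addrA subrK.
Qed.

Lemma Gw_lipschitz z y (Y Y' : nat) (R : rat) : (0 < Y)%N -> (0 < Y')%N -> 0 <= R ->
  let v := Y%:R^-1 *: el z in let v' := Y'%:R^-1 *: el (z + QQ%:Z *: y) in
  ht v <= R -> ht v' <= R ->
  `|Gw Y z - Gw Y' (z + QQ%:Z *: y)| <= Klip R * ht (v - v').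
Proof.
move=> Y0 Y0' R0 v v' vR vR'.
have [/andP[z1 zt]|n1] := boolP (O1 (el z) && (0 < wt (el z))).
  exact: Gw_lipschitz_pos.
have [/andP[z1 zt]|n2] := boolP (O1 (el (z + QQ%:Z *: y)) && (0 < wt (el (z + QQ%:Z *: y)))).
  have := @Gw_lipschitz_pos (z + QQ%:Z *: y) (- y) Y' Y R Y0' Y0 R0 z1 zt.
  rewrite /= scalerN addrK => H.
  by rewrite distrC -[v - v']opprB htN; apply: H.
have G0 X (w : 'rV[int]_D) : ~~ (O1 (el w) && (0 < wt (el w))) -> Gw X w = 0.
  rewrite negb_and /Gw; case: ifP => //= w1; rewrite -leNgt => h.
  by rewrite (_ : wt (el w) = 0) ?mul0r //; apply/eqP; rewrite eq_le h wt_ge0.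
by rewrite !G0 // subrr normr0 mulr_ge0 ?Klip_ge0 ?ht_ge0.
Qed.


Lemma Gw_support Y z : (0 < Y)%N -> Gw Y z != 0 -> z \in box (2 * Y).
Proof.
move=> Y0; rewrite /Gw; case: ifP => [z1|]; last by rewrite eqxx.
have YD : 0 < Y%:R ^+ D :> rat by rewrite exprn_gt0 // ltr0n.
move=> h; have wt0 : 0 < wt (el z).
  by rewrite lt_neqAle wt_ge0 andbT eq_sym; apply: contra h => /eqP->; rewrite !mul0r.
have k0 : (NS (el z))%:R < Y%:R ^+ D :> rat.
  rewrite -[Y%:R ^+ D]mul1r -ltr_pdivrMr // ltNge; apply: contra h => h.
  by rewrite /kap (elimT max_idPl) ?mulr0 // subr_le0.
move: wt0; rewrite wt_gt0 => h2; rewrite -ht_el_le leNgt; apply/negP => h3.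
have : ((2 * Y)%:R : rat) ^+ D < 2 * Y%:R ^+ D.
  apply: lt_trans (lt_trans h2 _); last by rewrite ltr_pM2l.
  by rewrite ltrXn2r ?nnegrE ?ht_ge0.
rewrite -!natrX -[2]/(2%:R) -natrM ltr_nat ltnNge expnMn leq_mul //.
by rewrite -{1}[2%N]expn1 leq_pexp2l.
Qed.

Lemma sum_supp (T : eqType) (V : nmodType) (s1 s2 : seq T) (g : T -> V) :
  uniq s1 -> uniq s2 -> (forall z : T, g z != 0 -> z \in s1) -> (forall z : T, g z != 0 -> z \in s2) ->
  \sum_(t <- s1) g t = \sum_(t <- s2) g t.
Proof.
move=> u1 u2 h1 h2.
rewrite (bigID (fun t => g t != 0)) /= [X in _ + X]big1 ?addr0; last first.
  by move=> t; rewrite negbK => /eqP.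
rewrite [RHS](bigID (fun t => g t != 0)) /= [X in _ = _ + X]big1 ?addr0; last first.
  by move=> t; rewrite negbK => /eqP.
rewrite -big_filter -[RHS]big_filter; apply: perm_big; apply: uniq_perm; rewrite ?filter_uniq //.
by move=> t; rewrite !mem_filter; case: eqP => //= /eqP gt; rewrite h1 ?h2.
Qed.

Lemma VolT Y T : (0 < Y)%N -> (2 * Y <= T)%N -> Vol Y = \sum_(z <- box T) Gw Y z.
Proof.
move=> Y0 YT; apply: sum_supp; rewrite ?uniq_box // => z /(Gw_support Y0) // h.
rewrite -ht_el_le; apply: le_trans (_ : (2 * Y)%:R <= _); first by rewrite ht_el_le.
by rewrite ler_nat.
Qed.

Lemma edivz_uniq (q a b r s : int) : 0 <= r < q -> 0 <= s < q ->
  r + q * a = s + q * b -> a = b /\ r = s.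
Proof.
move=> /andP[r0 rq] /andP[s0 sq] E.
have q0 : 0 < q by apply: le_lt_trans rq.
have H x y : 0 <= x < q -> ((x + q * y) %/ q)%Z = y.
  move=> /andP[x0 xq]; rewrite addrC mulrC divzMDl ?gt_eqF // divz_small ?addr0 //.
  by rewrite x0 gtz0_abs.
have ab : a = b by rewrite -(H r a) ?r0 // E H ?s0.
by split=> //; move: E; rewrite ab => /addIr.
Qed.

Lemma elZB (c : int) z y : el (c *: z - y) = c%:~R *: el z - el y.
Proof.
by apply: crd_inj; rewrite crdB crdZ !crd_el; apply/rowP => i; rewrite !mxE rmorphB rmorphM.
Qed.

(** Keeps the remainder modulo [QQ] and replaces the quotient [q] by [k q + f]. Each point at scale
    [Y] thus has [k^D] successors near [k z] in its own residue class, and together they cover every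
    point at scale [k Y] exactly once. *)
Definition refine (k : nat) z (f : {ffun 'I_D -> 'I_k}) : 'rV[int]_D :=
  \row_i ((z 0%R i %% QQ%:Z)%Z + QQ%:Z * (k%:Z * (z 0%R i %/ QQ%:Z)%Z + (f i : nat)%:Z)).

Let QQz : 0 < QQ%:Z. Proof. by rewrite ltz_nat QQ_gt0. Qed.
Let modQ (x : int) : 0 <= (x %% QQ%:Z)%Z < QQ%:Z.
Proof. by rewrite modz_ge0 ?gt_eqF // ltz_pmod. Qed.

Lemma refine_inj k z (w : 'rV[int]_D) f g : refine (k := k) z f = refine w g -> z = w /\ f = g.
Proof.
move=> /rowP E.
have H i : z 0 i = w 0 i /\ (f i : nat) = g i.
  have := E i; rewrite !mxE => /(edivz_uniq (modQ _) (modQ _))[e1 e2].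
  have fk (h : {ffun 'I_D -> 'I_k}) : 0 <= (h i : nat)%:Z < k%:Z by rewrite lez_nat ltz_nat ltn_ord.
  move: e1; rewrite addrC [RHS]addrC => /(edivz_uniq (fk f) (fk g))[e3 [e4]].
  by split=> //; rewrite (divz_eq (z 0%R i) QQ) (divz_eq (w 0 i) QQ) e3 e2.
by split; [apply/rowP => i; case: (H i) | apply/ffunP => i; apply: val_inj; case: (H i)].
Qed.

Lemma refine_cong k z f : exists y, refine (k := k) z f = z + QQ%:Z *: y.
Proof.
exists (\row_i (k%:Z * (z 0%R i %/ QQ%:Z)%Z + (f i : nat)%:Z - (z 0%R i %/ QQ%:Z)%Z)).
apply/rowP => i; rewrite !mxE {3}(divz_eq (z 0%R i) QQ%:Z); ring.
Qed.

Lemma refine_dist k z f i : (0 < k)%N ->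
  `|k%:Z * z 0 i - refine (k := k) z f 0 i| <= k%:Z * QQ%:Z.
Proof.
move=> k0; rewrite mxE {1}(divz_eq (z 0%R i) QQ%:Z).
have /andP[r0 rq] := modQ (z 0 i); move: ((_ %% _)%Z) ((_ %/ _)%Z) r0 rq => r q r0 rq.
rewrite (_ : _ - _ = (k%:Z - 1) * r - QQ%:Z * (f i : nat)%:Z); last by ring.
have h1 : 0 <= (k%:Z - 1) * r by rewrite mulr_ge0 // subr_ge0 lez_nat.
have h2 : (k%:Z - 1) * r <= k%:Z * QQ%:Z.
  by apply: ler_pM => //; [rewrite subr_ge0 lez_nat | rewrite gerBl | apply: ltW].
have h3 : 0 <= QQ%:Z * (f i : nat)%:Z by rewrite mulr_ge0 // ltW.
have h4 : QQ%:Z * (f i : nat)%:Z <= k%:Z * QQ%:Z.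
  by rewrite [leRHS]mulrC ler_wpM2l ?(ltW QQz) // lez_nat ltnW.
rewrite ler_norml -[leLHS]sub0r lerB //= lerBlDr; apply: le_trans h2 _.
by rewrite lerDl.
Qed.

Lemma refine_cover k Y z : (0 < k)%N -> (0 < Y)%N -> z \in box (2 * (k * Y)) ->
  exists (w : 'rV[int]_D) f, w \in box (2 * Y + QQ) /\ z = refine (k := k) w f.
Proof.
move=> k0 Y0; rewrite mem_box => /forallP zb.
pose q i := (z 0%R i %/ QQ%:Z)%Z; pose r i := (z 0%R i %% QQ%:Z)%Z.
have k0z : 0 < k%:Z by rewrite ltz_nat.
pose e i := (q i %% k%:Z)%Z; have eb i : 0 <= e i < k%:Z by rewrite modz_ge0 ?gt_eqF // ltz_pmod.
have ek i : (`|e i| < k)%N by rewrite -ltz_nat gez0_abs; case/andP: (eb i).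
pose f : {ffun 'I_D -> 'I_k} := [ffun i => Ordinal (ek i)].
pose w : 'rV[int]_D := \row_i (r i + QQ%:Z * (q i %/ k%:Z)%Z).
have wq i : (w 0%R i %/ QQ%:Z)%Z = (q i %/ k%:Z)%Z /\ (w 0%R i %% QQ%:Z)%Z = r i.
  apply: (@edivz_uniq QQ%:Z); rewrite ?modQ //.
  by rewrite addrC mulrC -divz_eq mxE.
have zE : z = refine w f.
  apply/rowP => i; rewrite mxE; have [-> ->] := wq i; rewrite ffunE /= gez0_abs; last by case/andP: (eb i).
  by rewrite [k%:Z * _]mulrC -divz_eq addrC mulrC -divz_eq.
exists w, f; split=> //; rewrite mem_box; apply/forallP => i.
have := @refine_dist k w f i k0; rewrite -zE; have := zb i.
rewrite -lez_nat -[(_ <= 2 * Y + QQ)%N]lez_nat !abszE => z2 d.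
have : k%:Z * `|w 0 i| <= k%:Z * (2 * Y + QQ)%N%:Z.
  rewrite -[X in X * `|_|](ger0_norm (ltW k0z)) -normrM.
  have -> : k%:Z * w 0 i = (k%:Z * w 0 i - z 0 i) + z 0 i by rewrite subrK.
  apply: le_trans (ler_normD _ _) _; apply: le_trans (lerD d z2) _.
  by rewrite -!PoszM -PoszD lez_nat mulnDr addnC mulnCA.
by rewrite ler_pM2l.
Qed.

(** [Rc] bounds the heights of all scaled points compared. In [Kv], [(5 + 2 QQ) Y] bounds the side
    [4Y + 2 QQ + 1] of the summation box, and [QQ/Y] is the distance between a point and its
    successors after scaling. *)
Definition Rc : rat := 2 + 2 * QQ%:R.
Definition Kv : rat := (5 + 2 * QQ)%N%:R ^+ D * (Klip Rc * QQ%:R).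

(** Two Riemann sums of the same Lipschitz function on each residue class: [refine] matches their
    points and [Gw_lipschitz] bounds each difference by a multiple of [1/Y]. *)
Lemma Vol_compare k Y : (0 < k)%N -> (0 < Y)%N ->
  `|Vol (k * Y) / (k * Y)%:R ^+ D - Vol Y / Y%:R ^+ D| <= Kv / Y%:R.
Proof.
move=> k0 Y0; have kY0 : (0 < k * Y)%N by rewrite muln_gt0 k0.
have Y0r : 0 < Y%:R :> rat by rewrite ltr0n.
have k0r : 0 < k%:R :> rat by rewrite ltr0n.
pose bx := box (2 * Y + QQ); pose fs := index_enum {ffun 'I_D -> 'I_k}.
have E1 : Vol (k * Y) = \sum_(z <- bx) \sum_(f : {ffun 'I_D -> 'I_k}) Gw (k * Y) (refine z f).
  transitivity (\sum_(x <- [seq refine z f | z <- bx, f <- fs]) Gw (k * Y) x); last first.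
    by rewrite big_allpairs_dep.
  apply: sum_supp; rewrite ?uniq_box //.
  - apply: allpairs_uniq; rewrite ?uniq_box ?index_enum_uniq //.
    by move=> [z f] [w g] _ _ /refine_inj[/= -> ->].
  - by move=> z /(Gw_support kY0).
  - move=> z /(Gw_support kY0)/(refine_cover k0 Y0)[w [f [wb ->]]].
    by apply/allpairsP; exists (w, f); rewrite /= wb mem_index_enum.
have E2 : Vol Y = \sum_(z <- bx) Gw Y z by apply: VolT => //; rewrite leq_addr.
have E3 : k%:R ^+ D * Vol Y = \sum_(z <- bx) \sum_(f : {ffun 'I_D -> 'I_k}) Gw Y z.
  rewrite E2 mulr_sumr; apply: eq_bigr => z _.
  by rewrite sumr_const card_ffun !card_ord -natrX mulr_natl.
have B1' : `|Vol (k * Y) - k%:R ^+ D * Vol Y| <= Kv * (k%:R ^+ D * Y%:R ^+ D) / Y%:R.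
  rewrite E1 E3 -sumrB; apply: le_trans (ler_norm_sum _ _ _) _.
  apply: le_trans (_ : \sum_(z <- bx) \sum_(f : {ffun 'I_D -> 'I_k}) Klip Rc * (QQ%:R / Y%:R) <= _).
    rewrite big_seq [leRHS]big_seq; apply: ler_sum => z zb; rewrite -sumrB.
    apply: le_trans (ler_norm_sum _ _ _) _; apply: ler_sum => f _.
    have [y yE] := refine_cong z f; rewrite distrC yE.
    have dz : ht (Y%:R^-1 *: el z - (k * Y)%:R^-1 *: el (z + QQ%:Z *: y)) <= QQ%:R / Y%:R.
      rewrite (_ : _ - _ = (k * Y)%:R^-1 *: (el (k%:Z *: z - (z + QQ%:Z *: y)))); last first.
        rewrite elZB scalerBr scalerA; congr (_ *: _ - _).
        by rewrite natrM invfM mulrAC mulVf ?mul1r // gt_eqF.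
      rewrite htZ ger0_norm ?invr_ge0 // mulrC ler_pdivrMr ?ltr0n //.
      apply: ht_le => [|i]; first by rewrite mulr_ge0 ?divr_ge0.
      rewrite crd_el mxE !mxE -intr_norm.
      apply: le_trans (_ : (k%:Z * QQ%:Z)%:~R <= _).
        by rewrite ler_int; have := @refine_dist k z f i k0; rewrite yE !mxE.
      by rewrite intrM -!pmulrn natrM mulrCA mulfVK ?gt_eqF.
    have hz : ht (Y%:R^-1 *: el z) <= 2 + QQ%:R.
      rewrite htZ ger0_norm ?invr_ge0 // mulrC ler_pdivrMr //.
      have : ht (el z) <= (2 * Y + QQ)%:R by rewrite ht_el_le.
      by move=> h; apply: le_trans h _; rewrite natrD natrM [leRHS]mulrDl lerD2l ler_peMr // ler1n.
    apply: le_trans (@Gw_lipschitz z y Y (k * Y) Rc Y0 kY0 _ _ _) _.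
    - by rewrite /Rc addr_ge0 ?mulr_ge0.
    - by apply: le_trans hz _; rewrite /Rc lerD2l ler_peMl // ler1n.
    - rewrite -[X in ht X](subrK (Y%:R^-1 *: el z)); apply: le_trans (htD _ _) _.
      rewrite -htN opprB; apply: le_trans (lerD dz hz) _; rewrite /Rc.
      have : QQ%:R / Y%:R <= QQ%:R :> rat by rewrite ler_pdivrMr // ler_peMr // ler1n.
      by move: (QQ%:R : rat) (QQ%:R / _) => b a ab; lra.
    by rewrite ler_wpM2l // Klip_ge0 // /Rc addr_ge0 ?mulr_ge0.
  rewrite big_const_seq count_predT iter_addr_0 sumr_const card_ffun !card_ord -mulrnA.
  rewrite -[leLHS]mulr_natl natrM size_box /Kv.
  rewrite [leRHS](_ : _ = ((k ^ D)%:R * ((5 + 2 * QQ)%N%:R ^+ D * Y%:R ^+ D)) * (Klip Rc * (QQ%:R / Y%:R))); last first.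
    by rewrite natrX; ring.
  rewrite ler_wpM2r ?mulr_ge0 ?divr_ge0 ?Klip_ge0 ?addr_ge0 ?mulr_ge0 //.
  rewrite ler_wpM2l // -exprMn natrX lerXn2r ?nnegrE ?mulr_ge0 //.
  by rewrite -natrM ler_nat; move: Y0; clear; nia.
rewrite (_ : _ - _ = (Vol (k * Y) - k%:R ^+ D * Vol Y) / (k%:R ^+ D * Y%:R ^+ D)); last first.
  rewrite natrM exprMn; have : k%:R ^+ D != 0 :> rat by rewrite expf_neq0 // gt_eqF.
  have : Y%:R ^+ D != 0 :> rat by rewrite expf_neq0 // gt_eqF.
  by move: (k%:R ^+ D) (Y%:R ^+ D) (Vol _) (Vol _) => a b c d b0 a0; field; rewrite ?a0 ?b0.
have P0 : 0 < k%:R ^+ D * Y%:R ^+ D :> rat by rewrite mulr_gt0 ?exprn_gt0.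
rewrite normrM [`|_^-1|]ger0_norm ?invr_ge0 ?(ltW P0) // ler_pdivrMr //.
by rewrite mulrAC.
Qed.

(** Near the scaled copies of one point where [Gw] is positive, the Lipschitz bound keeps it above
    half of that value on a positive proportion of the lattice points. The scales are multiples by
    [1 + QQ j], which preserve the residue class. *)
Lemma Vol_lower : exists2 c1 : rat, 0 < c1 &
  forall j : nat, c1 <= Vol (2 * QQ * (1 + QQ * j)) / (2 * QQ * (1 + QQ * j))%:R ^+ D.
Proof.
(* [N] is prime to [MM], so its whole norm [N^D] counts and [wt] equals 1 at the rational integer
   [N]; [Ys > N] keeps [kap] positive. *)
pose N := QQ.+1; pose Ys := (2 * QQ)%N; have Q0 := QQ_gt0.
have Ys0 : (0 < Ys)%N by rewrite muln_gt0.
pose row0 (c : int) : 'rV[int]_D := \row_i (c *+ (i == 0)).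
have elf (k : int) : el (row0 k) = k%:~R.
  rewrite /el (bigD1 ord0) //= big1 => [|i i0]; last by rewrite mxE (negPf i0) scale0r.
  by rewrite addr0 mxE eqxx mulr1n B0 scaler_int.
pose zs := row0 N; have zsE : el zs = N%:R by rewrite elf.
have MQ : (MM %| QQ)%N by rewrite dvdn_mull // dvdn_exp.
have z1 : O1 (el zs) by rewrite zsE /O1 isO_nat -scaler_nat scaler_eq0 oner_eq0 orbF pnatr_eq0.
have NSz : NS (el zs) = (N ^ D)%N.
  rewrite zsE NS_nat // part_pnat_id // -coprime_pi' ?MM_gt0 //.
  by rewrite /N -addn1; move/dvdnP: MQ => [c ->]; rewrite /coprime gcdnMDl gcdn1.
have htz : ht (el zs) = N%:R by rewrite zsE -scaler_nat htZ ht1 mulr1 normr_nat.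
have Nd : (N%:R ^+ D : rat) != 0 by rewrite expf_neq0 // pnatr_eq0.
have wtz : wt (el zs) = 1.
  by rewrite /wt htz NSz natrX divff // (_ : 2 - 1 = 1) // (elimT max_idPr).
have Q2 : (1 < QQ)%N.
  apply: leq_trans (dvdn_leq Q0 MQ).
  have := small_prime_dvd_MM (isT : prime 2) (leq_ltn_trans (isT : (0 < cC)%N) Hb_gt).
  by rewrite mem_primes => /and3P[_ M0 /(dvdn_leq M0)].
pose eta := Gw Ys zs.
have eta0 : 0 < eta.
  have Wz : 0 < Wt (el zs) by apply: lt_le_trans (Wt_ge1 z1 _) => //; rewrite wtz.
  have tb : 0 < (N%:R ^+ D / Ys%:R ^+ D : rat) < 1.
    rewrite divr_gt0 ?exprn_gt0 ?ltr0n //= ltr_pdivrMr ?exprn_gt0 ?ltr0n // mul1r.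
    by rewrite ltrXn2r ?nnegrE // ltr_nat /N /Ys; move: Q2; clear; lia.
  rewrite /eta /Gw z1 wtz NSz natrX mulr_gt0 ?divr_gt0 //.
  case/andP: tb => t0 t1; rewrite mulr_gt0 // /kap lt_max subr_gt0 t1 orbT.
  by [].
pose K := Klip Rc; have K0 : 0 <= K by rewrite Klip_ge0 // /Rc addr_ge0 ?mulr_ge0.
(* A displacement of height [1/(2m)] then costs at most half of [eta]. *)
pose m := (Num.truncn (2 * K / eta)).+1.
have mE : 2 * K <= m%:R * eta.
  rewrite -ler_pdivrMr //; apply: ltW; apply: truncnS_gt.
exists (eta / 2 / (2 * QQ * m)%:R ^+ D).
  by rewrite !divr_gt0 ?exprn_gt0 // ltr0n muln_gt0 muln_gt0 Q0.
move=> j; set kp := (1 + QQ * j)%N; set Y := (2 * QQ * kp)%N.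
have kp0 : (0 < kp)%N by []. have Y0 : (0 < Y)%N by rewrite muln_gt0 muln_gt0 Q0 kp0.
pose T := (kp %/ m)%N.
pose zz (y : 'rV[int]_D) := zs + QQ%:Z *: (row0 (j * N)%N + y).
have zzE y : el (zz y) = kp%:R *: el zs + QQ%:R *: el y.
  rewrite elDZ -[el (row0 _ + y)]/(el (row0 (j * N)%N + y)) -[y in row0 _ + y]scale1r elDZ elf zsE.
  rewrite scale1r scalerDr addrA; congr (_ + _).
  by rewrite -!pmulrn !scaler_nat -!mulrnA -mulrnDr /kp; congr (_ *+ _); move: (QQ) (N) => *; ring.
have G_ge y : y \in box T -> eta / 2 <= Gw Y (zz y).
  move=> yT; have YE : Y%:R^-1 *: (kp%:R *: el zs) = Ys%:R^-1 *: el zs.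
    rewrite scalerA; congr (_ *: _); rewrite /Y natrM invfM mulfVK //.
    by rewrite pnatr_eq0 -lt0n.
  have vy : Y%:R^-1 *: el (zz y) = Ys%:R^-1 *: el zs + (Y%:R^-1 * QQ%:R) *: el y.
    by rewrite zzE scalerDr YE scalerA.
  have hy : ht ((Y%:R^-1 * QQ%:R) *: el y) <= (2 * m%:R)^-1.
    rewrite htZ ger0_norm ?mulr_ge0 ?invr_ge0 //.
    apply: le_trans (_ : Y%:R^-1 * QQ%:R * T%:R <= _).
      by rewrite ler_wpM2l ?mulr_ge0 ?invr_ge0 // ht_el_le.
    rewrite -mulrA [leLHS]mulrC ler_pdivrMr ?ltr0n // [leRHS]mulrC ler_pdivlMr ?mulr_gt0 ?ltr0n //.
    rewrite -!natrM ler_nat /Y.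
    rewrite (_ : (QQ * T * (2 * m) = 2 * QQ * (T * m))%N); last by ring.
    by rewrite leq_mul // leq_trunc_div.
  have h1 : ht (Ys%:R^-1 *: el zs) <= 1.
    rewrite htZ htz ger0_norm ?invr_ge0 // mulrC ler_pdivrMr ?ltr0n // mul1r ler_nat /N /Ys.
    by move: Q2; clear; lia.
  have m1 : (2 * m%:R)^-1 <= 1 :> rat.
    by rewrite invf_le1 ?mulr_gt0 ?ltr0n // -[2]/(2%:R) -natrM ler1n muln_gt0.
  have Rc2 : 2 <= Rc by rewrite /Rc lerDl mulr_ge0.
  have := @Gw_lipschitz zs (row0 (j * N)%N + y) Ys Y Rc Ys0 Y0 _ _ _.
  rewrite -/(zz y) vy opprD addrA subrr add0r htN -/eta => H.
  have {H} : `|eta - Gw Y (zz y)| <= K * ht ((Y%:R^-1 / QQ%:R^-1) *: el y).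
    rewrite invrK; apply: H; first exact: le_trans Rc2.
      by apply: le_trans h1 (le_trans _ Rc2); rewrite ler1n.
    by apply: le_trans (htD _ _) (le_trans (lerD h1 (le_trans hy m1)) _).
  rewrite invrK => H.
  have : K * ht ((Y%:R^-1 * QQ%:R) *: el y) <= eta / 2.
    apply: le_trans (ler_wpM2l K0 hy) _.
    rewrite ler_pdivrMr ?mulr_gt0 ?ltr0n // mulrA divfK //.
    by rewrite mulrC; apply: le_trans mE; rewrite ler_peMl // ler1n.
  move: H; rewrite ler_norml => /andP[_]; move: (K * _) (Gw _ _) (eta) => a b c; lra.
have zz_inj : injective zz.
  move=> y y' /addrI/rowP E; apply/rowP => i; have := E i; rewrite !mxE.
  by move=> /(mulfI (lt0r_neq0 QQz))/addrI.
have Vge : (2 * T).+1%:R ^+ D * (eta / 2) <= Vol Y.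
  rewrite /Vol.
  have -> : \sum_(z <- box (2 * Y)) Gw Y z = \sum_(z <- undup (box (2 * Y) ++ map zz (box T))) Gw Y z.
    apply: sum_supp; rewrite ?undup_uniq ?uniq_box // => z /(Gw_support Y0) // h.
    by rewrite mem_undup mem_cat h.
  rewrite (bigID (mem (map zz (box T)))) /=.
  have -> : \sum_(i <- undup (box (2 * Y) ++ [seq zz i | i <- box T]) | i \in [seq zz i | i <- box T]) Gw Y i
      = \sum_(y <- box T) Gw Y (zz y).
    rewrite -(big_map zz xpredT (Gw Y)) -[LHS]big_filter; apply: perm_big; apply: uniq_perm.
    - by rewrite filter_uniq ?undup_uniq.
    - by rewrite map_inj_uniq ?uniq_box.
    by move=> z; rewrite mem_filter mem_undup mem_cat; case: (z \in map _ _); rewrite ?orbT ?andbF.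
  have G0 z : 0 <= Gw Y z.
    rewrite /Gw; case: ifP => // _; rewrite !mulr_ge0 ?divr_ge0 ?exprn_ge0 ?wt_ge0 //.
      by rewrite invr_ge0; apply: sumr_ge0 => *; exact: wt_ge0.
    by rewrite /kap le_max lexx.
  apply: le_trans (_ : \sum_(y <- box T) eta / 2 <= _).
    by rewrite big_const_seq count_predT iter_addr_0 size_box -[leRHS]mulr_natl natrX.
  rewrite -[leLHS]addr0; apply: lerD; last by apply: sumr_ge0.
  by rewrite big_seq [leRHS]big_seq; apply: ler_sum => y; apply: G_ge.
have YD : 0 < Y%:R ^+ D :> rat by rewrite exprn_gt0 // ltr0n.
rewrite ler_pdivlMr //; apply: le_trans Vge; rewrite mulrAC.
have M0 : 0 < (2 * QQ * m)%:R ^+ D :> rat.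
  by rewrite exprn_gt0 // ltr0n muln_gt0 muln_gt0 Q0.
rewrite ler_pdivrMr // [leRHS]mulrAC [leLHS]mulrC ler_wpM2r ?divr_ge0 ?(ltW eta0) //.
rewrite -exprMn lerXn2r ?nnegrE ?mulr_ge0 // -natrM ler_nat /Y.
rewrite (_ : ((2 * T).+1 * (2 * QQ * m) = 2 * QQ * ((2 * T).+1 * m))%N); last by ring.
rewrite leq_mul //; apply: leq_trans (ltnW (ltn_ceil kp (isT : 0 < m)%N)) _.
by rewrite leq_mul2r ltnS leq_pmull // orbT.
Qed.


Lemma bcl1 : bcl 1 = 1%N.
Proof.
suff : perm_eq (lev 1) [:: cls 1] by move=> /perm_size.
apply: uniq_perm => //; first exact: uniq_lev.
move=> c; rewrite mem_lev inE; apply/and3P/eqP => [[c1 /eqP cc /eqP cN]|->].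
  rewrite -{1}cc; apply: (cls_eq c1 O11).
  by apply/andP; split; [apply: dv_unit => //; exact: isO1 | apply/dv_O/O1_O].
by have [h _] := clsP O11; split=> //; [rewrite cls_cls // O11 | rewrite NS_cls ?O11 // NS1].
Qed.

(** * Counting classes by norm and the prime number theorem for them *)

Section Density.
Variable R : realType.

Definition mb (m : nat) : R := m%:R * (bcl m)%:R.

Lemma summ_mb_ge0 x : 0 <= summ mb x.
Proof. by apply: summ_ge0 => m; rewrite mulr_ge0. Qed.

(** With [X = Y^D], the cut-off [t (1 - t)] at [t = m/X] makes the volume a Cesaro sum:
    [m b(m) (X - m)] summed over [m <= X] is the sum of [summ mb j] over [j < X]. *)
Lemma VolR Y : (0 < Y)%N -> ratr (Vol Y / Y%:R ^+ D) * (Y ^ D)%:R ^+ 3 =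
  \sum_(j < (Y ^ D)%N) summ mb j :> R.
Proof.
move=> Y0; set X := (Y ^ D)%N; have X0 : (0 < X)%N by rewrite expn_gt0 Y0.
have Xn : X%:R != 0 :> R by rewrite pnatr_eq0 -lt0n.
have -> : \sum_(j < X) summ mb j = summ (fun m => mb m * (X%:R - m%:R)) X.
  rewrite -(big_mkord xpredT (summ mb)); elim: (X) => [|x IH]; first by rewrite big_geq // summ0.
  rewrite big_nat_recr //= IH summS subrr mulr0 addr0 /summ -big_split /=.
  apply: eq_big_nat => i _; rewrite -natr1; ring.
rewrite VolE // -/X fmorph_div rmorphXn /= ratr_nat -natrX -/X rmorph_sum /= mulr_suml mulr_suml.
rewrite /summ; apply: eq_big_nat => m _.
rewrite -[Y%:R ^+ D]natrX -/X rmorphM rmorphM rmorphB rmorph1 fmorph_div /= !ratr_nat /mb.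
by field.
Qed.

(** The error [1/Y] at [X = Y^D] is a relative saving of [X^(-1/D)]; differencing once to undo the
    Cesaro sum halves it, and partial summation removes the weight [m]. Hence [d = 1/(2D)]. *)
Lemma count_asymp : exists c K d : R, [/\ 0 < c, 0 < d, d <= 2^-1 & forall x, (0 < x)%N ->
  `|summ (bR R) x - c * x%:R| <= K * x%:R `^ (1 - d)].
Proof.
pose f Y : R := ratr (Vol Y / Y%:R ^+ D); pose K : R := ratr Kv.
have H k y : (0 < k)%N -> (0 < y)%N -> `|f (k * y)%N - f y| <= K / y%:R.
  move=> k0 y0; rewrite /f -rmorphB /= -ratr_norm.
  have -> : K / y%:R = ratr (Kv / y%:R) by rewrite fmorph_div /= ratr_nat.
  rewrite ler_rat.
  exact: Vol_compare.
have [c Hc] := cauchy_div_limit H.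
have K0 : 0 <= K by have := le_trans (normr_ge0 _) (Hc 1%N isT); rewrite divr1.
have [c1 c10 low] := Vol_lower.
have c0 : 0 < c.
  (* Along the scales of [Vol_lower], [f] stays above a positive constant while its distance to [c]
     tends to 0. *)
  rewrite ltNge; apply/negP => c0.
  have c1r : 0 < ratr c1 :> R by rewrite ltr0q.
  have [j jE] : exists j : nat, K < ratr c1 * j%:R.
    exists (Num.truncn (K / ratr c1)).+1; rewrite mulrC -ltr_pdivrMr //; exact: truncnS_gt.
  set Y := (2 * QQ * (1 + QQ * j))%N; have Y0 : (0 < Y)%N by rewrite muln_gt0 muln_gt0 QQ_gt0.
  have jY : (j <= Y)%N.
    have Q0 := QQ_gt0; rewrite /Y; move: Q0; case: (QQ) => // q _.
    apply: (@leq_trans (1 * (1 + q.+1 * j))); last by rewrite leq_mul.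
    by rewrite mul1n addnC; apply: leq_trans (leq_addr _ _); rewrite leq_pmull.
  have h1 : ratr c1 <= f Y by rewrite /f ler_rat; exact: low.
  have := Hc Y Y0; rewrite ler_norml => /andP[_ h2].
  have : ratr c1 <= K / Y%:R by move: h1 h2 c0; move: (f Y) (K / _) (ratr c1) => a b e *; lra.
  rewrite ler_pdivlMr ?ltr0n // leNgt => /negP; apply; apply: lt_le_trans jE _.
  by rewrite ler_wpM2l ?(ltW c1r) // ler_nat.
pose U x : R := \sum_(j < x) summ mb j.
have Umono x y : (x <= y)%N -> U x <= U y.
  move=> /subnK<-; elim: (y - x)%N => [//|k IH]; apply: le_trans IH _.
  by rewrite addSn /U [leRHS]big_ord_recr /= lerDl summ_mb_ge0.
have UY Y : (0 < Y)%N -> `|U (Y ^ D)%N - c * (Y ^ D)%:R ^+ 3| <= K * ((Y ^ D)%:R ^+ 3 / Y%:R).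
  move=> Y0; rewrite /U -(VolR Y0) -/(f Y) -mulrBl normrM [`|_ ^+ 3|]ger0_norm ?exprn_ge0 //.
  by rewrite [leRHS]mulrCA [leLHS]mulrC ler_wpM2l ?exprn_ge0 // Hc.
have [K1 K10 H1] := interpolate_powers c0 K0 Umono UY.
have d01 : 0 < (D%:R^-1 : R) <= 1 by rewrite invr_gt0 ltr0n /= invf_le1 ?ltr0n // ler1n.
have [K2 K20 H2] : exists2 K2 : R, 0 <= K2 & forall x, (0 < x)%N ->
    `|summ mb x - 3 * c * x%:R ^+ 2| <= K2 * (x%:R ^+ 2 * x%:R `^ (- (D%:R^-1 / 2))).
  apply: (desmooth_monotone c0 K10 d01 summ_mb_ge0 _ H1).
  by move=> x y xy; apply: le_summ_nat => // m; rewrite mulr_ge0.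
have /andP[d0 d1] := d01.
have d02 : 0 < (D%:R^-1 / 2 : R) <= 2^-1.
  by rewrite divr_gt0 //= ler_pdivrMr // mulVf.
have [K3 H3] := abel_remove_weight K20 d02 H2.
have /andP[e0 e1] := d02.
exists (2 * (3 * c)), K3, (D%:R^-1 / 2); split=> //.
by rewrite !mulr_gt0.
Qed.

Lemma sum_Lam_asymp (e : R) : 0 < e ->
  exists Y, forall v : nat, (Y <= v)%N -> `|summ (Lam R) v - v%:R| <= e * v%:R.
Proof.
have [c [K [d [c0 d0 d2 H]]]] := count_asymp.
apply: (@beurling_pnt R (bR R) (Lam R) c d K) => //.
- by rewrite /bR bcl1.
- exact: Lam_ge0.
- exact: dlog_bR.
Qed.

Lemma sum_prime_asymp (e : R) : 0 < e -> exists Y, forall v : nat, (Y <= v)%N ->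
  `|summ (fun p => ((bcl p)%:R * ln p%:R) *+ prime p) v - v%:R| <= e * v%:R.
Proof.
move=> e0; have e2 : 0 < e / 2 by rewrite divr_gt0.
have [Y HY] := sum_Lam_asymp e2.
pose C : R := D%:R * (12 * (24 * 24)).
have C0 : 0 < C by rewrite !mulr_gt0.
exists (maxn Y (maxn 2 (Num.truncn ((C / (e / 2)) ^+ 4)).+1)) => v.
rewrite !geq_max => /and3P[Yv v2 vM].
have v0 : 0 < v%:R :> R by rewrite ltr0n ltnW.
have v1 : 1 <= v%:R :> R by rewrite ler1n ltnW.
have := HY v Yv; set S := summ (Lam R) v.
have -> : S = summ (fun p => ((bcl p)%:R * ln p%:R) *+ prime p) v + summ (fun p => Lam R p *+ ~~ prime p) v.
  rewrite -summD; apply: eq_summ => p _; have [pp|pp] := boolP (prime p).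
    by rewrite Lam_prime // mulr1n mulr0n addr0.
  by rewrite mulr0n mulr1n add0r.
have np0 : 0 <= summ (fun p => Lam R p *+ ~~ prime p) v.
  by apply: summ_ge0 => p; apply: mulrn_wge0; exact: Lam_ge0.
have := sum_Lam_nonprime R v2; set N := summ _ v in np0 *.
(* With [q = v^(1/12)], each of the three logarithms in [sum_Lam_nonprime] is [O(q)] and the square
   root is [q^6], so the prime powers contribute [O(q^9)] against [v = q^12]. *)
set q := v%:R `^ (12^-1 : R).
have q0 : 0 < q by apply: powR_gt0.
have l1 : ln (v%:R : R) <= 12 * q.
  have := @ln_le_powR R 12^-1 v%:R; rewrite invrK; apply; first by rewrite invr_gt0.
  exact: v0.
have l2 : (trunc_log 2 v)%:R <= 24 * q :> R.
  have h : (2 ^ trunc_log 2 v <= v)%N by apply: trunc_logP => //; apply: ltnW.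
  have h2 : (trunc_log 2 v)%:R * ln (2%:R : R) <= ln v%:R.
    rewrite mulr_natl -lnXn ?ltr0n // -natrX; apply: ler_ln_nat => //.
    by rewrite expn_gt0.
  have /andP[ln2 _] := @ln_succ_bounds R 1 isT.
  have ln2' : 2^-1 <= ln (2%:R : R) by move: ln2; rewrite ln1 subr0.
  have := le_trans (ler_wpM2l (ler0n R (trunc_log 2 v)) ln2') h2.
  rewrite ler_pdivrMr // => h3; apply: le_trans h3 _.
  by apply: le_trans (ler_wpM2r _ l1) _ => //; apply: le_of_eq; ring.
have sq : Num.sqrt (v%:R : R) = q ^+ 6.
  rewrite -[q ^+ 6]ger0_norm ?exprn_ge0 ?(ltW q0) // -sqrtr_sqr; congr Num.sqrt.
  rewrite -exprM -powR_mulrn ?(ltW q0) // -powRrM mulVf ?powRr1 ?(ltW v0) //.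
have N1 : N <= C * q ^+ 9 -> N <= (e / 2) * v%:R.
  move=> h; apply: le_trans h _.
  have vq : v%:R = q ^+ 12 by rewrite -powR_mulrn ?(ltW q0) // -powRrM mulVf ?powRr1 ?(ltW v0).
  rewrite vq (_ : q ^+ 12 = q ^+ 3 * q ^+ 9); last by rewrite -exprD.
  rewrite mulrA ler_wpM2r ?exprn_ge0 ?(ltW q0) // mulrC -ler_pdivrMr //.
  have : (C / (e / 2)) ^+ 4 <= (q ^+ 3) ^+ 4.
    rewrite -exprM -vq; apply: ltW; apply: lt_le_trans (truncnS_gt _) _.
    by rewrite ler_nat.
  move=> h; rewrite -(ler_pXn2r (isT : (0 < 4)%N)) ?nnegrE ?exprn_ge0 ?divr_ge0 ?(ltW C0) ?(ltW e0) ?(ltW q0) //.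
move=> hN hS.
have {N1}N1 : N <= (e / 2) * v%:R.
  apply: N1; apply: le_trans hN _; rewrite sq.
  have -> : C * q ^+ 9 = D%:R * (12 * q) * (24 * q) ^+ 2 * q ^+ 6 by rewrite /C; ring.
  rewrite ler_wpM2r ?exprn_ge0 ?(ltW q0) //; apply: ler_pM; rewrite ?mulr_ge0 ?exprn_ge0 ?ln_nat_ge0 ?(ltnW v2) //.
    by rewrite ler_wpM2l.
  by rewrite lerXn2r ?nnegrE ?mulr_ge0 ?(ltW q0).
rewrite (_ : e * v%:R = e / 2 * v%:R + e / 2 * v%:R); last by rewrite -mulrDl -splitr.
move: hS np0 N1; rewrite !ler_norml; set a := summ _ v; set f := e / 2 * v%:R.
by move=> /andP[? ?] ? ?; apply/andP; split; lra.
Qed.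

End Density.


(** * Classes of prime norm and complete splitting *)

Definition intmod v w : Prop := exists k : int, dv v (w - k%:~R).

Lemma isO_int (k : int) : isO k%:~R.
Proof. by rewrite -[k%:~R]scaler_int; apply: isO_intZ; exact: isO1. Qed.

Lemma dvD v w x : dv v w -> dv v x -> dv v (w + x).
Proof. by move=> /dvP h1 /dvP h2; apply/dvP; rewrite mulrDl; apply: OS_add. Qed.

Lemma dvN v w : dv v w -> dv v (- w).
Proof. by move=> /dvP h1; apply/dvP; rewrite mulNr -sub0r; apply: OS_sub => //; apply/OS_O/isO0. Qed.

Lemma dv0 v : dv v 0.
Proof. by apply/dvP; rewrite mul0r; apply/OS_O/isO0. Qed.

Lemma intmodD v w x : intmod v w -> intmod v x -> intmod v (w + x).
Proof. by move=> [k kE] [l lE]; exists (k + l); rewrite rmorphD opprD addrACA; apply: dvD. Qed.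

Lemma intmodM v w x : isO w -> intmod v w -> intmod v x -> intmod v (w * x).
Proof.
move=> wO [k kE] [l lE]; exists (k * l).
rewrite rmorphM /= (_ : _ - _ = w * (x - l%:~R) + l%:~R * (w - k%:~R)); last by ring.
by apply: dvD; apply: dv_mull => //; apply: OS_O => //; exact: isO_int.
Qed.

Lemma intmodX v w i : isO w -> intmod v w -> intmod v (w ^+ i).
Proof.
move=> wO wv; elim: i => [|i IH]; first by exists 1; rewrite expr0 subrr dv0.
by rewrite exprS; apply: intmodM.
Qed.

Lemma isO_X w i : isO w -> isO (w ^+ i).
Proof. by move=> wO; elim: i => [|i IH]; [exact: isO1 | rewrite exprS isO_mul]. Qed.

Lemma dvX2 v w : O1 v -> dv (v ^+ 2) w -> dv v w.
Proof.
move=> /andP[vO v0]; apply: dv_trans; first by rewrite expf_neq0.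
by rewrite expr2; apply: dv_mulr.
Qed.

Lemma frob_expand (p : nat) : prime p ->
  exists g : {poly int}, \prod_(k < p) ('X - (k%:Z)%:P) = 'X^p - 'X + p%:Z *: g.
Proof.
move=> pp; set P := \prod_(k < p) _.
have mapP : map_poly (intr : int -> 'F_p) (P - ('X^p - 'X)) = 0.
  rewrite !rmorphB /= map_polyXn map_polyX rmorph_prod /=.
  have := finField_genPoly 'F_p; rewrite card_Fp // => ->.
  apply/eqP; rewrite subr_eq0; apply/eqP.
  rewrite (eq_bigr (fun k : 'I_p => 'X - ((k : nat)%:R : 'F_p)%:P)); last first.
    by move=> k _; rewrite rmorphB /= map_polyX map_polyC /= -pmulrn.
  have pE : (Zp_trunc (pdiv p)).+2 = p by rewrite Fp_cast.
  have H (V : comNzRingType) (G : nat -> V) N : N = p -> \prod_(k < p) G k = \prod_(k < N) G k.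
    by move=> ->.
  rewrite (H _ (fun k => 'X - (k%:R : 'F_p)%:P) _ pE).
  by apply: eq_bigr => k _; rewrite natr_Zp.
exists (map_poly (fun c => (c %/ p%:Z)%Z) (P - ('X^p - 'X))).
apply/eqP; rewrite addrC -subr_eq; apply/eqP/polyP => i; rewrite coefZ coef_map_id0 ?div0z //.
have /polyP/(_ i) := mapP; rewrite coef_map coef0 /= => h.
by rewrite mulrC divzK // -Fp_int_eq0 // h.
Qed.

Lemma prm_dv_prod v (I : Type) (s : seq I) (F : I -> L) : prm v ->
  (forall i, isO (F i)) -> dv v (\prod_(i <- s) F i) -> exists i, dv v (F i).
Proof.
move=> pv FO; have [v1 v2 vp] := elimT (prmP v) pv.
elim: s => [|i s IH].
  by rewrite big_nil => /(dv_NS v1 O11); rewrite NS1 dvdn1 => /eqP h; rewrite h in v2.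
rewrite big_cons => h.
have [F0|F0] := eqVneq (F i) 0; first by exists i; rewrite F0 dv0.
have [P0|P0] := eqVneq (\prod_(j <- s) F j) 0; first by apply: IH; rewrite P0 dv0.
have PO : isO (\prod_(j <- s) F j) by elim/big_ind: _ => [|a b|j _]; [exact: isO1 | exact: isO_mul | exact: FO].
have := vp (F i) _ _ _ h; rewrite /O1 FO F0 PO P0 => /(_ isT isT)/orP[|/IH //].
by exists i.
Qed.

Lemma dvR_eval v (g : {poly int}) w : isO w -> isO (map_poly intr g).[w].
Proof.
move=> wO; rewrite horner_coef; elim/big_ind: _ => [|x y|i _]; first exact: isO0.
  exact: isO_add.
by rewrite coef_map; apply: isO_mul; [exact: isO_int | exact: isO_X].
Qed.

(** The product of [w - k] over [0 <= k < p] is [w^p - w] modulo [p], hence divisible by the prime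
    [v]; so [v] divides one of its factors. *)
Lemma frob_intmod p v w : prime p -> prm v -> dv v p%:R -> isO w ->
  dv p%:R (w ^+ p - w) -> intmod v w.
Proof.
move=> pp pv vp wO pw; have [g gE] := frob_expand pp.
have p0 : p%:R != 0 :> L by apply: O1_n0; apply: O1_nat; exact: prime_gt0.
have : dv v (\prod_(k < p) (w - (k : nat)%:R)).
  have := congr1 (fun P => (map_poly (intr : int -> L) P).[w]) gE.
  rewrite rmorph_prod /= horner_prod.
  rewrite (eq_bigr (fun k : 'I_p => w - (k : nat)%:R)); last first.
    by move=> k _; rewrite rmorphB /= map_polyX map_polyC !hornerE.
  move=> ->; rewrite !rmorphD rmorphN /= map_polyXn map_polyX map_polyZ !hornerE.
  apply: dvD; first exact: dv_trans vp pw.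
  by rewrite mulrC; apply: dv_mull vp; apply/OS_O/(dvR_eval v).
move=> /(prm_dv_prod pv)[k|k kE]; first by apply: isO_sub => //; exact: isO_nat.
by exists (k : nat)%:Z.
Qed.

(** With [w = k + d] and [v | d], all terms of [(k + d)^p] beyond [k^p] are divisible by [v^2], the
    middle ones through [p] and the last because [p >= 2]. So [w], being [w^p] modulo [p], is [k^p]
    modulo [v^2]; this will exclude ramification. *)
Lemma frob_intmod2 p v w : prime p -> prm v -> dv (v ^+ 2) p%:R -> isO w ->
  dv p%:R (w ^+ p - w) -> intmod (v ^+ 2) w.
Proof.
move=> pp pv vp wO pw; have [v1 _ _] := elimT (prmP v) pv; have v0 := O1_n0 v1.
have p0 : p%:R != 0 :> L by apply: O1_n0; apply: O1_nat; exact: prime_gt0.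
have [k kE] := frob_intmod pp pv (dvX2 v1 vp) wO pw.
exists (k ^+ p); rewrite rmorphXn /=.
rewrite (_ : _ - _ = (w ^+ p - k%:~R ^+ p) - (w ^+ p - w)); last by ring.
apply: dvD; last by apply: dvN; apply: dv_trans vp pw.
set d := w - k%:~R in kE.
have dO : isO d by apply: isO_sub => //; exact: isO_int.
rewrite (_ : w = k%:~R + d); last by rewrite /d addrC subrK.
have kO := isO_int k.
rewrite exprDn big_ord_recl /= subn0 expr0 mulr1 bin0 mulr1n addrAC subrr add0r.
have dvs (I : Type) (s : seq I) (F : I -> L) : (forall i, dv (v ^+ 2) (F i)) -> dv (v ^+ 2) (\sum_(i <- s) F i).
  by move=> H; elim/big_ind: _ => //; [exact: dv0 | exact: dvD].
apply: dvs => i; rewrite /bump /= add1n -mulr_natl.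
have [ip|ip] := eqVneq i.+1 p.
  rewrite ip binn mul1r subnn expr0 mul1r.
  have -> : d ^+ p = d ^+ (p - 2) * d ^+ 2 by rewrite -exprD subnK // prime_gt1.
  apply: dv_mull; first by apply/OS_O/isO_X.
  by move/dvP: kE => kE; apply/dvP; rewrite -expr_div_n; apply: OS_X.
have ip' : (i.+1 < p)%N by rewrite ltn_neqAle ip ltn_ord.
have : (p %| 'C(p, i.+1))%N by rewrite prime_dvd_bin.
move=> /dvdnP[c ->]; rewrite natrM mulrAC; apply: (dv_mull _ vp).
by apply/OS_O/isO_mul; [exact: isO_nat | apply: isO_mul; exact: isO_X].
Qed.

Section Radical.
Variables (m e : nat) (A : int) (zt al : L).
Hypotheses (zO : isO zt) (aO : isO al) (m0 : (0 < m)%N) (e0 : (0 < e)%N) (em : (e %| m)%N).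
Hypotheses (ztm : m.-primitive_root zt) (ale : al ^+ e = A%:~R) (A0 : A != 0).
Hypothesis gen : forall i : 'I_D, exists k l : nat, B`_i = zt ^+ k * al ^+ l.

Lemma intmod_gen v : intmod v zt -> intmod v al -> forall w, isO w -> intmod v w.
Proof.
move=> vz va w /isOP[z ->]; rewrite /el.
elim/big_ind: _ => [|x y|i _]; first by exists 0; rewrite subr0 dv0.
  exact: intmodD.
rewrite scaler_int -mulrzl; apply: intmodM; first exact: isO_int.
  by exists (z 0 i); rewrite subrr dv0.
by have [k [l ->]] := gen i; apply: intmodM; [exact: isO_X | exact: intmodX | exact: intmodX].
Qed.

Lemma dv_intE v p (k : int) : O1 v -> prime p -> p \notin \pi(MM) -> (p %| NS v)%N ->
  dv v k%:~R -> (p%:Z %| k)%Z.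
Proof.
move=> v1 pp pM pv vk; have [->|k0] := eqVneq k 0; first exact: dvdz0.
have vk' : dv v (`|k|%N)%:R.
  by move: vk; case: (intP k) => [|j|j] //; rewrite ?abszN ?mulrNz => // /dvN; rewrite opprK.
have k0' : (0 < `|k|)%N by rewrite absz_gt0.
have := dvdn_trans pv (dv_NS v1 (O1_nat k0') vk'); rewrite NS_nat //.
rewrite Euclid_dvdX // => /andP[h _]; rewrite dvdzE absz_nat.
by apply: dvdn_trans h _; apply: dvdn_part.
Qed.

(** The residue ring has [NS v] elements by [residues], and the integers [0, ..., p-1] already
    represent all of them. *)
Lemma intmod_card v p : O1 v -> prime p -> p \notin \pi(MM) -> (p %| NS v)%N -> dv v p%:R ->
  (forall w, isO w -> intmod v w) -> (NS v <= p)%N.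
Proof.
move=> v1 pp pM pv vp vi; have [T [r [cT rs rE]]] := residues (O1_O v1) (O1_n0 v1).
rewrite -cT; pose f (k : 'I_p) : T := r (\row_i ((k : nat)%:Z *+ (i == 0))).
have elf (k : int) : el (\row_i (k *+ (i == 0))) = k%:~R.
  rewrite /el (bigD1 ord0) //= big1 => [|i i0]; last by rewrite mxE (negPf i0) scale0r.
  by rewrite addr0 mxE eqxx mulr1n B0 scaler_int.
rewrite -[p]card_ord; apply: (leq_trans _ (leq_image_card f xpredT)).
apply: subset_leq_card; apply/fintype.subsetP => t _.
have [z zE] := rs t; have [k kE] := vi _ (isO_el z).
have kp : (`|(k %% p%:Z)%Z| < p)%N.
  have p0 : p%:Z != 0 by rewrite eqz_nat -lt0n prime_gt0.
  by rewrite -ltz_nat gez0_abs ?modz_ge0 // ltz_pmod // ltz_nat prime_gt0.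
apply/fintype.imageP; exists (Ordinal kp) => //; rewrite -zE /f /=.
apply/rE; rewrite elf; apply/dvP.
rewrite gez0_abs ?modz_ge0 ?eqz_nat -?lt0n ?prime_gt0 //.
rewrite (_ : _ - _ = (el z - k%:~R) + (k %/ p%:Z)%Z%:~R * p%:R).
  by apply: dvD => //; apply: dv_mull => //; apply/OS_O/isO_int.
rewrite (_ : (k %% p%:Z)%Z = k - (k %/ p%:Z)%Z * p%:Z); last by rewrite {2}(divz_eq k p%:Z) addrC addKr.
by rewrite rmorphB rmorphM /= -pmulrn opprB addrA addrAC.
Qed.

(** Complete splitting of [p] in the field generated by the [m]-th roots of unity and an [e]-th root
    of [A], through Euler's criterion in the prime field. *)
Definition splitp (p : nat) : bool := (p == 1 %[mod m])%N &&
  (p%:Z %| A ^+ (p.-1 %/ e) - 1)%Z.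

Lemma frob_zt p : (p == 1 %[mod m])%N -> zt ^+ p = zt.
Proof. by move=> /eqP h; rewrite -(prim_expr_mod ztm) h (prim_expr_mod ztm) expr1. Qed.

Lemma isO_dv v w : v != 0 -> isO (w / v) -> dv v w. Proof. by move=> v0 h; apply/dvP/OS_O. Qed.

Lemma frob_al p : prime p -> splitp p -> dv p%:R (al ^+ p - al).
Proof.
move=> pp /andP[pm /dvdzP[c cE]].
have p0 : p%:R != 0 :> L by apply: O1_n0; apply: O1_nat; exact: prime_gt0.
have ep : (e %| p.-1)%N.
  by apply: dvdn_trans em _; rewrite -subn1 -eqn_mod_dvd ?prime_gt0.
have -> : al ^+ p - al = al * (A ^+ (p.-1 %/ e) - 1)%:~R.
  rewrite rmorphB rmorphXn /= -ale -exprM mulnC divnK // mulrBr mulr1 -exprS prednK //.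
  exact: prime_gt0.
apply: dv_mull; first exact: OS_O.
by apply: isO_dv => //; rewrite cE rmorphM /= -pmulrn mulfK //; exact: isO_int.
Qed.

(** For a split prime, Frobenius fixes both generators modulo [p], so every residue ring modulo a
    prime [v | p], or modulo [v^2] if [v^2 | p], consists of integers and has at most [p] elements.
    Thus each [v] has norm [p] and valuation 1, and [vlogE] at [p], of norm [p^D], counts [D] of
    them. *)
Lemma bcl_split (R : realType) p : prime p -> p \notin \pi(MM) -> splitp p -> bcl p = D.
Proof.
move=> pp pM sp; have p0 := prime_gt0 pp; have p1 := O1_nat p0.
have fz : dv p%:R (zt ^+ p - zt) by case/andP: sp => h _; rewrite frob_zt // subrr dv0.
have fa := frob_al pp sp.
have NSp : NS p%:R = (p ^ D)%N.
  by rewrite NS_nat // part_pnat_id // pnatE.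
have Nv v : prm v -> dv v p%:R -> NS v = p.
  move=> pv vp; have [v1 v2 _] := elimT (prmP v) pv.
  have := dv_NS v1 p1 vp; rewrite NSp => /(dvdn_pfactor _ _ pp)[f _ fE].
  have f0 : (0 < f)%N by case: f fE v2 => // ->.
  have pNv : (p %| NS v)%N by rewrite fE dvdn_exp.
  have := intmod_card v1 pp pM pNv vp (intmod_gen (frob_intmod pp pv vp zO fz) (frob_intmod pp pv vp aO fa)).
  by rewrite fE -{2}[p]expn1 leq_exp2l ?prime_gt1 //; case: f fE f0 => [|[|f]].
have sqf v : prm v -> dv (v ^+ 2) p%:R -> False.
  move=> pv vp; have [v1 v2 _] := elimT (prmP v) pv.
  have N1 := Nv v pv (dvX2 v1 vp).
  have v21 := O1X 2 v1; have N2 : NS (v ^+ 2) = (p ^ 2)%N by rewrite O1NSX // N1.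
  have := intmod_card v21 pp pM _ vp (intmod_gen (frob_intmod2 pp pv vp zO fz) (frob_intmod2 pp pv vp aO fa)).
  by rewrite N2 dvdn_exp // => /(_ isT); rewrite -{2}[p]expn1 leq_exp2l // prime_gt1.
rewrite -(prc_prime R pp); have lp : 0 < ln (p%:R : R).
  by apply: ln_nat_gt0; exact: prime_gt1.
have := @vlogE R p%:R (p ^ D) p1; rewrite NSp leqnn => /(_ isT) VE.
have pX : (p <= p ^ D)%N by rewrite -{1}[p]expn1 leq_pexp2l.
have VE2 : vlog R p%:R (p ^ D) = (prc p)%:R * ln p%:R.
  rewrite /vlog (eq_big_nat _ _ (F2 := fun j => ((prc p)%:R * ln p%:R) *+ (p == j))); last first.
    move=> j _; case: eqP => [<-|jp].
      rewrite mulr1n /prc; rewrite (eq_big_seq (fun=> ln p%:R)).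
        by rewrite big_const_seq count_predT iter_addr_0 mulr_natl.
      move=> v; rewrite mem_Pr => /and3P[pv _ /eqP Nvp].
      have [v1 v2 _] := elimT (prmP v) pv.
      have vp : dv v p%:R.
        have [q [qq vq NSq]] := prm_dv_prime pv; suff -> : p = q by [].
        have := dv_NS v1 (O1_nat (prime_gt0 qq)) vq; rewrite NSq Nvp Euclid_dvdX // => /andP[h _].
        by apply/eqP; rewrite -dvdn_prime2.
      rewrite big_ltn ?ltnS ?(leq_trans p0) // expr1 vp mulr1n big_nat_cond big1 ?addr0 //.
      move=> k /andP[/andP[k2 _] _]; case: (boolP (dv _ _)) => // h; exfalso; apply: (sqf v pv).
      apply: dv_trans h; first by rewrite expf_neq0 // O1_n0.
      apply/dvP; rewrite -(subnK k2) exprD mulfK ?expf_neq0 ?O1_n0 //.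
      by apply/OS_O/isO_X/O1_O.
    rewrite mulr0n big_seq big1 // => v; rewrite mem_Pr => /and3P[pv _ /eqP Nvj].
    have [v1 v2 _] := elimT (prmP v) pv.
    rewrite big_nat_cond big1 // => k /andP[/andP[k0 _] _].
    case: (boolP (dv _ _)) => // h; exfalso; apply: jp; rewrite -Nvj; apply/esym/Nv => //.
    apply: dv_trans h; first by rewrite expf_neq0 // O1_n0.
    by apply/dvP; rewrite -(prednK k0) exprSr mulfK ?O1_n0 //; apply/OS_O/isO_X/O1_O.
  by rewrite sum_nat_delta // pX mulr1n.
apply/eqP; rewrite -(eqr_nat R); apply/eqP/(mulIf (lt0r_neq0 lp)).
by rewrite -VE2 VE natrX lnXn ?ltr0n // mulr_natl.
Qed.

(** A class of norm [p] gives a reduction onto the prime field. There [A] becomes an [e]-th power,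
    and the image [x] of [zt] keeps exact order [m], so [m] divides [p - 1]. *)
Lemma split_bcl p : prime p -> p \notin \pi(MM) -> ~~ (p %| m)%N -> ~~ (p%:Z %| A)%Z ->
  (0 < bcl p)%N -> splitp p.
Proof.
move=> pp pM pm pA; rewrite /bcl; case E: (lev p) => [//|v s] _.
have : v \in lev p by rewrite E mem_head.
rewrite mem_lev => /and3P[v1 _ /eqP Nv].
have p0 := prime_gt0 pp.
have v0 := O1_n0 v1; have pNv : (p %| NS v)%N by rewrite Nv.
have im w : isO w -> intmod v w.
  move=> wO; have [z zE] := isOP wO.
  (* Two of the [p + 1] elements [0, ..., p-1, z] agree modulo [v]; two of these integers never do,
     so [z] is congruent to an integer. *)
  pose F (i : 'I_p.+1) : 'rV[int]_D :=
    if (i < p)%N then \row_j ((i : nat)%:Z *+ (j == 0)) else z.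
  have elf (k : int) : el (\row_i (k *+ (i == 0))) = k%:~R.
    rewrite /el (bigD1 ord0) //= big1 => [|i i0]; last by rewrite mxE (negPf i0) scale0r.
    by rewrite addr0 mxE eqxx mulr1n B0 scaler_int.
  have [i [j [ij /dvP h]]] : exists i j, i != j /\ OS ((el (F i) - el (F j)) / v).
    by apply: pigeonhole (O1_O v1) v0 _; rewrite Nv.
  wlog lij : i j ij h / (i < j)%N.
    move=> H; case: (ltngtP i j) => [|lji|/ord_inj eij]; first exact: (H i j).
      by apply: (H j i) => //; rewrite 1?eq_sym // -opprB; apply: dvN.
    by rewrite eij eqxx in ij.
  have ip : (i < p)%N by apply: leq_trans lij _; rewrite -ltnS.
  move: h; rewrite /F ip elf; case: ltnP => jp.
    rewrite elf -rmorphB /= => /(dv_intE v1 pp pM pNv).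
    rewrite -rpredN opprB subzn ?(ltnW lij) // dvdzE !absz_nat => h.
    have := dvdn_leq _ h; rewrite subn_gt0 lij => /(_ isT) h2.
    by exfalso; move: (leq_trans h2 (leq_subr _ _)); rewrite leqNgt jp.
  by rewrite -zE => h; exists (i : nat)%:Z; rewrite -opprB; apply: dvN.
have vp : dv v p%:R.
  have [k kE] := im (v) (O1_O v1).
  (* [v] divides its own norm, whose only prime factor outside [MM] is [p] *)
  have va := dv_an v1; have aE : an v = ((an v)`_(\pi(MM)) * p)%N.
    by rewrite -{1}(partnC \pi(MM) (an_gt0 (O1_O v1) v0)) -/(NS v) Nv.
  rewrite aE natrM in va.
  have := pnat_dvd_exp MM_gt0 (part_pnat \pi(MM) (an v)) => /dvdnP[c cE].
  have : dv v ((MM ^ ((an v)`_(\pi(MM))))%:R * p%:R).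
    by rewrite cE natrM -mulrA; apply: dv_mull va; apply/OS_O/isO_nat.
  by rewrite dv_MM.
have [x xE] := im _ zO; have [y yE] := im _ aO.
have eqX w k i : isO w -> dv v (w - k%:~R) -> dv v (w ^+ i - k%:~R ^+ i).
  move=> wO h; rewrite subrXX mulrC; apply: dv_mull => //; apply: OS_O.
  by elim/big_ind: _ => [|a b|j _]; [exact: isO0 | exact: isO_add | apply: isO_mul; apply: isO_X => //; exact: isO_int].
have yA : (p%:Z %| y ^+ e - A)%Z.
  have := eqX _ _ e aO yE; rewrite ale -rmorphXn -rmorphB /= => /(dv_intE v1 pp pM pNv).
  by rewrite -rpredN opprB.
suff pm1 : (p == 1 %[mod m])%N.
  rewrite /splitp pm1 /=; have ep : (e %| p.-1)%N.
    by apply: dvdn_trans em _; rewrite -subn1 -eqn_mod_dvd.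
  rewrite (_ : _ - 1 = (y ^+ p.-1 - 1) - ((y ^+ e) ^+ (p.-1 %/ e) - A ^+ (p.-1 %/ e))); last first.
    by rewrite -exprM mulnC divnK //; ring.
  rewrite rpredB // ?fermat_int //; last by rewrite subrXX dvdz_mulr.
  apply: contra pA => py; rewrite -[A](subKr (y ^+ e)) rpredB //.
  by rewrite -[e]prednK // exprS dvdz_mulr.
(* If the residue of [zt] had smaller order, [v] would divide some [zt^i - 1], hence [m], which is
   the product of the [1 - zt^j]. *)
have xord i : (0 < i < m)%N -> ~~ (p%:Z %| x ^+ i - 1)%Z.
  move=> /andP[i0 im']; apply/negP => pxi.
  have : dv v (zt ^+ i - 1).
    rewrite (_ : zt ^+ i - 1 = (zt ^+ i - x%:~R ^+ i) + (x ^+ i - 1)%:~R); last first.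
      by rewrite rmorphB rmorphXn /= addrA subrK.
    apply: dvD; first exact: eqX.
    by move/dvdzP: pxi => [c ->]; rewrite rmorphM /=; apply: dv_mull vp; apply/OS_O/isO_int.
  have mprod : exists c, isO c /\ (m%:R : L) = (zt ^+ i - 1) * c.
    have zm1 : forall j, (0 < j < m)%N -> zt ^+ j - 1 != 0.
      move=> j /andP[j0 jm]; rewrite subr_eq0 -(prim_order_dvd ztm).
      by apply/negP => /(dvdn_leq j0); rewrite leqNgt jm.
    (* [m = \prod_(0 < j < m) (1 - zt ^+ j)], from [X^m - 1] *)
    have Ep : \prod_(1 <= j < m) ('X - (zt ^+ j)%:P) = \sum_(j < m) 'X^j :> {poly L}.
      have X1 : ('X - 1%:P : {poly L}) != 0 by rewrite polyXsubC_eq0.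
      apply: (mulfI X1); rewrite -{1}(expr0 zt) -(big_ltn (F := fun j => 'X - (zt ^+ j)%:P)) //.
      by rewrite (factor_Xn_sub_1 ztm) polyC1 subrX1.
    have := congr1 (fun P => P.[1]) Ep.
    have -> : (\sum_(j < m) 'X^j).[1] = m%:R :> L.
      rewrite horner_sum (eq_bigr (fun=> 1)) ?sumr_const ?card_ord // => j _.
      by rewrite hornerXn expr1n.
    rewrite horner_prod => <-.
    rewrite (bigD1_seq i) ?iota_uniq ?mem_index_iota ?i0 //= !hornerE.
    exists (- \prod_(1 <= j < m | j != i) ('X - (zt ^+ j)%:P).[1]).
    split; last by rewrite mulrN -mulNr opprB.
    rewrite -sub0r; apply: isO_sub; first exact: isO0.
    elim/big_ind: _ => [|a b|j _]; [exact: isO1 | exact: isO_mul|].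
    by rewrite !hornerE; apply: isO_sub; [exact: isO1 | exact: isO_X].
  have [c [cO mE]] := mprod => h.
  have : dv v ((m%:Z)%:~R : L) by rewrite -pmulrn mE mulrC; apply: dv_mull h; exact: OS_O.
  by move=> /(dv_intE v1 pp pM pNv); rewrite dvdzE !absz_nat (negPf pm).
have xm : (p%:Z %| x ^+ m - 1)%Z.
  have := eqX _ _ m zO xE; rewrite (prim_expr_order ztm) -(rmorph1 (intr : int -> L)) -rmorphXn -rmorphB /=.
  by move=> /(dv_intE v1 pp pM pNv); rewrite -rpredN opprB.
pose X : 'F_p := x%:~R.
have Xm i : (X ^+ i == 1) = (p%:Z %| x ^+ i - 1)%Z.
  by rewrite -Fp_int_eq0 // rmorphB rmorphXn /= subr_eq0.
have primX : m.-primitive_root X.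
  have : X ^+ m = 1 by apply/eqP; rewrite Xm.
  move=> /(prim_order_exists m0)[k kp km].
  suff <- : k = m by [].
  have k0 := prim_order_gt0 kp; apply/eqP; rewrite eqn_leq dvdn_leq //= leqNgt; apply/negP => km'.
  by have := xord k; rewrite k0 km' -Xm (prim_expr_order kp) eqxx => /(_ isT).
have X0 : X != 0.
  by apply/eqP => h; have /eqP := prim_expr_order primX; rewrite h expr0n gtn_eqF // eq_sym oner_eq0.
have : X ^+ p.-1 = 1.
  by apply/eqP; rewrite Xm fermat_int // -Fp_int_eq0.
move=> /eqP; rewrite -(prim_order_dvd primX) => h.
by rewrite eqn_mod_dvd // subn1.
Qed.

End Radical.


Section SplitDensity.
Variables (m e : nat) (A : int) (zt al : L).
Hypotheses (zO : isO zt) (aO : isO al) (m0 : (0 < m)%N) (e0 : (0 < e)%N) (em : (e %| m)%N).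
Hypotheses (ztm : m.-primitive_root zt) (ale : al ^+ e = A%:~R) (A0 : A != 0).
Hypothesis gen : forall i : 'I_D, exists k l : nat, B`_i = zt ^+ k * al ^+ l.
Variable R : realType.

Lemma summ_initial (h : nat -> R) (P v : nat) : (forall p, 0 <= h p) ->
  summ (fun p => h p *+ (p <= P)%N) v <= summ h P.
Proof.
move=> h0; have [vP|Pv] := leqP v P.
  apply: le_trans (le_summ_nat h0 vP); apply: le_summ => p /andP[_ pv].
  by rewrite (leq_trans pv vP).
rewrite /summ (@big_cat_nat _ _ _ P.+1) //=; last exact: ltnW.
rewrite [X in _ + X]big_nat_cond [X in _ + X]big1 ?addr0; last first.
  by move=> p /andP[/andP[Pp _] _]; rewrite leqNgt Pp.
by apply: ler_sum_nat => p /andP[_]; rewrite ltnS => ->.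
Qed.

(** Beyond the bound [P] the function [bcl] is [D] times the indicator of [splitp] on primes, so
    [sum_prime_asymp] divided by [D] gives the result; the primes up to [P] contribute the constant
    [C]. *)
Lemma split_sum (eps : R) : 0 < eps -> exists Y : nat, forall v : nat, (Y <= v)%N ->
  `|summ (fun p => ln p%:R *+ (prime p && splitp m e A p)) v - v%:R / D%:R| <= eps * v%:R.
Proof.
move=> eps0; have e2 : 0 < eps / 2 by rewrite divr_gt0.
have [Y HY] := sum_prime_asymp e2.
pose P := (MM + m + `|A|)%N.
pose h (p : nat) : R := (D%:R + (bcl p)%:R) * ln p%:R *+ (0 < p)%N.
have h0 p : 0 <= h p.
  by case: p => [|p]; rewrite /h ?mulr0n // mulr1n mulr_ge0 ?addr_ge0 // ln_nat_ge0.
pose C := summ h P; have C0 : 0 <= C by apply: summ_ge0.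
exists (maxn Y (Num.truncn (C / (eps / 2))).+1) => v; rewrite geq_max => /andP[Yv Cv].
set S := summ _ v.
have D0 : 0 < D%:R :> R by rewrite ltr0n.
have CB : C <= eps / 2 * v%:R.
  rewrite mulrC -ler_pdivrMr //; apply: ltW; apply: lt_le_trans (truncnS_gt _) _.
  by rewrite ler_nat.
have main : `|D%:R * S - summ (fun p => ((bcl p)%:R * ln p%:R) *+ prime p) v| <= C.
  rewrite -summZ -summB; apply: le_trans (norm_summ _ _) _.
  apply: le_trans (_ : summ (fun p => h p *+ (p <= P)%N) v <= _); last exact: summ_initial.
  apply: le_summ => p /andP[p0 _]; have lp : 0 <= ln (p%:R : R) by apply: ln_nat_ge0.
  have [pp|pp] := boolP (prime p); last first.
    by rewrite !mulr0n mulr0 subrr normr0 mulrn_wge0.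
  rewrite mulr1n /=; have [pP|pP] := leqP p P.
    rewrite mulr1n /h p0 mulr1n mulrDl; apply: le_trans (ler_normB _ _) _; apply: lerD.
      rewrite ger0_norm ?mulr_ge0 ?mulrn_wge0 // ler_wpM2l //.
      by case: splitp; rewrite ?mulr1n ?mulr0n.
    by rewrite ger0_norm // mulr_ge0.
  have pM : p \notin \pi(MM).
    rewrite mem_primes pp MM_gt0 /=; apply/negP => /(dvdn_leq MM_gt0); rewrite leqNgt => /negP; apply.
    by apply: leq_ltn_trans pP; rewrite /P -addnA leq_addr.
  have pm : ~~ (p %| m)%N.
    apply/negP => /(dvdn_leq m0); rewrite leqNgt => /negP; apply.
    by apply: leq_ltn_trans pP; rewrite /P addnAC leq_addl.
  have pA : ~~ (p%:Z %| A)%Z.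
    rewrite dvdzE absz_nat; apply/negP => /dvdn_leq; rewrite absz_gt0 A0 => /(_ isT).
    rewrite leqNgt => /negP; apply; apply: leq_ltn_trans pP; exact: leq_addl.
  rewrite mulr0n; have [sp|sp] := boolP (splitp m e A p).
    by rewrite (@bcl_split _ _ _ _ _ zO aO m0 e0 em ztm ale A0 gen R p pp pM sp) mulr1n subrr normr0.
  have [b0|b0] := posnP (bcl p); first by rewrite b0 mul0r mulr0n mulr0 subrr normr0.
  by rewrite (@split_bcl _ _ _ _ _ zO aO m0 e0 em ztm ale A0 gen p pp pM pm pA b0) in sp.
have HV := HY v Yv.
have -> : S - v%:R / D%:R = (D%:R * S - v%:R) / D%:R by field; rewrite gt_eqF.
rewrite normrM [`|D%:R^-1|]gtr0_norm ?invr_gt0 // ler_pdivrMr //.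
apply: le_trans (_ : eps * v%:R <= _); last by rewrite ler_peMr ?ler1n // mulr_ge0 // ltW.
rewrite [X in `|X|](_ : _ = (D%:R * S - summ (fun p => ((bcl p)%:R * ln p%:R) *+ prime p) v) +
  (summ (fun p => ((bcl p)%:R * ln p%:R) *+ prime p) v - v%:R)); last by rewrite addrA subrK.
apply: le_trans (ler_normD _ _) _; apply: le_trans (lerD (le_trans main CB) HV) _.
by rewrite -mulrDl -splitr.
Qed.

End SplitDensity.

End Order.
Unset Default Proof Using.

Theorem radical_log_density (R : realType) (m e : nat) (A : int) (z : algC) :
  (0 < m)%N -> (0 < e)%N -> (e %| m)%N -> A != 0 -> m.-primitive_root z ->
  (forall q (P : {poly rat}), prime q -> (q %| e)%N -> (map_poly ratr P).[z] ^+ q != A%:~R) ->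
  forall eps : R, 0 < eps -> exists Y : nat, forall v : nat, (Y <= v)%N ->
    `|summ (fun p => ln p%:R *+ (prime p && splitp m e A p)) v - v%:R / (totient m * e)%:R|
      <= eps * v%:R.
Proof.
move=> m0 e0 em A0 zm npow eps eps0.
have [L [n [B [zt [al [basisB B0 intB <- [ztm ale gen int_gen]]]]]]] := kummer_field m0 e0 em A0 zm npow.
have zO : isO B zt by apply/forallP => i; have := int_gen 1%N 0%N i; rewrite expr1 expr0 mulr1.
have aO : isO B al by apply/forallP => i; have := int_gen 0%N 1%N i; rewrite expr1 expr0 mul1r.
exact: (split_sum basisB B0 intB zO aO m0 e0 em ztm ale A0 gen).
Qed.

(** * From logarithmic weights to counting primes *)

Section PrimeCounting.
Variable R : realType.

Definition cnt (P : pred nat) (v : nat) : R := summ (fun p => (prime p && P p)%:R) v.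
Definition theta (P : pred nat) (v : nat) : R := summ (fun p => ln p%:R *+ (prime p && P p)) v.

Lemma cnt_ge0 P v : 0 <= cnt P v.
Proof. by apply: summ_ge0. Qed.

Lemma abel_from (a f : nat -> R) N k :
  summ (fun n => a n * f n) (N + k) - summ (fun n => a n * f n) N =
  summ a (N + k) * f (N + k)%N - summ a N * f N +
  \sum_(i < k) summ a (N + i) * (f (N + i)%N - f (N + i).+1).
Proof.
elim: k => [|k IH]; first by rewrite addn0 !subrr big_ord0 addr0.
rewrite big_ord_recr /= addnS !summS addrAC IH; ring.
Qed.

Lemma theta_le_cnt P v : theta P v <= ln v%:R * cnt P v.
Proof.
rewrite -summZ; apply: le_summ => p /andP[p0 pv].
case: (_ && _); rewrite ?mulr1n ?mulr1 ?mulr0n ?mulr0 //.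
by apply: ler_ln_nat.
Qed.

Lemma cntE P v : cnt P v = summ (fun p => (ln p%:R *+ (prime p && P p)) * (ln p%:R)^-1) v.
Proof.
apply: eq_summ => p _; case: (boolP (prime p)) => pp /=; last by rewrite mulr0n mul0r.
case: (P p); last by rewrite mulr0n mul0r.
by rewrite mulr1n divff // gt_eqF // ln_nat_gt0 // prime_gt1.
Qed.

Hypothesis pnt : forall eps : R, 0 < eps -> exists Y : nat, forall v : nat, (Y <= v)%N ->
  `|theta xpredT v - v%:R| <= eps * v%:R.

Lemma cnt_unbounded (M : R) : exists Y : nat, forall v, (Y <= v)%N -> M <= cnt xpredT v.
Proof.
have h2 : 0 < 2^-1 :> R by [].
have [Y HY] := pnt h2.
exists (maxn Y (maxn 2 (Num.truncn ((4 * `|M|) ^+ 2)).+1)) => v; rewrite !geq_max => /and3P[Yv v2 Mv].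
have v0 : 0 < v%:R :> R by rewrite ltr0n ltnW.
have lv : 0 < ln (v%:R : R) by apply: ln_nat_gt0.
have := HY v Yv; rewrite ler_norml => /andP[h _].
have := theta_le_cnt xpredT v; set c := cnt _ _ => h3.
set q := v%:R `^ (2^-1 : R); have q0 : 0 < q by apply: powR_gt0.
have l1 : ln (v%:R : R) <= 2 * q.
  have := @ln_le_powR R 2^-1 v%:R; rewrite invrK; apply; first by [].
  exact: v0.
have vq : v%:R = q ^+ 2 by rewrite -powR_mulrn ?(ltW q0) // -powRrM mulVf ?powRr1 ?(ltW v0).
have c0 : 0 <= c by apply: cnt_ge0.
have h4 : q ^+ 2 <= 4 * q * c.
  have : ln v%:R * c <= 2 * q * c by rewrite ler_wpM2r.
  rewrite (_ : 4 * q * c = 2 * (2 * q * c)); last by ring.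
  by move: h h3; rewrite vq; move: (theta _ _) (q ^+ 2) (ln _ * c) (2 * q * c) => *; lra.
have h5 : q <= 4 * c by rewrite -(ler_pM2l q0) -expr2; apply: le_trans h4 _; apply: le_of_eq; ring.
have h6 : 4 * `|M| <= q.
  rewrite -(ler_pXn2r (isT : (0 < 2)%N)) ?nnegrE ?mulr_ge0 ?(ltW q0) // -vq.
  by apply: ltW; apply: lt_le_trans (truncnS_gt _) _; rewrite ler_nat.
by have := ler_norm M; move: h5 h6; move: (`|M|) => *; lra.
Qed.

(** Partial summation against [1/ln] turns a linear error into [W]. The same summation applied to
    all primes, with [theta n >= n/2], bounds [W] by twice the prime count plus a constant, so the
    error is measured against the prime count itself. In [eps/8], one half of [eps] is for [W] and
    one for the constants, absorbed by [cnt_unbounded]. *)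
Lemma count_density (P : pred nat) (dl : R) :
  (forall eps : R, 0 < eps -> exists Y : nat, forall v : nat, (Y <= v)%N ->
     `|theta P v - dl * v%:R| <= eps * v%:R) ->
  forall eps : R, 0 < eps -> exists Y : nat, forall v : nat, (Y <= v)%N ->
     `|cnt P v - dl * cnt xpredT v| <= eps * cnt xpredT v.
Proof.
move=> HP eps eps0; pose e1 := eps / 8.
have e10 : 0 < e1 by rewrite divr_gt0.
have dlp : 0 < `|dl| + 1 by rewrite ltr_wpDl.
have e20 : 0 < e1 / (`|dl| + 1) by rewrite divr_gt0.
have [Y1 H1] := HP _ e10. have [Y2 H2] := pnt e20.
have h2 : 0 < 2^-1 :> R by [].
have [Y3 H3] := pnt h2.
pose N := maxn (maxn Y1 Y2) (maxn Y3 2).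
have NY1 : (Y1 <= N)%N by rewrite !leq_max leqnn.
have NY2 : (Y2 <= N)%N by rewrite !leq_max leqnn orbT.
have NY3 : (Y3 <= N)%N by rewrite !leq_max leqnn !orbT.
have N2 : (2 <= N)%N by rewrite !leq_max leqnn !orbT.
pose f n : R := (ln n%:R)^-1.
pose a p : R := ln p%:R *+ (prime p && P p) - dl * (ln p%:R *+ (prime p && true)).
have aE v : summ a v = theta P v - dl * theta xpredT v by rewrite summB summZ.
have Ea v : (N <= v)%N -> `|summ a v| <= 2 * e1 * v%:R.
  move=> Nv; rewrite aE.
  have -> : theta P v - dl * theta xpredT v = (theta P v - dl * v%:R) - dl * (theta xpredT v - v%:R) by ring.
  apply: le_trans (ler_normB _ _) _; rewrite (_ : 2 * e1 * v%:R = e1 * v%:R + e1 * v%:R); last by ring.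
  apply: lerD; first by apply: H1; apply: leq_trans Nv.
  rewrite normrM; apply: le_trans (ler_wpM2l (normr_ge0 _) (H2 v (leq_trans NY2 Nv))) _.
  rewrite mulrA ler_wpM2r // mulrCA ler_piMr ?(ltW e10) // ler_pdivrMr // mul1r lerDl //.
pose W v := v%:R * f v + \sum_(i < (v - N)%N) (N + i)%:R * (f (N + i)%N - f (N + i).+1).
have f0 n : (1 < n)%N -> 0 < f n by move=> n1; rewrite invr_gt0 ln_nat_gt0.
have fd n : (1 < n)%N -> 0 <= f n - f n.+1.
  move=> n1; rewrite subr_ge0 lef_pV2 ?posrE ?ln_nat_gt0 //; last exact: ltnW.
  by apply: ler_ln_nat => //; apply: ltnW.
pose G v := cnt P v - dl * cnt xpredT v.
have GE v : G v = summ (fun n => a n * f n) v.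
  rewrite /G !cntE -summZ -summB; apply: eq_summ => p _; rewrite /a /f; ring.
pose C1 := `|G N| + `|summ a N * f N|.
have upG v : (N <= v)%N -> `|G v| <= C1 + 2 * e1 * W v.
  move=> Nv; have := abel_from a f N (v - N); rewrite subnKC // -!GE => E.
  have -> : G v = G N + (- (summ a N * f N)) + (summ a v * f v +
      \sum_(i < (v - N)%N) summ a (N + i) * (f (N + i)%N - f (N + i).+1)).
    by rewrite -[LHS](subrK (G N)) E; ring.
  apply: le_trans (ler_normD _ _) _; apply: lerD.
    by apply: le_trans (ler_normD _ _) _; rewrite normrN.
  apply: le_trans (ler_normD _ _) _; rewrite /W mulrDr; apply: lerD.
    rewrite normrM [`|f v|]gtr0_norm ?f0 ?(leq_trans N2) // mulrA ler_wpM2r ?Ea //.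
    by rewrite ltW // f0 // (leq_trans N2).
  apply: le_trans (ler_norm_sum _ _ _) _; rewrite mulr_sumr; apply: ler_sum => i _.
  have Ni : (1 < N + i)%N by apply: leq_trans N2 (leq_addr _ _).
  by rewrite normrM [`|f _ - _|]ger0_norm ?fd // mulrA ler_wpM2r ?fd // Ea ?leq_addr.
pose C2 := `|cnt xpredT N - theta xpredT N * f N|.
have loc v : (N <= v)%N -> W v <= 2 * (cnt xpredT v + C2).
  move=> Nv; pose b (p : nat) : R := ln p%:R *+ (prime p && true).
  have := abel_from b f N (v - N); rewrite subnKC // -!cntE -/(theta xpredT v) => E.
  have th n : (N <= n)%N -> 2^-1 * n%:R <= theta xpredT n.
    move=> Nn; have := H3 n (leq_trans NY3 Nn); rewrite ler_norml => /andP[+ _].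
    by move: (theta _ _) (n%:R : R) => x y; lra.
  pose S := \sum_(i < (v - N)%N) theta xpredT (N + i) * (f (N + i)%N - f (N + i).+1).
  have E' : cnt xpredT v - cnt xpredT N = theta xpredT v * f v - theta xpredT N * f N + S by [].
  have s1 : 2^-1 * W v <= theta xpredT v * f v +
S.
    rewrite /W mulrDr; apply: lerD.
      by rewrite mulrA ler_wpM2r ?th // ltW // f0 // (leq_trans N2).
    rewrite mulr_sumr; apply: ler_sum => i _.
    have Ni : (1 < N + i)%N by apply: leq_trans N2 (leq_addr _ _).
    by rewrite mulrA ler_wpM2r ?fd // th // leq_addr.
  have C2' : - C2 <= cnt xpredT N - theta xpredT N * f N by rewrite lerNl /C2 -[X in _ <= X]normrN ler_norm.
  move: E' s1 C2'.
  by move: (cnt xpredT v) (cnt xpredT N) (theta xpredT v * f v) (theta xpredT N * f N) S (W v) => *; lra.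
have [Y4 H4] := cnt_unbounded ((C1 + 4 * e1 * C2) / (4 * e1)).
exists (maxn N Y4) => v; rewrite geq_max => /andP[Nv Yv].
have e41 : 0 < 4 * e1 by rewrite mulr_gt0.
have := H4 v Yv; rewrite ler_pdivrMr // => h4.
apply: le_trans (upG v Nv) _.
have h5 : 2 * e1 * W v <= 2 * e1 * (2 * (cnt xpredT v + C2)).
  by rewrite ler_wpM2l ?loc // mulr_ge0 // ltW.
apply: le_trans (lerD (lexx _) h5) _.
have -> : eps * cnt xpredT v = cnt xpredT v * (4 * e1) + 4 * e1 * cnt xpredT v by rewrite /e1; field.
rewrite (_ : 2 * e1 * (2 * _) = 4 * e1 * cnt xpredT v + 4 * e1 * C2); last by ring.
by move: h4; move: (cnt xpredT v * (4 * e1)) (4 * e1 * cnt xpredT v) (4 * e1 * C2) => *; lra.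
Qed.

End PrimeCounting.

Lemma expr_coprime_eq1 (F : fieldType) (x : F) (i j : nat) :
  coprime i j -> x ^+ i = 1 -> x ^+ j = 1 -> x = 1.
Proof.
case: i => [|i] cij xi xj.
  by move: cij; rewrite /coprime gcd0n => /eqP j1; rewrite j1 expr1 in xj.
have [u v E _] := egcdnP j (ltn0Sn i); move: E; rewrite (eqP cij) => E.
by have : x ^+ (u * i.+1) = 1; [rewrite mulnC exprM xi expr1n | rewrite E exprD mulnC exprM xj expr1n mul1r expr1].
Qed.

(** [l] is the product of [1 - z^j] over [0 < j < l] for a primitive [l]-th root [z] in the prime
    field. Pairing [j] with [l - j] gives [- z^(l-j) (1 - z^j)^2], and [z^(l-j)] is a square because
    [l] is odd: halving its exponent is multiplying it by [(l+1)/2]. *)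
Lemma star_square (p l : nat) : prime p -> prime l -> odd l -> (l %| p.-1)%N ->
  exists w : 'F_p, (l%:R : 'F_p) = (-1) ^+ (l./2) * w ^+ 2.
Proof.
move=> pp lp ol lp1; have l0 := prime_gt0 lp; have p1 := prime_gt1 pp.
have [z zl] : exists z : 'F_p, l.-primitive_root z.
  pose k := (p.-1 %/ l)%N; have k0 : (0 < k)%N by rewrite divn_gt0 // dvdn_leq // -subn1 subn_gt0.
  have klt : (k < p.-1)%N by rewrite ltn_Pdiv ?prime_gt1 // -subn1 subn_gt0.
  have [x x0 xk] : exists2 x : 'F_p, x != 0 & x ^+ k != 1.
    apply/exists_inP; apply: contraT; rewrite negb_exists_in => /forall_inP H.
    have Z : ('X^k - 1 : {poly 'F_p}) != 0 by rewrite -size_poly_eq0 size_XnsubC.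
    have := max_poly_roots Z (_ : all (root _) (enum [pred x : 'F_p | x != 0])) (enum_uniq _).
    rewrite size_XnsubC // -cardE => h.
    have : (#|[pred x : 'F_p | x != 0%R]| < k.+1)%N.
      apply: h; apply/allP => x; rewrite mem_enum inE => x0.
      by rewrite /root !hornerE subr_eq0; have := H x x0; rewrite negbK.
    have -> : #|[pred x : 'F_p | x != 0%R]| = p.-1 by rewrite (cardC1 (0 : 'F_p)) card_Fp.
    by rewrite ltnS leqNgt klt.
  exists (x ^+ k).
  have xl : (x ^+ k) ^+ l = 1.
    rewrite -exprM divnK //; apply: (mulfI x0); rewrite -exprS prednK ?prime_gt0 // mulr1.
    by have := expf_card x; rewrite card_Fp.
  have [j jp jl] := prim_order_exists l0 xl.
  have /orP[/eqP j1|/eqP jl'] := (primeP lp).2 _ jl; last by rewrite -jl'.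
  by move: (prim_expr_order jp); rewrite j1 expr1 => h; rewrite h eqxx in xk.
pose n := l./2; have lE : l = n.*2.+1 by rewrite -[LHS]odd_double_half ol.
have Ep : \prod_(1 <= j < l) ('X - (z ^+ j)%:P) = \sum_(j < l) 'X^j :> {poly 'F_p}.
  have X1 : ('X - 1%:P : {poly 'F_p}) != 0 by rewrite polyXsubC_eq0.
  apply: (mulfI X1); rewrite -{1}(expr0 z) -(big_ltn (F := fun j => 'X - (z ^+ j)%:P)) //.
  by rewrite (factor_Xn_sub_1 zl) polyC1 subrX1.
have := congr1 (fun P => P.[1]) Ep.
have -> : (\sum_(j < l) 'X^j).[1] = l%:R :> 'F_p.
  rewrite horner_sum (eq_bigr (fun=> 1)) ?sumr_const ?card_ord // => j _.
  by rewrite hornerXn expr1n.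
rewrite horner_prod => <-.
exists (\prod_(1 <= j < n.+1) (z ^+ ((l - j) * n.+1) * (1 - z ^+ j))).
rewrite (eq_bigr (fun j => 1 - z ^+ j)); last by move=> j _; rewrite !hornerE.
rewrite (@big_cat_nat _ _ _ n.+1) //=; last by rewrite lE ltnS -addnn leq_addr.
rewrite [X in _ * X](_ : _ = \prod_(1 <= j < n.+1) (1 - z ^+ (l - j))); last first.
  rewrite [RHS]big_nat_rev /= -[n.+1 in LHS]add0n big_addn.
  have -> : (l - n.+1 = n)%N by rewrite lE -addnn subSS addnK.
  rewrite big_add1 /= [RHS]big_mkord [LHS]big_mkord.
  apply: eq_bigr => j _; have jn := ltn_ord j; congr (1 - _); congr (z ^+ _).
  by rewrite lE -addnn; move: jn; move: (nat_of_ord j) => i jn; lia.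
rewrite -big_split /= -[n]/(l./2) -/n.
have -> : (-1) ^+ n = \prod_(1 <= j < n.+1) (-1 : 'F_p) by rewrite prodr_const_nat subn1.
rewrite -prodrXl -big_split /=; apply: eq_big_nat => j /andP[j0 jn].
have jl : (j <= l)%N by rewrite lE; lia.
have sq : (z ^+ ((l - j) * n.+1)) ^+ 2 = z ^+ (l - j).
  rewrite -exprM -mulnA (_ : (n.+1 * 2 = l + 1)%N); last by rewrite lE; lia.
  by rewrite mulnDr muln1 exprD mulnC exprM (prim_expr_order zl) expr1n mul1r.
have zj : z ^+ (l - j) * z ^+ j = 1 by rewrite -exprD subnK // (prim_expr_order zl).
rewrite exprMn sq expr2.
have -> : 1 - z ^+ (l - j) = - (z ^+ (l - j) * (1 - z ^+ j)) by rewrite mulrBr zj mulr1 opprB.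
ring.
Qed.

(** The signed primes of [star_square] are all 1 modulo 4, so their product is the sign of the given
    number that is 1 modulo 4. *)
Lemma squarefree_star (p : nat) (ls : seq nat) : prime p ->
  all (fun l => [&& prime l, odd l & (l %| p.-1)%N]) ls ->
  exists c : int, [/\ `|c|%N = (\prod_(l <- ls) l)%N, (4%:Z %| c - 1)%Z &
    exists w : 'F_p, c%:~R = w ^+ 2].
Proof.
move=> pp; elim: ls => [|l ls IH] /=.
  by exists 1; split=> //; [rewrite big_nil | exists 1; rewrite expr1n].
move=> /andP[/and3P[lp ol lp1] /IH[c [cE c4 [w wE]]]].
have [x xE] := star_square pp lp ol lp1.
have lz : l%:Z = 1 + 2 * (l./2)%:Z.
  have lh := odd_double_half l; rewrite ol in lh.
  by rewrite -{1}lh; move: (l./2) => k; lia.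
exists ((-1) ^+ l./2 * l%:Z * c); split.
- by rewrite big_cons !abszM abszX absz_nat cE exp1n mul1n.
- have -> : (-1) ^+ l./2 * l%:Z * c - 1 = ((-1) ^+ l./2 * l%:Z - 1) * c + (c - 1) by ring.
  rewrite rpredD // dvdz_mulr // lz -signr_odd; move: (l./2) => k.
  have := odd_double_half k; case: (odd k) => /= kE; apply/dvdzP.
    have kz : k%:Z = 1 + 2 * (k./2)%:Z by rewrite -{1}kE; move: (k./2) => j; lia.
    exists (- (k./2)%:Z - 1); rewrite expr1 kz; ring.
  have kz : k%:Z = 2 * (k./2)%:Z by rewrite -{1}kE; move: (k./2) => j; lia.
  exists (k./2)%:Z; rewrite expr0 kz; ring.
exists (x * w); rewrite rmorphM /= wE exprMn rmorphM /= rmorphXn /= rmorphN1 -pmulrn xE.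
by rewrite !mulrA -expr2 sqrr_sign mul1r.
Qed.

Lemma sum6_lt (x1 x2 x3 x4 x5 x6 p : nat) : (x1 + x2 + x3 + x4 + x5 + x6 + 2 < p)%N ->
  [/\ (x1 < p)%N, (x2 < p)%N, (x3 < p)%N & [/\ (x4 < p)%N, (x5 < p)%N, (x6 < p)%N & (2 < p)%N]].
Proof. by move=> H; split; [lia | lia | lia | split; lia]. Qed.

(** * Residual indices and splitting *)

Section Index.
Variable a : rat.
Hypothesis a0 : a != 0.

Definition idx (p : nat) : nat := (p.-1 %/ ordp p a)%N.
Definition ev (p : nat) (r : rat) : 'F_p := (numq r)%:~R / (denq r)%:~R.

Lemma Fp_den_num p : prime p -> nu p a == 0 ->
  ((numq a)%:~R != 0 :> 'F_p) && ((denq a)%:~R != 0 :> 'F_p).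
Proof.
move=> pp; rewrite !Fp_int_eq0 // !dvdzE !absz_nat /nu subr_eq0 eqz_nat => /eqP E.
have cop := coprime_num_den a.
have n0 : (0 < `|numq a|)%N by rewrite absz_gt0 numq_eq0.
have d0 : (0 < `|denq a|)%N by rewrite absz_gt0 denq_eq0.
have h (x y : nat) : (0 < x)%N -> (0 < y)%N -> coprime x y -> logn p x = logn p y -> ~~ (p %| x)%N.
  move=> x0 y0 cxy e; apply/negP => px.
  have : (0 < logn p y)%N by rewrite -e logn_gt0 mem_primes pp x0.
  rewrite logn_gt0 mem_primes pp y0 /= => py.
  by have := dvdn_gcd p x y; rewrite px py (eqP cxy) dvdn1 => /eqP p1; rewrite p1 in pp.
by rewrite (h _ _ n0 d0 cop E) (h _ _ d0 n0) // coprime_sym.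
Qed.

(** The exponents which the search in [ordp] accepts are the multiples of the order of [a] modulo
    [p], and this order is at most [p - 1]; the first hit is therefore the order. *)
Lemma ordp_prim p : prime p -> nu p a == 0 -> (ordp p a).-primitive_root (ev p a).
Proof.
move=> pp na; have /andP[n0 d0] := Fp_den_num pp na.
have x0 : ev p a != 0 by rewrite mulf_neq0 ?invr_eq0.
have xm m : ((p%:Z) %| numq a ^+ m - denq a ^+ m)%Z = (ev p a ^+ m == 1).
  rewrite -Fp_int_eq0 // rmorphB !rmorphXn /= subr_eq0 /ev expr_div_n.
  by rewrite -[RHS](inj_eq (mulIf (expf_neq0 m d0))) mulfVK ?expf_neq0 // mul1r.
have xp : ev p a ^+ p.-1 = 1.
  apply: (mulfI x0); rewrite -exprS prednK ?prime_gt0 // mulr1.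
  by have := expf_card (ev p a); rewrite card_Fp.
have p10 : (0 < p.-1)%N by rewrite -subn1 subn_gt0 prime_gt1.
have [k kp kd] := prim_order_exists p10 xp.
suff -> : ordp p a = k by [].
have k0 := prim_order_gt0 kp; have kle : (k <= p)%N.
  by apply: leq_trans (dvdn_leq p10 kd) (leq_pred _).
have iE : iota 1 p = iota 1 k.-1 ++ k :: iota k.+1 (p - k).
  rewrite -[in LHS](_ : (k.-1 + (p - k).+1 = p)%N); first by rewrite iotaD /= add1n prednK.
  by rewrite addnS -addSn prednK // subnKC.
rewrite /ordp iE filter_cat.
have -> : [seq m <- iota 1 k.-1 | (p%:Z %| numq a ^+ m - denq a ^+ m)%Z] = [::].
  apply/eqP; rewrite -size_eq0 size_filter -leqn0 leqNgt -has_count; apply/hasPn => m.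
  rewrite mem_iota add1n (prednK k0) => /andP[m0 mk]; rewrite xm -(prim_order_dvd kp).
  by apply/negP => /(dvdn_leq m0); rewrite leqNgt mk.
by rewrite /= xm (prim_expr_order kp) eqxx.
Qed.

(** Writing [p - 1 = idx p * ordp p a], the condition [d | idx p] says that the order divides
    [(p - 1)/d]. *)
Lemma idx_dvd p d : prime p -> nu p a == 0 -> (0 < d)%N ->
  (d %| idx p)%N = (d %| p.-1)%N && (ev p a ^+ (p.-1 %/ d) == 1).
Proof.
move=> pp na d0; have op := ordp_prim pp na; have o0 := prim_order_gt0 op.
have /andP[n0 dn0] := Fp_den_num pp na.
have x0 : ev p a != 0 by rewrite mulf_neq0 ?invr_eq0.
have xp : ev p a ^+ p.-1 = 1.
  apply: (mulfI x0); rewrite -exprS prednK ?prime_gt0 // mulr1.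
  by have := expf_card (ev p a); rewrite card_Fp.
have od : (ordp p a %| p.-1)%N by rewrite (prim_order_dvd op) xp.
rewrite /idx -(prim_order_dvd op); apply/idP/andP.
  move=> /dvdnP[k kE]; have E : p.-1 = (k * ordp p a * d)%N by rewrite mulnAC -kE divnK.
  by rewrite E dvdn_mull // mulnK // dvdn_mull.
move=> [dp /dvdnP[k kE]]; have E : p.-1 = (k * d * ordp p a)%N by rewrite mulnAC -kE divnK.
by rewrite E mulnK // dvdn_mull.
Qed.

Variables (s : int) (a1 : rat) (h b0 : nat) (c0 : rat).
Hypotheses (hs : (s == 1) || (s == -1)) (a1p : 0 < a1) (h0 : (0 < h)%N)
  (hdec : a = s%:~R * a1 ^+ h) (hnpp : forall (r : rat) (m : nat), (2 <= m)%N -> a1 != r ^+ m)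
  (hb0 : (0 < b0)%N /\ forall p : nat, prime p -> ~~ (p ^ 2 %| b0)%N)
  (hbc : a1 = b0%:R * c0 ^+ 2).

(** For odd [h] the sign is itself an [h]-th power and joins the base of [a]; for even [h] it
    affects only the modulus. *)
Definition sign_part : int := if odd h then s else 1.
Definition entangled : bool := odd h && ((s * b0%:Z - 1) %% 4 == 0)%Z.

Section Fixed.
Variables (e g : nat).
Hypotheses (e0 : (0 < e)%N) (g0 : (0 < g)%N) (gh : (g %| h)%N) (eh : coprime e h).
Local Notation d := (e * g)%N.
Hypothesis sqf : forall q, prime q -> ~~ (q ^ 2 %| d)%N.

(** For [a < 0], [h] even and [d] even, the sign contributes [(-1)^((p-1)/d)], which is 1 exactly
    when [2d] divides [p - 1]; for odd [d] the exponent is even anyway. *)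
Definition split_modulus : nat := if [&& ~~ odd h, s == -1 & ~~ odd d] then (2 * d)%N else d.
(** The base of [a] times the [e]-th power of its denominator: an integer with the same [e]-th power
    residue behaviour. *)
Definition radicand : int := sign_part * numq a1 * denq a1 ^+ e.-1.
Definition bad_prime_bound : nat := (`|numq a| + `|denq a| + `|numq a1| + `|denq a1| + `|numq c0| + `|denq c0| + 2)%N.

Let big_neq0 p (x : int) : prime p -> (`|x| < p)%N -> x != 0 -> x%:~R != 0 :> 'F_p.
Proof.
move=> pp xp x0; rewrite Fp_int_eq0 // dvdzE absz_nat; apply/negP => /dvdn_leq.
by rewrite absz_gt0 x0 => /(_ isT); rewrite leqNgt xp.
Qed.

Let c00 : c0 != 0.
Proof. by apply/eqP => c; move: a1p; rewrite hbc c expr0n /= mulr0 ltxx. Qed.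

Lemma large_prime p : prime p -> (bad_prime_bound < p)%N ->
  [/\ nu p a == 0, (numq a1)%:~R != 0 :> 'F_p, (denq a1)%:~R != 0 :> 'F_p &
   [/\ odd p, ev p a = s%:~R * ev p a1 ^+ h & exists2 t : 'F_p, t != 0 & ev p a1 = b0%:R * t ^+ 2]].
Proof.
move=> pp; rewrite /bad_prime_bound => Pp.
have [X1 X2 X3 [X4 X5 X6 X7]] := sum6_lt Pp.
have na : nu p a == 0.
  have lg (x : int) : (`|x| < p)%N -> x != 0 -> logn p `|x| = 0%N.
    move=> xp x0; rewrite lognE pp /= absz_gt0 x0 /=; case: ifP => // /dvdn_leq.
    by rewrite absz_gt0 x0 => /(_ isT); rewrite leqNgt xp.
  by rewrite /nu !lg ?denq_eq0 ?numq_eq0.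
have N1 : (numq a1)%:~R != 0 :> 'F_p by apply: big_neq0; rewrite // numq_eq0 gt_eqF.
have D1 : (denq a1)%:~R != 0 :> 'F_p by apply: big_neq0; rewrite // denq_eq0.
have DA : (denq a)%:~R != 0 :> 'F_p by apply: big_neq0; rewrite // denq_eq0.
have NC : (numq c0)%:~R != 0 :> 'F_p by apply: big_neq0; rewrite // numq_eq0.
have DC : (denq c0)%:~R != 0 :> 'F_p by apply: big_neq0; rewrite // denq_eq0.
split=> //; split.
- by have := even_prime pp; case=> // p2; rewrite p2 in X7.
- have E : numq a * denq a1 ^+ h = s * numq a1 ^+ h * denq a.
    apply: (@intr_inj rat); rewrite !(rmorphXn, rmorphM) /=.
    have := hdec; rewrite -{1}(divq_num_den a) -{1}(divq_num_den a1) expr_div_n => H.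
    have d1 : (denq a)%:~R != 0 :> rat by rewrite intr_eq0 denq_eq0.
    have d2 : (denq a1)%:~R ^+ h != 0 :> rat by rewrite expf_neq0 // intr_eq0 denq_eq0.
    by apply: (mulIf (invr_neq0 d1)); rewrite mulrAC H; field; rewrite d1 d2.
  have := congr1 (fun x : int => x%:~R : 'F_p) E; rewrite !(rmorphXn, rmorphM) /= => E'.
  rewrite /ev expr_div_n; have D1h : (denq a1)%:~R ^+ h != 0 :> 'F_p by rewrite expf_neq0.
  apply: (mulIf DA); rewrite divfK //; apply: (mulIf D1h); rewrite E'; field.
  by rewrite D1h.
exists (ev p c0); first by rewrite mulf_neq0 ?invr_eq0.
have E : numq a1 * denq c0 ^+ 2 = b0%:Z * numq c0 ^+ 2 * denq a1.
  apply: (@intr_inj rat); rewrite !(rmorphXn, rmorphM) /=.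
  have := hbc; rewrite -{1}(divq_num_den a1) -{1}(divq_num_den c0) => H.
  have d1 : (denq a1)%:~R != 0 :> rat by rewrite intr_eq0 denq_eq0.
  have d2 : (denq c0)%:~R != 0 :> rat by rewrite intr_eq0 denq_eq0.
  by apply: (mulIf (invr_neq0 d1)); rewrite mulrAC H -(pmulrn _ b0); field; rewrite d1 d2.
have := congr1 (fun x : int => x%:~R : 'F_p) E; rewrite !(rmorphXn, rmorphM) /= => E'.
rewrite /ev expr_div_n; have D1h : (denq c0)%:~R ^+ 2 != 0 :> 'F_p by rewrite expf_neq0.
apply: (mulIf D1); rewrite divfK //; apply: (mulIf D1h); rewrite E' -(pmulrn _ b0); field; exact: DC.
Qed.

Lemma fermatF p (x : 'F_p) : prime p -> x != 0 -> x ^+ p.-1 = 1.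
Proof.
move=> pp x0; apply: (mulfI x0); rewrite -exprS prednK ?prime_gt0 // mulr1.
by have := expf_card x; rewrite card_Fp.
Qed.

Lemma Ad_expr p k : prime p -> (bad_prime_bound < p)%N -> (k %| e)%N -> (k %| p.-1)%N -> (0 < k)%N ->
  (p%:Z %| radicand ^+ (p.-1 %/ k) - 1)%Z = ((sign_part%:~R * ev p a1) ^+ (p.-1 %/ k) == 1).
Proof.
move=> pp Pp ke kp k0; have [_ N1 D1 _] := large_prime pp Pp.
rewrite -Fp_int_eq0 // rmorphB rmorphXn /= subr_eq0 /radicand; congr (_ == _).
have -> : (sign_part * numq a1 * denq a1 ^+ e.-1)%:~R = (sign_part%:~R * ev p a1) * (denq a1)%:~R ^+ e :> 'F_p.
  by rewrite !rmorphM rmorphXn /= /ev -{2}(prednK e0) exprS; field.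
rewrite exprMn -exprM; move/dvdnP: ke => [j ->].
by rewrite -mulnA [(k * _)%N]mulnC divnK // mulnC exprM fermatF // expr1n mulr1.
Qed.

(** Put [n = (p-1)/d] and [h = h' g]. Up to the sign, [a^n] is the [h']-th power of [X], which is
    the base to the power [(p-1)/e]. As [X^e = 1] and [e] is prime to [h'], the value 1 is reached
    only for [X = 1]; for odd [e] this also excludes [X^h' = -1]. *)
Lemma idx_dvd_split p : prime p -> (bad_prime_bound < p)%N ->
  (d %| idx p)%N = splitp split_modulus e radicand p.
Proof.
move=> pp Pp; have [na N1 D1 [op evE _]] := large_prime pp Pp.
have d0 : (0 < d)%N by rewrite muln_gt0 e0.
have md_d : (d %| split_modulus)%N by rewrite /split_modulus; case: ifP => // _; rewrite dvdn_mull.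
rewrite idx_dvd // /splitp eqn_mod_dvd ?prime_gt0 // subn1.
have [dp|ndp] := boolP (d %| p.-1)%N; last first.
  by rewrite /=; apply/esym/negbTE; rewrite negb_and (contra _ ndp) // => /(dvdn_trans md_d).
have ep : (e %| p.-1)%N by apply: dvdn_trans dp; apply: dvdn_mulr.
rewrite (Ad_expr pp Pp (dvdnn e) ep e0) /=.
pose n := (p.-1 %/ d)%N; have pn : p.-1 = (n * d)%N by rewrite divnK.
have -> : (p.-1 %/ e = g * n)%N by rewrite pn mulnCA mulKn // mulnC.
rewrite -/n; set y := ev p a1; set X := (sign_part%:~R * y) ^+ (g * n).
have y0 : y != 0 by rewrite mulf_neq0 ?invr_eq0.
have s0 : sign_part%:~R != 0 :> 'F_p.
  by rewrite /sign_part; case: (odd h); rewrite ?oner_eq0 //; case/orP: hs => /eqP ->; rewrite ?rmorphN ?oppr_eq0 ?oner_eq0.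
have Xe : X ^+ e = 1.
  by rewrite /X -exprM mulnC mulnA mulnC -pn fermatF // mulf_neq0.
pose h' := (h %/ g)%N; have hE : h = (h' * g)%N by rewrite divnK.
have eh' : coprime e h' by apply: coprime_dvdr eh; rewrite hE dvdn_mulr.
have X1 : (X ^+ h' == 1) = (X == 1).
  apply/eqP/eqP => [Xh|->]; last by rewrite expr1n.
  exact: expr_coprime_eq1 eh' Xe Xh.
have sn k : s%:~R ^+ k = 1 :> 'F_p \/ s%:~R ^+ k = (-1) ^+ k :> 'F_p /\ s = -1.
  by case/orP: hs => /eqP ->; [left; rewrite expr1n | right; split=> //; rewrite rmorphN1].
rewrite evE exprMn -exprM.
have XE : X ^+ h' = sign_part%:~R ^+ (h * n) * y ^+ (h * n).
  by rewrite /X -exprM exprMn (_ : (g * n * h' = h * n)%N) // hE; ring.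
rewrite /split_modulus; case oh: (odd h) => /=.
  rewrite -X1 XE /sign_part oh dp /=; congr (_ * _ == _).
  rewrite exprM; congr (_ ^+ _); case/orP: hs => /eqP ->; first by rewrite expr1n.
  by rewrite rmorphN1 -signr_odd oh expr1.
rewrite /sign_part oh expr1n mul1r in XE.
have [s1|s1] := boolP (s == -1); last first.
  have -> : s = 1 by case/orP: hs => /eqP sE //; rewrite sE eqxx in s1.
  by rewrite /= dp /= expr1n mul1r -XE X1.
rewrite (eqP s1) rmorphN1 -XE -signr_odd.
have evp : ~~ odd p.-1 by move: (prime_gt0 pp) op; case: (p) => //= q _; rewrite negbK || case: odd.
case od: (odd d) => /=.
  have -> : odd n = false by move: evp; rewrite pn oddM od andbT => /negbTE.
  by rewrite dp expr0 mul1r X1.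
have -> : (2 * d %| p.-1)%N = ~~ odd n by rewrite pn dvdn_pmul2r // dvdn2.
case on: (odd n) => /=; last by rewrite expr0 mul1r X1.
rewrite expr1 mulN1r; apply/eqP => h1.
have Xm : X ^+ h' = -1 by rewrite -h1 opprK.
have oe : odd e.
  by rewrite -[odd e]negbK -dvdn2; apply/negP => e2; move: eh; move/dvdnP: e2 => [k ->]; rewrite coprimeMl => /andP[_]; rewrite coprime2n oh.
have : (X ^+ h') ^+ e = 1 by rewrite -exprM mulnC exprM Xe expr1n.
rewrite Xm -signr_odd oe expr1 => /eqP; rewrite eq_sym -subr_eq0 opprK -(natrD _ 1 1).
rewrite -(dvdn_pcharf (pchar_Fp pp)) => /(dvdn_leq (isT : (0 < 1 + 1)%N)) p2.
by have := prime_gt1 pp; move: op; case: (p) p2 => [|[|[|q]]].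
Qed.

End Fixed.
End Index.

Lemma squarefree_logn (n p : nat) : (0 < n)%N -> (forall q, prime q -> ~~ (q ^ 2 %| n)%N) ->
  (logn p n <= 1)%N.
Proof.
move=> n0 sqf; have [pp|np] := boolP (prime p); last by rewrite lognE (negbTE np).
by rewrite leqNgt; apply/negP => l2; have := sqf p pp; rewrite pfactor_dvdn // l2.
Qed.

Lemma squarefree_dvd (n k : nat) : (0 < n)%N -> (forall q, prime q -> ~~ (q ^ 2 %| n)%N) ->
  (forall q, prime q -> (q %| n)%N -> (q %| k)%N) -> (n %| k)%N.
Proof.
move=> n0 sqf H; apply/dvdn_partP => // p; rewrite mem_primes => /and3P[pp _ pn].
rewrite p_part; have := squarefree_logn p n0 sqf.
by case: (logn p n) => [|[|//]] _; rewrite ?expn0 ?expn1 ?dvd1n //; apply: H.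
Qed.

Lemma squarefree_prod_primes (n : nat) : (0 < n)%N -> (forall q, prime q -> ~~ (q ^ 2 %| n)%N) ->
  (\prod_(l <- primes n) l)%N = n.
Proof.
move=> n0 sqf; rewrite [RHS](prod_prime_decomp n0) prime_decompE big_map /=.
rewrite big_seq [RHS]big_seq; apply: eq_bigr => p pn.
have l1 := squarefree_logn p n0 sqf; have : (0 < logn p n)%N by rewrite logn_gt0.
by move: l1; case: (logn p n) => [|[|//]] _ //; rewrite expn1.
Qed.

(** * Powers in cyclotomic fields and the entanglement *)

Section Nonpower.
Variables (a : rat) (s : int) (a1 : rat) (h b0 : nat) (c0 : rat).
Hypotheses (a0 : a != 0) (hs : (s == 1) || (s == -1)) (a1p : 0 < a1) (h0 : (0 < h)%N)
  (hdec : a = s%:~R * a1 ^+ h) (hnpp : forall (r : rat) (m : nat), (2 <= m)%N -> a1 != r ^+ m)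
  (hb0 : (0 < b0)%N /\ forall p : nat, prime p -> ~~ (p ^ 2 %| b0)%N)
  (hbc : a1 = b0%:R * c0 ^+ 2).
Variables (e g : nat).
Hypotheses (e0 : (0 < e)%N) (g0 : (0 < g)%N) (gh : (g %| h)%N) (eh : coprime e h).
Hypothesis sqf : forall q, prime q -> ~~ (q ^ 2 %| e * g)%N.
Local Notation d := (e * g)%N.
Local Notation sgh := (sign_part s h).
Local Notation Ad := (radicand s a1 h e).
Local Notation ent := (entangled s h b0).

Lemma sgh_sqr : sgh * sgh = 1.
Proof. by rewrite /sign_part; case: (odd h) => //; case/orP: hs => /eqP ->. Qed.

Lemma Ad_neq0 : Ad != 0.
Proof.
rewrite /radicand !mulf_neq0 ?expf_neq0 ?denq_eq0 ?numq_eq0 ?(gt_eqF a1p) //.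
by apply/eqP => S; have := sgh_sqr; rewrite S mul0r.
Qed.

Lemma AdE : Ad%:~R = sgh%:~R * a1 * (denq a1)%:~R ^+ e :> rat.
Proof.
by rewrite /radicand !rmorphM rmorphXn /= numqE -[in RHS](prednK e0) exprS; ring.
Qed.

(** By [cyclotomic_odd_power] the radicand would be a rational [q]-th power; sign and denominator
    are [q]-th powers as well, so the base of [a] would be a perfect power. *)
Lemma nonpower_odd m (z : algC) q P : m.-primitive_root z -> prime q -> odd q -> (q %| e)%N ->
  (map_poly ratr P).[z] ^+ q != Ad%:~R.
Proof.
move=> zm qp oq /dvdnP[e' eE]; apply/eqP => H.
have A0 : (Ad%:~R : rat) != 0 by rewrite intr_eq0 Ad_neq0.
have H' : (map_poly ratr P).[z] ^+ q = ratr Ad%:~R by rewrite ratr_int.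
have [r rE] := cyclotomic_odd_power zm oq A0 H'.
have dn : (denq a1)%:~R != 0 :> rat by rewrite intr_eq0 denq_eq0.
have := hnpp (sgh%:~R * r / (denq a1)%:~R ^+ e') (prime_gt1 qp); apply/negP; rewrite negbK.
have sq : sgh%:~R ^+ q = sgh%:~R :> rat.
  have s2 : (sgh%:~R : rat) ^+ 2 = 1 by rewrite expr2 -rmorphM sgh_sqr.
  by rewrite -(odd_double_half q) oq exprS -mul2n exprM s2 expr1n mulr1.
rewrite expr_div_n exprMn sq -rE AdE -exprM -eE; apply/eqP.
have s2 : (sgh%:~R : rat) * sgh%:~R = 1 by rewrite -rmorphM sgh_sqr.
by rewrite -(mulrA (sgh%:~R)) [X in _ = X / _]mulrA s2 mul1r mulfK // expf_neq0.
Qed.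

(** As [d] is squarefree and even, [d = 2 d'] with [d'] odd, and the [d]-th roots of unity generate
    the same field as the [d']-th. Removing squares from the radicand leaves [s b0], to which
    [sqrt_cyclotomic] applies. *)
Lemma nonpower_two (z : algC) P : d.-primitive_root z -> ~~ odd e ->
  ~~ (ent && (2 * b0 %| d)%N) -> (map_poly ratr P).[z] ^+ 2 != Ad%:~R.
Proof.
move=> zd ee; apply: contra => /eqP H.
have oh : odd h by rewrite -coprime2n; apply: coprime_dvdl eh; rewrite dvdn2.
have eE : e = (2 * e./2)%N by rewrite mul2n -[LHS]odd_double_half (negbTE ee).
pose d' := (e./2 * g)%N; have dE : d = (2 * d')%N by rewrite /d' mulnA -eE.
have od' : odd d'.
  rewrite -[odd d']negbK -dvdn2; apply/negP => /dvdnP[k kE].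
  by have := sqf (isT : prime 2); rewrite dE kE mulnCA dvdn_mull.
have d'0 : (0 < d')%N by rewrite odd_gt0.
have z2 : d'.-primitive_root (z ^+ 2).
  by have := exp_prim_root zd 2; rewrite dE gcdnMr // mulKn.
have zd1 : z ^+ d' = -1.
  have : (z ^+ d') ^+ 2 = 1 by rewrite -exprM mulnC -dE (prim_expr_order zd).
  move/eqP; rewrite sqrf_eq1 => /orP[|/eqP //].
  rewrite -(prim_order_dvd zd) dE => /(dvdn_leq d'0).
  by rewrite leqNgt ltn_Pmull.
have d1E : (d'.+1)./2.*2 = d'.+1 by rewrite -[RHS]odd_double_half /= od'.
(* Expresses [z] through the primitive [d']-th root [z^2], using [z^d' = -1]. *)
have zE : - (z ^+ 2) ^+ (d'.+1)./2 = z.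
  by rewrite -exprM mul2n d1E exprS zd1 mulrN1 opprK.
have dn : (denq a1)%:~R != 0 :> rat by rewrite intr_eq0 denq_eq0.
have c00 : c0 != 0 by apply/eqP => c; move: a1p; rewrite hbc c expr0n /= mulr0 ltxx.
pose u : rat := c0 * (denq a1)%:~R ^+ e./2.
have u0 : u != 0 by rewrite mulf_neq0 // expf_neq0.
pose Q := u^-1 *: (P \Po (- 'X^((d'.+1)./2))).
have QE : (map_poly ratr Q).[z ^+ 2] ^+ 2 = (s * b0%:Z)%:~R.
  rewrite /Q map_polyZ /= hornerZ map_comp_poly rmorphN /= map_polyXn horner_comp !hornerE.
  rewrite zE exprMn H -ratr_int AdE -rmorphXn -rmorphM /=.
  have -> : u ^- 1 ^+ 2 * (sgh%:~R * a1 * (denq a1)%:~R ^+ e) = (s * b0%:Z)%:~R.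
    have a1E X : a1 * X = b0%:R * c0 ^+ 2 * X by rewrite -hbc.
    rewrite /sign_part oh -(mulrA s%:~R a1) a1E [in LHS]eE mulnC exprM /u rmorphM /= -(pmulrn _ b0); field.
    by rewrite c00 expf_neq0.
  by rewrite ratr_int.
have s1 : `|s|%N = 1%N by case/orP: hs => /eqP ->.
have cE : `|(s * b0%:Z)%R|%N = b0 by rewrite abszM s1 mul1n.
have sqc l : prime l -> ~~ (l ^ 2 %| `|(s * b0%:Z)%R|)%N by rewrite cE; apply: hb0.2.
have [L1 L2] := sqrt_cyclotomic z2 od' sqc QE.
rewrite /entangled oh /=; apply/andP; split; first by apply/eqP/dvdz_mod0P.
rewrite dE dvdn_pmul2l //; apply: squarefree_dvd; [exact: hb0.1 | exact: hb0.2 |].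
by move=> q qp qb; apply: L1; rewrite // cE.
Qed.

(** [s b0] and the product of signed primes from [squarefree_star] are both [b0] up to sign and 1
    modulo 4; since [b0] is odd they coincide. *)
Lemma sqrt_mod p : prime p -> ent -> (b0 %| p.-1)%N -> exists w : 'F_p, (s * b0%:Z)%:~R = w ^+ 2.
Proof.
move=> pp /andP[oh /eqP/dvdz_mod0P b4] bp.
have s1 : `|s|%N = 1%N by case/orP: hs => /eqP ->.
have ob : odd b0.
  rewrite -[odd b0]negbK -dvdn2; apply/negP => /dvdnP[k kE].
  move: b4; rewrite kE PoszM => /dvdzP[j jE].
  by case/orP: hs jE => /eqP ->; lia.
have all_l : all (fun l => [&& prime l, odd l & (l %| p.-1)%N]) (primes b0).
  apply/allP => l; rewrite mem_primes => /and3P[lp _ lb]; rewrite lp (dvdn_trans lb bp) andbT /=.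
  rewrite -[odd l]negbK -dvdn2; apply/negP => l2; have := dvdn_trans l2 lb.
  by rewrite dvdn2 ob.
have [c [cE c4 wE]] := squarefree_star pp all_l.
rewrite (squarefree_prod_primes hb0.1 hb0.2) in cE.
suff -> : s * b0%:Z = c by [].
have cc : c = b0%:Z \/ c = - b0%:Z by rewrite -cE; lia.
move/dvdzP: b4 => [j jE]; move/dvdzP: c4 => [i iE].
by case/orP: hs jE => /eqP ->; case: cc iE => ->; lia.
Qed.

(** When [p] is 1 modulo [d], the radicand is a square modulo [p]. The condition at 2 thus holds by
    itself, and the odd number [e/2] may replace [e]; this is what doubles the density. *)
Lemma entangled_split p : prime p -> (bad_prime_bound a a1 c0 < p)%N -> ent -> (2 * b0 %| d)%N ->
  splitp d e Ad p = splitp d e./2 Ad p.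
Proof.
move=> pp Pp en bd; have /andP[oh _] := en.
have og : odd g by apply: dvdn_odd gh oh.
have ee : ~~ odd e.
  by have := dvdn_trans (dvdn_mulr b0 (dvdnn 2)) bd; rewrite dvdn2 oddM og andbT.
have eE : e = (2 * e./2)%N by rewrite mul2n -[LHS]odd_double_half (negbTE ee).
have e20 : (0 < e./2)%N by move: e0; rewrite {1}eE muln_gt0 => /andP[].
have oe2 : odd e./2.
  rewrite -[odd e./2]negbK -dvdn2; apply/negP => /dvdnP[k kE].
  by have := sqf (isT : prime 2); rewrite eE kE (mulnC k) (mulnA 2 2)%N -(mulnA (2 * 2))%N dvdn_mulr.
rewrite /splitp; case dp: (p == 1 %[mod d])%N => //=.
have {}dp : (d %| p.-1)%N by move: dp; rewrite eqn_mod_dvd ?prime_gt0 // subn1.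
have ep : (e %| p.-1)%N by apply: dvdn_trans dp; apply: dvdn_mulr.
have e2e : (e./2 %| e)%N by rewrite {2}eE dvdn_mull.
have AE k := Ad_expr a0 a1p hdec hbc e0 pp Pp (k := k).
rewrite !AE ?(dvdn_trans e2e) //.
have [_ _ _ [op _ [t t0 tE]]] := large_prime a0 a1p hdec hbc pp Pp.
set n := (p.-1 %/ e)%N; have pn : p.-1 = (n * e)%N by rewrite divnK.
have -> : (p.-1 %/ e./2 = n * 2)%N by rewrite pn {1}eE mulnA mulnK.
set x := _ * _; rewrite exprM; set Z := x ^+ n.
apply/eqP/eqP => [->|Z2]; first by rewrite expr1n.
apply: (@expr_coprime_eq1 _ Z 2 e./2) => //; first by rewrite coprime2n.
have bp : (b0 %| p.-1)%N by apply: dvdn_trans dp; apply: dvdn_trans bd; rewrite dvdn_mull.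
have [w wE] := sqrt_mod pp en bp.
have xE : x = (w * t) ^+ 2.
  by rewrite /x /sign_part oh tE exprMn -wE rmorphM /= -(pmulrn _ b0) mulrA.
have pE : p.-1 = (n * e./2 * 2)%N by rewrite pn {1}eE; ring.
rewrite /Z -exprM xE -exprM mulnC -pE; apply: fermatF => //.
have x0 : x != 0.
  rewrite mulf_neq0 //.
    apply/eqP => S; have := congr1 (fun y : int => y%:~R : 'F_p) sgh_sqr.
    by rewrite rmorphM /= S mul0r => /eqP; rewrite eq_sym oner_eq0.
  have [_ N1 D1 _] := large_prime a0 a1p hdec hbc pp Pp.
  by rewrite mulf_neq0 // invr_eq0.
by apply: contra_neq x0; rewrite xE => ->; rewrite expr0n.
Qed.

End Nonpower.

Lemma prod_primes_gt0 (ds : seq nat) : all prime ds -> (0 < \prod_(l <- ds) l)%N.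
Proof. by move=> pds; rewrite big_seq prodn_cond_gt0 // => x xds; apply/prime_gt0/(allP pds). Qed.

Lemma logn_prod_primes (ds : seq nat) q : uniq ds -> all prime ds -> prime q ->
  logn q (\prod_(l <- ds) l)%N = (q \in ds).
Proof.
move=> + + qp; elim: ds => [|l ds IH] /=; first by rewrite big_nil logn1.
move=> /andP[lds uds] /andP[lp pds]; rewrite big_cons lognM ?prod_primes_gt0 ?(prime_gt0 lp) //.
rewrite IH // logn_prime // inE; case: (eqVneq q l) => [->|//].
by rewrite (negbTE lds).
Qed.

Lemma prod_primes_squarefree (ds : seq nat) q : uniq ds -> all prime ds -> prime q ->
  ~~ (q ^ 2 %| \prod_(l <- ds) l)%N.
Proof.
move=> uds pds qp; rewrite pfactor_dvdn ?prod_primes_gt0 // logn_prod_primes //.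
by case: (q \in ds).
Qed.

Lemma prime_dvd_prod (ds : seq nat) q : uniq ds -> all prime ds -> prime q ->
  (q %| \prod_(l <- ds) l)%N = (q \in ds).
Proof.
move=> uds pds qp; have := logn_prod_primes uds pds qp; rewrite lognE qp prod_primes_gt0 //=.
by case: (_ %| _)%N; case: (q \in ds).
Qed.

Lemma totient_prod_primes (ds : seq nat) : uniq ds -> all prime ds ->
  totient (\prod_(l <- ds) l)%N = (\prod_(l <- ds) l.-1)%N.
Proof.
elim: ds => [|l ds IH] /=; first by rewrite !big_nil.
move=> /andP[lds uds] /andP[lp pds]; rewrite !big_cons totient_coprime.
  by rewrite IH // -{1}(expn1 l) totient_pfactor // muln1.
by rewrite prime_coprime // prime_dvd_prod.
Qed.

(** * Density of divisibility of the index *)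

Section IndexDensity.
Variable R : realType.

Lemma summ_eq_large (f g : nat -> R) N v : (forall p, (N < p)%N -> f p = g p) -> (N <= v)%N ->
  summ f v - summ g v = summ f N - summ g N.
Proof.
move=> H /subnK<-; elim: (v - N)%N => [//|k IH].
by rewrite addSn !summS -IH H ?ltnS ?leq_addl //; ring.
Qed.

Lemma density_eq_large (f g : nat -> R) N (dl : R) : (forall p, (N < p)%N -> f p = g p) ->
  (forall eps : R, 0 < eps -> exists Y : nat, forall v : nat, (Y <= v)%N ->
     `|summ g v - dl * v%:R| <= eps * v%:R) ->
  forall eps : R, 0 < eps -> exists Y : nat, forall v : nat, (Y <= v)%N ->
     `|summ f v - dl * v%:R| <= eps * v%:R.
Proof.
move=> fg H eps eps0; have e2 : 0 < eps / 2 by rewrite divr_gt0.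
have [Y HY] := H _ e2; set K := summ f N - summ g N.
exists (maxn N (maxn Y (Num.truncn (`|K| / (eps / 2))).+1)) => v; rewrite !geq_max => /and3P[Nv Yv Kv].
have KE : `|K| <= eps / 2 * v%:R.
  rewrite mulrC -ler_pdivrMr //; apply: le_trans (ltW (truncnS_gt _)) _.
  by rewrite ler_nat.
have -> : summ f v - dl * v%:R = (summ g v - dl * v%:R) + K.
  by rewrite /K -(summ_eq_large fg Nv); ring.
apply: le_trans (ler_normD _ _) _; apply: le_trans (lerD (HY v Yv) KE) _.
by rewrite -mulrDl -splitr.
Qed.

(** The case [m = e = 1], in which [splitp] holds for every prime. *)
Lemma pnt (eps : R) : 0 < eps -> exists Y : nat, forall v : nat, (Y <= v)%N ->
  `|theta R xpredT v - v%:R| <= eps * v%:R.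
Proof.
move=> eps0; have one1 : 1.-primitive_root (1 : algC) by rewrite /primitive_root_of_unity; apply/forallP => i; rewrite ord1 unity_rootE expr1 eqxx.
have np q (P : {poly rat}) : prime q -> (q %| 1)%N -> (map_poly ratr P).[1 : algC] ^+ q != 1%:~R.
  by move=> qp; rewrite dvdn1 => /eqP q1; rewrite q1 in qp.
have [Y HY] := @radical_log_density R 1 1 1 1 isT isT isT isT one1 np eps eps0.
exists Y => v /HY; congr (`|_ - _| <= _); last by rewrite muln1 (_ : totient 1 = 1%N) // divr1.
by apply: eq_summ => p _; rewrite /splitp !modn1 eqxx expr1n subrr dvdz0.
Qed.

Variables (a : rat) (s : int) (a1 : rat) (h b0 : nat) (c0 : rat).
Hypotheses (a0 : a != 0) (hs : (s == 1) || (s == -1)) (a1p : 0 < a1) (h0 : (0 < h)%N)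
  (hdec : a = s%:~R * a1 ^+ h) (hnpp : forall (r : rat) (m : nat), (2 <= m)%N -> a1 != r ^+ m)
  (hb0 : (0 < b0)%N /\ forall p : nat, prime p -> ~~ (p ^ 2 %| b0)%N)
  (hbc : a1 = b0%:R * c0 ^+ 2).
Local Notation sgh := (sign_part s h).
Local Notation ent := (entangled s h b0).

(** [totient (split_modulus s h e g) * e] is the Kummer degree, except in the entangled case, where
    the degree is computed with [e/2] and is half of it. *)
Lemma idx_log_density (e g : nat) : (0 < e)%N -> (0 < g)%N -> (g %| h)%N -> coprime e h ->
  (forall q, prime q -> ~~ (q ^ 2 %| e * g)%N) ->
  forall eps : R, 0 < eps -> exists Y : nat, forall v : nat, (Y <= v)%N ->
   `|theta R (fun p => e * g %| idx a p)%N v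
     - (1 + (ent && (2 * b0 %| e * g)%N)%:R) / (totient (split_modulus s h e g) * e)%:R * v%:R| <= eps * v%:R.
Proof.
move=> e0 g0 gh eh sqf.
pose A := radicand s a1 h e; have A0 : A != 0 by apply: Ad_neq0.
have mdE : ent || ~~ odd e -> split_modulus s h e g = (e * g)%N.
  move=> H; rewrite /split_modulus; suff -> : odd h by [].
  case/orP: H => [/andP[]//|ee].
  by rewrite -coprime2n; apply: coprime_dvdl eh; rewrite dvdn2.
have md0 : (0 < split_modulus s h e g)%N by rewrite /split_modulus; case: ifP; rewrite !muln_gt0 e0 g0.
have emd : (e %| split_modulus s h e g)%N.
  by rewrite /split_modulus; case: ifP => _; [rewrite dvdn_mull | rewrite ?dvdn_mulr]; rewrite ?dvdn_mulr.
have [z zm] := C_prim_root_exists md0.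
apply: (@density_eq_large _ (fun p => ln p%:R *+ (prime p && splitp (split_modulus s h e g) e A p)) (bad_prime_bound a a1 c0)).
  move=> p Pp; case pp : (prime p) => //=.
  by rewrite (idx_dvd_split a0 hs a1p hdec hbc e0 g0 gh eh pp Pp).
have [/andP[en bd]|nent] := boolP (ent && (2 * b0 %| e * g)%N); last first.
  move=> eps eps0.
  have np q P : prime q -> (q %| e)%N -> (map_poly ratr P).[z] ^+ q != A%:~R.
    move=> qp qe; have [oq|eq] := boolP (odd q); first exact: (nonpower_odd h hs a1p hnpp e0 P zm qp oq qe).
    have q2 : q = 2%N by have [//|oq] := even_prime qp; rewrite oq in eq.
    have ee : ~~ odd e by rewrite -dvdn2 -q2.
    have zd := zm; rewrite mdE ?ee ?orbT // in zd.
    by rewrite q2; apply: (nonpower_two hs a1p hb0 hbc e0 eh sqf P zd ee nent).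
  have [Y HY] := radical_log_density md0 e0 emd A0 zm np eps0.
  by exists Y => v /HY; rewrite addr0 mul1r mulrC.
have oh : odd h by case/andP: en.
have og : odd g by apply: dvdn_odd gh oh.
have ee : ~~ odd e.
  by have := dvdn_trans (dvdn_mulr b0 (dvdnn 2)) bd; rewrite dvdn2 oddM og andbT.
have eE : e = (2 * e./2)%N by rewrite mul2n -[LHS]odd_double_half (negbTE ee).
have e20 : (0 < e./2)%N by move: e0; rewrite {1}eE muln_gt0 => /andP[].
have e2e : (e./2 %| e)%N by rewrite {2}eE dvdn_mull.
have oe2 : odd e./2.
  rewrite -[odd e./2]negbK -dvdn2; apply/negP => /dvdnP[k kE].
  by have := sqf 2 isT; rewrite eE kE (mulnC k) (mulnA 2 2)%N -(mulnA (2 * 2))%N dvdn_mulr.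
have zd := zm; rewrite mdE ?en // in zd md0 emd *.
apply: (@density_eq_large _ (fun p => ln p%:R *+ (prime p && splitp (e * g) e./2 A p)) (bad_prime_bound a a1 c0)).
  move=> p Pp; case pp : (prime p) => //=.
  by rewrite (entangled_split a0 hs a1p h0 hdec hb0 hbc e0 g0 gh eh sqf pp Pp en bd).
move=> eps eps0.
have np q P : prime q -> (q %| e./2)%N -> (map_poly ratr P).[z] ^+ q != A%:~R.
  move=> qp qe; apply: (nonpower_odd h hs a1p hnpp e0 P zm qp _ (dvdn_trans qe e2e)).
  by apply: dvdn_odd oe2.
have [Y HY] := radical_log_density md0 e20 (dvdn_trans e2e emd) A0 zd np eps0.
exists Y => v /HY; rewrite mulrC; congr (`|_ - _ * _| <= _).
have t0 : (totient (e * g))%:R != 0 :> R by rewrite pnatr_eq0 -lt0n totient_gt0.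
have e2n : (e./2)%:R != 0 :> R by rewrite pnatr_eq0 -lt0n.
have eR : e%:R = 2 * (e./2)%:R :> R by rewrite {1}eE natrM.
rewrite !natrM eR /=; field; by rewrite t0 e2n.
Qed.

(** The inverse of the local degree at [q]: the roots of unity contribute [q - 1], and the radical
    contributes [q] unless [q] divides [h]. For [q = 2], [h] even and [a < 0] the fourth roots of
    unity enter, giving 1/2. *)
Definition local_density (q : nat) : R :=
  if (q %| h)%N then (if (q == 2%N) && (s == -1) then 2^-1 else (q.-1)%:R^-1) else (q * q.-1)%:R^-1.

(** Separates the primes not dividing [h], which need a radical, from those dividing it.
    Multiplicativity of [totient] does the rest; doubling an even modulus doubles its totient. *)
Lemma density_prod (ds : seq nat) : uniq ds -> all prime ds ->
  let e := (\prod_(q <- ds | ~~ (q %| h)%N) q)%N in let g := (\prod_(q <- ds | (q %| h)%N) q)%N in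
  [/\ (0 < e)%N, (0 < g)%N, (g %| h)%N, coprime e h & (e * g = \prod_(q <- ds) q)%N] /\
  (totient (split_modulus s h e g) * e)%:R^-1 = \prod_(q <- ds) local_density q.
Proof.
move=> uds pds e g.
have pf (P : pred nat) : all prime (seq.filter P ds) by apply/allP => x; rewrite mem_filter => /andP[_ /(allP pds)].
have e0 : (0 < e)%N by rewrite /e -big_filter prod_primes_gt0.
have g0 : (0 < g)%N by rewrite /g -big_filter prod_primes_gt0.
have eg : (e * g = \prod_(q <- ds) q)%N.
  by rewrite mulnC /e /g [RHS](bigID (fun q => q %| h)%N).
have gh : (g %| h)%N.
  apply: squarefree_dvd => // q qp; rewrite /g -big_filter ?prod_primes_squarefree ?filter_uniq //.
  by rewrite prime_dvd_prod ?filter_uniq // mem_filter => /andP[].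
have ceh : coprime e h.
  rewrite coprime_has_primes //; apply/hasPn => q; rewrite mem_primes => /and3P[qp _ qh].
  rewrite mem_primes qp e0 /= /e -big_filter prime_dvd_prod ?filter_uniq // mem_filter qh.
  by [].
split; first by split.
have tE : totient (split_modulus s h e g) = (totient (e * g) * (if [&& ~~ odd h, (s == -1)%R & (2%N \in ds)] then 2 else 1))%N.
  rewrite /split_modulus eg -(dvdn2 (\prod_(q <- ds) q)%N) prime_dvd_prod //; case: ifP => [/and3P[_ _ d2]|]; last by rewrite muln1.
  have [r [rE ru rp]] : exists r, [/\ perm_eq ds (2%N :: r), uniq (2%N :: r) & all prime (2%N :: r)].
    exists (rem 2%N ds); have pe := perm_to_rem d2; split=> //; first by rewrite -(perm_uniq pe).
    by rewrite -(perm_all _ pe).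
  have [/= /andP[r2 ur] pr] := (ru, rp).
  rewrite (perm_big _ rE) big_cons /= mulnA (_ : 2 * 2 = 2 ^ 2)%N //.
  have c2 : coprime 2 (\prod_(j <- r) j) by rewrite prime_coprime // prime_dvd_prod.
  by rewrite totient_coprime ?coprime_pexpl // totient_pfactor // [in RHS]totient_coprime // (_ : totient 2 = 1%N) // mul1n [RHS]mulnC.
rewrite tE eg totient_prod_primes // /e natrM natrM !natr_prod.
rewrite (big_mkcond (fun q => ~~ (q %| h)%N)) /=.
have twoE : (if [&& ~~ odd h, (s == -1)%R & 2%N \in ds] then 2 else 1)%N%:R
   = \prod_(q <- ds) (if [&& q == 2%N, (q %| h)%N & s == -1] then 2 else 1) :> R.
  case d2 : (2%N \in ds); last first.
    rewrite !andbF big_seq big1 // => q qds; case: eqP => // q2; by rewrite -q2 qds in d2.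
  rewrite (bigD1_seq 2%N) //= big1 ?mulr1 => [|q /negbTE-> //].
  by rewrite andbT dvdn2; case: ifP.
rewrite twoE -!big_split /= -prodfV big_seq [RHS]big_seq; apply: eq_bigr => q qds.
have qp := allP pds q qds; rewrite /local_density natrM; have [q1 q0] := (prime_gt1 qp, prime_gt0 qp).
case: (q %| h)%N => /=; last by rewrite andbF mulr1 mulrC.
case: (eqVneq q 2%N) => [->|] /=; last by rewrite !mulr1.
by case: (s == -1); rewrite !mulr1 ?mul1r.
Qed.

Lemma ent_odd : ent -> odd b0.
Proof.
move=> /andP[oh /eqP/dvdz_mod0P b4]; rewrite -[odd b0]negbK -dvdn2; apply/negP => /dvdnP[k kE].
move: b4; rewrite kE PoszM => /dvdzP[j jE].
by case/orP: hs jE => /eqP ->; lia.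
Qed.

Definition delta (ds : seq nat) : R :=
  (\prod_(q <- ds) local_density q) * (1 + (ent && all (mem ds) (primes (2 * b0)))%:R).

Theorem idx_density (ds : seq nat) : uniq ds -> all prime ds ->
  forall eps : R, 0 < eps -> exists Y : nat, forall v : nat, (Y <= v)%N ->
   `|cnt R (fun p => \prod_(q <- ds) q %| idx a p)%N v - delta ds * cnt R xpredT v|
     <= eps * cnt R xpredT v.
Proof.
move=> uds pds; apply: (count_density pnt).
have [[e0 g0 gh eh eg] dE] := density_prod uds pds.
move: e0 g0 gh eh eg dE; set e := (\prod_(q <- _ | _) _)%N; set g := (\prod_(q <- _ | _) _)%N.
move=> e0 g0 gh eh eg dE.
have sqf q : prime q -> ~~ (q ^ 2 %| e * g)%N by move=> qp; rewrite eg prod_primes_squarefree.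
have := idx_log_density e0 g0 gh eh sqf; rewrite eg => H.
rewrite /delta -dE mulrC; suff -> : ent && all (mem ds) (primes (2 * b0))
  = ent && (2 * b0 %| \prod_(q <- ds) q)%N by [].
case en : ent => //=; have ob := ent_odd en; have [b00 b0s] := hb0.
have b20 : (0 < 2 * b0)%N by rewrite muln_gt0.
apply/allP/idP => [H2|bd q]; last first.
  by rewrite mem_primes => /and3P[qp _ qb]; suff: q \in ds by []; rewrite -prime_dvd_prod // (dvdn_trans qb).
apply: squarefree_dvd => // q qp.
  have [->|q2] := eqVneq q 2%N; first by rewrite dvdn_pmul2l // dvdn2 negbK.
  rewrite Gauss_dvdr ?b0s // coprime_pexpl // prime_coprime // dvdn_prime2 //.
by move=> qb; rewrite prime_dvd_prod //; apply: H2; rewrite mem_primes qp b20.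
Qed.

End IndexDensity.

(** * Averages of truncated generating polynomials *)

Section CoefficientAverages.
Variable R : realType.
Implicit Types (phi : nat -> {poly R}) (T : {poly R}).

(** Convergence of the averages over primes coefficient by coefficient, so that inclusion-exclusion
    can be done with polynomials in the formal variable. *)
Definition has_mean phi T : Prop := forall (n : nat) (eps : R), 0 < eps ->
  exists Y : nat, forall v, (Y <= v)%N ->
    `|summ (fun p => (phi p)`_n *+ prime p) v - T`_n * cnt R xpredT v| <= eps * cnt R xpredT v.

Lemma eq_has_mean phi psi T : (forall p, prime p -> phi p = psi p) -> has_mean phi T -> has_mean psi T.
Proof.
move=> E H n eps /(H n)[Y HY]; exists Y => v /HY.
rewrite (@eq_summ _ _ (fun p => (psi p)`_n *+ prime p)) // => p _.
by case pp : (prime p); rewrite ?mulr0n // E.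
Qed.

Lemma has_meanD phi psi T U : has_mean phi T -> has_mean psi U ->
  has_mean (fun p => phi p + psi p) (T + U).
Proof.
move=> HT HU n eps e0; have e2 : 0 < eps / 2 by rewrite divr_gt0.
have [Y HY] := HT n _ e2; have [Z HZ] := HU n _ e2.
exists (maxn Y Z) => v; rewrite geq_max => /andP[/HY h1 /HZ h2].
rewrite (@eq_summ _ _ (fun p => (phi p)`_n *+ prime p + (psi p)`_n *+ prime p)); last first.
  by move=> p _; rewrite coefD mulrnDl.
rewrite summD coefD mulrDl opprD addrACA (splitr eps) mulrDl.
by apply: le_trans (ler_normD _ _) _; apply: lerD.
Qed.

Lemma has_meanN phi T : has_mean phi T -> has_mean (fun p => - phi p) (- T).
Proof.
move=> H n eps /(H n)[Y HY]; exists Y => v /HY.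
rewrite (@eq_summ _ (fun p => (- phi p)`_n *+ prime p) (fun p => -1 * ((phi p)`_n *+ prime p))).
  by rewrite summZ mulN1r coefN mulNr -opprD normrN.
by move=> p _; rewrite coefN mulN1r mulNrn.
Qed.

Lemma has_meanX phi T : has_mean phi T -> has_mean (fun p => 'X * phi p) ('X * T).
Proof.
move=> H [|n] eps e0.
  exists 0%N => v _; rewrite coefXM mul0r subr0.
  rewrite (@eq_summ _ _ (fun p => 0 * 0)) ?summZ ?mul0r ?normr0 ?mulr_ge0 ?cnt_ge0 ?ltW // => p _.
  by rewrite coefXM mul0rn ?mul0r.
have [Y HY] := H n eps e0; exists Y => v /HY; rewrite coefXM /=.
by rewrite (@eq_summ _ (fun p => ('X * phi p)`_n.+1 *+ prime p) (fun p => (phi p)`_n *+ prime p)) // => p _; rewrite coefXM.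
Qed.

Lemma has_meanXB1 phi T : has_mean phi T -> has_mean (fun p => ('X - 1) * phi p) (('X - 1) * T).
Proof.
move=> H; apply: (@eq_has_mean (fun p => 'X * phi p + - phi p)) => [p _|]; first by rewrite mulrBl mul1r.
by rewrite mulrBl mul1r; apply: has_meanD (has_meanX H) (has_meanN H).
Qed.

Lemma has_mean_const (P : pred nat) (dl : R) :
  (forall eps : R, 0 < eps -> exists Y : nat, forall v : nat, (Y <= v)%N ->
   `|cnt R P v - dl * cnt R xpredT v| <= eps * cnt R xpredT v) ->
  has_mean (fun p => (P p)%:R%:P) dl%:P.
Proof.
move=> H [|n] eps e0; last first.
  exists 0%N => v _; rewrite coefC mul0r subr0.
  rewrite (@eq_summ _ _ (fun p => 0 * 0)) ?summZ ?mul0r ?normr0 ?mulr_ge0 ?cnt_ge0 ?ltW // => p _.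
  by rewrite coefC mul0rn ?mul0r.
have [Y HY] := H eps e0; exists Y => v /HY; rewrite coefC /= /cnt.
rewrite (@eq_summ _ (fun p => (P p)%:R%:P`_0 *+ prime p) (fun p => (prime p && P p)%:R)) // => p _.
by rewrite coefC /=; case: (prime p); rewrite ?mulr0n.
Qed.

Variables (idx : nat -> nat) (C : nat -> R) (B : seq nat) (en : bool).

Definition delta0 (ds : seq nat) : R := (\prod_(q <- ds) C q) * (1 + (en && all (mem ds) B)%:R).

Hypothesis dens : forall ds, uniq ds -> all prime ds ->
  forall eps : R, 0 < eps -> exists Y : nat, forall v : nat, (Y <= v)%N ->
   `|cnt R (fun p => \prod_(q <- ds) q %| idx p)%N v - delta0 ds * cnt R xpredT v|
     <= eps * cnt R xpredT v.

(** Limit when the primes of [ds] are required to divide and those of [qs] are still free. It is the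
    sum over subsets of [qs] of [('X - 1)] to their size times [delta0]; the entangled term survives
    only for subsets containing all of [B] in [qs], so a factor with [q \in B] loses its 1. *)
Definition limpoly (ds qs : seq nat) : {poly R} :=
  (\prod_(q <- ds) C q)%:P * (\prod_(q <- qs) (1 + (C q)%:P * ('X - 1)) +
    (en && all (mem (ds ++ qs)) B)%:R%:P *
    \prod_(q <- qs) ((~~ (q \in B))%:R%:P + (C q)%:P * ('X - 1))).

Lemma limpoly_cons ds q qs : uniq (ds ++ q :: qs) ->
  limpoly ds (q :: qs) = limpoly ds qs + ('X - 1) * limpoly (q :: ds) qs.
Proof.
move=> u; rewrite /limpoly !big_cons.
have mE : all (mem ((q :: ds) ++ qs)) B = all (mem (ds ++ q :: qs)) B.
  by apply: eq_all => x; rewrite /= !inE !mem_cat !inE orbCA orbA.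
rewrite mE !polyCM; set A := all (mem (ds ++ q :: qs)) B; set A' := all (mem (ds ++ qs)) B.
have [qB|qB] := boolP (q \in B); last first.
  have -> : A' = A.
    apply: eq_in_all => x xB; rewrite /= !mem_cat !inE; case: eqP => // xq.
    by rewrite -xq xB in qB.
  by rewrite /= ; ring.
have -> : A' = false.
  apply/negbTE/negP => /allP/(_ q qB) /=; rewrite mem_cat.
  by move: u; rewrite -[q :: qs]cat1s uniq_catCA /= mem_cat => /andP[/negbTE->].
by rewrite andbF /=; ring.
Qed.

(** Induction on [qs]: the factor of [q] splits the product into the part ignoring [q] and ['X - 1]
    times the part where [q] is moved to [ds]. Generality in [ds] is what lets the induction run. *)
Lemma has_mean_product ds qs : uniq (ds ++ qs) -> all prime ds -> all prime qs ->
  has_mean (fun p => ((\prod_(q <- ds) q)%N %| idx p)%:R%:P *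
              \prod_(q <- qs) (1 + ('X - 1) * (q %| idx p)%:R%:P)) (limpoly ds qs).
Proof.
elim: qs ds => [|q qs IH] ds u pds.
  move=> _; rewrite /limpoly !big_nil cats0 mulr1 -polyC1 -polyCD -polyCM -/(delta0 ds).
  rewrite cats0 in u.
  apply: (@eq_has_mean (fun p => ((\prod_(q <- ds) q)%N %| idx p)%:R%:P)) => [p _|].
    by rewrite big_nil mulr1.
  by apply: has_mean_const; apply: dens.
move=> /= /andP[qp pqs]; rewrite limpoly_cons //.
have u2 : uniq ((q :: ds) ++ qs) by move: u; rewrite -[q :: qs]cat1s uniq_catCA.
have u1 : uniq (ds ++ qs) by move: u2 => /= /andP[].
have H1 := IH ds u1 pds pqs.
have p2 : all prime (q :: ds) by rewrite /= qp.
have H2 := has_meanXB1 (IH (q :: ds) u2 p2 pqs).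
apply: eq_has_mean (has_meanD H1 H2) => p _; rewrite !big_cons.
have -> : (q * \prod_(j <- ds) j %| idx p)%N = (q %| idx p)%N && (\prod_(j <- ds) j %| idx p)%N.
  apply: Gauss_dvd; rewrite prime_coprime //; apply/negP.
  have : q \notin ds by move: u2 => /= /andP[]; rewrite mem_cat negb_or => /andP[].
  move: pds; elim: (ds) => [|l l' IH'] /=; first by rewrite big_nil dvdn1 => _ _ /eqP q1; rewrite q1 in qp.
  move=> /andP[lp l'p]; rewrite inE negb_or big_cons Euclid_dvdM // => /andP[ql ql'].
  by rewrite dvdn_prime2 // (negbTE ql) /=; apply: IH'.
by case: (q %| _)%N; case: (_ %| _)%N => /=; ring.
Qed.

Lemma prod_indicator qs n : \prod_(q <- qs) (1 + ('X - 1) * (q %| n)%:R%:P) = 'X^(count (fun q => q %| n)%N qs) :> {poly R}.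
Proof.
elim: qs => [|q qs IH]; first by rewrite big_nil.
by rewrite big_cons IH /= exprD; case: (q %| n)%N => /=; rewrite ?expr1 ?expr0; ring.
Qed.

Lemma omega_mean qs : uniq qs -> all prime qs ->
  has_mean (fun p => 'X^(count (fun q => q %| idx p)%N qs)) (limpoly [::] qs).
Proof.
move=> u pq; apply: eq_has_mean (@has_mean_product [::] qs u isT pq) => p _.
by rewrite big_nil dvd1n mul1r prod_indicator.
Qed.

End CoefficientAverages.

(** * Limits of the generating polynomials *)

Section PowerSeries.
Local Open Scope classical_set_scope.
Local Open Scope ring_scope.
Variable R : realType.
Implicit Types (g : nat -> R) (x z : R).

(** Radius of convergence at least 1, in a form stable under termwise differentiation. *)
Definition subexp g : Prop := forall r, 0 < r < 1 -> exists M, forall n, `|g n| * r ^+ n <= M.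

Lemma subexp_bounded g (B : R) : (forall n, `|g n| <= B) -> subexp g.
Proof.
move=> gB r /andP[r0 r1]; exists B => n; apply: le_trans (gB n).
by rewrite ler_piMr // exprn_ile1 // ltW.
Qed.

Lemma natmul_geometric_le (t : R) n : 0 < t < 1 -> n.+1%:R * t ^+ n <= (1 - t)^-1.
Proof.
move=> /andP[t0 t1]; have s0 : 0 < 1 - t by rewrite subr_gt0.
rewrite -[leRHS]mul1r ler_pdivlMr //.
have := subrX1 t n.+1; set S := \sum_(i < _) _ => E.
have h : n.+1%:R * t ^+ n <= S.
  rewrite mulr_natl -{1}[n.+1]card_ord -sumr_const; apply: ler_sum => i _.
  by apply: ler_wiXn2l; rewrite ?ltW // -ltnS.
apply: le_trans (_ : S * (1 - t) <= _); first by rewrite ler_wpM2r // ltW.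
have -> : S * (1 - t) = 1 - t ^+ n.+1 by move: E; move: (t ^+ n.+1) => u E; lra.
by rewrite gerBl exprn_ge0 // ltW.
Qed.

(** The factor [n + 1] is paid by passing from [r] to the midpoint [r'] of [r] and 1, as
    [(n+1) (r/r')^n] is bounded. *)
Lemma subexp_diffs g : subexp g -> subexp (pseries_diffs g).
Proof.
move=> gs r /andP[r0 r1]; pose r' := (r + 1) / 2.
have r'01 : 0 < r' < 1 by rewrite /r'; apply/andP; split; lra.
have /andP[r'0 r'1] := r'01; have [M HM] := gs r' r'01.
pose t := r / r'; have t01 : 0 < t < 1.
  by rewrite /t divr_gt0 //= ltr_pdivrMr // mul1r /r'; lra.
have M0 : 0 <= M by apply: le_trans (HM 0%N); rewrite mulr_ge0 ?exprn_ge0 // ltW.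
exists ((1 - t)^-1 * (M / r')) => n; rewrite /pseries_diffs normrM ger0_norm //.
have rE : r = t * r' by rewrite /t divfK // gt_eqF.
rewrite {1}rE exprMn.
rewrite (_ : _ * _ * _ = n.+1%:R * t ^+ n * (`|g n.+1| * r' ^+ n)); last by ring.
have t0 : 0 <= t by case/andP: t01 => /ltW.
apply: ler_pM; rewrite ?mulr_ge0 ?exprn_ge0 ?(ltW r'0) //; first exact: natmul_geometric_le.
by rewrite ler_pdivlMr // -mulrA -exprSr.
Qed.

Lemma subexp_cvg g z : subexp g -> `|z| < 1 -> cvgn (pseries g z).
Proof.
move=> gs z1; apply: normed_cvg.
pose r := (`|z| + 1) / 2; have zr : `|z| < r by rewrite /r; lra.
have z0 : 0 <= `|z| by [].
have r01 : 0 < r < 1 by rewrite /r; apply/andP; split; lra.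
have /andP[r0 r1] := r01; have [M HM] := gs r r01.
pose t := `|z| / r; have t0 : 0 <= t by rewrite divr_ge0 // ltW.
have t1 : `|t| < 1 by rewrite ger0_norm // ltr_pdivrMr // mul1r.
have M0 : 0 <= M by apply: le_trans (HM 0%N); rewrite mulr_ge0 ?exprn_ge0 // ltW.
apply: (@series_le_cvg _ _ (geometric M t)).
- by move=> n /=.
- by move=> n /=; rewrite mulr_ge0 ?exprn_ge0.
- move=> n /=; rewrite normrM normrX.
  have -> : `|z| = t * r by rewrite divfK // gt_eqF.
  by rewrite exprMn mulrCA [leRHS]mulrC ler_wpM2l ?exprn_ge0 // HM.
exact: is_cvg_geometric_series.
Qed.

(** The induction carries a power series for each derivative on the whole unit disc, since
    differentiating once more needs the identity near every point; at 0 only the constant term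
    remains. *)
Lemma derive1n_pseries g (G : R -> R) : subexp g ->
  (forall z, `|z| < 1 -> G z = limn (pseries g z)) ->
  forall n, derive1n n G 0 = n`!%:R * g n.
Proof.
move=> gs HG n.
have near_unit z : `|z| < 1 -> \forall y \near z, `|y| < 1.
  move=> z1; have e0 : 0 < 1 - `|z| by rewrite subr_gt0.
  near=> y; have : `|z - y| < 1 - `|z| by near: y; apply: cvgr_dist_lt => //; exact: cvg_id.
  have := ler_normB z (z - y); rewrite opprB addrC subrK => h1 h2.
  by move: h1 h2; move: (`|y|) (`|z|) (`|z - y|) => a b c; lra.
have main : forall m, exists c : nat -> R, [/\ subexp c, c 0%N = m`!%:R * g m,
    (forall j, c j * j`!%:R = (j + m)`!%:R * g (j + m)%N) &
    forall z, `|z| < 1 -> derive1n m G z = limn (pseries c z)].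
  elim=> [|m [c [cs c0 cj cz]]].
    exists g; split=> //; first by rewrite fact0 mul1r.
    by move=> j; rewrite addn0 mulrC.
  exists (pseries_diffs c); split.
  - exact: subexp_diffs.
  - by have := cj 1%N; rewrite /pseries_diffs mul1r add1n (_ : (1`!)%:R = 1 :> R) // mulr1.
  - by move=> j; rewrite addnS -addSn -cj /pseries_diffs factS natrM; ring.
  move=> z z1; rewrite derive1nS derive1E.
  pose K : R := (`|z| + 1) / 2.
  have K0 : 0 <= K by rewrite /K; have := normr_ge0 z; lra.
  have zK : `|z| < `|K| by rewrite (ger0_norm K0) /K; lra.
  have K1 : `|K| < 1 by rewrite (ger0_norm K0) /K; lra.
  have dc := @pseries_snd_diffs R c K z (subexp_cvg cs K1) (subexp_cvg (subexp_diffs cs) K1)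
     (subexp_cvg (subexp_diffs (subexp_diffs cs)) K1) zK.
  rewrite (@near_eq_derive _ _ _ _ (fun x => limn (pseries c x))) ?oner_eq0 //.
    by rewrite derive_val.
  near=> y; apply: cz; near: y; exact: near_unit.
have [c [_ c0 _ cz]] := main n.
rewrite cz ?normr0 // -c0; apply: cvg_lim => //.
apply: cvg_near_cst; near=> k.
rewrite /pseries /series /= big_ltn; last by near: k; exists 1%N.
rewrite expr0 mulr1 big_nat_cond big1 ?addr0 // => i /andP[/andP[i0 _] _].
by rewrite expr0n gtn_eqF // mulr0.
Unshelve. all: by end_near. Qed.

Section Product.
(** Each new factor [1 - C + C 'X] forms a convex combination of neighbouring coefficients, so the
    bound [B] is preserved. A step moves a coefficient by at most [2B/(N(N-1))], which telescopes to
    the rate [r N], uniformly in the degree. *)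
Variables (P : nat -> {poly R}) (C : nat -> R) (N0 : nat) (B : R).
Hypotheses (N02 : (2 <= N0)%N)
  (C01 : forall N, (N0 <= N)%N -> 0 <= C N <= (N%:R * (N%:R - 1))^-1)
  (PS : forall N, (N0 <= N)%N -> P N.+1 = P N * ((1 - C N)%:P + C N *: 'X))
  (PB : forall n, `|(P N0)`_n| <= B).

Let r (N : nat) : R := 2 * B / (N%:R - 1).

Let B0 : 0 <= B. Proof. exact: le_trans (PB 0). Qed.
Let N1 N : (N0 <= N)%N -> 0 < N%:R - 1 :> R.
Proof. by move=> h; rewrite subr_gt0 ltr1n (leq_trans N02 h). Qed.

Let C1 N : (N0 <= N)%N -> C N <= 1.
Proof.
move=> h; have h2 : (2 <= N)%N by apply: leq_trans h.
have /andP[_ +] := C01 h; move/le_trans; apply.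
have p1 : 1 <= N%:R * (N%:R - 1) :> R.
  rewrite -[leLHS]mulr1; apply: ler_pM => //; first by rewrite ler1n ltnW.
  by rewrite lerBrDr -[1 + 1]/(2%:R) ler_nat.
by rewrite invf_le1 // (lt_le_trans ltr01 p1).
Qed.

Let coefS N n : (N0 <= N)%N ->
  (P N.+1)`_n = (1 - C N) * (P N)`_n + C N * (if n is n'.+1 then (P N)`_n' else 0).
Proof.
move=> h; rewrite PS // mulrDr coefD coefMC -scalerAr coefZ coefMX mulrC; congr (_ + _ * _).
by case: n.
Qed.

Lemma coef_bounded N n : (N0 <= N)%N -> `|(P N)`_n| <= B.
Proof.
move=> /subnK<-; elim: (N - N0)%N n => [//|k IH] n.
have h : (N0 <= k + N0)%N by apply: leq_addl.
rewrite addSn coefS //; have /andP[c0 _] := C01 h.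
apply: le_trans (ler_normD _ _) _; rewrite !normrM (ger0_norm c0) ger0_norm ?subr_ge0 ?C1 //.
have -> : B = (1 - C (k + N0)) * B + C (k + N0) * B by ring.
apply: lerD; first by rewrite ler_wpM2l ?subr_ge0 ?C1.
by rewrite ler_wpM2l //; case: n => [|n]; rewrite ?normr0.
Qed.

Lemma coef_step N n : (N0 <= N)%N -> `|(P N.+1)`_n - (P N)`_n| <= r N - r N.+1.
Proof.
move=> h; rewrite coefS //; have /andP[c0 cN] := C01 h.
set u := (P N)`_n; set w := (if n is _.+1 then _ else _).
have -> : (1 - C N) * u + C N * w - u = C N * (w - u) by ring.
have -> : r N - r N.+1 = (N%:R * (N%:R - 1))^-1 * (2 * B).
  rewrite /r -[N.+1%:R]natr1 addrK; have := N1 h => n1.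
  have n0 : N%:R != 0 :> R by rewrite pnatr_eq0 -lt0n (leq_trans _ h) // (leq_trans _ N02).
  by field; rewrite n0 gt_eqF.
rewrite normrM (ger0_norm c0); apply: ler_pM => //.
apply: le_trans (ler_normB _ _) _; rewrite (_ : 2 * B = B + B); last by ring.
by apply: lerD; [rewrite /w; case: (n) => [|n']; rewrite ?normr0 ?coef_bounded | apply: coef_bounded].
Qed.

Lemma coef_limit : exists g : nat -> R, (forall n, `|g n| <= 3 * B) /\
  forall n N, (N0 <= N)%N -> `|(P N)`_n - g n| <= r N.
Proof.
suff H n : exists c : R, forall N, (N0 <= N)%N -> `|(P N)`_n - c| <= r N.
  have [g gH] := choice H; exists g; split=> // n.
  have := gH n N0 (leqnn _); have := PB n.
  have : r N0 <= 2 * B.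
    rewrite /r ler_pdivrMr ?N1 // ler_peMr ?mulr_ge0 //.
    by rewrite lerBrDr -[1 + 1]/(2%:R) ler_nat.
  rewrite !ler_norml; move: (r N0) ((P N0)`_n) (g n) => a b c h1 /andP[h2 h3] /andP[h4 h5].
  by apply/andP; split; lra.
have mono N k : (N0 <= N)%N -> `|(P (N + k))`_n - (P N)`_n| <= r N - r (N + k).
  move=> h; elim: k => [|k IH]; first by rewrite addn0 !subrr normr0.
  have hk : (N0 <= N + k)%N by apply: leq_trans (leq_addr _ _).
  have := coef_step n hk; rewrite -addnS; move: IH; rewrite !ler_norml.
  move: ((P (N + k))`_n) ((P (N + k.+1))`_n) ((P N)`_n) (r N) (r (N + k)) (r (N + k.+1)) => a b c d e f.
  by move=> /andP[h1 h2] /andP[h3 h4]; apply/andP; split; lra.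
have r0 N : (N0 <= N)%N -> 0 <= r N.
  by move=> h; rewrite /r divr_ge0 ?mulr_ge0 // ltW // N1.
have cmp N M : (N0 <= N)%N -> (N0 <= M)%N -> (P M)`_n - r M <= (P N)`_n + r N.
  move=> hN hM; have [NM|/ltnW MN] := leqP N M.
    have := mono N (M - N)%N hN; rewrite subnKC // ler_norml => /andP[_].
    have := r0 M hM; move: ((P N)`_n) ((P M)`_n) (r N) (r M) => *; lra.
  have := mono M (N - M)%N hM; rewrite subnKC // ler_norml => /andP[h _].
  move: h; have := r0 N hN; move: ((P N)`_n) ((P M)`_n) (r N) (r M) => *; lra.
pose E : set R := fun v => exists2 N, (N0 <= N)%N & v = (P N)`_n - r N.
have E0 : E !=set0 by exists ((P N0)`_n - r N0); exists N0.
exists (sup E) => N hN; rewrite ler_norml; apply/andP; split.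
  suff : sup E <= (P N)`_n + r N by lra.
  by apply: ge_sup => // _ [M hM ->]; apply: cmp.
suff : (P N)`_n - r N <= sup E by lra.
apply: ub_le_sup; last by exists N.
by exists ((P N0)`_n + r N0) => _ [M hM ->]; apply: cmp.
Qed.

(** The coefficient error [r N] is uniform, so evaluating inside the unit disc multiplies it by at
    most [1/(1 - |z|)]. *)
Lemma horner_limit g z : (forall n N, (N0 <= N)%N -> `|(P N)`_n - g n| <= r N) ->
  (forall n, `|g n| <= 3 * B) -> `|z| < 1 ->
  (P N).[z] @[N --> \oo] --> limn (pseries g z).
Proof.
move=> gr gB z1; have cg := subexp_cvg (subexp_bounded gB) z1.
have z10 : 0 < 1 - `|z| by rewrite subr_gt0.
have key N : (N0 <= N)%N -> `|limn (pseries g z) - (P N).[z]| <= r N / (1 - `|z|).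
  move=> hN; apply/ler_addgt0Pr => eps eps0.
  have rN : 0 <= r N by rewrite /r divr_ge0 ?mulr_ge0 // ltW // N1.
  have /cvgrPdist_lt/(_ eps eps0)[M _ HM] := cg.
  pose K := maxn M (size (P N)).
  have hK := HM K (leq_maxl _ _).
  have PE : (P N).[z] = \sum_(0 <= i < K) (P N)`_i * z ^+ i.
    by rewrite big_mkord; apply: horner_coef_wide; apply: leq_maxr.
  have -> : limn (pseries g z) - (P N).[z] =
    - \sum_(0 <= i < K) ((P N)`_i - g i) * z ^+ i + (limn (pseries g z) - pseries g z K).
    rewrite PE /pseries /series /=.
    under [in RHS]eq_bigr do rewrite mulrBl.
    by rewrite sumrB; ring.
  apply: le_trans (ler_normD _ _) _; apply: lerD; last exact: ltW.
  rewrite normrN; apply: le_trans (ler_norm_sum _ _ _) _.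
  apply: le_trans (_ : \sum_(0 <= i < K) r N * `|z| ^+ i <= _).
    by apply: ler_sum => i _; rewrite normrM normrX ler_wpM2r ?exprn_ge0 // gr.
  rewrite -mulr_sumr ler_wpM2l // -[leRHS]mul1r ler_pdivlMr //.
  have := subrX1 `|z| K; rewrite big_mkord; set S := \sum_(i < K) _ => h.
  have -> : S * (1 - `|z|) = 1 - `|z| ^+ K by move: h; move: (`|z| ^+ K) => u h; lra.
  by rewrite gerBl exprn_ge0.
apply/cvgrPdist_le => eps eps0.
near=> N; have hN : (N0 <= N)%N by near: N; exists N0.
apply: le_trans (key N hN) _; rewrite ler_pdivrMr // /r ler_pdivrMr ?N1 //.
rewrite -ler_pdivrMl ?mulr_gt0 //.
set T := (eps * (1 - `|z|))^-1 * (2 * B).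
have h : (Num.truncn T).+2%:R <= N%:R :> R.
  by rewrite ler_nat; near: N; exists (Num.truncn T).+2.
rewrite lerBrDr; apply: le_trans h; rewrite -[(Num.truncn T).+2%:R]natr1 lerD2r ltW //.
exact: truncnS_gt.
Unshelve. all: by end_near. Qed.

End Product.
End PowerSeries.

Lemma euler_factor_gt0 (R : realFieldType) (x z : R) : 2 <= x -> `|z| < 1 -> 0 < x ^+ 2 - x + z - 1.
Proof. by move=> x2; rewrite ltr_norml => /andP[z1 z2]; nra. Qed.

(** For an odd prime dividing [h] the local factor is the generic Euler factor times the factor of
    [H_omega]. *)
Lemma euler_factor_divisor (R : realFieldType) (x z : R) : 2 <= x -> `|z| < 1 ->
  1 + (x - 1)^-1 * (z - 1) =
  (1 + (x * (x - 1))^-1 * (z - 1)) * (x * (x + z - 2) / (x ^+ 2 - x + z - 1)).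
Proof.
move=> x2 z1; have D := lt0r_neq0 (euler_factor_gt0 x2 z1).
have x0 : x != 0 by apply: lt0r_neq0; lra.
have x10 : x - 1 != 0 by apply: lt0r_neq0; lra.
have -> : 1 + (x * (x - 1))^-1 * (z - 1) = (x ^+ 2 - x + z - 1) / (x * (x - 1)).
  by field; rewrite x0 x10.
have -> : 1 + (x - 1)^-1 * (z - 1) = (x + z - 2) / (x - 1) by field.
by move: D; set y := _ - 1 => D; field; rewrite D x0 x10.
Qed.

Lemma euler_ratio (R : realFieldType) (c u : R) : 0 < 1 + c * u -> c != 0 -> c * u / (1 + c * u) = u / (c^-1 + u).
Proof.
move=> h c0; have h' := lt0r_neq0 h.
have -> : c^-1 + u = (1 + c * u) / c by field.
by move: h'; set y := 1 + _ => h'; field; rewrite h' c0.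
Qed.

Lemma prod_if_mem (R : comNzRingType) (qs t : seq nat) (r : nat -> R) : uniq qs -> uniq t ->
  {subset t <= qs} -> \prod_(q <- qs) (if q \in t then r q else 1) = \prod_(q <- t) r q.
Proof.
move=> uq ut st; rewrite -big_mkcond -big_filter; apply: perm_big.
apply: uniq_perm; rewrite ?filter_uniq // => q; rewrite mem_filter andb_idr //; exact: st.
Qed.

Lemma poly_coef_bound (R : realType) (p : {poly R}) : exists B : R, forall n, `|p`_n| <= B.
Proof.
exists (\sum_(i < size p) `|p`_i|) => n.
have [h|h] := ltnP n (size p); last by rewrite nth_default // normr0 sumr_ge0.
by rewrite (bigD1 (Ordinal h)) //= lerDl sumr_ge0.
Qed.

Definition primes_below (N : nat) : seq nat := [seq q <- iota 0 N | prime q].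

Lemma primes_belowS N : primes_below N.+1 = primes_below N ++ (if prime N then [:: N] else [::]).
Proof. by rewrite /primes_below -addn1 iotaD filter_cat. Qed.

Lemma primes_below_uniq N : uniq (primes_below N).
Proof. by rewrite filter_uniq // iota_uniq. Qed.

Lemma primes_below_prime N : all prime (primes_below N).
Proof. exact: filter_all. Qed.

Lemma mem_primes_below N q : (q \in primes_below N) = prime q && (q < N)%N.
Proof. by rewrite mem_filter mem_iota. Qed.

Section LimitSeries.
Local Open Scope classical_set_scope.
Variables (R : realType) (s : int) (h b0 : nat).
Hypotheses (hs : (s == 1) || (s == -1)) (h0 : (0 < h)%N)
  (hb0 : (0 < b0)%N /\ forall p : nat, prime p -> ~~ (p ^ 2 %| b0)%N).

Local Notation Cq := (@local_density R s h).
Local Notation ent := (entangled s h b0).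
Local Notation B := (primes (2 * b0)).
Definition cE (q : nat) : R := (q%:R * (q%:R - 1))^-1.
Definition PN (N : nat) : {poly R} := limpoly Cq B ent [::] (primes_below N).
Definition EN (N : nat) : {poly R} := \prod_(q <- primes_below N) (1 + (cE q)%:P * ('X - 1)).
(** Beyond this bound no prime divides [h] or [2 b0], so each further prime multiplies the
    polynomial by a generic Euler factor. In [CN] the value 0 at composite numbers gives one
    recursion for all [N]. *)
Definition N1 : nat := (h + 2 * b0 + 2)%N.
Definition CN (N : nat) : R := if prime N then cE N else 0.

Lemma pred_natr q : prime q -> (q.-1)%:R = q%:R - 1 :> R.
Proof. by move=> /prime_gt0 q0; rewrite -{2}(prednK q0) -natr1 addrK. Qed.

Lemma CN_bound N : (2 <= N)%N -> 0 <= CN N <= (N%:R * (N%:R - 1))^-1.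
Proof.
move=> N2; have n0 : (0 : R) <= (N%:R * (N%:R - 1))^-1.
  by rewrite invr_ge0 mulr_ge0 // subr_ge0 ler1n ltnW.
by rewrite /CN /cE; case: ifP => _; rewrite ?lexx ?n0.
Qed.

Lemma ENS N : EN N.+1 = EN N * ((1 - CN N)%:P + CN N *: 'X).
Proof.
rewrite /EN primes_belowS big_cat /=; congr (_ * _); rewrite /CN.
case: ifP => _; rewrite ?big_cons big_nil; last by rewrite scale0r subr0 addr0.
by rewrite mulr1 -mul_polyC polyCB polyC1; ring.
Qed.

Lemma PNE N : (N1 <= N)%N -> PN N = \prod_(q <- primes_below N) (1 + (Cq q)%:P * ('X - 1))
  + ent%:R%:P * \prod_(q <- primes_below N) ((~~ (q \in B))%:R%:P + (Cq q)%:P * ('X - 1)).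
Proof.
move=> hN; rewrite /PN /limpoly big_nil mul1r /= (_ : all _ _ = true) ?andbT //.
apply/allP => q; rewrite mem_primes => /and3P[qp b2 qb] /=.
suff: q \in primes_below N by [].
by rewrite mem_primes_below qp /=; apply: leq_trans hN; rewrite /N1; have := dvdn_leq b2 qb; lia.
Qed.

Lemma PNS N : (N1 <= N)%N -> PN N.+1 = PN N * ((1 - CN N)%:P + CN N *: 'X).
Proof.
move=> hN; rewrite !PNE ?(leq_trans hN) // primes_belowS !big_cat /= /CN.
case: ifP => Np; rewrite ?big_cons ?big_nil; last by rewrite scale0r subr0 !mulr1 addr0 mulr1.
have Nh : (N %| h)%N = false.
  by apply/negbTE/negP => /(dvdn_leq h0); move: hN; rewrite /N1; lia.
have NB : (N \in B) = false.
  apply/negbTE/negP; rewrite mem_primes => /and3P[_ b2 /(dvdn_leq b2)].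
  by move: hN; rewrite /N1; lia.
have -> : Cq N = cE N by rewrite /local_density Nh natrM pred_natr.
by rewrite NB /= !mulr1 -mul_polyC polyCB polyC1; ring.
Qed.

Lemma Cq_divisor q : prime q -> (q %| h)%N -> q != 2%N -> Cq q = (q%:R - 1)^-1.
Proof. by move=> qp qh /negbTE q2; rewrite /local_density qh q2 pred_natr. Qed.

Lemma Cq_nondivisor q : prime q -> ~~ (q %| h)%N -> Cq q = cE q.
Proof. by move=> qp /negbTE qh; rewrite /local_density qh natrM pred_natr. Qed.

Lemma natr2 q : prime q -> 2 <= q%:R :> R.
Proof. by move=> /prime_gt1; rewrite -(ler_nat R). Qed.

(** The product of local factors gives the Euler product with [H_omega], and for even [h] also the
    factor at 2 that appears in [F_omega]. In the entangled sum the factor at [q \in B] is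
    [Cq q (z-1)] instead of [1 + Cq q (z-1)]; the ratios multiply to [f_omega]. No division by 0
    occurs: for odd [h] the densities are at most 1/2 and [z - 1 > -2]. *)
Lemma PN_horner N z : (N1 <= N)%N -> `|z| < 1 ->
  (PN N).[z] = F_omega s b0 h z * H_omega h z * (EN N).[z].
Proof.
move=> hN z1; rewrite PNE // hornerD hornerM hornerC /EN !horner_prod.
have ev (c x : R) : (c%:P + x%:P * ('X - 1)).[z] = c + x * (z - 1) by rewrite !hornerE.
have ev1 (x : R) : (1 + x%:P * ('X - 1)).[z] = 1 + x * (z - 1) by rewrite !hornerE.
under eq_bigr do rewrite ev1; under [X in _ * X]eq_bigr do rewrite ev.
under [X in _ = _ * X]eq_bigr do rewrite ev1.
set qs := primes_below N; set u := z - 1.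
have uq : uniq qs := primes_below_uniq N.
have pq q : q \in qs -> prime q by apply/allP/primes_below_prime.
have sh : {subset primes h <= qs}.
  move=> q; rewrite mem_primes => /and3P[qp _ /(dvdn_leq h0) qh].
  by rewrite mem_primes_below qp /=; apply: leq_trans hN; rewrite /N1; lia.
have b20 : (0 < 2 * b0)%N by rewrite muln_gt0; case: hb0.
have sB : {subset B <= qs}.
  move=> q; rewrite mem_primes => /and3P[qp _ /(dvdn_leq b20) qh].
  by rewrite mem_primes_below qp /=; apply: leq_trans hN; rewrite /N1; lia.
pose rho q : R := if q == 2%N then (if s == -1 then 1 else 2 * z / (z + 1))
   else q%:R * (q%:R + z - 2) / (q%:R ^+ 2 - q%:R + z - 1).
have z10 : z + 1 != 0 by apply: lt0r_neq0; move: z1; rewrite ltr_norml => /andP[]; lra.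
have P1 : \prod_(q <- qs) (1 + Cq q * u) = \prod_(q <- qs) (1 + cE q * u) * \prod_(q <- primes h) rho q.
  rewrite -(prod_if_mem rho uq (primes_uniq h) sh) -big_split big_seq [RHS]big_seq.
  apply: eq_bigr => q /pq qp; rewrite mem_primes qp h0 /=.
  have [qh|qh] := boolP (q %| h)%N; last by rewrite Cq_nondivisor ?mulr1.
  rewrite /rho; have [q2|q2] := eqVneq q 2%N.
    rewrite /local_density qh q2 eqxx /= /cE /u; case: (s == -1).
      by rewrite mulr1 (_ : 2 * (2 - 1) = 2 :> R) //; ring.
    have -> : (2 * (2 - 1) = 2 :> R) by ring.
    by rewrite invr1; field.
  by rewrite Cq_divisor // /cE /u euler_factor_divisor ?natr2.
have P2 : ent%:R * \prod_(q <- qs) ((~~ (q \in B))%:R + Cq q * u)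
  = ent%:R * (\prod_(q <- qs) (1 + Cq q * u) * f_omega b0 h z).
  case en : ent; rewrite ?mul0r ?mul1r //.
  have oh : odd h by case/andP: en.
  have u2 : - 2 < u by rewrite /u; move: z1; rewrite ltr_norml => /andP[]; lra.
  have qd q : prime q -> (q %| h)%N -> q != 2%N.
    by move=> qp qh; apply/eqP => q2; move: qh; rewrite q2 dvdn2 oh.
  have Cpos q : prime q -> 0 < Cq q <= 2^-1.
    move=> qp; have x2 := natr2 qp; have [qh|qh] := boolP (q %| h)%N.
      rewrite Cq_divisor ?qd // invr_gt0 lef_pV2 ?posrE; last 2 first; [lra | lra |].
      have : (3 <= q)%N by rewrite ltn_neqAle eq_sym qd // prime_gt1.
      by rewrite -(ler_nat R) => ?; apply/andP; split; lra.
    rewrite Cq_nondivisor // /cE invr_gt0 lef_pV2 ?posrE //; last by nra.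
    by apply/andP; split; nra.
  have gt0 q : prime q -> 0 < 1 + Cq q * u by move=> /Cpos /andP[c1 c2]; nra.
  have -> : f_omega b0 h z = \prod_(q <- B) (Cq q * u / (1 + Cq q * u)).
    rewrite /f_omega [RHS](bigID (fun q => q %| h)%N) /= mulrC; congr (_ * _).
      rewrite -[RHS]big_filter.
      have pe : perm_eq (primes (gcdn b0 h)) [seq q <- B | (q %| h)%N].
        apply: uniq_perm; rewrite ?filter_uniq ?primes_uniq // => q.
        rewrite mem_filter !mem_primes gcdn_gt0 h0 orbT b20 dvdn_gcd /=.
        case qp : (prime q); rewrite ?andbF //=; case qh : (q %| h)%N; rewrite ?andbF //= andbT.
        rewrite Gauss_dvdr // coprime_sym prime_coprime // dvdn_prime2 // eq_sym.
        exact: qd.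
      rewrite (perm_big _ pe) big_seq [RHS]big_seq; apply: eq_bigr => q.
      rewrite mem_filter mem_primes => /and4P[qh qp _ _].
      rewrite euler_ratio ?gt0 ?gt_eqF //; last by case/andP: (Cpos q qp).
      by rewrite Cq_divisor ?qd // invrK /u; congr (_ / _); ring.
    rewrite big_seq_cond [RHS]big_seq_cond; apply: eq_bigr => q.
    rewrite mem_primes => /andP[/and3P[qp _ _] qh].
    rewrite euler_ratio ?gt0 ?gt_eqF //; last by case/andP: (Cpos q qp).
    by rewrite Cq_nondivisor // /cE invrK /u; congr (_ / _); ring.
  rewrite -(prod_if_mem _ uq (primes_uniq _) sB) -big_split big_seq [RHS]big_seq.
  apply: eq_bigr => q /pq qp; case: (q \in B) => /=; last by rewrite mulr1.
  by rewrite add0r [RHS]mulrC divfK // lt0r_neq0 // gt0.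
rewrite P2 P1 /u; set E := \prod_(q <- qs) (1 + cE q * _).
have HE : \prod_(q <- primes h) rho q = H_omega h z * (if odd h then 1 else if s == -1 then 1 else 2 * z / (z + 1)).
  have h2 : (2%N \in primes h) = ~~ odd h by rewrite mem_primes h0 dvdn2.
  rewrite /H_omega; case oh : (odd h).
    rewrite mulr1 [RHS]big_seq_cond big_seq; apply: eq_big => q.
      by case: eqP => [->|]; rewrite ?andbT // h2 oh.
    rewrite /rho; case: eqP => // ->; by rewrite h2 oh.
  rewrite (bigD1_seq 2%N) ?primes_uniq ?h2 ?oh //= mulrC; congr (_ * _).
  by apply: eq_bigr => q /negbTE q2; rewrite /rho q2.
rewrite HE /F_omega /entangled; case oh : (odd h) => /=.
  by case: ifP => _ /=; ring.
by case/orP: hs => /eqP -> /=; ring.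
Qed.

(** The coefficients of [PN N] and of [EN N] converge to bounded sequences. On the unit disc the
    first sequence sums to the limit of [PN N], which [PN_horner] identifies with [G_omega];
    uniqueness of Taylor coefficients then gives [Dtilde]. *)
Lemma Dtilde_limit n (eps : R) : 0 < eps -> exists N2 : nat, forall N, (N2 <= N)%N ->
  `|(PN N)`_n - Dtilde R s b0 h n| <= eps.
Proof.
move=> eps0.
have N12 : (2 <= N1)%N by rewrite /N1; lia.
have C1 N : (N1 <= N)%N -> 0 <= CN N <= (N%:R * (N%:R - 1))^-1.
  by move=> hN; apply: CN_bound; apply: leq_trans hN.
have C2 N : (2 <= N)%N -> 0 <= CN N <= (N%:R * (N%:R - 1))^-1 by apply: CN_bound.
have [K HK] := poly_coef_bound (PN N1); have [K' HK'] := poly_coef_bound (EN 2).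
have [g [gB gl]] := coef_limit N12 C1 PNS HK.
have [g' [gB' gl']] := coef_limit (isT : 2 <= 2)%N C2 (fun N _ => ENS N) HK'.
have GE z : `|z| < 1 -> G_omega s b0 h z = limn (pseries g z).
  move=> z1; have H1 := horner_limit N12 HK gl gB z1.
  have H2 := horner_limit (isT : 2 <= 2)%N HK' gl' gB' z1.
  have EP : Euler_prod z = limn (pseries g' z).
    rewrite /Euler_prod -(cvg_lim _ H2) //; congr (limn _); apply/funext => N.
    rewrite /EN horner_prod /primes_below big_filter -(big_mkord prime (fun q => 1 + (z - 1) / (q%:R * (q%:R - 1)))).
    by rewrite /index_iota subn0; apply: eq_bigr => q _; rewrite !hornerE /cE mulrC.
  rewrite /G_omega EP; symmetry; apply: (cvg_unique _ H1); first exact: norm_hausdorff.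
  have H3 : F_omega s b0 h z * H_omega h z * (EN N).[z] @[N --> \oo] -->
    F_omega s b0 h z * H_omega h z * limn (pseries g' z).
    by apply: cvgM H2; exact: cvg_cst.
  apply: cvg_trans H3; apply: near_eq_cvg; rewrite /prop_near1; exists N1 => // N /= hN.
  by rewrite PN_horner.
have DE := derive1n_pseries (subexp_bounded gB) GE n.
have -> : Dtilde R s b0 h n = g n.
  by rewrite /Dtilde DE mulrC mulKf // pnatr_eq0 -lt0n fact_gt0.
have K0 : 0 <= K by apply: le_trans (HK 0%N).
exists (maxn N1 (Num.truncn (2 * K / eps)).+2) => N; rewrite geq_max => /andP[hN tN].
apply: le_trans (gl n N hN) _.
have N1' : (Num.truncn (2 * K / eps)).+1%:R <= N%:R - 1 :> R.
  by rewrite lerBrDr natr1 ler_nat.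
have lt1 := truncnS_gt (2 * K / eps).
have NN : 0 < N%:R - 1 :> R by apply: lt_le_trans N1'.
rewrite ler_pdivrMr // [leRHS]mulrC -ler_pdivrMr //; exact: le_trans (ltW lt1) N1'.
Qed.

End LimitSeries.

Lemma count_summ (R : realType) (P : pred nat) v : ~~ P 0%N ->
  (count P (iota 0 v.+1))%:R = summ (fun p => (P p)%:R) v :> R.
Proof.
move=> /negbTE P0; rewrite -sum1_count natr_sum /= big_cons P0 /summ /index_iota subSS subn0.
by rewrite big_mkcond; apply: eq_bigr => p _; case: (P p).
Qed.

Lemma count_primes_le_omega (N m : nat) : (0 < m)%N ->
  (count (fun q => q %| m)%N (primes_below N) <= omega m)%N.
Proof.
move=> m0; rewrite -size_filter /omega; apply: uniq_leq_size.
  by rewrite filter_uniq // primes_below_uniq.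
by move=> q; rewrite mem_filter mem_primes_below mem_primes m0 => /andP[-> /andP[-> _]].
Qed.

Lemma idx_gt0 (a : rat) p : a != 0 -> prime p -> nu p a == 0 -> (0 < idx a p)%N.
Proof.
move=> a0 pp na; have op := ordp_prim a0 pp na.
have p10 : (0 < p.-1)%N by rewrite -subn1 subn_gt0 prime_gt1.
rewrite /idx divn_gt0 ?(prim_order_gt0 op) // dvdn_leq // (prim_order_dvd op).
apply/eqP; apply: fermatF => //; apply/eqP => x0; have := prim_expr_order op.
by rewrite x0 expr0n gtn_eqF ?(prim_order_gt0 op) //= => /eqP; rewrite eq_sym oner_eq0.
Qed.

Lemma sum_indicator (R : realType) (k c : nat) : \sum_(n < k) ((n : nat) == c)%:R = (c < k)%:R :> R.
Proof.
have [ck|ck] := ltnP c k.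
  rewrite (bigD1 (Ordinal ck)) //= eqxx big1 ?addr0 // => n.
  by rewrite -val_eqE /= => /negbTE->.
by rewrite big1 // => n _; rewrite ltn_eqF // (leq_trans (ltn_ord n)).
Qed.

Lemma eventually_all (k : nat) (Q : nat -> nat -> Prop) :
  (forall n, (n < k)%N -> exists Y, forall v, (Y <= v)%N -> Q n v) ->
  exists Y, forall v, (Y <= v)%N -> forall n, (n < k)%N -> Q n v.
Proof.
elim: k => [|k IH] H; first by exists 0%N.
have [Y HY] := IH (fun n nk => H n (ltnW nk)); have [Z HZ] := H k (ltnSn k).
exists (maxn Y Z) => v; rewrite geq_max => /andP[Yv Zv] n.
by rewrite ltnS leq_eqVlt => /orP[/eqP->|nk]; [apply: HZ | apply: HY].
Qed.

Theorem theorem8p1 (R : realType) (a : rat)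
  (ha : a \notin [:: -1; 0; 1])
  (s : int) (a0 : rat) (h : nat) (b0 : nat) (c0 : rat)
  (hs : (s == 1) || (s == -1))
  (ha0 : 0 < a0) (hh : (0 < h)%N)
  (hdec : a = s%:~R * a0 ^+ h)
  (hnpp : forall (r : rat) (m : nat), (2 <= m)%N -> a0 != r ^+ m)
  (hb0 : (0 < b0)%N /\ forall p : nat, prime p -> ~~ (p ^ 2 %| b0)%N)
  (hbc : a0 = b0%:R * c0 ^+ 2)
  (k : nat) :
  forall eps : R, 0 < eps -> exists X : R, forall x : R, X <= x ->
    \sum_(n < k.+1) Domega a n x <= \sum_(n < k.+1) Dtilde R s b0 h n + eps.
Proof.
move=> eps eps0; have an0 : a != 0 by move: ha; rewrite !inE !negb_or => /and3P[].
(* For each of the [k + 1] coefficients, one [e2] for replacing [Dtilde] by the coefficient of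
   [PN N] and one for replacing that by the average over primes. *)
pose e2 := eps / (2 * k.+1%:R); have e20 : 0 < e2 by rewrite divr_gt0 // mulr_gt0.
have [N HN] : exists N, forall v, (N <= v)%N -> forall n, (n < k.+1)%N ->
    `|(PN R s h b0 v)`_n - Dtilde R s b0 h n| <= e2.
  by apply: eventually_all => n _; apply: Dtilde_limit.
have {}HN := HN N (leqnn N).
have mean := omega_mean (@idx_density R a s a0 h b0 c0 an0 hs ha0 hh hdec hnpp hb0 hbc)
  (primes_below_uniq N) (primes_below_prime N).
set f := (fun p : nat => 'X^_) in mean.
have [Y HY] : exists Y, forall v, (Y <= v)%N -> forall n, (n < k.+1)%N ->
    `|summ (fun p => (f p)`_n *+ prime p) v - (PN R s h b0 N)`_n * cnt R xpredT v| <= e2 * cnt R xpredT v.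
  by apply: eventually_all => n _; apply: mean.
have [Z HZ] := cnt_unbounded (@pnt R) 1.
(* Beyond [Z] the prime count is at least 1, so the quotient in [Domega] is a genuine one. *)
exists (maxn Y Z).+1%:R => x Xx; have x0 : 0 <= x by apply: le_trans Xx.
pose v := Num.truncn x.
have : (maxn Y Z <= v)%N.
  by rewrite /v truncn_ge_nat //; apply: le_trans Xx; rewrite ler_nat.
rewrite geq_max => /andP[/HY{}HY /HZ{}HZ].
have c0' : 0 < cnt R xpredT v by apply: lt_le_trans HZ.
have vx : v%:R <= x by rewrite -truncn_ge_nat.
have px p : (0 < p <= v)%N -> p%:R <= x :> R.
  by move=> /andP[_ pv]; apply: le_trans vx; rewrite ler_nat.
have piE : (primepi x)%:R = cnt R xpredT v.
  rewrite /primepi count_summ // /cnt; apply: eq_summ => p /px ->.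
  by [].
have DE n : Domega a n x = summ (fun p => [&& prime p, p%:R <= x, nu p a == 0 &
    omega (idx a p) == n]%:R) v / cnt R xpredT v.
  by rewrite /Domega piE count_summ.
rewrite (eq_bigr _ (fun (n : 'I_k.+1) _ => DE n)) -mulr_suml ler_pdivrMr //.
(* Prime by prime: [omega <= k] implies that at most [k] primes below [N] divide the index. A prime
   with [nu p a != 0] counts 0 on the left and something nonnegative on the right. *)
apply: (@le_trans _ _ (\sum_(n < k.+1) summ (fun p => (f p)`_n *+ prime p) v)).
  rewrite /summ exchange_big [leRHS]exchange_big /=; apply: ler_sum => p _.
  case pp : (prime p) => /=; last by rewrite !big1.
  rewrite [leRHS](eq_bigr (fun n : 'I_k.+1 => ((n : nat) == count (fun q => q %| idx a p)%N (primes_below N))%:R)).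
    rewrite sum_indicator; have [na|na] := boolP (nu p a == 0); last first.
      by rewrite big1 // => n _; rewrite andbF.
    case: (p%:R <= x); last by rewrite big1.
    rewrite (eq_bigr (fun n : 'I_k.+1 => ((n : nat) == omega (idx a p))%:R)); last first.
      by move=> n _; rewrite /= eq_sym.
    rewrite sum_indicator ler_nat; have := count_primes_le_omega N (idx_gt0 an0 pp na).
    by move=> co; case: ltnP => // ok; rewrite (leq_ltn_trans co ok).
  by move=> n _; rewrite coefXn mulr1n.
rewrite mulrDl mulr_suml.
have -> : eps * cnt R xpredT v = \sum_(n < k.+1) (e2 + e2) * cnt R xpredT v.
  rewrite sumr_const card_ord -mulr_natl mulrA; congr (_ * _).
  have K0 : k.+1%:R != 0 :> R by rewrite pnatr_eq0.
  by rewrite /e2; move: K0; move: (k.+1%:R) => K K0; field; exact: K0.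
rewrite -big_split /=; apply: ler_sum => n _.
have h1 := HN n (ltn_ord n); have h2 := HY n (ltn_ord n).
move: h1 h2; rewrite !ler_norml => /andP[_ h1] /andP[_ h2].
have h3 : (PN R s h b0 N)`_n * cnt R xpredT v <= (Dtilde R s b0 h n + e2) * cnt R xpredT v.
  by rewrite ler_wpM2r ?(ltW c0') // addrC -lerBlDr.
by rewrite -mulrDl addrA [leRHS]mulrDl; lra.
Qed.
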